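(* Let $R>1$, let $f\in\mathcal{S}(R)$, and for $1\le r<R$ let $$\psi_{\mathrm{Cap}}(r)=\frac{\operatorname{Cap}\big(f(A(1,r))\cup\overline{\mathbb{D}}\big)}{\operatorname{Cap}(r\mathbb{D})}.$$ Then $\log\psi_{\mathrm{Cap}}$ is a convex function of $\log r$ and $\psi_{\mathrm{Cap}}$ is strictly increasing, unless $f$ is the identity. In particular, $$\operatorname{Cap}\big(f(A(1,r))\cup\overline{\mathbb{D}}\big)\le r\,\frac{\operatorname{Cap}\big(f(A(1,R))\cup\overline{\mathbb{D}}\big)}{R}$$ for $1\le r<R$.
   Context: Notation: $\mathbb{D}=\{z\in\mathbb{C}:|z|<1\}$, $r\mathbb{D}=\{|z|<r\}$, and $A(1,r)=\{z\in\mathbb{C}:1<|z|<r\}$ (so $A(1,1)=\emptyset$). $\operatorname{Cap}$ denotes logarithmic capacity, normalized so that $\operatorname{Cap}(r\mathbb{D})=r$; for a non-compact Borel set it is the supremum of the capacities of its compact subsets (with value $+\infty$ allowed). The family $\mathcal{S}(R)$ ($R>1$) consists of the analytic and one-to-one functions $f$ on $A(1,R)$ that map $A(1,R)$ onto a topological annulus $\mathcal{A}$ such that the bounded component of $\mathbb{C}\setminus\mathcal{A}$ is the closed unit disk $\overline{\mathbb{D}}$, and such that $|f(z)|\to 1$ as $|z|\downarrow 1$. By the Schwarz reflection principle such an $f$ extends analytically across $|z|=1$; the extension is also denoted $f$. Equivalently, $f$ is analytic and one-to-one on $A(1,R)$, extends analytically across $|z|=1$, $|f(z)|>1$ for all $z\in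 A(1,R)$, and $|f(z)|=1$ for $|z|=1$.
   Formalization: The exception ''unless f is the identity'' is read as ''unless f is a rotation f(z)=cz with |c|=1'': rotations lie in S(R) and have ψ_Cap constantly 1, so strict increase fails for them. Convexity and the final inequality are proved for every f. *)

(* Defs.v *)
From HB Require Import structures.
From mathcomp Require Import all_boot all_order all_algebra.
From mathcomp Require Import all_classical all_reals all_analysis.
From mathcomp Require Import complex.

Set Implicit Arguments.
Unset Strict Implicit.
Unset Printing Implicit Defensive.

Import Order.TTheory GRing.Theory Num.Theory.
Import numFieldNormedType.Exports.

Local Open Scope classical_set_scope.
Local Open Scope ring_scope.
Local Open Scope complex_scope.

(* The complex plane over R is written R[i]^o: this is R[i], as a normed space
   over itself, and this is the type that carries the library's topology.  The
   library's norm on R[i] takes its values in R[i]; for a modulus in R we use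
   Normc.normc. *)

Section Plane.
Context {R : realType}.

Definition disk (r : R) : set R[i]^o := [set z | Normc.normc z < r].

Definition closed_unit_disk : set R[i]^o := [set z | Normc.normc z <= 1].

Definition annulus (r : R) : set R[i]^o := [set z | 1 < Normc.normc z < r].

End Plane.

Section Capacity.
Context {R : realType}.

(* Borel measures on the plane are measures on R * R with the product
   sigma-algebra, transported to subsets of R[i] by this identification. *)
Definition to_complex (p : R * R) : R[i]^o := p.1 +i* p.2.

(* lne 0 = -oo, so atoms make the energy equal to -oo. *)
Definition log_energy (mu : probability (R * R)%type R) : \bar R :=
  (\int[mu]_z \int[mu]_w
     lne (Normc.normc (to_complex z - to_complex w))%:E)%E.

(* exp(-V), where V is the infimum of the energies with kernel log(1/|z - w|);
   expeR -oo = 0, so this is 0 when K is empty or polar. *)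
Definition compact_capacity (K : set R[i]^o) : \bar R :=
  expeR (ereal_sup [set log_energy mu
    | mu in [set mu : probability (R * R)%type R |
             mu (to_complex @^-1` K) = 1%E]]).

Definition Cap (E : set R[i]^o) : \bar R :=
  ereal_sup [set compact_capacity K
    | K in [set K : set R[i]^o | compact K /\ K `<=` E]].

End Capacity.

Section ClassS.
Context {R : realType}.

Definition homeomorphic (T U : topologicalType) (A : set T) (B : set U) :=
  exists (g : T -> U) (h : U -> T),
    [/\ {within A, continuous g}, {within B, continuous h},
        (forall x, A x -> B (g x) /\ h (g x) = x) &
        (forall y, B y -> A (h y) /\ g (h y) = y)].

Definition topological_annulus (U : set R[i]^o) :=
  homeomorphic (annulus (2 : R)) U.

Definition bounded_components_of_complement (U : set R[i]^o) :
    set (set R[i]^o) :=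
  [set K | bounded_set K /\
           exists2 w, (~` U) w & K = connected_component (~` U) w].

(* Functions are total; only the values on the annulus matter. Analyticity is
   complex differentiability: the increment in derivable ranges over R[i]. *)
Definition class_S (rho : R) (f : R[i]^o -> R[i]^o) : Prop :=
  [/\ forall z, annulus rho z -> derivable f z 1,
      forall z w, annulus rho z -> annulus rho w -> f z = f w -> z = w,
      topological_annulus (f @` annulus rho),
      bounded_components_of_complement (f @` annulus rho)
        = [set closed_unit_disk] &
      forall e : R, 0 < e -> \forall s \near (1 : R)^'+,
        forall z, Normc.normc z = s -> `|Normc.normc (f z) - 1| < e].

(* With r = 1 the annulus is empty, and this is the closed unit disk. *)
Definition filled_image (f : R[i]^o -> R[i]^o) (r : R) : set R[i]^o :=
  f @` annulus r `|` closed_unit_disk.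

Definition psi_Cap (f : R[i]^o -> R[i]^o) (r : R) : \bar R :=
  (Cap (filled_image f r) / Cap (disk r))%E.

Definition rotation_on (A : set R[i]^o) (f : R[i]^o -> R[i]^o) : Prop :=
  exists2 c : R[i]^o, Normc.normc c = 1 & forall z, A z -> f z = c * z.

End ClassS.

(* Main.v *)
From HB Require Import structures.
Require Import Defs.
From mathcomp Require Import all_boot all_order all_algebra.
From mathcomp Require Import all_classical all_reals all_analysis.
From mathcomp Require Import measurable_realfun.
From mathcomp Require Import complex.
From mathcomp Require Import ring lra.

(* Write A_r for the filled image of radius r.  Capacity is governed by products of mutual
   distances of finitely many points, and as a function of each point such a product is the
   modulus of a polynomial, which composed with f is holomorphic on the annulus.  Hadamard's
   three circles theorem in each point thus makes log Cap A_(exp t) convex in t.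

   For the slope at t = 0, let k be the inverse of f near the unit circle and Z = w k'(w) / k(w),
   which extends to the unit circle as a positive function of mean 1.  Up to o(t), the set
   A_(exp t) contains the points exp(i u + t / Z(exp(i u))); pushing an optimal configuration of
   the disk out to these points, after a rotation chosen by averaging, multiplies the capacity by
   at least exp(t * mean of 1/Z), and the mean of 1/Z is at least 1.  Equality forces Z = 1, so
   that k and f are rotations.  Hence log Cap A_(exp t) - t is convex with nonnegative slope at 0,
   and positive slope unless f is a rotation. *)

Set Implicit Arguments.
Unset Strict Implicit.
Unset Printing Implicit Defensive.

Import Order.TTheory GRing.Theory Num.Theory.
Import numFieldNormedType.Exports.

Local Open Scope classical_set_scope.
Local Open Scope ring_scope.

Local Notation normc := Normc.normc.
Local Notation Re := complex.Re.
Local Notation Im := complex.Im.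

(** The obstacle is the unit circle: [f] is known there only through |f| -> 1, so nothing is ever
    evaluated on it. The extension of Z to the circle is replaced by estimates on |w| = exp s that
    are uniform as s -> 0: a three-circles bound for f(w cis eta) / f(w) gives Im Z = O(s), and a
    Borel-Caratheodory estimate at scale s then bounds the derivative of Z. The mean of 1/Z has no
    closed form either: 1/Z is bounded below by a quadratic polynomial in Z, whose mean follows from
    two integrals independent of the circle, that of Z, which is a degree, and that of (Z - 1)^2,
    the [defect]. The latter is the gain in slope, and it vanishes only for rotations. Capacity is
    defined by measures, and configurations are reached in both directions with errors of order n in
    an exponent of order n^2: a measure yields points by conditional expectations, and points yield
    a measure by smearing each over a small circle. Smearing requires room around the points, hence
    the pairs of slightly different radii everywhere. *)

Section Modulus.
Context {R : realType}.
Implicit Types z w : R[i].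

Lemma normc_ge0 z : 0 <= normc z.
Proof. by case: z => a b; rewrite sqrtr_ge0. Qed.

Lemma normc_eq0 z : (normc z == 0) = (z == 0).
Proof.
apply/eqP/eqP => [/Normc.eq0_normc//|->]; exact: Normc.normc0.
Qed.

Lemma normc_gt0 z : (0 < normc z) = (z != 0).
Proof. by rewrite lt_neqAle normc_ge0 eq_sym normc_eq0 andbT. Qed.

Lemma normcB z w : normc (z - w) = normc (w - z).
Proof. by rewrite -normcN opprB. Qed.

Lemma normc_tri z w : normc (z - w) <= normc z + normc w.
Proof. by rewrite (le_trans (le_normcD _ _))// normcN. Qed.

Lemma normc_dist w z u : normc (z - u) <= normc (z - w) + normc (w - u).
Proof. by have := le_normcD (z - w) (w - u); rewrite addrA subrK. Qed.

Lemma normc_rtri z w : `|normc z - normc w| <= normc (z - w).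
Proof.
rewrite ler_norml lerBlDl lerBrDl; apply/andP; split.
  rewrite -subr_ge0.
  have := le_normcD z (w - z); rewrite addrC subrK normcB; lra.
have := le_normcD w (z - w); rewrite addrC subrK; lra.
Qed.

Lemma normcX z n : normc (z ^+ n) = normc z ^+ n.
Proof.
by elim: n => [|n IH]; rewrite ?expr0 ?Normc.normc1// !exprS Normc.normcM IH.
Qed.

Lemma normc_real (x : R) : normc (x%:C)%C = `|x|.
Proof. by rewrite /= expr0n addr0 sqrtr_sqr. Qed.

Lemma normcf_div z w : normc (z / w) = normc z / normc w.
Proof. by rewrite Normc.normcM Normc.normcV. Qed.

Lemma normc_sqr z : normc z ^+ 2 = Re z ^+ 2 + Im z ^+ 2.
Proof. by case: z => a b /=; rewrite sqr_sqrtr// addr_ge0// sqr_ge0. Qed.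

Lemma normc_Re z : `|Re z| <= normc z.
Proof.
rewrite -(ler_pXn2r (n := 2))// ?nnegrE ?normc_ge0//.
by rewrite normc_sqr real_normK ?num_real// lerDl sqr_ge0.
Qed.

Lemma normc_Im z : `|Im z| <= normc z.
Proof.
rewrite -(ler_pXn2r (n := 2))// ?nnegrE ?normc_ge0//.
by rewrite normc_sqr real_normK ?num_real// lerDr sqr_ge0.
Qed.

Lemma normc_le_ReIm z : normc z <= `|Re z| + `|Im z|.
Proof.
rewrite -(ler_pXn2r (n := 2))// ?nnegrE ?normc_ge0// ?addr_ge0//.
rewrite normc_sqr sqrrD !real_normK ?num_real//.
by rewrite -addrA lerD2l lerDr mulrn_wge0// mulr_ge0.
Qed.

Lemma normc_i : normc ('i%C : R[i]) = 1.
Proof. by rewrite /= expr0n expr1n add0r sqrtr1. Qed.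

Lemma normc_conj z : normc (conjc z) = normc z.
Proof. by case: z => a b /=; rewrite sqrrN. Qed.

Lemma normc_prod (I : Type) (r : seq I) (P : pred I) (F : I -> R[i]) :
  normc (\prod_(i <- r | P i) F i) = \prod_(i <- r | P i) normc (F i).
Proof.
exact: (big_morph (fun z => normc z) (@Normc.normcM R) (@Normc.normc1 R)).
Qed.

End Modulus.

Arguments Normc.normc : simpl never.

(** * Differentiation of complex-valued functions *)

(* The domain is the real line or the plane, seen inside the plane through the
   embedding [emb], so that the two derivatives share their calculus. *)
Section Differentiation.
Context {R : realType} {T : zmodType} (emb : {additive T -> R[i]}).
Implicit Types (f g phi : T -> R[i]) (x y h : T) (c d : R[i]).

Definition contat f x := forall e : R, 0 < e -> exists2 dl : R, 0 < dl &
  forall y, normc (emb (y - x)) < dl -> normc (f y - f x) < e.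

(* Caratheodory's form of differentiability: the slope is continuous at 0. *)
Definition diffat f x d := exists phi, [/\ contat phi 0, phi 0 = d &
  forall h, f (x + h) = f x + phi h * emb h].

Definition embI := forall h, emb h = 0 -> h = 0.

Lemma contat_near f g x : contat f x -> (exists2 dl : R, 0 < dl &
  forall y, normc (emb (y - x)) < dl -> f y = g y) -> contat g x.
Proof.
move=> cf [d1 d10 fg] e e0; have [d2 d20 h] := cf e e0.
exists (Num.min d1 d2); first by rewrite lt_min d10.
move=> y; rewrite lt_min => /andP[y1 y2].
by rewrite -!fg ?h// subrr raddf0 Normc.normc0.
Qed.

Lemma contat_cst c x : contat (fun=> c) x.
Proof. by move=> e e0; exists 1 => // y _; rewrite subrr Normc.normc0. Qed.

Lemma contat_emb x : contat emb x.
Proof. by move=> e e0; exists e => // y; rewrite raddfB. Qed.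

Lemma contatD f g x : contat f x -> contat g x -> contat (fun y => f y + g y) x.
Proof.
move=> cf cg e e0; have e20 : 0 < e / 2 by rewrite divr_gt0.
have [d1 d10 h1] := cf _ e20; have [d2 d20 h2] := cg _ e20.
exists (Num.min d1 d2); first by rewrite lt_min d10.
move=> y; rewrite lt_min => /andP[/h1 ? /h2 ?].
rewrite opprD addrACA (le_lt_trans (le_normcD _ _))//; lra.
Qed.

Lemma contatM f g x : contat f x -> contat g x -> contat (fun y => f y * g y) x.
Proof.
move=> cf cg e e0.
pose M := normc (f x) + normc (g x) + 1.
have M0 : 0 < M by rewrite ltr_wpDl// addr_ge0// normc_ge0.
pose e' := Num.min 1 (e / (2 * M)).
have e'0 : 0 < e' by rewrite lt_min ltr01 divr_gt0// mulr_gt0.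
have [d1 d10 h1] := cf _ e'0; have [d2 d20 h2] := cg _ e'0.
exists (Num.min d1 d2); first by rewrite lt_min d10.
move=> y; rewrite lt_min => /andP[/h1 + /h2].
have -> : f y * g y - f x * g x =
  (f y - f x) * (g y - g x) + ((f y - f x) * g x + f x * (g y - g x)) by ring.
set a := f y - f x; set b := g y - g x => ha hb.
have [ha1 ha2] : normc a < 1 /\ normc a < e / (2 * M) by apply/andP; rewrite -lt_min.
have [hb1 hb2] : normc b < 1 /\ normc b < e / (2 * M) by apply/andP; rewrite -lt_min.
apply: le_lt_trans (le_normcD _ _) _.
apply: le_lt_trans (lerD (lexx _) (le_normcD _ _)) _.
rewrite !Normc.normcM.
have -> : e = e / (2 * M) * M + e / (2 * M) * M by field; rewrite gt_eqF.
set t := e / (2 * M) in ha2 hb2 *.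
have fx := normc_ge0 (f x); have gx := normc_ge0 (g x).
have na := normc_ge0 a; have nb := normc_ge0 b.
have t0 : 0 < t by rewrite divr_gt0// mulr_gt0.
have : normc a * normc b <= t * 1 by apply: ler_pM => //; exact: ltW.
have : normc a * normc (g x) <= t * normc (g x) by apply: ler_wpM2r => //; exact: ltW.
have : normc (f x) * normc b <= normc (f x) * t by apply: ler_wpM2l => //; exact: ltW.
rewrite /M; nra.
Qed.

Lemma contatN f x : contat f x -> contat (fun y => - f y) x.
Proof.
move=> cf e e0; have [d d0 h] := cf e e0; exists d => // y /h.
by rewrite -opprD normcN.
Qed.

Lemma contatB f g x : contat f x -> contat g x -> contat (fun y => f y - g y) x.
Proof. by move=> cf /contatN; exact: contatD. Qed.

Lemma contat_neq0 f x : contat f x -> f x != 0 -> exists2 dl : R, 0 < dl &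
  forall y, normc (emb (y - x)) < dl -> normc (f x) / 2 < normc (f y).
Proof.
rewrite -normc_gt0 => cf fx0; have [|d d0 h] := cf (normc (f x) / 2).
  by rewrite divr_gt0.
exists d => // y /h; have := normc_rtri (f y) (f x).
by rewrite ler_norml => /andP[? ?]; lra.
Qed.

Lemma contatV f x : contat f x -> f x != 0 -> contat (fun y => (f y)^-1) x.
Proof.
move=> cf fx0 e e0; have [d1 d10 h1] := contat_neq0 cf fx0.
have nx : 0 < normc (f x) by rewrite normc_gt0.
have [|d2 d20 h2] := cf (e * (normc (f x) ^+ 2 / 2)).
  by rewrite mulr_gt0// divr_gt0// exprn_gt0.
exists (Num.min d1 d2); first by rewrite lt_min d10.
move=> y; rewrite lt_min => /andP[/h1 y1 /h2 y2].
have ny : 0 < normc (f y) by rewrite (le_lt_trans _ y1)// divr_ge0// ltW.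
have fy0 : f y != 0 by rewrite -normc_gt0.
have -> : (f y)^-1 - (f x)^-1 = (f x - f y) / (f x * f y).
  by field; rewrite fx0 fy0.
rewrite normcf_div Normc.normcM ltr_pdivrMr ?mulr_gt0// normcB.
apply: lt_le_trans y2 _; rewrite ler_pM2l//.
by rewrite expr2 -mulrA ler_pM2l// ltW.
Qed.

Lemma contatX f x n : contat f x -> contat (fun y => f y ^+ n) x.
Proof.
move=> cf; elim: n => [|n IH]; first exact: contat_cst.
apply: (contat_near (contatM cf IH)).
by exists 1 => // y _; rewrite exprS.
Qed.

Lemma diffat_cont f x d : diffat f x d -> contat f x.
Proof.
case=> phi [cphi _ fE].
have /contatM/(_ (contat_emb 0)) H := cphi.
move=> e e0; have [dl dl0 h] := H e e0.
exists dl => // y yx; have := h (y - x); rewrite subr0 raddf0 mulr0 subr0.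
by have := fE (y - x); rewrite addrC subrK => ->; rewrite [f x + _]addrC addrK; apply.
Qed.

(** The slope has to be defined at every [h]: it is given the value [d] at h = 0, and elsewhere
    [embI] allows the division by [emb h]. *)
Lemma eps_diffat f x d : embI ->
  (forall e : R, 0 < e -> exists2 dl : R, 0 < dl & forall h,
    normc (emb h) < dl ->
    normc (f (x + h) - f x - d * emb h) <= e * normc (emb h)) ->
  diffat f x d.
Proof.
move=> inj df.
have h0 h : h != 0 -> emb h != 0 by apply: contraNN => /eqP/inj ->.
exists (fun h => if h == 0 then d else (f (x + h) - f x) / emb h); split.
- move=> e e0; have [|dl dl0 H] := df (e / 2); first by rewrite divr_gt0.
  exists dl => // h; rewrite subr0 eqxx => /H le.
  case: eqVneq => [_|hn]; first by rewrite subrr Normc.normc0.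
  have nh : 0 < normc (emb h) by rewrite normc_gt0 h0.
  have -> : (f (x + h) - f x) / emb h - d = (f (x + h) - f x - d * emb h) / emb h.
    by field; rewrite h0.
  rewrite normcf_div ltr_pdivrMr// (le_lt_trans le)// ltr_pM2r//; lra.
- by rewrite eqxx.
- move=> h; case: eqVneq => [->|hn]; first by rewrite addr0 raddf0 mulr0 addr0.
  by rewrite divfK ?h0// [f x + _]addrC subrK.
Qed.

Lemma diffat_cst c x : diffat (fun=> c) x 0.
Proof.
by exists (fun=> 0); split => [||h]; [exact: contat_cst| |rewrite mul0r addr0].
Qed.

Lemma diffat_emb x : diffat emb x 1.
Proof.
by exists (fun=> 1); split => [||h]; [exact: contat_cst| |rewrite mul1r raddfD].
Qed.

Lemma diffatD f g x c d : diffat f x c -> diffat g x d ->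
  diffat (fun y => f y + g y) x (c + d).
Proof.
move=> [p [cp p0 fE]] [q [cq q0 gE]].
exists (fun h => p h + q h); split; [exact: contatD|by rewrite p0 q0|].
by move=> h; rewrite fE gE; ring.
Qed.

Lemma diffatM f g x c d : diffat f x c -> diffat g x d ->
  diffat (fun y => f y * g y) x (c * g x + f x * d).
Proof.
move=> [p [cp p0 fE]] [q [cq q0 gE]].
exists (fun h => p h * g x + f x * q h + p h * q h * emb h); split.
- apply: contatD; last exact: contatM (contatM cp cq) (contat_emb _).
  by apply: contatD; apply: contatM => //; exact: contat_cst.
- by rewrite p0 q0 raddf0 mulr0 addr0.
- by move=> h; rewrite fE gE; ring.
Qed.

Lemma diffatZ f x c d : diffat f x d -> diffat (fun y => c * f y) x (c * d).
Proof.
by move=> /(diffatM (diffat_cst c x)); rewrite mul0r add0r.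
Qed.

Lemma diffatN f x d : diffat f x d -> diffat (fun y => - f y) x (- d).
Proof.
move=> [p [cp p0 fE]]; exists (fun h => - p h).
by split => [||h]; [exact: contatN|rewrite p0|rewrite fE; ring].
Qed.

Lemma diffatB f g x c d : diffat f x c -> diffat g x d ->
  diffat (fun y => f y - g y) x (c - d).
Proof. by move=> df /diffatN; exact: diffatD. Qed.

Lemma contat_shift f x : contat f x -> contat (fun h => f (x + h)) 0.
Proof.
move=> cf e e0; have [d d0 h] := cf e e0; exists d => // y.
by rewrite subr0 addr0 => yd; apply: h; rewrite [x + y]addrC addrK.
Qed.

Lemma diffat_eps f x d : diffat f x d -> forall e : R, 0 < e ->
  exists2 dl : R, 0 < dl & forall h, normc (emb h) < dl ->
    normc (f (x + h) - f x - d * emb h) <= e * normc (emb h).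
Proof.
move=> [p [cp p0 fE]] e e0; have [dl dl0 H] := cp e e0; exists dl => // h hd.
have := H h; rewrite subr0 p0 => /(_ hd) /ltW.
rewrite fE => le.
have -> : f x + p h * emb h - f x - d * emb h = (p h - d) * emb h by ring.
by rewrite Normc.normcM ler_wpM2r// normc_ge0.
Qed.

Lemma diffat_near f g x d : embI ->
  diffat f x d -> (exists2 dl : R, 0 < dl &
  forall y, normc (emb (y - x)) < dl -> f y = g y) -> diffat g x d.
Proof.
move=> inj df [dl dl0 fg]; apply: eps_diffat => // e /(diffat_eps df)[d1 d10 H].
exists (Num.min d1 dl); first by rewrite lt_min d10.
move=> h; rewrite lt_min => /andP[/H + hd].
by rewrite !fg ?subrr ?raddf0 ?Normc.normc0// [x + h]addrC addrK.
Qed.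

Lemma diffatV f x d : embI ->
  diffat f x d -> f x != 0 -> diffat (fun y => (f y)^-1) x (- d / f x ^+ 2).
Proof.
move=> inj df fx0; have cf := diffat_cont df.
have [d1 d10 fn0] := contat_neq0 cf fx0.
(* [g] agrees with [f] near [x] and never vanishes, so that the slope formula of the inverse holds
   for every increment, as [diffat] requires. *)
pose g y := if f y == 0 then f x else f y.
have gx : g x = f x by rewrite /g (negbTE fx0).
have fg : exists2 dl : R, 0 < dl & forall y, normc (emb (y - x)) < dl -> f y = g y.
  exists d1 => // y /fn0 ny; rewrite /g ifN// -normc_gt0.
  by rewrite (le_lt_trans _ ny)// divr_ge0// normc_ge0.
have dg := diffat_near inj df fg; have cg := diffat_cont dg.
have gn0 y : g y != 0 by rewrite /g; case: ifP => // /negbT.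
apply: (@diffat_near (fun y => (g y)^-1)) => //; last first.
  by case: fg => dl dl0 H; exists dl => // y /H ->.
case: dg => p [cp p0 gE]; exists (fun h => - p h / (g x * g (x + h))); split.
- apply: contatM; first exact: contatN.
  apply: contatV; last by rewrite addr0 mulf_neq0.
  by apply: contatM; [exact: contat_cst|exact: contat_shift].
- by rewrite p0 addr0 gx expr2.
- move=> h; move: (gn0 (x + h)); rewrite gE => gh0; field.
  by rewrite gn0 gh0.
Qed.

Lemma diffat_comp (F : R[i] -> R[i]) f x c d :
  (exists psi : R[i] -> R[i], [/\
    forall e : R, 0 < e -> exists2 dl : R, 0 < dl & forall k,
      normc k < dl -> normc (psi k - psi 0) < e,
    psi 0 = d & forall k, F (f x + k) = F (f x) + psi k * k]) ->
  diffat f x c -> diffat (fun y => F (f y)) x (d * c).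
Proof.
move=> [psi [cpsi psi0 FE]] df.
have [p [cp p0 fE]] := df.
have cm : contat (fun h => p h * emb h) 0 := contatM cp (contat_emb _).
exists (fun h => psi (p h * emb h) * p h); split.
- apply: contatM => // e e0; have [d1 d10 h1] := cpsi e e0.
  have [d2 d20 h2] := cm _ d10; exists d2 => // y /h2.
  by rewrite raddf0 mulr0 subr0 => /h1.
- by rewrite raddf0 mulr0 psi0 p0.
- by move=> h; rewrite fE FE; ring.
Qed.

End Differentiation.

Notation ccont := (contat idfun).
Notation cdiff := (diffat idfun).
Notation pcont := (contat (real_complex _)).
Notation pdiff := (diffat (real_complex _)).

Section PlaneDerivative.
Context {R : realType}.
Implicit Types (F G : R[i] -> R[i]) (z w c d : R[i]).

Lemma idfun_inj : embI (idfun : {additive R[i] -> R[i]}). Proof. by []. Qed.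

Lemma real_complex_inj : embI (real_complex R). Proof. by move=> h []. Qed.

Lemma cdiff_id z : cdiff (fun w => w) z 1.
Proof. exact: diffat_emb. Qed.

Lemma ccont_id z : ccont (fun w : R[i] => w) z.
Proof. exact: contat_emb. Qed.

Lemma diffat_chain (T : zmodType) (emb : {additive T -> R[i]}) F
    (f : T -> R[i]) x c d :
  cdiff F (f x) d -> diffat emb f x c -> diffat emb (fun y => F (f y)) x (d * c).
Proof.
move=> [psi [cpsi psi0 FE]]; apply: diffat_comp.
exists psi; split => // e /cpsi[dl dl0 H]; exists dl => // k kd; apply: H.
by rewrite subr0.
Qed.

Lemma contat_comp (T : zmodType) (emb : {additive T -> R[i]}) F
    (f : T -> R[i]) x :
  ccont F (f x) -> contat emb f x -> contat emb (fun y => F (f y)) x.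
Proof.
move=> cF cf e /cF[d1 d10 H1]; have [d2 d20 H2] := cf _ d10.
by exists d2 => // y /H2 /H1.
Qed.

Lemma cdiffX F z d n : cdiff F z d ->
  cdiff (fun w => F w ^+ n) z (n%:R * F z ^+ n.-1 * d).
Proof.
move=> dF; elim: n => [|n IH].
  rewrite mul0r mul0r; apply: (diffat_near idfun_inj (diffat_cst _ 1 z)).
  by exists 1 => // y _; rewrite expr0.
have -> : n.+1%:R * F z ^+ n.+1.-1 * d =
  d * F z ^+ n + F z * (n%:R * F z ^+ n.-1 * d).
  case: n {IH} => [|n] /=; first by rewrite !expr0; ring.
  by rewrite exprS -[n.+2]addn1 natrD; ring.
apply: (diffat_near idfun_inj (diffatM dF IH)).
by exists 1 => // y _; rewrite exprS.
Qed.

Lemma diffat_uniq F z c d : cdiff F z c -> cdiff F z d -> c = d.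
Proof.
move=> /diffat_eps dc /diffat_eps dd; apply/eqP; rewrite -subr_eq0 -normc_eq0.
rewrite eq_le normc_ge0 andbT; apply/ler_addgt0Pl => e e0; rewrite addr0.
have e20 : 0 < e / 2 by rewrite divr_gt0.
have [d1 d10 H1] := dc _ e20; have [d2 d20 H2] := dd _ e20.
pose t := Num.min d1 d2 / 2.
have t0 : 0 < t by rewrite divr_gt0// lt_min d10.
have nt : normc (t%:C)%C = t by rewrite normc_real gtr0_norm.
have t1 : normc (t%:C)%C < d1 by rewrite nt /t; have := ge_min d1 d1 d2; lra.
have t2 : normc (t%:C)%C < d2 by rewrite nt /t; have := ge_min d2 d1 d2; lra.
have := H1 _ t1; have := H2 _ t2; rewrite nt /=.
set A := F _ - F z => h1 h2.
have : normc ((c - d) * (t%:C)%C) <= e / 2 * t + e / 2 * t.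
  have -> : (c - d) * (t%:C)%C = (A - d * (t%:C)%C) - (A - c * (t%:C)%C) by ring.
  exact: le_trans (normc_tri _ _) (lerD _ _).
rewrite Normc.normcM nt -mulrDl -splitr ler_pM2r//.
Qed.

Lemma pdiff_real (f : R -> R) x (d : R) : is_derive x (1 : R) f d ->
  pdiff (fun t => (f t)%:C)%C x (d%:C)%C.
Proof.
move=> [df fd]; apply: eps_diffat real_complex_inj _ => e e0.
have := df; rewrite /derivable => /cvg_ex[l fl].
have ld : l = d by rewrite -fd; apply/esym/cvg_lim => //; exact: fl.
move: fl; rewrite ld => /cvgrPdist_le/(_ e e0).
rewrite near_withinE => /nbhs_ballP[dl /= dl0 H]; exists dl => // h.
rewrite normc_real => hd.
have [->|hn] := eqVneq h 0.
  by rewrite addr0 subrr rmorph0 mulr0 subr0 Normc.normc0 normr0 mulr0.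
have := H h; rewrite /ball /= sub0r normrN => /(_ hd hn).
have -> : (f (x + h))%:C%C - (f x)%:C%C - d%:C%C * h%:C%C =
  ((f (x + h) - f x - d * h)%:C)%C by rewrite !rmorphB rmorphM.
rewrite normc_real /GRing.scale /= mulr1 [h + x]addrC.
have -> : f (x + h) - f x - d * h = - ((d - h^-1 * (f (x + h) - f x)) * h).
  by field.
by rewrite normrN normrM ler_pM2r// normr_gt0.
Qed.

Lemma pdiff_hline (c x : R) : pdiff (fun t => (t +i* c)%C) x 1.
Proof.
exists (fun=> 1); split => [||h]; [exact: contat_cst|by []|].
by rewrite mul1r; simpc.
Qed.

Lemma pdiff_vline (a y : R) : pdiff (fun t => (a +i* t)%C) y 'i%C.
Proof.
exists (fun=> 'i%C); split => [||h]; [exact: contat_cst|by []|].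
by simpc.
Qed.

End PlaneDerivative.

(** * Bisection *)

Section Bisection.
Context {R : realType}.

(* A property of the homothetic copies [x, x + s A] x [y, y + s B] of a rectangle
   that passes from the four quarters to the whole, and that holds for all small
   copies around each point, holds everywhere (Cousin's lemma); B = 0 is the
   one-dimensional case. *)
Lemma bisection (A B x0 y0 s0 : R) (Q : R -> R -> R -> Prop) :
  0 <= A -> 0 <= B -> 0 < s0 ->
  (forall x y s, 0 < s -> Q x y (s / 2) -> Q (x + s / 2 * A) y (s / 2) ->
    Q x (y + s / 2 * B) (s / 2) -> Q (x + s / 2 * A) (y + s / 2 * B) (s / 2) ->
    Q x y s) ->
  (forall p q, x0 <= p <= x0 + s0 * A -> y0 <= q <= y0 + s0 * B ->
    exists2 dl, 0 < dl & forall x y s, 0 < s < dl ->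
      x <= p <= x + s * A -> y <= q <= y + s * B ->
      x0 <= x -> x + s * A <= x0 + s0 * A ->
      y0 <= y -> y + s * B <= y0 + s0 * B -> Q x y s) ->
  Q x0 y0 s0.
Proof.
move=> A0 B0 s00 Qsplit Qloc; apply: contrapT => nQ.
pose st : Type := (R * R * R)%type.
have step (u : st) : exists v : st, 0 < u.2 -> ~ Q u.1.1 u.1.2 u.2 ->
    [/\ v.2 = u.2 / 2 /\ ~ Q v.1.1 v.1.2 v.2,
      u.1.1 <= v.1.1, v.1.1 + v.2 * A <= u.1.1 + u.2 * A,
      u.1.2 <= v.1.2 & v.1.2 + v.2 * B <= u.1.2 + u.2 * B].
  case: u => [[x y] s] /=.
  have [sp|sp] := ltP 0 s; last by exists (x, y, s) => //; rewrite ltNge sp.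
  have sA : 0 <= s * A by rewrite mulr_ge0// ltW.
  have sB : 0 <= s * B by rewrite mulr_ge0// ltW.
  have [h1|h1] := pselect (Q x y (s / 2)); last first.
    by exists (x, y, s / 2) => _ _ /=; split; [split => //|nra..].
  have [h2|h2] := pselect (Q (x + s / 2 * A) y (s / 2)); last first.
    by exists (x + s / 2 * A, y, s / 2) => _ _ /=; split; [split => //|nra..].
  have [h3|h3] := pselect (Q x (y + s / 2 * B) (s / 2)); last first.
    by exists (x, y + s / 2 * B, s / 2) => _ _ /=; split; [split => //|nra..].
  have [h4|h4] := pselect (Q (x + s / 2 * A) (y + s / 2 * B) (s / 2)); last first.
    by exists (x + s / 2 * A, y + s / 2 * B, s / 2) => _ _ /=; split; [split => //|nra..].
  by exists (x, y, s) => _ []; apply: Qsplit.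
have [nxt nxtP] := choice step.
pose u n := iter n nxt (x0, y0, s0).
have u2 n : (u n).2 = s0 / 2 ^+ n /\ ~ Q (u n).1.1 (u n).1.2 (u n).2.
  elim: n => [|n [IH1 IH2]]; first by rewrite /= expr0 divr1.
  have [|//|[E nQn] _ _ _ _] := nxtP (u n).
    by rewrite IH1 divr_gt0// exprn_gt0.
  split => //; rewrite /u iterS -/(u n) E IH1.
  by rewrite exprSr invfM mulrA.
have s_gt0 n : 0 < (u n).2 by rewrite (u2 n).1 divr_gt0// exprn_gt0.
have mon n : [/\ (u n).1.1 <= (u n.+1).1.1,
    (u n.+1).1.1 + (u n.+1).2 * A <= (u n).1.1 + (u n).2 * A,
    (u n).1.2 <= (u n.+1).1.2 &
    (u n.+1).1.2 + (u n.+1).2 * B <= (u n).1.2 + (u n).2 * B].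
  by have [] := nxtP (u n) (s_gt0 n) (u2 n).2.
have mono n k : [/\ (u n).1.1 <= (u (n + k)%N).1.1,
    (u (n + k)%N).1.1 + (u (n + k)%N).2 * A <= (u n).1.1 + (u n).2 * A,
    (u n).1.2 <= (u (n + k)%N).1.2 &
    (u (n + k)%N).1.2 + (u (n + k)%N).2 * B <= (u n).1.2 + (u n).2 * B].
  elim: k => [|k [h1 h2 h3 h4]]; first by rewrite addn0.
  rewrite addnS; have [g1 g2 g3 g4] := mon (n + k)%N.
  split; [exact: le_trans h1 g1|exact: le_trans g2 h2|exact: le_trans h3 g3|].
  exact: le_trans g4 h4.
(* The supremum of the lower ends lies in all the nested intervals; [D] is [A] for the abscissas and
   [B] for the ordinates. *)
have pts (x : nat -> R) (D : R) : 0 <= D ->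
  (forall n k, x n <= x (n + k)%N /\
    x (n + k)%N + (u (n + k)%N).2 * D <= x n + (u n).2 * D) ->
  exists p, forall n, x n <= p <= x n + (u n).2 * D.
  move=> D0 xm; exists (sup (range x)) => n.
  have ub m k : x k <= x m + (u m).2 * D.
    have [/subnKC <-|/ltnW/subnKC E] := leqP m k.
      have [_] := xm m (k - m)%N; apply: le_trans.
      by rewrite lerDl mulr_ge0// ltW.
    have [h1 h2] := xm k (m - k)%N; rewrite E in h1 h2.
    by rewrite (le_trans h1)// lerDl mulr_ge0// ltW.
  have hs : has_sup (range x).
    by split; [exists (x 0%N), 0%N|exists (x 0%N + (u 0%N).2 * D) => _ [k _ <-]].
  rewrite (ub_le_sup hs.2)/=; last by exists n.
  by apply: ge_sup => [|_ [k _ <-]]; [exact: hs.1|exact: ub].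
have [p pP] : exists p, forall n, (u n).1.1 <= p <= (u n).1.1 + (u n).2 * A.
  by apply: pts => // n k; have [] := mono n k.
have [q qP] : exists p, forall n, (u n).1.2 <= p <= (u n).1.2 + (u n).2 * B.
  by apply: pts => // n k; have [] := mono n k.
have [dl dl0 H] := Qloc p q (pP 0%N) (qP 0%N).
have [n nP] : exists n, s0 / 2 ^+ n < dl.
  have [n hn] : exists n, s0 / dl < 2 ^+ n.
    exists (Num.truncn (s0 / dl)).+1; rewrite (lt_le_trans (Num.Theory.truncnS_gt _))//.
    by rewrite -natrX ler_nat ltnW// ltn_expl.
  exists n; rewrite ltr_pdivrMr ?exprn_gt0// mulrC -ltr_pdivrMr//.
have [h1 h2 h3 h4] := mono 0%N n; apply: (u2 n).2; apply: H => //.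
by rewrite s_gt0 (u2 n).1.
Qed.

End Bisection.

(** * Integration of continuous complex-valued functions *)

Section Integration.
Context {R : realType}.
Implicit Types (g P : R -> R[i]) (a b : R).

(** Mean value inequality without continuity of [g], by Cousin's lemma in dimension one: near each
    point differentiability gives the bound with slack [e'], and the increments of adjacent
    intervals add up. *)
Lemma pdiff_Re_le P g a b (M : R) : a <= b ->
  (forall x, a <= x <= b -> pdiff P x (g x)) ->
  (forall x, a <= x <= b -> Re (g x) <= M) -> Re (P b - P a) <= M * (b - a).
Proof.
rewrite le_eqVlt => /predU1P[<-|ab dP gM].
  by move=> _ _; rewrite !subrr mulr0.
apply/ler_addgt0Pr => e e0.
have ba : 0 < b - a by rewrite subr_gt0.
pose e' := e / (b - a).
have -> : M * (b - a) + e = (M + e') * (b - a) by rewrite /e'; field; rewrite gt_eqF.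
have e'0 : 0 < e' by rewrite divr_gt0.
have := @bisection _ 1 0 a 0 (b - a)
  (fun x _ s => Re (P (x + s) - P x) <= (M + e') * s).
have E : a + (b - a) = b by ring.
rewrite E; apply => // [x _ s s0 h1 h2 _ _|p q].
  have -> : P (x + s) - P x =
    (P (x + s / 2 + s / 2) - P (x + s / 2)) + (P (x + s / 2) - P x).
    by rewrite addrA subrK -(addrA x) -splitr.
  by rewrite mulr1 in h2; rewrite raddfD /=; lra.
rewrite mulr1 E => pab _; have [dl dl0 H] := diffat_eps (dP p pab) e'0.
exists dl => // x y s /andP[s0 sd]; rewrite mulr1 => /andP[xp px] _ _ _ _ _.
have K t : `|t| < dl -> Re (P (p + t)) - Re (P p) - Re (g p) * t <= e' * `|t|
   /\ - (e' * `|t|) <= Re (P (p + t)) - Re (P p) - Re (g p) * t.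
  move=> td; have := H t; rewrite normc_real => /(_ td) le.
  have := le_trans (normc_Re _) le; rewrite ler_norml => /andP[].
  rewrite !raddfB /=.
  have -> : Re (g p * (t%:C)%C) = Re (g p) * t by case: (g p) => u v; simpc.
  by [].
have [k1 _] := K (x + s - p) ltac:(rewrite ger0_norm; lra).
have [_ k2] := K (x - p) ltac:(rewrite ler0_norm; lra).
move: k1 k2; rewrite !(addrC p) !subrK (ger0_norm (x := _ - p)); last lra.
rewrite ler0_norm; last lra.
have := gM p pab; rewrite raddfB /=; nra.
Qed.

(** A unit factor turns the modulus into a real part, so that bounds for real parts pass to
    moduli. *)
Lemma normc_attained (z : R[i]) : exists2 u : R[i], normc u = 1 & normc z = Re (u * z).
Proof.
have [->|z0] := eqVneq z 0.
  by exists 1; rewrite ?Normc.normc1// mulr0 Normc.normc0.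
have nz : normc z != 0 by rewrite normc_eq0.
exists (conjc z / (normc z)%:C%C).
  by rewrite normcf_div normc_conj normc_real ger0_norm ?divff// normc_ge0.
have E : conjc z * z = ((normc z ^+ 2)%:C)%C.
  by rewrite normc_sqr; case: z {z0 nz} => x y; simpc; congr (_ +i* _)%C; ring.
by rewrite mulrAC E expr2 rmorphM mulfK// fmorph_eq0.
Qed.

Lemma pdiff_normc_le P g a b (M : R) : a <= b ->
  (forall x, a <= x <= b -> pdiff P x (g x)) ->
  (forall x, a <= x <= b -> normc (g x) <= M) -> normc (P b - P a) <= M * (b - a).
Proof.
move=> ab dP gM; have [u u1 ->] := normc_attained (P b - P a).
rewrite mulrBr.
apply: (@pdiff_Re_le (fun x => u * P x) (fun x => u * g x)) => // x xab.
  exact: diffatZ (dP _ _).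
rewrite (le_trans (ler_norm _))// (le_trans (normc_Re _))//.
by rewrite Normc.normcM u1 mul1r gM.
Qed.

(** The integral is the increment of any primitive, with default 0 when there is none. Independence
    of the primitive is the mean value inequality, and linearity is that of derivatives; measure
    theory enters only through the existence of primitives. *)
Definition cint g a b : R[i] :=
  xget 0 [set v | exists2 P, forall x, a <= x <= b -> pdiff P x (g x)
                           & v = P b - P a].

Lemma cint_FTC P g a b : a <= b ->
  (forall x, a <= x <= b -> pdiff P x (g x)) -> cint g a b = P b - P a.
Proof.
move=> ab dP; rewrite /cint; case: xgetP => [v _ [P' dP' ->]|/(_ (P b - P a))].
  apply/eqP; rewrite -subr_eq0 -normc_eq0 eq_le normc_ge0 andbT.
  have -> : P' b - P' a - (P b - P a) = (P' b - P b) - (P' a - P a) by ring.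
  have := @pdiff_normc_le (fun x => P' x - P x) (fun=> 0) a b 0 ab.
  rewrite mul0r; apply => x xab; last by rewrite Normc.normc0.
  by have := diffatB (dP' x xab) (dP x xab); rewrite subrr.
by case; exists P.
Qed.

Lemma pcont_Re g x : pcont g x -> {for x, continuous (fun t => Re (g t))}.
Proof.
move=> cg; apply/cvgrPdist_lt => e e0; have [dl dl0 H] := cg e e0.
apply/nbhs_ballP; exists dl => // y yx; have {}yx : `|y - x| < dl by rewrite distrC.
have := H y; rewrite normc_real => /(_ yx).
by apply: le_lt_trans; rewrite distrC -raddfB normc_Re.
Qed.

Lemma real_primitive (h : R -> R) a b : a <= b -> continuous h ->
  exists P : R -> R, forall x, a <= x <= b -> is_derive x (1 : R) P (h x).
Proof.
move=> ab ch; pose mu := @lebesgue_measure R.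
(* Starting at a - 1 and working below b + 1 makes every point of the closed segment interior, so
   that the fundamental theorem applies at the ends too. *)
exists (fun x => (\int[mu]_(t in [set` `[a - 1, x]]) h t)%R) => x /andP[ax xb].
have [||||d1 d2] := @continuous_FTC1_closed R h (a - 1) x (b + 1).
- lra.
- apply: continuous_compact_integrable; first exact: segment_compact.
  exact: continuous_subspaceT.
- lra.
- exact: ch.
by split; [exact: d1|rewrite -d2 derive1E].
Qed.

Lemma cprimitive g a b : a <= b -> (forall x, a <= x <= b -> pcont g x) ->
  exists P, forall x, a <= x <= b -> pdiff P x (g x).
Proof.
(* [cl] is the nearest-point projection onto the segment; composing with this 1-Lipschitz map makes
   [g] continuous on the whole line. *)
move=> ab cg; pose cl x := Num.max a (Num.min b x).
have clP x : a <= cl x <= b.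
  by rewrite /cl le_max lexx /= ge_max ab /= ge_min lexx.
have clE x : a <= x <= b -> cl x = x.
  by move=> /andP[ax xb]; rewrite /cl (min_idPr xb) (max_idPr ax).
have cl1 x y : `|cl y - cl x| <= `|y - x|.
  have lipmax (u v : R) : `|Num.max a u - Num.max a v| <= `|u - v|.
    by rewrite ler_norml; case: (leP a u); case: (leP a v) => h1 h2; have := ler_norm (u - v);
      have := ler_norm (v - u); rewrite distrC; clear -h1 h2; lra.
  have lipmin (u v : R) : `|Num.min b u - Num.min b v| <= `|u - v|.
    by rewrite ler_norml; case: (leP b u); case: (leP b v) => h1 h2; have := ler_norm (u - v);
      have := ler_norm (v - u); rewrite distrC; clear -h1 h2; lra.
  exact: le_trans (lipmax _ _) (lipmin _ _).
have cgc x : pcont (fun t => g (cl t)) x.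
  move=> e e0; have [dl dl0 H] := cg _ (clP x) e e0.
  exists dl => // y; rewrite normc_real => yx; apply: H.
  by rewrite normc_real (le_lt_trans (cl1 _ _)).
have cRe : continuous (fun t => Re (g (cl t))) by move=> x; apply: pcont_Re.
(* Multiplication by -i turns the imaginary part into a real part, so [pcont_Re] serves both. *)
have cIm : continuous (fun t => Re (- 'i%C * g (cl t))).
  by move=> x; apply: pcont_Re; apply: contatM => //; exact: contat_cst.
have [P1 dP1] := real_primitive ab cRe.
have [P2 dP2] := real_primitive ab cIm.
exists (fun x => (P1 x)%:C%C + 'i%C * (P2 x)%:C%C) => x xab.
have := diffatD (pdiff_real (dP1 x xab)) (diffatZ 'i%C (pdiff_real (dP2 x xab))).
rewrite /= clE//; congr (pdiff _ _ _).
by case: (g x) => u v; simpc.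
Qed.

Lemma cintP g a b : a <= b -> (forall x, a <= x <= b -> pcont g x) ->
  exists2 P, forall x, a <= x <= b -> pdiff P x (g x) & cint g a b = P b - P a.
Proof.
by move=> ab cg; have [P dP] := cprimitive ab cg; exists P => //; exact: cint_FTC.
Qed.

Lemma cint_ext g h a b : (forall x, a <= x <= b -> g x = h x) ->
  cint g a b = cint h a b.
Proof.
move=> gh; rewrite /cint; congr (xget 0 _); apply/seteqP; split => v [P dP ->];
  by exists P => // x xab; have := dP x xab; rewrite gh.
Qed.

Lemma cintxx g a : cint g a a = 0.
Proof.
rewrite /cint; case: xgetP => // v _ [P _ ->]; exact: subrr.
Qed.

Lemma cint_split g a c b : a <= c <= b -> (forall x, a <= x <= b -> pcont g x) ->
  cint g a b = cint g a c + cint g c b.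
Proof.
move=> /andP[ac cb] cg; have ab := le_trans ac cb.
have [P dP ->] := cintP ab cg.
have -> : cint g a c = P c - P a.
  by apply: cint_FTC => // x /andP[? ?]; apply: dP; lra.
have -> : cint g c b = P b - P c.
  by apply: cint_FTC => // x /andP[? ?]; apply: dP; lra.
ring.
Qed.

Lemma cintD g h a b : a <= b -> (forall x, a <= x <= b -> pcont g x) ->
  (forall x, a <= x <= b -> pcont h x) ->
  cint (fun x => g x + h x) a b = cint g a b + cint h a b.
Proof.
move=> ab cg ch; have [P dP ->] := cintP ab cg; have [Q dQ ->] := cintP ab ch.
rewrite (@cint_FTC (fun x => P x + Q x))//; first ring.
by move=> x xab; apply: diffatD; [exact: dP|exact: dQ].
Qed.

Lemma cintZ (k : R[i]) g a b : a <= b -> (forall x, a <= x <= b -> pcont g x) ->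
  cint (fun x => k * g x) a b = k * cint g a b.
Proof.
move=> ab cg; have [P dP ->] := cintP ab cg.
rewrite (@cint_FTC (fun x => k * P x))//; first ring.
by move=> x xab; apply: diffatZ; exact: dP.
Qed.

Lemma cint_cst (k : R[i]) a b : a <= b -> cint (fun=> k) a b = k * ((b - a)%:C)%C.
Proof.
move=> ab; rewrite (@cint_FTC (fun x => k * (x%:C)%C))//.
  by rewrite -mulrBr rmorphB.
by move=> x _; have := diffatZ k (diffat_emb (real_complex R) x); rewrite mulr1.
Qed.

Lemma cint_normc_le g a b (M : R) : a <= b ->
  (forall x, a <= x <= b -> pcont g x) ->
  (forall x, a <= x <= b -> normc (g x) <= M) -> normc (cint g a b) <= M * (b - a).
Proof.
by move=> ab cg gM; have [P dP ->] := cintP ab cg; exact: pdiff_normc_le dP gM.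
Qed.

Lemma cint_Re_le g a b (M : R) : a <= b ->
  (forall x, a <= x <= b -> pcont g x) ->
  (forall x, a <= x <= b -> Re (g x) <= M) -> Re (cint g a b) <= M * (b - a).
Proof.
by move=> ab cg gM; have [P dP ->] := cintP ab cg; exact: pdiff_Re_le dP gM.
Qed.

End Integration.

(** * Cauchy's theorem on rectangles *)

Section Rectangle.
Context {R : realType}.
Implicit Types (F G : R[i] -> R[i]) (a b c d : R) (z w : R[i]).

Definition inrect a b c d z := (a <= Re z <= b) && (c <= Im z <= d).

Definition onrect a b c d z := inrect a b c d z &&
  [|| Re z == a, Re z == b, Im z == c | Im z == d].

Definition oint F a b c d : R[i] :=
  cint (fun x => F (x +i* c)%C) a b - cint (fun x => F (x +i* d)%C) a b
  + 'i%C * (cint (fun y => F (b +i* y)%C) c d - cint (fun y => F (a +i* y)%C) c d).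

Lemma onrect_sub a b c d z : onrect a b c d z -> inrect a b c d z.
Proof. by case/andP. Qed.

Lemma onrect_sides a b c d : a <= b -> c <= d ->
  [/\ forall x, a <= x <= b -> onrect a b c d (x +i* c)%C,
      forall x, a <= x <= b -> onrect a b c d (x +i* d)%C,
      forall y, c <= y <= d -> onrect a b c d (b +i* y)%C &
      forall y, c <= y <= d -> onrect a b c d (a +i* y)%C].
Proof.
move=> ab cd; split => x xab; rewrite /onrect /inrect /=
  ?xab ?lexx ?ab ?cd ?eqxx ?orbT//.
Qed.

Lemma pcont_h F x c : ccont F (x +i* c)%C -> pcont (fun t => F (t +i* c)%C) x.
Proof. by move=> cF; apply: contat_comp => //; exact: diffat_cont (pdiff_hline _ _). Qed.

Lemma pcont_v F a y : ccont F (a +i* y)%C -> pcont (fun t => F (a +i* t)%C) y.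
Proof. by move=> cF; apply: contat_comp => //; exact: diffat_cont (pdiff_vline _ _). Qed.

Lemma sides_cont F a b c d : a <= b -> c <= d ->
  (forall z, onrect a b c d z -> ccont F z) ->
  [/\ forall x, a <= x <= b -> pcont (fun x => F (x +i* c)%C) x,
      forall x, a <= x <= b -> pcont (fun x => F (x +i* d)%C) x,
      forall y, c <= y <= d -> pcont (fun y => F (b +i* y)%C) y &
      forall y, c <= y <= d -> pcont (fun y => F (a +i* y)%C) y].
Proof.
move=> ab cd cF; have [h1 h2 h3 h4] := onrect_sides ab cd.
by split => x xab; first [apply: pcont_h; apply: cF|apply: pcont_v; apply: cF];
  auto.
Qed.

Lemma oint_ext F G a b c d : a <= b -> c <= d ->
  (forall z, onrect a b c d z -> F z = G z) -> oint F a b c d = oint G a b c d.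
Proof.
move=> ab cd FG; have [h1 h2 h3 h4] := onrect_sides ab cd.
by congr (_ - _ + 'i%C * (_ - _)); apply: cint_ext => x /= xab; apply: FG; auto.
Qed.

Lemma ointD F G a b c d : a <= b -> c <= d ->
  (forall z, onrect a b c d z -> ccont F z) ->
  (forall z, onrect a b c d z -> ccont G z) ->
  oint (fun z => F z + G z) a b c d = oint F a b c d + oint G a b c d.
Proof.
move=> ab cd cF cG; have [f1 f2 f3 f4] := sides_cont ab cd cF.
by have [g1 g2 g3 g4] := sides_cont ab cd cG; rewrite /oint !cintD//; ring.
Qed.

Lemma ointZ F (k : R[i]) a b c d : a <= b -> c <= d ->
  (forall z, onrect a b c d z -> ccont F z) ->
  oint (fun z => k * F z) a b c d = k * oint F a b c d.
Proof.
move=> ab cd cF; have [f1 f2 f3 f4] := sides_cont ab cd cF.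
by rewrite /oint !cintZ//; ring.
Qed.

Lemma oint_bound F a b c d (M : R) : a <= b -> c <= d ->
  (forall z, onrect a b c d z -> ccont F z) ->
  (forall z, onrect a b c d z -> normc (F z) <= M) ->
  normc (oint F a b c d) <= 2 * M * ((b - a) + (d - c)).
Proof.
move=> ab cd cF FM; have [f1 f2 f3 f4] := sides_cont ab cd cF.
have [h1 h2 h3 h4] := onrect_sides ab cd.
apply: le_trans (le_normcD _ _) _; rewrite Normc.normcM normc_i mul1r.
apply: le_trans (lerD (normc_tri _ _) (normc_tri _ _)) _.
have -> : 2 * M * (b - a + (d - c)) = (M * (b - a) + M * (b - a)) +
  (M * (d - c) + M * (d - c)) by ring.
by apply: lerD; apply: lerD; apply: cint_normc_le => // x xab; apply: FM; auto.
Qed.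

Lemma oint_prim F G a b c d : a <= b -> c <= d ->
  (forall z, onrect a b c d z -> cdiff G z (F z)) -> oint F a b c d = 0.
Proof.
move=> ab cd dG; have [h1 h2 h3 h4] := onrect_sides ab cd.
have H k : (forall x, a <= x <= b -> onrect a b c d (x +i* k)%C) ->
    cint (fun x => F (x +i* k)%C) a b = G (b +i* k)%C - G (a +i* k)%C.
  move=> hk; apply: (@cint_FTC _ (fun t => G (t +i* k)%C)) => // x /hk/dG dGx.
  by have := diffat_chain dGx (pdiff_hline k x); rewrite mulr1.
have V k : (forall y, c <= y <= d -> onrect a b c d (k +i* y)%C) ->
    'i%C * cint (fun y => F (k +i* y)%C) c d = G (k +i* d)%C - G (k +i* c)%C.
  move=> hk.
  have -> : cint (fun y => F (k +i* y)%C) c d =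
      - 'i%C * (G (k +i* d)%C - G (k +i* c)%C).
    rewrite mulrBr; apply: (@cint_FTC _ (fun t => - 'i%C * G (k +i* t)%C)) => // y.
    move=> /hk/dG dGx.
    have := diffatZ (- 'i%C) (diffat_chain dGx (pdiff_vline k y)).
    by rewrite mulrCA mulNr -expr2 sqr_i opprK mulr1.
  by rewrite mulrA mulrN -expr2 sqr_i opprK mul1r.
rewrite /oint mulrBr (H c)// (H d)// (V b)// (V a)//; ring.
Qed.

Lemma oint_hsplit F a e b c d : a <= e <= b -> c <= d ->
  (forall z, inrect a b c d z -> ccont F z) ->
  oint F a b c d = oint F a e c d + oint F e b c d.
Proof.
move=> aeb cd cF; have ab : a <= b by lra.
have [h1 h2 h3 h4] := onrect_sides ab cd.
have cc k : (forall x, a <= x <= b -> onrect a b c d (x +i* k)%C) ->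
   forall x, a <= x <= b -> pcont (fun x => F (x +i* k)%C) x.
  by move=> H x /H/onrect_sub/cF; exact: pcont_h.
rewrite /oint !(@cint_split _ _ a e b)//; [ring|exact: cc..].
Qed.

Lemma oint_vsplit F a b c e d : a <= b -> c <= e <= d ->
  (forall z, inrect a b c d z -> ccont F z) ->
  oint F a b c d = oint F a b c e + oint F a b e d.
Proof.
move=> ab ced cF; have cd : c <= d by lra.
have [h1 h2 h3 h4] := onrect_sides ab cd.
have cc k : (forall x, c <= x <= d -> onrect a b c d (k +i* x)%C) ->
   forall x, c <= x <= d -> pcont (fun x => F (k +i* x)%C) x.
  by move=> H x /H/onrect_sub/cF; exact: pcont_v.
rewrite /oint !(@cint_split _ _ c e d)//; [ring|exact: cc..].
Qed.

Lemma inrect_trans a b c d a' b' c' d' z : a <= a' -> b' <= b -> c <= c' ->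
  d' <= d -> inrect a' b' c' d' z -> inrect a b c d z.
Proof. by rewrite /inrect => ? ? ? ? /andP[/andP[? ?] /andP[? ?]]; lra. Qed.

Lemma inrect_normc a b c d z w : inrect a b c d z -> inrect a b c d w ->
  normc (z - w) <= (b - a) + (d - c).
Proof.
move=> /andP[/andP[z1 z2] /andP[z3 z4]] /andP[/andP[w1 w2] /andP[w3 w4]].
apply: le_trans (normc_le_ReIm _) _.
by rewrite !raddfB; apply: lerD; rewrite ler_norml; apply/andP; split; lra.
Qed.

Lemma oint_quarters F x y h k (e s : R) : 0 <= h -> 0 <= k ->
  (forall z, inrect x (x + h + h) y (y + k + k) z -> ccont F z) ->
  normc (oint F x (x + h) y (y + k)) <= e * (s / 2) ^+ 2 ->
  normc (oint F (x + h) (x + h + h) y (y + k)) <= e * (s / 2) ^+ 2 ->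
  normc (oint F x (x + h) (y + k) (y + k + k)) <= e * (s / 2) ^+ 2 ->
  normc (oint F (x + h) (x + h + h) (y + k) (y + k + k)) <= e * (s / 2) ^+ 2 ->
  normc (oint F x (x + h + h) y (y + k + k)) <= e * s ^+ 2.
Proof.
move=> h0 k0 cF l1 l2 l3 l4.
rewrite (@oint_hsplit _ x (x + h)); [|lra..|exact: cF].
rewrite (@oint_vsplit _ x _ y (y + k)); [|lra..|]; last first.
  by move=> z zin; apply: cF; apply: inrect_trans zin; lra.
rewrite (@oint_vsplit _ _ _ y (y + k) (y + k + k)); [|lra..|]; last first.
  by move=> z zin; apply: cF; apply: inrect_trans zin; lra.
apply: le_trans (le_normcD _ _) _.
apply: le_trans (lerD (le_normcD _ _) (le_normcD _ _)) _.
have -> : e * s ^+ 2 = e * (s / 2) ^+ 2 + e * (s / 2) ^+ 2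
   + (e * (s / 2) ^+ 2 + e * (s / 2) ^+ 2) by field.
by rewrite lerD// lerD.
Qed.

(** The bound e s^2 for the copy of size s is additive over quarters. It holds for small copies
    around a point because F differs there from an affine function, which has a primitive, by o(s)
    on a boundary of length O(s). *)
Lemma goursat F a b c d : a <= b -> c <= d ->
  (forall z, inrect a b c d z -> exists D, cdiff F z D) -> oint F a b c d = 0.
Proof.
move=> ab cd dF.
have cF z : inrect a b c d z -> ccont F z by move=> /dF[D]; exact: diffat_cont.
apply/eqP; rewrite -normc_eq0 eq_le normc_ge0 andbT.
apply/ler_addgt0Pr => e e0; rewrite add0r.
pose Q x y s := a <= x -> x + s * (b - a) <= b -> c <= y -> y + s * (d - c) <= d ->
  normc (oint F x (x + s * (b - a)) y (y + s * (d - c))) <= e * s ^+ 2.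
have A0 : 0 <= b - a by lra.
have B0 : 0 <= d - c by lra.
suff : Q a c 1.
  rewrite /Q !mul1r expr1n mulr1 (_ : a + (b - a) = b); last by ring.
  by rewrite (_ : c + (d - c) = d); [apply|ring].
apply: (@bisection _ (b - a) (d - c)) => //.
- move=> x y s s0 q1 q2 q3 q4 ax xb cy yd.
  pose h := s / 2 * (b - a); pose k := s / 2 * (d - c).
  have h0 : 0 <= h by rewrite mulr_ge0// divr_ge0// ltW.
  have k0 : 0 <= k by rewrite mulr_ge0// divr_ge0// ltW.
  have hE : s * (b - a) = h + h by rewrite /h; field.
  have kE : s * (d - c) = k + k by rewrite /k; field.
  rewrite hE kE addrA [y + _]addrA in xb yd *.
  rewrite /Q -/h -/k in q1 q2 q3 q4.
  apply: oint_quarters => //.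
  + by move=> z /(inrect_trans ax xb cy yd); exact: cF.
  + by apply: q1 => //; clear -h0 k0 xb yd; lra.
  + by apply: q2 => //; clear -h0 k0 ax xb yd; lra.
  + by apply: q3 => //; clear -h0 k0 cy xb yd; lra.
  + by apply: q4 => //; clear -h0 k0 ax cy xb yd; lra.
- move=> p q; rewrite !mul1r => /andP[p1 p2] /andP[q1 q2].
  have pq : inrect a b c d (p +i* q)%C.
    by rewrite /inrect /=; apply/andP; split; lra.
  have [D dFp] := dF _ pq.
  pose K := (b - a) + (d - c).
  have K0 : 0 <= K by rewrite /K; lra.
  (* The perimeter of the copy is 2 s K and the error on it at most e' s K; this choice makes 2 e'
     K^2 at most e. *)
  pose e' := e / (2 * K ^+ 2 + 1).
  have K21 : 0 < 2 * K ^+ 2 + 1 by rewrite ltr_wpDl// mulr_ge0// sqr_ge0.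
  have e'0 : 0 < e' by rewrite divr_gt0.
  have [dl dl0 H] := diffat_eps dFp e'0.
  exists (dl / (K + 1)); first by rewrite divr_gt0// ltr_wpDl.
  move=> x y s /andP[s0 sd] px py _ _ _ _ ax xb cy yd.
  have sA : 0 <= s * (b - a) by rewrite mulr_ge0// ltW.
  have sB : 0 <= s * (d - c) by rewrite mulr_ge0// ltW.
  set b' := x + _; set d' := y + _.
  have xb' : x <= b' by rewrite /b'; lra.
  have yd' : y <= d' by rewrite /d'; lra.
  pose P := (p +i* q)%C.
  have pin : inrect x b' y d' P by rewrite /inrect px py.
  pose L z := F P + D * (z - P).
  have cL z : ccont L z.
    apply: contatD; first exact: contat_cst.
    apply: contatM; first exact: contat_cst.
    by apply: contatB; [exact: ccont_id|exact: contat_cst].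
  have cFL z : onrect x b' y d' z -> ccont (fun z => F z - L z) z.
    move=> /onrect_sub/(inrect_trans ax xb cy yd)/cF cz.
    exact: contatB.
  have -> : oint F x b' y d' = oint (fun z => F z - L z) x b' y d'.
    transitivity (oint (fun z => (F z - L z) + L z) x b' y d').
      by apply: oint_ext => // z _; rewrite subrK.
    rewrite ointD// [X in _ + X](@oint_prim _ (fun z => F P * z + D / 2 * (z - P) ^+ 2))//.
      by rewrite addr0.
    move=> z _; rewrite /L.
    have := diffatD (diffatZ (F P) (cdiff_id z))
      (diffatZ (D / 2) (cdiffX 2 (diffatB (cdiff_id z) (diffat_cst idfun P z)))).
    by congr (diffat _ _ _ _); rewrite /= expr1; field.
  have sK : s * K < dl.
    rewrite (@le_lt_trans _ _ (s * (K + 1)))// ?ler_pM2l ?lerDl//.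
    by rewrite -ltr_pdivlMr// ltr_wpDl.
  have bnd z : onrect x b' y d' z -> normc (F z - L z) <= e' * (s * K).
    move=> /onrect_sub zin; have := inrect_normc zin pin.
    have -> : b' - x + (d' - y) = s * K by rewrite /b' /d' /K; ring.
    move=> zP; have := H (z - P); rewrite /= (le_lt_trans zP sK) => /(_ isT).
    have -> : P + (z - P) = z by ring.
    rewrite /L => le.
    rewrite opprD addrA (le_trans le)// ler_wpM2l// ltW//.
  apply: le_trans (oint_bound xb' yd' cFL bnd) _.
  have -> : b' - x + (d' - y) = s * K by rewrite /b' /d' /K; ring.
  have -> : 2 * (e' * (s * K)) * (s * K) = e' * (2 * K ^+ 2) * s ^+ 2 by ring.
  rewrite ler_wpM2r ?sqr_ge0// /e' mulrAC ler_pdivrMr// ler_pM2l//; lra.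
Qed.

Lemma oint_degenerate F a b c d : a <= b -> c <= d -> a = b \/ c = d ->
  oint F a b c d = 0.
Proof.
by move=> ab cd [->|->]; rewrite /oint !cintxx !subrr ?mulr0 ?addr0.
Qed.

(** Each end of the small interval either is the end of the large one or lies strictly beside [p].
    The rectangles cut off around [p] are therefore degenerate or avoid [p]. *)
Lemma window a b p t : a <= p <= b -> 0 < t -> exists x1 x2,
  [/\ a <= x1 <= p, p <= x2 <= b, p - t <= x1 /\ x2 <= p + t,
    a = x1 \/ x1 < p & x2 = b \/ p < x2].
Proof.
move=> /andP[ap pb] t0; exists (Num.max a (p - t)), (Num.min b (p + t)).
case: (leP a (p - t)) => h1; case: (leP b (p + t)) => h2;
  split; try (by split; lra); try lra; first [by left|by right; lra].
Qed.

(** Induction on [S]: four strips around [p] contribute 0, and the central rectangle is as small as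
    desired while F stays bounded near [p]. *)
Lemma goursat_except (S : seq R[i]) F a b c d : a <= b -> c <= d ->
  (forall z, inrect a b c d z -> ccont F z) ->
  (forall z, inrect a b c d z -> z \notin S -> exists D, cdiff F z D) ->
  oint F a b c d = 0.
Proof.
elim: S a b c d => [|p S IH] a b c d ab cd cF dF.
  by apply: goursat => // z zin; exact: dF.
have IH' a' b' c' d' : a' <= b' -> c' <= d' -> a <= a' -> b' <= b -> c <= c' ->
    d' <= d -> ~~ inrect a' b' c' d' p -> oint F a' b' c' d' = 0.
  move=> ? ? ? ? ? ? npin; apply: (IH a' b' c' d') => //.
    by move=> z zin; apply: cF; apply: inrect_trans zin.
  move=> z zin zS; apply: dF; first exact: inrect_trans zin.
  rewrite inE negb_or zS andbT; apply: contraNN npin => /eqP <-; exact: zin.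
have [pin|] := boolP (inrect a b c d p); last exact: IH'.
apply/eqP; rewrite -normc_eq0 eq_le normc_ge0 andbT.
apply/ler_addgt0Pr => e e0; rewrite add0r.
have /andP[pab pcd] := pin.
have [dl dl0 Fb] := cF p pin 1 ltr01.
pose M := normc (F p) + 1.
have M0 : 0 < M by rewrite ltr_wpDl// normc_ge0.
(* The central rectangle has half-perimeter at most 4 t: the first bound keeps it within [dl] of
   [p], the second makes 2 M (4 t) at most e. *)
pose t := Num.min (dl / 5) (e / (8 * M)).
have t0 : 0 < t by rewrite lt_min !divr_gt0// mulr_gt0.
have t1 : t <= dl / 5 by rewrite /t ge_min lexx.
have t2 : t <= e / (8 * M) by rewrite /t ge_min lexx orbT.
have [x1 [x2 [/andP[a1 x1p] /andP[x2p x2b] [tx1 tx2] xa xb]]] := window pab t0.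
have [y1 [y2 [/andP[c1 y1p] /andP[y2p y2d] [ty1 ty2] yc yd]]] := window pcd t0.
have [x12 y12] := (le_trans x1p x2p, le_trans y1p y2p).
have [ax2 x1b] := (le_trans a1 x12, le_trans x12 x2b).
have [cy2 y1d] := (le_trans c1 y12, le_trans y12 y2d).
have left0 : oint F a x1 c d = 0.
  case: xa => [->|x1p']; first by apply: oint_degenerate => //; left.
  by apply: IH' => //; rewrite /inrect [Re p <= _]leNgt x1p' andbF.
have right0 : oint F x2 b c d = 0.
  case: xb => [->|x2p']; first by apply: oint_degenerate => //; left.
  by apply: IH' => //; rewrite /inrect [x2 <= _]leNgt x2p'.
have bot0 : oint F x1 x2 c y1 = 0.
  case: yc => [->|y1p']; first by apply: oint_degenerate => //; right.
  by apply: IH' => //; rewrite /inrect [Im p <= _]leNgt y1p' !andbF.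
have top0 : oint F x1 x2 y2 d = 0.
  case: yd => [->|y2p']; first by apply: oint_degenerate => //; right.
  by apply: IH' => //; rewrite /inrect [y2 <= _]leNgt y2p' !andbF.
have cF1 z : inrect x1 b c d z -> ccont F z.
  by move=> zin; apply: cF; apply: inrect_trans zin.
have cF2 z : inrect x1 x2 c d z -> ccont F z.
  by move=> zin; apply: cF; apply: inrect_trans zin.
have cF3 z : inrect x1 x2 y1 d z -> ccont F z.
  by move=> zin; apply: cF; apply: inrect_trans zin.
have cF4 z : inrect x1 x2 y1 y2 z -> ccont F z.
  by move=> zin; apply: cF; apply: inrect_trans zin.
rewrite (@oint_hsplit F a x1 b) ?a1//; rewrite left0 add0r.
rewrite (@oint_hsplit F x1 x2 b) ?x12//; rewrite right0 addr0.
rewrite (@oint_vsplit F x1 x2 c y1) ?c1//; rewrite bot0 add0r.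
rewrite (@oint_vsplit F x1 x2 y1 y2) ?y12//; rewrite top0 addr0.
have K4 : x2 - x1 + (y2 - y1) <= 4 * t by lra.
have pin' : inrect x1 x2 y1 y2 p by rewrite /inrect x1p x2p y1p y2p.
have bnd z : onrect x1 x2 y1 y2 z -> normc (F z) <= M.
  move=> /onrect_sub zin; have /Fb : normc (z - p) < dl.
    by apply: le_lt_trans (inrect_normc zin pin') _; clear -K4 t1 dl0; lra.
  have := normc_rtri (F z) (F p); rewrite ler_norml /M => /andP[_].
  by clear; lra.
have := oint_bound x12 y12 (fun z zb => cF4 z (onrect_sub zb)) bnd.
move=> /le_trans; apply.
have -> : e = 2 * M * (4 * (e / (8 * M))) by field; rewrite gt_eqF.
by rewrite ler_pM2l ?mulr_gt0// (le_trans K4)// ler_pM2l.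
Qed.

End Rectangle.

(** * Cauchy's integral formula and regularity *)

Section CauchyFormula.
Context {R : realType}.
Implicit Types (F G : R[i] -> R[i]) (a b c d : R) (z w q : R[i]).

Definition inint a b c d w := (a < Re w < b) && (c < Im w < d).

Lemma inint_inrect a b c d w : inint a b c d w -> inrect a b c d w.
Proof. by rewrite /inint /inrect => /andP[/andP[? ?] /andP[? ?]]; rewrite !ltW. Qed.

Lemma rect_bounded F a b c d : a <= b -> c <= d ->
  (forall z, inrect a b c d z -> ccont F z) ->
  exists2 M, 0 < M & forall z, inrect a b c d z -> normc (F z) <= M.
Proof.
move=> ab cd cF.
pose Q x y s := exists2 M, 0 < M & forall z,
  inrect x (x + s * (b - a)) y (y + s * (d - c)) z -> normc (F z) <= M.
suff : Q a c 1.
  rewrite /Q !mul1r (_ : a + (b - a) = b); last by ring.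
  by rewrite (_ : c + (d - c) = d); [|ring].
apply: (@bisection _ (b - a) (d - c)) => //; [lra|lra|..].
- move=> x y s s0 [M1 M10 H1] [M2 M20 H2] [M3 M30 H3] [M4 M40 H4].
  exists (M1 + M2 + M3 + M4); first by lra.
  move=> z /andP[/andP[z1 z2] /andP[z3 z4]].
  have hx : x + s / 2 * (b - a) + s / 2 * (b - a) = x + s * (b - a) by field.
  have hy : y + s / 2 * (d - c) + s / 2 * (d - c) = y + s * (d - c) by field.
  have [x1|x1] := leP (Re z) (x + s / 2 * (b - a));
  have [y1|y1] := leP (Im z) (y + s / 2 * (d - c)).
  + have : normc (F z) <= M1 by apply: H1; rewrite /inrect z1 x1 z3 y1.
    by clear -M20 M30 M40; lra.
  + have : normc (F z) <= M3 by apply: H3; rewrite /inrect hy z1 x1 z4 (ltW y1).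
    by clear -M20 M10 M40; lra.
  + have : normc (F z) <= M2 by apply: H2; rewrite /inrect hx z2 z3 y1 (ltW x1).
    by clear -M30 M10 M40; lra.
  + have : normc (F z) <= M4.
      by apply: H4; rewrite /inrect hx hy z2 z4 (ltW y1) (ltW x1).
    by clear -M30 M10 M20; lra.
- move=> p q; rewrite !mul1r => /andP[p1 p2] /andP[q1 q2].
  have pin : inrect a b c d (p +i* q)%C by rewrite /inrect /=; apply/andP; split; lra.
  have [dl dl0 H] := cF _ pin 1 ltr01.
  have K0 : 0 <= (b - a) + (d - c) by lra.
  exists (dl / ((b - a) + (d - c) + 1)); first by rewrite divr_gt0// ltr_wpDl.
  move=> x y s /andP[s0 sd] px py _ _ _ _.
  exists (normc (F (p +i* q)%C) + 1); first by rewrite ltr_wpDl// normc_ge0.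
  move=> z zin; have : normc (z - (p +i* q)%C) < dl.
    apply: le_lt_trans (inrect_normc zin _) _; first by rewrite /inrect px py.
    rewrite ltr_pdivlMr ?ltr_wpDl// in sd; apply: le_lt_trans sd.
    by clear -s0; lra.
  move=> /H; have := normc_rtri (F z) (F (p +i* q)%C).
  by rewrite ler_norml => /andP[_]; clear; lra.
Qed.

Definition idist a b c d w : R :=
  Num.min (Num.min (Re w - a) (b - Re w)) (Num.min (Im w - c) (d - Im w)).

Lemma idist_gt0 a b c d w : inint a b c d w -> 0 < idist a b c d w.
Proof.
by move=> /andP[/andP[? ?] /andP[? ?]]; rewrite /idist !lt_min !subr_gt0;
  apply/andP; split; apply/andP.
Qed.

Lemma idist_le a b c d w z : onrect a b c d z -> idist a b c d w <= normc (z - w).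
Proof.
have h1 := normc_Re (z - w); have h2 := normc_Im (z - w).
rewrite !raddfB /= in h1 h2.
move=> /andP[_ /or4P[] /eqP E]; rewrite E in h1 h2 *.
- apply: le_trans h1; rewrite distrC (le_trans _ (ler_norm _))//.
  by rewrite /idist !ge_min lexx.
- apply: le_trans h1; rewrite (le_trans _ (ler_norm _))//.
  by rewrite /idist !ge_min lexx orbT.
- apply: le_trans h2; rewrite distrC (le_trans _ (ler_norm _))//.
  by rewrite /idist !ge_min lexx !orbT.
- apply: le_trans h2; rewrite (le_trans _ (ler_norm _))//.
  by rewrite /idist !ge_min lexx !orbT.
Qed.

(** The remainder of the kernel is quadratic in h uniformly on the boundary, so it can be
    integrated. *)
Lemma oint_param_diff F a b c d (k : R[i] -> R[i] -> R[i]) (k' : R[i] -> R[i])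
    w (C0 dl : R) : a <= b -> c <= d -> 0 < dl -> 0 < C0 ->
  (forall z, inrect a b c d z -> ccont F z) ->
  (forall z, onrect a b c d z -> ccont k' z) ->
  (forall h z, normc h < dl -> onrect a b c d z -> ccont (k (w + h)) z) ->
  (forall h z, normc h < dl -> onrect a b c d z ->
    normc (k (w + h) z - k w z - k' z * h) <= C0 * normc h ^+ 2) ->
  cdiff (fun w => oint (fun z => F z * k w z) a b c d) w
    (oint (fun z => F z * k' z) a b c d).
Proof.
move=> ab cd dl0 C00 cF ck' ck H; have [M M0 FM] := rect_bounded ab cd cF.
apply: eps_diffat idfun_inj _ => e e0.
pose K := 2 * (M * C0) * ((b - a) + (d - c)) + 1.
have K0 : 0 < K by rewrite ltr_wpDl// mulr_ge0//; [rewrite !mulr_ge0// ltW|lra].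
exists (Num.min dl (e / K)); first by rewrite lt_min dl0 divr_gt0.
move=> h; rewrite lt_min => /andP[hd he] /=.
have c1 z : onrect a b c d z -> ccont (fun z => F z * k (w + h) z) z.
  by move=> zb; apply: contatM; [exact/cF/onrect_sub|exact: ck].
have c2 z : onrect a b c d z -> ccont (fun z => F z * k w z) z.
  move=> zb; apply: contatM; first exact/cF/onrect_sub.
  by have := ck 0 z; rewrite addr0 Normc.normc0; apply.
have c3 z : onrect a b c d z -> ccont (fun z => F z * k' z) z.
  by move=> zb; apply: contatM; [exact/cF/onrect_sub|exact: ck'].
have c2' z : onrect a b c d z -> ccont (fun z => -1 * (F z * k w z)) z.
  by move=> zb; apply: contatM; [exact: contat_cst|exact: c2].
have c3' z : onrect a b c d z -> ccont (fun z => - h * (F z * k' z)) z.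
  by move=> zb; apply: contatM; [exact: contat_cst|exact: c3].
have c12 z : onrect a b c d z ->
    ccont (fun z => F z * k (w + h) z + -1 * (F z * k w z)) z.
  by move=> zb; apply: contatD; [exact: c1|exact: c2'].
have -> : oint (fun z => F z * k (w + h) z) a b c d - oint (fun z => F z * k w z) a b c d
    - oint (fun z => F z * k' z) a b c d * h =
    oint (fun z => F z * k (w + h) z + -1 * (F z * k w z) + - h * (F z * k' z)) a b c d.
  by rewrite !ointD// !ointZ//; ring.
have bnd z : onrect a b c d z -> normc (F z * k (w + h) z + -1 * (F z * k w z) +
    - h * (F z * k' z)) <= M * C0 * normc h ^+ 2.
  move=> zb; have -> : F z * k (w + h) z + -1 * (F z * k w z) + - h * (F z * k' z) =
    F z * (k (w + h) z - k w z - k' z * h) by ring.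
  by rewrite Normc.normcM -mulrA ler_pM ?normc_ge0 ?H// FM// onrect_sub.
apply: le_trans (oint_bound ab cd _ bnd) _.
  by move=> z zb; apply: contatD; [exact: c12|exact: c3'].
rewrite ltr_pdivlMr// in he.
have -> : 2 * (M * C0 * normc h ^+ 2) * (b - a + (d - c)) =
  normc h * (K - 1) * normc h by rewrite /K; ring.
rewrite ler_wpM2r ?normc_ge0//; apply: le_trans (ltW he).
by rewrite ler_wpM2l ?normc_ge0//; clear; lra.
Qed.

Definition cauchyT F n a b c d w := oint (fun z => F z * ((z - w) ^+ n)^-1) a b c d.

Lemma ccont_kernel n w z : z != w -> ccont (fun z => ((z - w) ^+ n)^-1) z.
Proof.
move=> zw; apply: contatV; last by rewrite expf_neq0// subr_eq0.
by apply: contatX; apply: contatB; [exact: ccont_id|exact: contat_cst].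
Qed.

Lemma onrect_neq a b c d w z : inint a b c d w -> onrect a b c d z -> z != w.
Proof.
move=> /idist_gt0 w0 /(idist_le w) le.
by rewrite -subr_eq0 -normc_gt0 (lt_le_trans w0 le).
Qed.

(** The case n = 1 gives the derivative of F through Cauchy's formula, and n = 2 the
    differentiability of that derivative. *)
Lemma cauchyT_diff F n a b c d w : (n == 1%N) || (n == 2%N) -> inint a b c d w ->
  (forall z, inrect a b c d z -> ccont F z) ->
  cdiff (cauchyT F n a b c d) w (n%:R * cauchyT F n.+1 a b c d w).
Proof.
move=> n12 win cF.
have /andP[/andP[w1 w2] /andP[w3 w4]] := win.
have ab : a <= b by lra.
have cd : c <= d by lra.
pose m := idist a b c d w; have m0 : 0 < m := idist_gt0 win.
have m20 : 0 < m / 2 by lra.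
(* The two summands bound the second-order remainders of the kernel for n = 1 and n = 2, given that
   |z - w - h| is at least half of |z - w| on the boundary. *)
have K0 : 0 < 16 / m ^+ 3 + 16 / m ^+ 4.
  by rewrite addr_gt0// divr_gt0// exprn_gt0.
have near h z : normc h < m / 2 -> onrect a b c d z ->
    m <= normc (z - w) /\ normc (z - w) / 2 <= normc (z - (w + h)).
  move=> hm zb; have mz := idist_le w zb; split => //.
  have := normc_rtri (z - w) h; rewrite ler_norml opprD addrA => /andP[_].
  by rewrite -/m in mz; clear -mz hm; lra.
have neq h z : normc h < m / 2 -> onrect a b c d z ->
    z - w != 0 /\ z - (w + h) != 0.
  move=> hm zb; have [n1 n2] := near _ _ hm zb.
  by rewrite -!normc_gt0; split; lra.
have := @oint_param_diff F a b c d (fun w z => ((z - w) ^+ n)^-1)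
  (fun z => n%:R * ((z - w) ^+ n.+1)^-1) w _ (m / 2) ab cd m20 K0 cF.
rewrite /cauchyT -ointZ//; last first.
  move=> z zb; apply: contatM; first exact/cF/onrect_sub.
  exact/ccont_kernel/(onrect_neq win).
move=> H; have {}H := H _ _ _; move: H.
set D1 := oint _ _ _ _ _; set D2 := oint _ _ _ _ _.
have -> : D1 = D2 by apply: oint_ext => // z _; rewrite mulrCA.
apply.
- move=> z zb; apply: contatM; first exact: contat_cst.
  exact/ccont_kernel/(onrect_neq win).
- move=> h z hm zb; apply: ccont_kernel; rewrite -subr_eq0.
  by have [] := neq _ _ hm zb.
- move=> h z hm zb; have [n1 n2] := near _ _ hm zb; have [n3 n4] := neq _ _ hm zb.
  set u := z - w in n1 n2 n3 *.
  have hu : z - (w + h) = u - h by rewrite /u; ring.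
  rewrite hu in n2 n4 *.
  have nu : 0 < normc u by lra.
  have nuh : 0 < normc (u - h) by lra.
  have h2 : 0 <= normc h ^+ 2 by rewrite sqr_ge0.
  case/orP: n12 => /eqP ->.
    have -> : ((u - h) ^+ 1)^-1 - (u ^+ 1)^-1 - 1%:R * (u ^+ 2)^-1 * h =
      h ^+ 2 / (u ^+ 2 * (u - h)) by field; rewrite n3 n4.
    rewrite normcf_div [normc (u ^+ 2 * _)]Normc.normcM !normcX mulrC ler_wpM2r//.
    apply: (@le_trans _ _ (16 / m ^+ 3)); last first.
      by rewrite lerDl divr_ge0// exprn_ge0// ltW.
    rewrite -[X in X <= _]div1r ler_pdivrMr ?mulr_gt0 ?exprn_gt0//.
    rewrite mulrAC ler_pdivlMr ?exprn_gt0// mul1r.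
    apply: (@le_trans _ _ (16 * (m ^+ 2 * (m / 2)))).
      have : 0 <= m ^+ 3 by rewrite exprn_ge0// ltW.
      by clear; rewrite !exprS expr0; lra.
    rewrite ler_pM2l// ler_pM// ?exprn_ge0 ?(ltW m20)//; [exact: ltW| |lra].
    by rewrite ler_pXn2r// nnegrE ltW.
  have -> : ((u - h) ^+ 2)^-1 - (u ^+ 2)^-1 - 2%:R * (u ^+ 3)^-1 * h =
    h ^+ 2 * (3%:R * u - 2%:R * h) / (u ^+ 3 * (u - h) ^+ 2).
    by field; rewrite n3 n4.
  rewrite normcf_div [normc (u ^+ 3 * _)]Normc.normcM [normc (h ^+ 2 * _)]Normc.normcM.
  rewrite !normcX -mulrA mulrC ler_wpM2r//.
  apply: (@le_trans _ _ (16 / m ^+ 4)); last first.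
    by rewrite lerDr divr_ge0// exprn_ge0// ltW.
  have num : normc (3%:R * u - 2%:R * h) <= 4 * normc u.
    apply: le_trans (normc_tri _ _) _; rewrite !Normc.normcM.
    have -> : normc (3%:R : R[i]) = 3.
      by rewrite -[3%:R](rmorph_nat (real_complex R)) normc_real normr_nat.
    have -> : normc (2%:R : R[i]) = 2.
      by rewrite -[2%:R](rmorph_nat (real_complex R)) normc_real normr_nat.
    by lra.
  rewrite ler_pdivrMr ?mulr_gt0 ?exprn_gt0//.
  rewrite mulrAC ler_pdivlMr ?exprn_gt0//.
  apply: (@le_trans _ _ (4 * normc u * m ^+ 4)).
    by rewrite ler_wpM2r// exprn_ge0// ltW.
  have q1 : m ^+ 2 <= normc u ^+ 2 by rewrite ler_pXn2r// nnegrE ltW.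
  have q2 : (normc u / 2) ^+ 2 <= normc (u - h) ^+ 2.
    by rewrite ler_pXn2r// nnegrE ?ltW// divr_gt0.
  have q3 : (m / 2) ^+ 2 <= normc (u - h) ^+ 2.
    by apply: le_trans q2; rewrite ler_pXn2r// ?nnegrE; lra.
  have q4 : m ^+ 2 * (m / 2) ^+ 2 <= normc u ^+ 2 * normc (u - h) ^+ 2.
    by rewrite ler_pM// sqr_ge0.
  have -> : 4 * normc u * m ^+ 4 = 16 * normc u * (m ^+ 2 * (m / 2) ^+ 2) by field.
  have -> : 16 * (normc u ^+ 3 * normc (u - h) ^+ 2) =
    16 * normc u * (normc u ^+ 2 * normc (u - h) ^+ 2) by ring.
  by rewrite ler_wpM2l// mulr_ge0// ltW.
Qed.

Lemma Re_cinv_i (X Y : R) : Re ('i%C * ((X +i* Y)%C)^-1) = Y / (X ^+ 2 + Y ^+ 2).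
Proof. by rewrite mulrC ReiNIm /= ?mulNr opprK. Qed.

Lemma ReN z : Re (- z) = - Re z. Proof. by case: z. Qed.

Lemma Re_cinv (X Y : R) : Re (((X +i* Y)%C)^-1) = X / (X ^+ 2 + Y ^+ 2).
Proof. by []. Qed.

(** The imaginary part of dz / (z - w) is the angle seen from [w], which increases along each side.
    A side contributes at least its length times its distance to [w] over [D], and the four terms
    add up to twice the area over [D]. *)
Lemma cauchyT1_lower a b c d w (D : R) : inint a b c d w ->
  (forall z, onrect a b c d z -> normc (z - w) ^+ 2 <= D) -> 0 < D ->
  2 * ((b - a) * (d - c)) / D <= normc (cauchyT (fun=> 1) 1 a b c d w).
Proof.
move=> win zD D0; have /andP[/andP[w1 w2] /andP[w3 w4]] := win.
have ab : a <= b by lra.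
have cd : c <= d by lra.
have [h1 h2 h3 h4] := onrect_sides ab cd.
have ck z : onrect a b c d z -> ccont (fun z => 1 * ((z - w) ^+ 1)^-1) z.
  move=> zb; apply: contatM; first exact: contat_cst.
  exact/ccont_kernel/(onrect_neq win).
have [f1 f2 f3 f4] := sides_cont ab cd ck.
set T := cauchyT _ _ _ _ _ _ _.
have nT : normc T = normc ('i%C * T) by rewrite Normc.normcM normc_i mul1r.
rewrite nT -normcN (le_trans _ (normc_Re _))// (le_trans _ (ler_norm _))//.
have T0 z : onrect a b c d z -> 0 < Re (z - w) ^+ 2 + Im (z - w) ^+ 2 <= D.
  by move=> zb; rewrite -normc_sqr zD// exprn_gt0// normc_gt0 subr_eq0 (onrect_neq win).
have est (x : R[i]) (r : R) : onrect a b c d x -> r < 0 ->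
    r / (Re (x - w) ^+ 2 + Im (x - w) ^+ 2) <= r / D.
  move=> /T0/andP[p1 p2] r0; rewrite ler_nM2l//.
  by rewrite lef_pV2// posrE (lt_le_trans p1).
have cpl (x : R[i]) : (Re x +i* Im x)%C = x by case: x.
have bot : Re (cint (fun x => 'i%C * (1 * (((x +i* c)%C - w) ^+ 1)^-1)) a b)
    <= (c - Im w) / D * (b - a).
  apply: cint_Re_le => // x xab.
    by apply: contatM; [exact: contat_cst|exact: f1].
  rewrite expr1 mul1r -[(_ - w)]cpl Re_cinv_i.
  by rewrite {1}raddfB /=; apply: est; [exact: h1|lra].
have top : Re (cint (fun x => - 'i%C * (1 * (((x +i* d)%C - w) ^+ 1)^-1)) a b)
    <= (Im w - d) / D * (b - a).
  apply: cint_Re_le => // x xab.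
    by apply: contatM; [exact: contat_cst|exact: f2].
  rewrite expr1 mul1r -[(_ - w)]cpl mulNr ReN Re_cinv_i -mulNr.
  by rewrite {1}raddfB /= opprB; apply: est; [exact: h2|lra].
have rig : Re (cint (fun y => -1 * (1 * (((b +i* y)%C - w) ^+ 1)^-1)) c d)
    <= (Re w - b) / D * (d - c).
  apply: cint_Re_le => // x xab.
    by apply: contatM; [exact: contat_cst|exact: f3].
  rewrite expr1 mul1r -[(_ - w)]cpl mulN1r ReN Re_cinv -mulNr.
  by rewrite {1}raddfB /= opprB; apply: est; [exact: h3|lra].
have lef : Re (cint (fun y => 1 * (((a +i* y)%C - w) ^+ 1)^-1) c d)
    <= (a - Re w) / D * (d - c).
  apply: cint_Re_le => // x xab.
  rewrite expr1 mul1r -[(_ - w)]cpl Re_cinv.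
  by rewrite {1}raddfB /=; apply: est; [exact: h4|lra].
have -> : 'i%C * T = cint (fun x => 'i%C * (1 * (((x +i* c)%C - w) ^+ 1)^-1)) a b
  + cint (fun x => - 'i%C * (1 * (((x +i* d)%C - w) ^+ 1)^-1)) a b
  + cint (fun y => -1 * (1 * (((b +i* y)%C - w) ^+ 1)^-1)) c d
  + cint (fun y => 1 * (((a +i* y)%C - w) ^+ 1)^-1) c d.
  rewrite (cintZ 'i%C)// (cintZ (- 'i%C))// (cintZ (-1))//.
  rewrite /T /cauchyT /oint.
  have ii : 'i%C * 'i%C = -1 :> R[i] by rewrite -expr2 sqr_i.
  set A := cint _ a b; set B := cint _ a b; set C := cint _ c d; set E := cint _ c d.
  rewrite mulrDr mulrA ii; ring.
rewrite ReN !raddfD /=.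
have -> : 2 * ((b - a) * (d - c)) / D = - ((c - Im w) / D * (b - a) +
  (Im w - d) / D * (b - a) + (Re w - b) / D * (d - c) + (a - Re w) / D * (d - c)).
  by field; rewrite gt_eqF.
clear -bot top rig lef; lra.
Qed.

Lemma cauchyT1_neq0 a b c d w : inint a b c d w -> cauchyT (fun=> 1) 1 a b c d w != 0.
Proof.
move=> win; have /andP[/andP[w1 w2] /andP[w3 w4]] := win.
pose D := ((b - a) + (d - c)) ^+ 2.
have D0 : 0 < D by rewrite exprn_gt0//; lra.
rewrite -normc_gt0; apply: lt_le_trans (cauchyT1_lower win (D := D) _ D0).
  by rewrite divr_gt0// !mulr_gt0//; lra.
move=> z /onrect_sub zin; rewrite ler_pXn2r ?nnegrE ?normc_ge0//; last by lra.
by apply: inrect_normc => //; exact: inint_inrect.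
Qed.

(** The difference quotient at [w], completed by the derivative, is continuous, and it is
    differentiable off [q] and [w]: its boundary integral vanishes by [goursat_except]. *)
Lemma cauchy_formula_off q F a b c d w : inint a b c d w -> w != q ->
  (forall z, inrect a b c d z -> ccont F z) ->
  (forall z, inrect a b c d z -> z != q -> exists D, cdiff F z D) ->
  F w * cauchyT (fun=> 1) 1 a b c d w = cauchyT F 1 a b c d w.
Proof.
move=> win wq cF dF; have /andP[/andP[w1 w2] /andP[w3 w4]] := win.
have ab : a <= b by lra.
have cd : c <= d by lra.
have [D dFw] := dF w (inint_inrect win) wq.
have [phi [cphi phi0 FE]] := dFw.
pose G z := phi (z - w).
have GE z : z != w -> G z = (F z - F w) * (z - w)^-1.
  move=> zw; rewrite /G; have := FE (z - w).
  have -> : w + (z - w) = z by ring.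
  by move=> ->; rewrite [F w + _]addrC addrK /= mulfK// subr_eq0.
have G0 : oint G a b c d = 0.
  apply: (goursat_except (S := [:: q; w])) => // z zin.
    have [->|zw] := eqVneq z w.
      move=> e /cphi[dl dl0 H]; exists dl => // y yw.
      by have := H (y - w); rewrite /G subrr subr0; apply.
    apply: (@contat_near _ _ _ (fun z => (F z - F w) * (z - w)^-1)).
      apply: contatM; first by apply: contatB; [exact: cF|exact: contat_cst].
      apply: contatV; last by rewrite subr_eq0.
      by apply: contatB; [exact: ccont_id|exact: contat_cst].
    exists (normc (z - w)); first by rewrite normc_gt0 subr_eq0.
    move=> y yz; rewrite GE//; apply: contraTneq yz => ->.
    by rewrite normcB ltxx.
  rewrite !inE negb_or => /andP[zq zw].
  have [Dz dFz] := dF z zin zq.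
  exists ((Dz - 0) * (z - w)^-1 + (F z - F w) * (- (1 - 0) / (z - w) ^+ 2)).
  apply: (@diffat_near _ _ _ (fun z => (F z - F w) * (z - w)^-1) _ _ _ idfun_inj).
    apply: diffatM; first exact: diffatB dFz (diffat_cst _ _ _).
    apply: diffatV idfun_inj _ _; last by rewrite subr_eq0.
    exact: diffatB (cdiff_id _) (diffat_cst _ _ _).
  exists (normc (z - w)); first by rewrite normc_gt0 subr_eq0.
  move=> y yz; rewrite GE//; apply: contraTneq yz => ->.
  by rewrite normcB ltxx.
have ck z : onrect a b c d z -> ccont (fun z => 1 * ((z - w) ^+ 1)^-1) z.
  move=> zb; apply: contatM; first exact: contat_cst.
  exact/ccont_kernel/(onrect_neq win).
have cFk z : onrect a b c d z -> ccont (fun z => F z * ((z - w) ^+ 1)^-1) z.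
  move=> zb; apply: contatM; first exact/cF/onrect_sub.
  exact/ccont_kernel/(onrect_neq win).
rewrite /cauchyT -ointZ//; apply/eqP; rewrite eq_sym -subr_eq0.
have -> : oint (fun z => F z * ((z - w) ^+ 1)^-1) a b c d -
    oint (fun z => F w * (1 * ((z - w) ^+ 1)^-1)) a b c d =
    oint (fun z => F z * ((z - w) ^+ 1)^-1 + (- F w) * (1 * ((z - w) ^+ 1)^-1)) a b c d.
  rewrite ointD//; last by move=> z zb; apply: contatM; [exact: contat_cst|exact: ck].
  by rewrite (ointZ (- F w))// (ointZ (F w))//; ring.
apply/eqP; rewrite -G0; apply: oint_ext => // z zb.
rewrite GE ?(onrect_neq win)// expr1; ring.
Qed.

Lemma contat_punctured F G q : ccont F q -> ccont G q ->
  (exists2 dl : R, 0 < dl & forall w, w != q -> normc (w - q) < dl -> F w = G w) ->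
  F q = G q.
Proof.
move=> cF cG [dl dl0 FG]; apply/eqP; rewrite -subr_eq0 -normc_eq0.
rewrite eq_le normc_ge0 andbT; apply/ler_addgt0Pr => e e0; rewrite add0r.
have [d1 d10 H] := contatB cF cG e0.
pose t := Num.min dl d1 / 2.
have t0 : 0 < t by rewrite divr_gt0// lt_min dl0.
have qt : normc (q + (t%:C)%C - q) = t by rewrite addrC addKr normc_real gtr0_norm.
have m1 : Num.min dl d1 <= dl by rewrite ge_min lexx.
have m2 : Num.min dl d1 <= d1 by rewrite ge_min lexx orbT.
have := H (q + (t%:C)%C); rewrite raddfB /= -[_ - q](raddfB idfun) /= qt.
rewrite FG ?subrr ?sub0r ?normcN; last first.
- by rewrite qt /t; clear -m1 t0 dl0; rewrite /t in t0; lra.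
- rewrite -subr_eq0 -normc_gt0 qt//.
by move=> /(_ _)/ltW; apply; rewrite /t; rewrite /t in t0; clear -m2 t0 d10; lra.
Qed.

(** The transform of the constant 1 stands for 2 pi i, and its nonvanishing is all that the quotient
    asks for. At w = q the formula follows by continuity from the nearby points. *)
Lemma cauchy_formula q F a b c d w : inint a b c d w ->
  (forall z, inrect a b c d z -> ccont F z) ->
  (forall z, inrect a b c d z -> z != q -> exists D, cdiff F z D) ->
  F w = cauchyT F 1 a b c d w / cauchyT (fun=> 1) 1 a b c d w.
Proof.
move=> win cF dF; have T0 := cauchyT1_neq0 win.
have [wq|wq] := eqVneq w q; last first.
  by apply: (canRL (mulfK T0)); exact: (cauchy_formula_off win wq).
have cT : ccont (fun w => cauchyT F 1 a b c d w / cauchyT (fun=> 1) 1 a b c d w) w.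
  apply: contatM; first exact: diffat_cont (cauchyT_diff _ win cF).
  apply: contatV => //; apply: diffat_cont (cauchyT_diff _ win _) => //.
  by move=> z _; exact: contat_cst.
apply: (contat_punctured (cF _ (inint_inrect win)) cT).
exists (idist a b c d w); first exact: idist_gt0.
move=> v vw vd; have vin : inint a b c d v.
  have h1 := normc_Re (v - w); have h2 := normc_Im (v - w).
  rewrite !raddfB /= in h1 h2.
  have {}h1 := le_lt_trans h1 vd; have {}h2 := le_lt_trans h2 vd.
  move: h1 h2; rewrite /idist !lt_min !ltr_norml.
  move=> /andP[/andP[/andP[_ a1] /andP[_ a2]] _] /andP[_ /andP[/andP[_ a3] /andP[_ a4]]].
  move: vd; rewrite /idist !lt_min => /andP[/andP[b1 b2] /andP[b3 b4]].
  have := normc_Re (v - w); have := normc_Im (v - w).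
  rewrite !raddfB /= !ler_norml => /andP[c1 c2] /andP[c3 c4].
  by rewrite /inint; apply/andP; split; apply/andP; split; lra.
apply: (canRL (mulfK (cauchyT1_neq0 vin))).
by apply: (@cauchy_formula_off q) => //; rewrite -wq.
Qed.

Definition copen (U : set R[i]) := forall z, U z ->
  exists2 r : R, 0 < r & forall w, normc (w - z) < r -> U w.

Definition holo (U : set R[i]) F := forall z, U z -> exists D, cdiff F z D.

Definition cder F z : R[i] := xget 0 [set D | cdiff F z D].

Lemma cderP F z : (exists D, cdiff F z D) -> cdiff F z (cder F z).
Proof. by move=> h; rewrite /cder; case: xgetP => [d -> //|]; case: h => d dF /(_ d). Qed.

Lemma cder_eq F z (D : R[i]) : cdiff F z D -> cder F z = D.
Proof. by move=> dF; apply: diffat_uniq (dF); apply: cderP; exists D. Qed.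

Lemma holo_cont U F z : holo U F -> U z -> ccont F z.
Proof. by move=> hF /hF[d]; exact: diffat_cont. Qed.

Lemma square_in_ball z (r : R) w : 
  inrect (Re z - r) (Re z + r) (Im z - r) (Im z + r) w -> normc (w - z) <= 2 * r.
Proof.
move=> /andP[/andP[h1 h2] /andP[h3 h4]].
apply: le_trans (normc_le_ReIm _) _; rewrite !raddfB /=.
have : `|Re w - Re z| <= r by rewrite ler_norml; apply/andP; split; lra.
have : `|Im w - Im z| <= r by rewrite ler_norml; apply/andP; split; lra.
lra.
Qed.

Lemma center_in_square z (r : R) : 0 < r ->
  inint (Re z - r) (Re z + r) (Im z - r) (Im z + r) z.
Proof. by move=> r0; rewrite /inint; apply/andP; split; apply/andP; split; lra. Qed.

Lemma inint_near a b c d w : inint a b c d w -> exists2 dl : R, 0 < dl &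
  forall v, normc (v - w) < dl -> inint a b c d v.
Proof.
move=> win; exists (idist a b c d w); first exact: idist_gt0.
move=> v; rewrite /idist !lt_min => /andP[/andP[b1 b2] /andP[b3 b4]].
have := normc_Re (v - w); have := normc_Im (v - w).
rewrite !raddfB /= !ler_norml => /andP[c1 c2] /andP[c3 c4].
by rewrite /inint; apply/andP; split; apply/andP; split; lra.
Qed.

(** Near [z] Cauchy's formula writes F as a quotient of two transforms, which can be differentiated
    twice. The exceptional point [q] makes the same statement yield removable singularities. *)
Lemma holo_regular q U F z : copen U -> U z -> (forall w, U w -> ccont F w) ->
  (forall w, U w -> w != q -> exists D, cdiff F w D) ->
  (exists D, cdiff F z D) /\ exists D, cdiff (cder F) z D.
Proof.
move=> oU Uz cF dF; have [r r0 rU] := oU z Uz.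
pose l := r / 3; have l0 : 0 < l by rewrite divr_gt0.
pose a := Re z - l; pose b := Re z + l; pose c := Im z - l; pose d := Im z + l.
have zin : inint a b c d z := center_in_square z l0.
have sub w : inrect a b c d w -> U w.
  by move=> /square_in_ball wl; apply: rU; rewrite /l in wl; lra.
have cF' w : inrect a b c d w -> ccont F w by move=> /sub; exact: cF.
have c1 w : inrect a b c d w -> ccont (fun=> 1) w by move=> _; exact: contat_cst.
pose T := cauchyT F; pose N := cauchyT (fun=> 1).
have FE w : inint a b c d w -> F w = T 1%N a b c d w / N 1%N a b c d w.
  by move=> win; apply: (@cauchy_formula q) => // v /sub; exact: dF.
have [dl dl0 dlin] := inint_near zin.
pose F' w := 1%:R * T 2%N a b c d w * (N 1%N a b c d w)^-1 +
  T 1%N a b c d w * (- (1%:R * N 2%N a b c d w) / N 1%N a b c d w ^+ 2).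
have dF' w : inint a b c d w -> cdiff F w (F' w).
  move=> win; have [dw dw0 dwin] := inint_near win.
  apply: (@diffat_near _ _ _ (fun w => T 1%N a b c d w / N 1%N a b c d w) _ _ _ idfun_inj).
    apply: diffatM; first exact: cauchyT_diff.
    apply: diffatV idfun_inj _ _; last exact: cauchyT1_neq0.
    exact: cauchyT_diff.
  by exists dw => // v /dwin vin; rewrite FE.
split; first by exists (F' z); exact: dF'.
have [D dD] : exists D, cdiff F' z D.
  eexists; apply: diffatD.
    apply: diffatM.
      apply: diffatZ; exact: cauchyT_diff.
    apply: diffatV idfun_inj _ _; last exact: cauchyT1_neq0.
    exact: cauchyT_diff.
  apply: diffatM; first exact: cauchyT_diff.
  apply: diffatM.
    apply: diffatN; apply: diffatZ; exact: cauchyT_diff.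
  apply: diffatV idfun_inj _ _; last by rewrite expf_neq0// cauchyT1_neq0.
  apply: cdiffX; exact: cauchyT_diff.
exists D; apply: (@diffat_near _ _ _ F' _ _ _ idfun_inj) => //.
by exists dl => // v /dlin/dF' dv; rewrite (cder_eq dv).
Qed.

Lemma removable q U F : copen U -> (forall w, U w -> ccont F w) ->
  (forall w, U w -> w != q -> exists D, cdiff F w D) -> holo U F.
Proof. by move=> oU cF dF z Uz; have [] := holo_regular oU Uz cF dF. Qed.

Lemma holo_cder U F : copen U -> holo U F -> holo U (cder F).
Proof.
move=> oU hF z Uz.
have [] := @holo_regular 0 U F z oU Uz (fun w => holo_cont hF) => //.
by move=> w Uw _; exact: hF.
Qed.

(* The constant 2 is harmless: it disappears when powers of F are considered. *)
Lemma center_bound F z (l M : R) : 0 < l ->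
  (forall w, inrect (Re z - l) (Re z + l) (Im z - l) (Im z + l) w ->
    exists D, cdiff F w D) ->
  (forall w, onrect (Re z - l) (Re z + l) (Im z - l) (Im z + l) w ->
    normc (F w) <= M) -> normc (F z) <= 2 * M.
Proof.
move=> l0; set a := Re z - l; set b := Re z + l; set c := Im z - l.
set d := Im z + l => dF FM.
have zin : inint a b c d z := center_in_square z l0.
have ab : a <= b by rewrite /a /b; lra.
have cd : c <= d by rewrite /c /d; lra.
have cF w : inrect a b c d w -> ccont F w by move=> /dF[D]; exact: diffat_cont.
rewrite (@cauchy_formula 0 F a b c d)//; last by move=> w win _; exact: dF.
have zl w : onrect a b c d w -> l <= normc (w - z).
  move=> /(idist_le z); apply: le_trans; rewrite /idist /a /b /c /d.
  by rewrite !le_min; apply/andP; split; apply/andP; split; lra.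
have T4 : 4 <= normc (cauchyT (fun=> 1) 1 a b c d z).
  apply: le_trans (cauchyT1_lower zin (D := 2 * l ^+ 2) _ _).
  - by rewrite le_eqVlt; apply/orP; left; apply/eqP; rewrite /a /b /c /d; field; rewrite gt_eqF.
  - move=> w /onrect_sub /andP[/andP[h1 h2] /andP[h3 h4]].
    rewrite normc_sqr !raddfB /=; rewrite /a /b /c /d in h1 h2 h3 h4.
    have : (Re w - Re z) ^+ 2 <= l ^+ 2.
      by rewrite -ler_sqrt ?sqr_ge0// !sqrtr_sqr (gtr0_norm l0) ler_norml; apply/andP; split; lra.
    have : (Im w - Im z) ^+ 2 <= l ^+ 2.
      by rewrite -ler_sqrt ?sqr_ge0// !sqrtr_sqr (gtr0_norm l0) ler_norml; apply/andP; split; lra.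
    lra.
  - by rewrite mulr_gt0// exprn_gt0.
rewrite normcf_div ler_pdivrMr; last by lra.
have M0 : 0 <= M.
  have [h1 _ _ _] := onrect_sides ab cd.
  by apply: le_trans (normc_ge0 _) (FM _ (h1 a _)); rewrite lexx ab.
have bnd w : onrect a b c d w -> normc (F w * ((w - z) ^+ 1)^-1) <= M / l.
  move=> wb; rewrite Normc.normcM Normc.normcV expr1.
  rewrite ler_pM ?normc_ge0 ?invr_ge0 ?normc_ge0 ?FM//.
  by rewrite lef_pV2 ?posrE ?zl//; apply: lt_le_trans (zl _ wb).
apply: le_trans (oint_bound ab cd _ bnd) _.
  move=> w wb; apply: contatM; first exact/cF/onrect_sub.
  exact/ccont_kernel/(onrect_neq zin).
have -> : 2 * (M / l) * (b - a + (d - c)) = 2 * M * 4.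
  by rewrite /a /b /c /d; field; rewrite gt_eqF.
by rewrite ler_wpM2l// mulr_ge0.
Qed.

End CauchyFormula.

(** * The maximum principle *)

Section Topology.
Context {R : realType}.
Implicit Types (z w : R[i]) (U K : set R[i]).

Lemma normc_normE z : `|z| = ((normc z)%:C)%C.
Proof. by []. Qed.

Lemma nbhs_normc (z : R[i]^o) (A : set R[i]^o) : nbhs z A <->
  exists2 r : R, 0 < r & forall w, normc (w - z) < r -> A w.
Proof.
split=> [/nbhs_ballP[e /= e0 eA]|[r r0 rA]].
  move: (e0); rewrite ltcE /= => /andP[/eqP e1 e2].
  exists (Re e) => // w wz; apply: eA.
  rewrite -ball_normE /ball_ /= normc_normE ltcE /= e1 eqxx /=.
  by rewrite -normcN opprB.
apply/nbhs_ballP; exists (r%:C)%C => /=; first by rewrite ltcR.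
move=> w; rewrite -ball_normE /ball_ /= normc_normE ltcR => zw.
by apply: rA; rewrite -normcN opprB.
Qed.

Lemma copenP U : copen U <-> open (U : set R[i]^o).
Proof.
rewrite openE; split => [oU z Uz|oU z /oU].
  by apply/nbhs_normc; have [r r0 rU] := oU z Uz; exists r.
by move=> /nbhs_normc[r r0 rU]; exists r.
Qed.

Lemma rect_compact (a b : R) :
  compact ([set z | inrect a b a b z] : set R[i]^o).
Proof.
have -> : [set z | inrect a b a b z] =
    @to_complex R @` (`[a, b]%classic `*` `[a, b]%classic).
  apply/seteqP; split => [[x y]|_ [[x y] /= [xab yab] <-]].
    by move=> /andP[/= xab yab]; exists (x, y) => //=; rewrite !in_itv.
  by rewrite /inrect /=; move: xab yab; rewrite !in_itv /= => -> ->.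
apply: continuous_compact; last first.
  by apply: compact_setX; exact: segment_compact.
apply: continuous_subspaceT => p; apply/cvgrPdist_lt => e e0.
move: (e0); rewrite ltcE /= => /andP[/eqP e1 e2].
have e20 : 0 < Re e / 2 by rewrite divr_gt0.
exists (ball p.1 (Re e / 2), ball p.2 (Re e / 2)).
  by split; exact: nbhsx_ballx.
move=> q []; rewrite -!ball_normE /ball_ /= => q1 q2.
rewrite normc_normE ltcE /= e1 eqxx /=.
apply: le_lt_trans (normc_le_ReIm _) _; rewrite /=; lra.
Qed.

Lemma closed_bounded_compact K (B : R) : copen (~` K) ->
  (forall z, K z -> normc z <= B) -> compact (K : set R[i]^o).
Proof.
move=> /copenP cK KB; rewrite openC in cK.
apply: (subclosed_compact cK (@rect_compact (- B) B)) => z /KB zB.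
rewrite /= /inrect -!ler_norml.
by rewrite !(le_trans _ zB)// ?normc_Re ?normc_Im.
Qed.

Lemma compact_max K (psi : R[i] -> R) z0 : compact (K : set R[i]^o) -> K z0 ->
  (forall z, K z -> forall e : R, 0 < e -> exists2 dl : R, 0 < dl &
    forall w, normc (w - z) < dl -> `|psi w - psi z| < e) ->
  exists2 c, K c & forall z, K z -> psi z <= psi c.
Proof.
move=> cK Kz0 cpsi.
have [||c /[!inE] Kc H] := @compact_EVT_max R[i]^o R psi K _ cK.
- by exists z0.
- apply: continuous_in_subspaceT => z; rewrite inE => Kz.
  move=> P /(@nbhs_ballP R)[e e0 eP]; apply/nbhs_normc.
  have [dl dl0 h] := cpsi z Kz e e0; exists dl => // w /h wz; apply: eP.
  by rewrite -ball_normE /ball_ /= distrC.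
by exists c => // z Kz; apply: H; rewrite inE.
Qed.

Lemma compact_normc_max K F z0 : compact (K : set R[i]^o) -> K z0 ->
  (forall z, K z -> ccont F z) ->
  exists2 c, K c & forall z, K z -> normc (F z) <= normc (F c).
Proof.
move=> cK Kz0 cF; apply: (compact_max cK Kz0 (psi := fun z => normc (F z))).
move=> z Kz e /(cF z Kz)[dl dl0 H]; exists dl => // w /H.
exact: le_lt_trans (normc_rtri _ _).
Qed.

Lemma compact_normc_min K F z0 : compact (K : set R[i]^o) -> K z0 ->
  (forall z, K z -> ccont F z) ->
  exists2 c, K c & forall z, K z -> normc (F c) <= normc (F z).
Proof.
move=> cK Kz0 cF.
have [|c Kc H] := @compact_max K (fun z => - normc (F z)) z0 cK Kz0.
- move=> z Kz e /(cF z Kz)[dl dl0 H]; exists dl => // w /H.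
  by apply: le_lt_trans; rewrite opprK addrC distrC; exact: normc_rtri.
- by exists c => // z /H; rewrite lerN2.
Qed.

Lemma compact_bound K : compact (K : set R[i]^o) ->
  exists2 B : R, 0 < B & forall z, K z -> normc z <= B.
Proof.
move=> cK; have [K0|[z0 Kz0]] : K = set0 \/ exists z, K z.
  by have [[z Kz]|nK] := pselect (exists z, K z); [right; exists z|left;
    apply/seteqP; split => // z Kz; apply: nK; exists z].
  by exists 1 => // z; rewrite K0.
have [c Kc H] := compact_normc_max cK Kz0 (fun z _ => @ccont_id _ z).
exists (normc c + 1); first by rewrite ltr_wpDl// normc_ge0.
by move=> z /H; lra.
Qed.

Lemma geometric_small (th e : R) : 0 <= th < 1 -> 0 < e -> exists n, th ^+ n < e.
Proof.
move=> /andP[th0 th1] e0.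
have : (fun n => th ^+ n) @ \oo --> (0 : R) by apply: cvg_expr; rewrite ger0_norm.
move=> /cvgrPdist_lt/(_ e e0)[n _ H]; exists n.
by have := H n (leqnn n); rewrite /= sub0r normrN ger0_norm// exprn_ge0.
Qed.

(** A maximum of |F| need not be strict, so |F| is weighted by W = 1 + ep |z|^2, with ep small
    enough to keep the maximum point z0 in U. Around z0 the weight is traded for the square of a
    polynomial, which makes the maximum strict with a factor th < 1; [center_bound] applied to high
    powers gives the contradiction. *)
Lemma max_principle K U F (M : R) : compact (K : set R[i]^o) -> copen U ->
  U `<=` K -> (forall z, K z -> ccont F z) -> holo U F -> 0 <= M ->
  (forall z, K z -> ~ U z -> normc (F z) <= M) ->
  forall z, K z -> normc (F z) <= M.
Proof.
move=> cK oU UK cF hF M0 FM z1 Kz1; rewrite leNgt; apply/negP => FMz1.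
have [B B0 KB] := compact_bound cK.
(* Chosen so that M (1 + ep B^2) < |F z1|: points outside U cannot carry the weighted maximum. *)
pose ep := (normc (F z1) - M) / (2 * (M + 1) * B ^+ 2).
have ep0 : 0 < ep by rewrite divr_gt0 ?subr_gt0// !mulr_gt0 ?exprn_gt0// ltr_wpDl.
pose W z := 1 + ep * normc z ^+ 2.
have W1 z : 1 <= W z by rewrite /W lerDl mulr_ge0 ?sqr_ge0// ltW.
have [z0 Kz0 z0max] : exists2 c, K c & forall z, K z ->
    normc (F z) * W z <= normc (F c) * W c.
  pose G z := F z * (1 + (ep%:C)%C * (z * conjc z)).
  have cJ z : ccont (@conjc R) z.
    by move=> e e0; exists e => // w; rewrite -raddfB normc_conj.
  have GE z : normc (G z) = normc (F z) * W z.
    rewrite Normc.normcM; congr (_ * _).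
    have -> : 1 + (ep%:C)%C * (z * conjc z) = ((W z)%:C)%C.
      by rewrite /W normc_sqr; case: z => x y; simpc; congr (_ +i* _)%C; rewrite /=; ring.
    by rewrite normc_real ger0_norm// (le_trans _ (W1 z)).
  have [|c Kc H] := @compact_normc_max K G z1 cK Kz1; last first.
    by exists c => // z /H; rewrite !GE.
  move=> z Kz; apply: contatM; first exact: cF.
  apply: contatD; first exact: contat_cst.
  apply: contatM; first exact: contat_cst.
  by apply: contatM; [exact: ccont_id|exact: cJ].
have F10 : normc (F z1) <= normc (F z0) * W z0.
  by apply: le_trans (z0max z1 Kz1); rewrite ler_peMr ?normc_ge0.
have Uz0 : U z0.
  apply: contrapT => nU; have := FM z0 Kz0 nU; apply/negP; rewrite -ltNge.
  rewrite -(ltr_pM2r (x := W z0)); last by rewrite (lt_le_trans ltr01).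
  apply: lt_le_trans F10; apply: (@le_lt_trans _ _ (M * (1 + ep * B ^+ 2))).
    rewrite ler_wpM2l// /W lerD2l ler_pM2l// ler_pXn2r ?nnegrE ?normc_ge0 ?KB//.
    exact: ltW.
  have epB : ep * B ^+ 2 = (normc (F z1) - M) / (2 * (M + 1)).
    have M1 : M + 1 != 0 by rewrite gt_eqF// ltr_wpDl.
    have Bn : B != 0 by rewrite gt_eqF.
    by rewrite /ep; field; rewrite M1 Bn.
  have h : (normc (F z1) - M) * (M / (2 * (M + 1))) < (normc (F z1) - M) * 1.
    rewrite ltr_pM2l ?subr_gt0// ltr_pdivrMr ?mulr_gt0 ?ltr_wpDl//; lra.
  by rewrite epB mulrDr mulrCA; lra.
have F0 : 0 < normc (F z0).
  rewrite lt_neqAle normc_ge0 andbT; apply/eqP => F00.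
  by move: F10; rewrite -F00 mul0r; have := le_lt_trans M0 FMz1; lra.
have [r r0 rU] := oU z0 Uz0.
pose l := r / 3; have l0 : 0 < l by rewrite divr_gt0.
pose k w := 1 + (ep%:C)%C * conjc z0 * w.
pose G w := F w * k w ^+ 2.
have sq w : inrect (Re z0 - l) (Re z0 + l) (Im z0 - l) (Im z0 + l) w -> U w.
  by move=> /square_in_ball wl; apply: rU; rewrite /l in wl; lra.
(* Lagrange's identity, that is, the Cauchy-Schwarz inequality for (1, sqrt ep z0) and (1, sqrt ep
   w) with its deficit. On the square around z0 the deficit is at least ep l^2, which gives the
   factor [th]. *)
have kE w : normc (k w) ^+ 2 + ep * normc (w - z0) ^+ 2 = W z0 * W w.
  rewrite /W /k !normc_sqr; case: z0 {Kz0 z0max F10 Uz0 F0 rU k G sq} => x y.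
  by case: w => u v; simpc; rewrite /=; ring.
have kz0 : normc (k z0) ^+ 2 = W z0 ^+ 2.
  by have := kE z0; rewrite subrr Normc.normc0 expr0n mulr0 addr0 expr2.
pose Pm := W z0 * (1 + ep * B ^+ 2).
have Pm0 : 0 < Pm.
  rewrite mulr_gt0 ?(lt_le_trans ltr01 (W1 z0))//.
  by rewrite ltr_wpDr// mulr_ge0 ?sqr_ge0// ltW.
pose th := Pm / (Pm + ep * l ^+ 2).
have el0 : 0 < ep * l ^+ 2 by rewrite mulr_gt0// exprn_gt0.
have th01 : 0 <= th < 1.
  rewrite /th divr_ge0 ?addr_ge0 ?ltW//=.
  by rewrite ltr_pdivrMr ?mul1r ?ltrDl// addr_gt0.
have Gz0 : normc (G z0) = normc (F z0) * W z0 ^+ 2.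
  by rewrite /G Normc.normcM normcX kz0.
have Gz00 : 0 < normc (G z0).
  by rewrite Gz0 mulr_gt0// exprn_gt0// (lt_le_trans ltr01).
have bnd w : onrect (Re z0 - l) (Re z0 + l) (Im z0 - l) (Im z0 + l) w ->
    normc (G w) <= th * normc (G z0).
  move=> wb; have Uw := sq w (onrect_sub wb).
  have lw : l <= normc (w - z0).
    apply: le_trans (idist_le z0 wb); rewrite /idist !le_min.
    by apply/andP; split; apply/andP; split; lra.
  rewrite /G Normc.normcM normcX -/(G z0) Gz0.
  have Fw := z0max w (UK w Uw).
  set P := normc (k w) ^+ 2; have P0 : 0 <= P by rewrite sqr_ge0.
  have PE : W z0 * W w = P + ep * normc (w - z0) ^+ 2 by rewrite kE.
  have Ww0 : 0 < W w by rewrite (lt_le_trans ltr01).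
  have Wz0 : 0 < W z0 by rewrite (lt_le_trans ltr01).
  have l2 : l ^+ 2 <= normc (w - z0) ^+ 2.
    by rewrite ler_pXn2r// nnegrE ?normc_ge0// ltW.
  have PPm : P <= Pm.
    apply: (@le_trans _ _ (W z0 * W w)).
      by rewrite PE lerDl mulr_ge0 ?sqr_ge0// ltW.
    rewrite /Pm ler_pM2l// /W lerD2l ler_pM2l// ler_pXn2r ?nnegrE ?normc_ge0 ?(ltW B0)//.
    exact/KB/UK.
  have thP : P <= th * (W z0 * W w).
    rewrite PE /th mulrAC ler_pdivlMr ?addr_gt0//.
    rewrite !mulrDr [P * Pm]mulrC lerD2l.
    rewrite [Pm * _]mulrCA [P * _]mulrCA ler_pM2l//.
    by apply: ler_pM => //; rewrite sqr_ge0.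
  apply: (@le_trans _ _ (normc (F w) * (th * (W z0 * W w)))).
    by rewrite ler_wpM2l ?normc_ge0.
  have -> : normc (F w) * (th * (W z0 * W w)) = th * W z0 * (normc (F w) * W w) by ring.
  have -> : th * (normc (F z0) * W z0 ^+ 2) = th * W z0 * (normc (F z0) * W z0) by ring.
  by rewrite ler_wpM2l// mulr_ge0 ?(ltW Wz0)//; case/andP: th01.
(* A power below 1/2 beats the constant 2 of [center_bound]. *)
have [n nth] := geometric_small th01 (ltac:(lra) : 0 < (1 / 2 : R)).
have := @center_bound _ (fun w => G w ^+ n) z0 l ((th * normc (G z0)) ^+ n) l0.
rewrite normcX exprMn => cb.
have := cb _ _; rewrite mulrA -{1}[X in X <= _]mul1r ler_pM2r ?exprn_gt0// => {}cb.
suff : 1 <= 2 * th ^+ n by lra.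
apply: cb => w win.
  have [D dF] := hF w (sq w win); eexists.
  apply: cdiffX; apply: diffatM dF _; apply: cdiffX.
  apply: diffatD (diffat_cst _ _ _) _; apply: diffatZ; exact: cdiff_id.
rewrite normcX -exprMn lerXn2r ?nnegrE ?normc_ge0 ?bnd//.
by rewrite mulr_ge0 ?normc_ge0//; case/andP: th01.
Qed.

End Topology.

(** * Hadamard's three circles theorem *)

Section ThreeCircles.
Context {R : realType}.
Implicit Types (z w : R[i]).

Lemma copen_annulus (a b : R) : copen [set z : R[i] | a < normc z < b].
Proof.
move=> z /= /andP[az zb]; exists (Num.min (normc z - a) (b - normc z)).
  by rewrite lt_min !subr_gt0 az.
move=> w; rewrite lt_min => /andP[w1 w2].
have := normc_rtri w z; rewrite ler_norml => /andP[h1 h2].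
by apply/andP; split; lra.
Qed.

Lemma compact_annulus (a b : R) :
  compact ([set z | a <= normc z <= b] : set R[i]^o).
Proof.
apply: (@closed_bounded_compact _ _ b) => [z /= /negP|z /= /andP[]//].
rewrite negb_and -!ltNge => /orP[h|h].
  exists (a - normc z); first by rewrite subr_gt0.
  move=> w wz /=; apply/negP; rewrite negb_and -!ltNge.
  by have := normc_rtri w z; rewrite ler_norml => /andP[h1 h2]; apply/orP; left; lra.
exists (normc z - b); first by rewrite subr_gt0.
move=> w wz /=; apply/negP; rewrite negb_and -!ltNge.
by have := normc_rtri w z; rewrite ler_norml => /andP[h1 h2]; apply/orP; right; lra.
Qed.

Lemma compact_disk (b : R) : compact ([set z | normc z <= b] : set R[i]^o).
Proof.
have -> : [set z : R[i] | normc z <= b] = [set z | 0 <= normc z <= b].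
  by apply/seteqP; split => z /=; rewrite normc_ge0.
exact: compact_annulus.
Qed.

(** The function F^q z^(m - n) is single-valued only for integer exponents; two naturals [m] and [n]
    cover both signs. The maximum principle is applied to it on the annulus. *)
Lemma three_circles_int F (a b A B : R) (q m n : nat) : a < b ->
  (forall z, expR a <= normc z <= expR b -> exists D, cdiff F z D) ->
  (forall z, normc z = expR a -> normc (F z) <= expR A) ->
  (forall z, normc z = expR b -> normc (F z) <= expR B) ->
  forall z (x : R), normc z = expR x -> a <= x <= b ->
  normc (F z) ^+ q * expR ((m%:R - n%:R) * x) <=
  expR (Num.max (q%:R * A + (m%:R - n%:R) * a) (q%:R * B + (m%:R - n%:R) * b)).
Proof.
move=> ab dF FA FB z x zx xab.
pose G w := F w ^+ q * (w ^+ m / w ^+ n).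
have GE w (t : R) : normc w = expR t ->
    normc (G w) = normc (F w) ^+ q * expR ((m%:R - n%:R) * t).
  move=> wt; rewrite Normc.normcM normcf_div !normcX wt -!expRM_natl.
  by rewrite -expRN -expRD mulrBl.
rewrite -(GE z x zx).
have hG w : expR a <= normc w <= expR b -> exists D, cdiff G w D.
  move=> wab; have [D dFw] := dF w wab.
  have w0 : w != 0 by rewrite -normc_gt0 (lt_le_trans (expR_gt0 a))//; case/andP: wab.
  eexists; apply: diffatM; first exact: cdiffX dFw.
  apply: diffatM; first exact: cdiffX (cdiff_id w).
  apply: diffatV idfun_inj _ _; first exact: cdiffX (cdiff_id w).
  by rewrite expf_neq0.
apply: (@max_principle _ [set w | expR a <= normc w <= expR b]
  [set w | expR a < normc w < expR b] G) => //.
- exact: compact_annulus.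
- exact: copen_annulus.
- by move=> w /= /andP[h1 h2]; rewrite !ltW.
- by move=> w /hG[D]; exact: diffat_cont.
- by move=> w /= /andP[h1 h2]; apply: hG; rewrite !ltW.
- move=> w /= /andP[h1 h2] /negP; rewrite negb_and -!leNgt => /orP[h|h].
    have wa : normc w = expR a by apply/eqP; rewrite eq_le h h1.
    rewrite (GE w a wa) (@le_trans _ _ (expR (q%:R * A + (m%:R - n%:R) * a)))//.
      rewrite expRD ler_wpM2r ?expR_ge0// expRM_natl.
      by rewrite lerXn2r ?nnegrE ?normc_ge0 ?expR_ge0 ?FA.
    by rewrite ler_expR le_max lexx.
  have wb : normc w = expR b by apply/eqP; rewrite eq_le h h2.
  rewrite (GE w b wb) (@le_trans _ _ (expR (q%:R * B + (m%:R - n%:R) * b)))//.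
    rewrite expRD ler_wpM2r ?expR_ge0// expRM_natl.
    by rewrite lerXn2r ?nnegrE ?normc_ge0 ?expR_ge0 ?FB.
  by rewrite ler_expR le_max lexx orbT.
- by rewrite /= zx !ler_expR.
Qed.

Theorem three_circles F (a b A B : R) : a < b ->
  (forall z, expR a <= normc z <= expR b -> exists D, cdiff F z D) ->
  (forall z, normc z = expR a -> normc (F z) <= expR A) ->
  (forall z, normc z = expR b -> normc (F z) <= expR B) ->
  forall z (x : R), normc z = expR x -> a <= x <= b ->
  normc (F z) <= expR (((b - x) * A + (x - a) * B) / (b - a)).
Proof.
move=> ab dF FA FB z x zx /andP[ax xb].
have [->|Fz0] := eqVneq (normc (F z)) 0; first exact: expR_ge0.
have Fz : 0 < normc (F z) by rewrite lt_neqAle eq_sym Fz0 normc_ge0.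
rewrite -(lnK (x := normc (F z)))// ler_expR.
set u := ln (normc (F z)); set V := _ / _.
have ba : 0 < b - a by rewrite subr_gt0.
(* With exponent s the two boundary bounds A + s a and B + s b of |F| |z|^s coincide, which is
   Hadamard's interpolation. *)
pose s := (A - B) / (b - a).
have VA : V = A + s * (a - x) by rewrite /V /s; field; rewrite gt_eqF.
have VB : V = B + s * (b - x) by rewrite /V /s; field; rewrite gt_eqF.
apply/ler_addgt0Pr => e e0.
(* Rounding s q to an integer changes the exponent by at most 1, an error of (b - a) / q after
   division by q. *)
pose q := (Num.truncn ((b - a) / e)).+1.
have q0 : 0 < q%:R :> R by rewrite ltr0n.
have qe : (b - a) < e * q%:R.
  by rewrite mulrC -ltr_pdivrMr// /q truncnS_gt.
have [m [n mn]] : exists m n : nat, `|(m%:R - n%:R) - s * q%:R| <= 1.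
  have [s0|s0] := leP 0 s.
    exists (Num.truncn (s * q%:R)), 0%N; rewrite subr0.
    have sq : 0 <= s * q%:R by rewrite mulr_ge0// ltW.
    have /andP[] := truncn_itv sq.
    by rewrite -natr1 ler_norml => ? ?; apply/andP; split; lra.
  exists 0%N, (Num.truncn (- s * q%:R)).
  have sq : 0 <= - s * q%:R by rewrite mulr_ge0// oppr_ge0 ltW.
  have /andP[] := truncn_itv sq.
  by rewrite -natr1 ler_norml mulNr => ? ?; apply/andP; split; lra.
have := @three_circles_int F a b A B q m n ab dF FA FB z x zx _.
rewrite ax xb => /(_ isT).
rewrite -{1}(lnK (x := normc (F z)))// -/u -expRM_natl -expRD ler_expR.
set p := m%:R - n%:R in mn *.
move: mn; rewrite ler_norml => /andP[p1 p2].
rewrite le_max => /orP[] le.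
  rewrite VA -(ler_pM2l q0).
  have : (p - s * q%:R) * (a - x) <= e * q%:R by nra.
  lra.
rewrite VB -(ler_pM2l q0).
have : (p - s * q%:R) * (b - x) <= e * q%:R by nra.
lra.
Qed.

(* The inner circle of the annulus is a boundary value only. *)
Lemma log_linear_bound F (b B : R) (rho : R) : 0 < b -> expR b < rho ->
  (forall z, 1 < normc z < rho -> exists D, cdiff F z D) ->
  (forall e : R, 0 < e -> exists2 dl : R, 0 < dl & forall z,
    1 < normc z < 1 + dl -> normc (F z) <= expR e) ->
  (forall z, normc z = expR b -> normc (F z) <= expR B) ->
  forall z (x : R), normc z = expR x -> 0 < x <= b ->
  normc (F z) <= expR (x * B / b).
Proof.
move=> b0 brho dF F1 FB z x zx /andP[x0 xb].
have [Fz0|Fz0] := eqVneq (normc (F z)) 0; first by rewrite Fz0 expR_ge0.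
have Fz : 0 < normc (F z) by rewrite lt_neqAle eq_sym Fz0 normc_ge0.
rewrite -(lnK (x := normc (F z)))// ler_expR.
set u := ln (normc (F z)).
apply/ler_addgt0Pr => e e0.
have [dl dl0 H] := F1 (e / 2) (ltac:(lra)).
have e20 : 0 < e / 2 by lra.
pose M := `|B| + 1; have M0 : 0 < M by rewrite ltr_wpDl.
(* The inner circle lies in the collar where |F| <= exp(e / 2), to the left of [x], and so close to
   the unit circle that replacing (x - a) / (b - a) by x / b costs little. *)
pose a := Num.min (ln (1 + dl / 2)) (Num.min x (e * b / (2 * M)) / 2).
have l0 : 0 < ln (1 + dl / 2) by apply: ln_gt0; lra.
have eb0 : 0 < e * b / (2 * M) by rewrite divr_gt0 ?mulr_gt0.
have mx : 0 < Num.min x (e * b / (2 * M)) by rewrite lt_min x0.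
have a0 : 0 < a by rewrite lt_min l0 divr_gt0.
have a1 : a <= ln (1 + dl / 2) by rewrite /a ge_min lexx.
have a2 : a <= Num.min x (e * b / (2 * M)) / 2 by rewrite /a ge_min lexx orbT.
have a3 : Num.min x (e * b / (2 * M)) <= x by rewrite ge_min lexx.
have a4 : Num.min x (e * b / (2 * M)) <= e * b / (2 * M) by rewrite ge_min lexx orbT.
have ab : a < b by lra.
have := @three_circles F a b (e / 2) B ab _ _ FB z x zx _.
rewrite -{1}(lnK (x := normc (F z)))// -/u ler_expR => K.
have {}K : u <= ((b - x) * (e / 2) + (x - a) * B) / (b - a).
  apply: K; last by lra.
    move=> w /andP[w1 w2]; apply: dF; rewrite (le_lt_trans w2)// andbT.
    by apply: lt_le_trans w1; rewrite expR_gt1.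
  move=> w wa; apply: H; rewrite wa expR_gt1 a0 /=.
  apply: (@le_lt_trans _ _ (1 + dl / 2)); last by lra.
  by rewrite -(lnK (x := 1 + dl / 2)) ?ler_expR// posrE; lra.
apply: le_trans K _.
have ba : 0 < b - a by lra.
rewrite ler_pdivrMr//.
have aB : - (a * B) <= a * M.
  have := ler_norm (- B); rewrite normrN /M => hB.
  by rewrite -mulrN ler_pM2l//; lra.
have aM : a * M <= e * b / 4.
  have h : a * M <= e * b / (2 * M) / 2 * M by rewrite ler_pM2r//; lra.
  apply: le_trans h _.
  by rewrite le_eqVlt; apply/orP; left; apply/eqP; field; rewrite gt_eqF.
have xB : x * B / b * (b - a) = x * B - x / b * (a * B) by field; rewrite gt_eqF.
rewrite [(_ + e) * _]mulrDl xB.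
have xb1 : x / b <= 1 by rewrite ler_pdivrMr ?mul1r.
have xb0 : 0 <= x / b by rewrite divr_ge0 ?ltW.
have aB' : (1 - x / b) * - (a * B) <= 1 * (e * b / 4).
  apply: (@le_trans _ _ ((1 - x / b) * (a * M))).
    by rewrite ler_wpM2l// subr_ge0.
  have aM0 : 0 <= a * M by rewrite mulr_ge0 ?ltW.
  by apply: (ler_pM _ aM0 _ aM); [rewrite subr_ge0|rewrite gerBl].
have ax : a <= x / 2 by lra.
have ea : e * a <= e * (x / 2) by rewrite ler_pM2l.
have ex : 0 < e * x by rewrite mulr_gt0.
have eb : 0 < e * b by rewrite mulr_gt0.
lra.
Qed.

End ThreeCircles.

(** * Energies and products of distances *)

Section Kernel.
Context {R : realType}.
Local Notation T := (R * R)%type.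
Local Open Scope ereal_scope.

Definition dist (x y : T) : R := normc (to_complex x - to_complex y)%R.

(** Truncation at 0 makes the kernel nonnegative on the whole plane, so that Tonelli's theorem
    applies; on a support of diameter at most exp L it changes nothing. *)
Definition gker (L : R) (x y : T) : \bar R := maxe 0 (L%:E - lne (dist x y)%:E).

Lemma dist_ge0 x y : (0 <= dist x y)%R. Proof. exact: normc_ge0. Qed.

Lemma gker_ge0 L x y : 0 <= gker L x y.
Proof. by rewrite /gker le_max lexx. Qed.

Lemma lne_ln (r : R) : (0 < r)%R -> lne r%:E = (ln r)%:E.
Proof. exact: lne_EFin. Qed.

Lemma measurable_lne_comp d (X : measurableType d) (f : X -> R) :
  measurable_fun setT f -> measurable_fun setT (fun x => lne (f x)%:E).
Proof.
move=> mf; rewrite /lne; apply: measurable_fun_ifT => //.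
  exact: measurable_fun_ler.
by apply/measurable_EFinP; apply: measurableT_comp mf; exact: measurable_ln.
Qed.

Lemma measurable_normc d (X : measurableType d) (f g : X -> R) :
  measurable_fun setT f -> measurable_fun setT g ->
  measurable_fun setT (fun x => normc (f x +i* g x)%C).
Proof.
move=> mf mg; apply: (@measurableT_comp _ _ _ _ _ _ (@Num.sqrt R)).
  by apply: continuous_measurable_fun; exact: sqrt_continuous.
by apply: measurable_funD; exact: measurable_funX.
Qed.

Lemma measurable_dist : measurable_fun setT (fun p : T * T => dist p.1 p.2).
Proof.
apply: (@measurable_normc _ _ (fun p : T * T => (p.1.1 - p.2.1)%R)
  (fun p : T * T => (p.1.2 - p.2.2)%R)).
  by apply: measurable_funB; exact: measurableT_comp.
by apply: measurable_funB; exact: measurableT_comp.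
Qed.

Lemma measurable_gker L : measurable_fun setT (fun p : T * T => gker L p.1 p.2).
Proof.
apply: measurable_maxe => //; apply: emeasurable_funB => //.
exact: measurable_lne_comp measurable_dist.
Qed.

Lemma measurable_gker2 L x : measurable_fun setT (gker L x).
Proof.
exact: (measurable_fun_pair2 (f := fun p : T * T => gker L p.1 p.2)) (measurable_gker L).
Qed.

Lemma measurable_lne2 x : measurable_fun setT (fun y => lne (dist x y)%:E).
Proof.
apply: measurable_lne_comp.
exact: (measurable_fun_pair2 (f := fun p : T * T => dist p.1 p.2)) measurable_dist.
Qed.

Variable mu : probability T R.

(** The integral of [g] may be infinite, so f = L - g need not be integrable. Its positive part is
    at most L, and f^+ + g = L + f^- is an identity between nonnegative functions, which integrates
    term by term. *)
Lemma integral_sub_ge0 (L : R) (g : T -> \bar R) : (0 <= L)%R ->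
  measurable_fun setT g -> (forall x, 0 <= g x) ->
  \int[mu]_x (L%:E - g x) = L%:E - \int[mu]_x g x.
Proof.
move=> L0 mg g0; set f := fun x => L%:E - g x.
have mf : measurable_fun setT f by apply: emeasurable_funB.
rewrite integralE.
have E : \int[mu]_x (f^\+ x) + \int[mu]_x g x = L%:E + \int[mu]_x (f^\- x).
  rewrite -ge0_integralD//; last exact: measurable_funepos.
  rewrite -[L%:E](_ : \int[mu]_x (cst L%:E x) = _); last first.
    by rewrite integral_cst// [X in _ * X]probability_setT mule1.
  rewrite -ge0_integralD//; last exact: measurable_funeneg.
  apply: eq_integral => x _; rewrite funeposE funenegE /f.
  have := g0 x; case: (g x) => [r| |]//=.
    rewrite lee_fin => r0; rewrite -!EFinB -?EFinN -!EFin_max -!EFinD; congr EFin.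
    by case: (leP (L - r) 0)%R => ?; case: (leP (- (L - r)) 0)%R => ?; lra.
  by move=> _; rewrite maxNye maxye add0e addey.
have P1 : \int[mu]_x (f^\+ x) <= L%:E.
  rewrite -[L%:E](_ : \int[mu]_x (cst L%:E x) = _); last first.
    by rewrite integral_cst// [X in _ * X]probability_setT mule1.
  apply: ge0_le_integral => //; first exact: measurable_funepos.
  move=> x _; rewrite funeposE /f ge_max lee_fin L0 andbT.
  by have := g0 x; case: (g x) => [r| |]//=; rewrite ?leNye// !lee_fin; lra.
have P0 : 0 <= \int[mu]_x (f^\+ x) by apply: integral_ge0.
have N0 : 0 <= \int[mu]_x (f^\- x) by apply: integral_ge0.
have G0 : 0 <= \int[mu]_x g x by apply: integral_ge0.
move: E P1 P0 N0 G0; case: (\int[mu]_x (f^\+ x)) => [p| |]//.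
case: (\int[mu]_x (f^\- x)) => [n| |]//; case: (\int[mu]_x g x) => [t| |]//=.
by case=> E _ _ _ _; congr EFin; lra.
Qed.

Lemma integral_truncated_sub (K : set T) (L : R) (f : T -> \bar R) : (0 <= L)%R ->
  measurable K -> mu K = 1 -> measurable_fun setT f ->
  (forall x, K x -> f x <= L%:E) ->
  \int[mu]_x f x = L%:E - \int[mu]_x maxe 0 (L%:E - f x).
Proof.
move=> L0 mK K1 mf fL.
have mg : measurable_fun setT (fun x => maxe 0 (L%:E - f x)).
  by apply: measurable_maxe => //; exact: emeasurable_funB.
rewrite -integral_sub_ge0//; last by move=> x; rewrite le_max lexx.
apply: ae_eq_integral => //; first exact: emeasurable_funB.
exists (~` K); split; first exact: measurableC.
  by rewrite [LHS]probability_setC// K1 subee.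
move=> x /= /not_implyP[_ +] Kx; apply.
have := fL x Kx; case: (f x) => [r| |]//=.
  rewrite lee_fin => rL; rewrite -EFinB -EFin_max -EFinB; congr EFin.
  by rewrite max_r; lra.
by move=> _; rewrite maxey.
Qed.


Section Energy.
Variables (K : set R[i]) (L : R).
Hypotheses (L0 : (0 <= L)%R) (cK : compact (K : set R[i]^o))
  (KL : forall z w, K z -> K w -> (normc (z - w) <= expR L)%R)
  (mK : measurable (@to_complex R @^-1` K)) (K1 : mu (@to_complex R @^-1` K) = 1).

Let P := @to_complex R @^-1` K.

(** On a support of diameter at most exp L this is L plus the potential for the kernel log(1/|x -
    y|). *)
Definition potential (x : T) : \bar R := \int[mu]_y gker L x y.

Lemma lne_dist_le x y : P x -> P y -> lne (dist x y)%:E <= L%:E.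
Proof.
move=> Px Py; have := KL Px Py; rewrite -/(dist x y) => le.
have [d0|d0] := leP (dist x y) 0%R; first by rewrite /= d0 leNye.
by rewrite lne_ln// lee_fin -[L]expRK ler_ln// posrE expR_gt0.
Qed.

Lemma inner_energy x : P x ->
  \int[mu]_y lne (dist x y)%:E = L%:E - potential x.
Proof.
move=> Px; rewrite (@integral_truncated_sub P L)//; first exact: measurable_lne2.
by move=> y Py; exact: lne_dist_le.
Qed.

Lemma potential_ge0 x : 0 <= potential x.
Proof. by apply: integral_ge0 => y _; exact: gker_ge0. Qed.

Lemma measurable_potential : measurable_fun setT potential.
Proof.
apply: (@measurable_fun_fubini_tonelli_F _ _ _ _ _ mu (fun p => gker L p.1 p.2)).
  exact: measurable_gker.
by move=> p; exact: gker_ge0.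
Qed.

Lemma measurable_inner : measurable_fun setT (fun x => \int[mu]_y lne (dist x y)%:E).
Proof.
pose f (p : T * T) := lne (dist p.1 p.2)%:E.
have mf : measurable_fun setT f by exact: measurable_lne_comp measurable_dist.
rewrite (_ : (fun x => _) = (fubini_F mu f^\+) \- (fubini_F mu f^\-)).
  by apply: emeasurable_funB; apply: measurable_fun_fubini_tonelli_F => //;
    [exact: measurable_funepos|exact: measurable_funeneg].
apply/funext => x; rewrite integralE.
by congr (_ - _); apply: eq_integral => y _; rewrite ?funeposE ?funenegE.
Qed.

Lemma log_energy_potential : log_energy mu = L%:E - \int[mu]_x potential x.
Proof.
have le x : P x -> \int[mu]_y lne (dist x y)%:E <= L%:E.
  move=> Px; rewrite inner_energy//.
  by have := potential_ge0 x; case: (potential x) => [r| |]//=;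
    rewrite ?leNye// !lee_fin => ?; lra.
rewrite /log_energy (@integral_truncated_sub P L)//; first last.
- exact: measurable_inner.
congr (_ - _); apply: ae_eq_integral => //.
- by apply: measurable_maxe => //; apply: emeasurable_funB => //; exact: measurable_inner.
- exact: measurable_potential.
exists (~` P); split; first exact: measurableC.
  by rewrite [LHS]probability_setC// K1 subee.
move=> x /= /not_implyP[_ +] Px; apply; rewrite [X in L%:E - X](inner_energy Px).
have := potential_ge0 x; case: (potential x) => [r| |]//=.
  by rewrite lee_fin => r0; rewrite -!EFinB -EFin_max opprB addrCA subrr addr0 max_r.
by move=> _; rewrite maxey.
Qed.

Lemma exists_le_integral (h : T -> \bar R) (c : R) : measurable_fun setT h ->
  (forall x, 0 <= h x) -> \int[mu]_x h x < c%:E -> exists2 x, P x & h x <= c%:E.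
Proof.
move=> mh h0 hc; apply: contrapT => no.
have H x : P x -> c%:E < h x.
  by move=> Px; rewrite ltNge; apply/negP => le; apply: no; exists x.
have c0 : (0 <= c)%R.
  have : 0 <= \int[mu]_x h x by apply: integral_ge0.
  by move=> /le_lt_trans/(_ hc); rewrite lte_fin => /ltW.
suff : c%:E <= \int[mu]_x h x by rewrite leNgt hc.
have -> : c%:E = \int[mu]_x (cst c%:E x) by rewrite integral_cst// [X in _ * X]probability_setT mule1.
have mN : measurable (~` P) by exact: measurableC.
have N0 : mu (~` P) = 0 by rewrite [LHS]probability_setC// K1 subee.
rewrite (ge0_negligible_integral mN)// [leRHS](ge0_negligible_integral mN)//.
apply: ge0_le_integral => //; first exact: measurableD.
- by apply: measurable_funTS.
- by move=> x [_ /contrapT/H/ltW].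
Qed.

End Energy.

End Kernel.

(** Taken over ordered pairs, this is the squared modulus of the Vandermonde determinant, of degree
    n(n - 1) in the distances. *)
Definition vdm {R : realType} n (z : 'I_n -> R[i]) : R :=
  \prod_i \prod_(j | j != i) normc (z i - z j).

Section Pairs.
Context {R : realType}.

Lemma prod_pairs n (g : 'I_n -> 'I_n -> R) : (forall i j, g i j = g j i) ->
  \prod_i \prod_(j | j != i) g i j = (\prod_(i < n) \prod_(j < n | (j < i)%N) g i j) ^+ 2.
Proof.
move=> gC.
have -> : \prod_i \prod_(j | j != i) g i j =
  \prod_(i < n) \prod_(j < n | (j < i)%N) g i j * \prod_(i < n) \prod_(j < n | (i < j)%N) g i j.
  rewrite -big_split /=; apply: eq_bigr => i _.
  rewrite (bigID (fun j : 'I_n => (j < i)%N)) /=; congr (_ * _); apply: eq_bigl => j.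
    by rewrite -val_eqE /=; case: ltngtP.
  by rewrite -val_eqE /= -leqNgt; case: ltngtP.
rewrite expr2; congr (_ * _).
rewrite (exchange_big_dep xpredT) //=.
by apply: eq_bigr => i _; apply: eq_bigr => j _.
Qed.

Lemma count_pairs m : \sum_(j < m) \sum_(i < j) (1 : R) = 'C(m, 2)%:R.
Proof.
have -> : \sum_(j < m) \sum_(i < j) (1 : R) = \sum_(j < m) (j%:R : R).
  by apply: eq_bigr => j _; rewrite sumr_const card_ord.
by rewrite -natr_sum -(big_mkord xpredT id) bin2_sum.
Qed.

End Pairs.

Section ClosedMeasurable.
Context {R : realType}.

(** The sigma-algebra is the product one, so the open complement is written as a countable union of
    boxes, with rational centers and half-widths 1/(n + 1). *)
Lemma closed_plane_measurable (K : set R[i]) : copen (~` K) ->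
  measurable (@to_complex R @^-1` K).
Proof.
move=> oK; pose P := @to_complex R @^-1` K.
pose box (q : rat * rat * nat) : set (R * R) :=
  `]ratr q.1.1 - q.2.+1%:R^-1, ratr q.1.1 + q.2.+1%:R^-1[%classic `*`
  `]ratr q.1.2 - q.2.+1%:R^-1, ratr q.1.2 + q.2.+1%:R^-1[%classic.
have mbox q : measurable (box q) by apply: measurableX; exact: measurable_itv.
pose F q := if `[< box q `<=` ~` P >] then box q else set0.
have E : ~` P = \bigcup_q F q.
  apply/seteqP; split => [x nPx|x [q _]]; last first.
    by rewrite /F; case: asboolP => // qP /qP.
  have [r r0 rK] := oK (to_complex x) nPx.
  have [n nr] : exists n, n.+1%:R^-1 < r / 4.
    exists (Num.truncn (4 / r)); rewrite invf_plt ?posrE ?divr_gt0 ?ltr0n//.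
    by rewrite invf_div truncnS_gt.
  have n0 : 0 < n.+1%:R^-1 :> R by rewrite invr_gt0 ltr0n.
  have pm (t : R) : t - n.+1%:R^-1 < t + n.+1%:R^-1.
    by rewrite ltrBlDr -addrA ltrDl addr_gt0.
  have [a] := @rat_in_itvoo R (x.1 - n.+1%:R^-1) (x.1 + n.+1%:R^-1) (pm _).
  have [b] := @rat_in_itvoo R (x.2 - n.+1%:R^-1) (x.2 + n.+1%:R^-1) (pm _).
  rewrite !in_itv /= => /andP[b1 b2] /andP[a1 a2].
  exists (a, b, n); [by []|]; rewrite /F ifT; last apply/asboolP.
    by split; rewrite /= in_itv /=; apply/andP; split; rewrite ?ltrBlDr// -ltrBlDr.
  set d := n.+1%:R^-1 in nr b1 b2 a1 a2.
  move=> y [/= + +]; rewrite !in_itv /= -/d => /andP[y1 y2] /andP[y3 y4].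
  apply: rK; apply: le_lt_trans (normc_le_ReIm _) _; rewrite !raddfB /=.
  have : `|y.1 - x.1| < r / 2 by rewrite ltr_norml; apply/andP; split; lra.
  have : `|y.2 - x.2| < r / 2 by rewrite ltr_norml; apply/andP; split; lra.
  lra.
rewrite -[_ @^-1` K]setCK -/P; apply: measurableC; rewrite E.
apply: countable_bigcupT_measurable => [|q]; last by rewrite /F; case: ifP.
exact: countableP.
Qed.

Lemma compact_copenC (K : set R[i]) : compact (K : set R[i]^o) -> copen (~` K).
Proof.
move=> cK; apply/copenP; rewrite openC; apply: compact_closed cK.
exact: norm_hausdorff.
Qed.

End ClosedMeasurable.

(** * From measures of finite energy to point configurations *)

Section Greedy.
Context {R : realType}.
Local Notation T := (R * R)%type.
Local Open Scope ereal_scope.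
Variables (mu : probability T R) (K : set R[i]) (L Er e : R).
Hypotheses (mK : measurable (@to_complex R @^-1` K))
  (K1 : mu (@to_complex R @^-1` K) = 1)
  (EE : \int[mu]_x potential mu L x = Er%:E) (e0 : (0 < e)%R).
Let P := @to_complex R @^-1` K.
Let U := potential mu L.

(** Integrating the left side in [z] against [mu] gives u + q Er, and a function exceeds its mean by
    e or more only off some point of the support. *)
Lemma greedy_step (s : nat) (x : nat -> T) (q : nat) (u : R) :
  \sum_(i < s) U (x i) = u%:E -> exists2 z, P z &
  \sum_(i < s) gker L (x i) z + q%:R%:E * U z <= (u + q%:R * Er + e)%:E.
Proof.
move=> uE; pose h z := \sum_(i < s) gker L (x i) z + q%:R%:E * U z.
have U0 z : 0 <= U z by exact: potential_ge0.
have s0 z : 0 <= \sum_(i < s) gker L (x i) z.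
  by apply: sume_ge0 => i _; exact: gker_ge0.
have q0 z : 0 <= q%:R%:E * U z by apply: mule_ge0; rewrite ?lee_fin.
have mU : measurable_fun setT U := measurable_potential mu L.
have ms : measurable_fun setT (fun z => \sum_(i < s) gker L (x i) z).
  by apply: emeasurable_sum => i; exact: measurable_gker2.
have mq : measurable_fun setT (fun z => q%:R%:E * U z) by exact: measurable_funeM.
apply: (exists_le_integral (K := K) mK K1 (h := h)).
- exact: emeasurable_funD.
- by move=> z; exact: adde_ge0.
- rewrite ge0_integralD// ge0_integral_sum//.
  + rewrite ge0_integralZl//.
    have -> : \sum_(i < s) \int[mu]_y gker L (x i) y = u%:E by rewrite -uE.
    by rewrite EE -EFinM -EFinD lte_fin ltrDl.
  + by move=> i; exact: measurable_gker2.
  + by move=> i z _; exact: gker_ge0.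
Qed.

(** Method of conditional expectations: the left side is the mean of the pairwise energy of n
    points, m of them fixed and the others independent with law [mu]. Each further point can be
    fixed at the cost of e. *)
Lemma greedy n m : (m <= n)%N -> exists x : nat -> T, [/\
  forall i, (i < m)%N -> P (x i) &
  \sum_(j < m) \sum_(i < j) gker L (x i) (x j) + (n - m)%:R%:E * \sum_(i < m) U (x i)
  + ('C(n - m, 2)%:R * Er)%:E <= ('C(n, 2)%:R * Er + m%:R * e)%:E].
Proof.
have U0 z : 0 <= U z by exact: potential_ge0.
elim: m => [_|m IH mn].
  exists (fun=> (0, 0)%R); split => //.
  by rewrite !big_ord0 mule0 add0e add0e subn0 mul0r addr0.
have [x [xP le]] := IH (ltnW mn).
set S := \sum_(j < m) _ in le; set V := \sum_(i < m) _ in le.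
have S0 : 0 <= S by apply: sume_ge0 => j _; apply: sume_ge0 => i _; exact: gker_ge0.
have V0 : 0 <= V by apply: sume_ge0 => j _.
have nm : (n - m = (n - m.+1).+1)%N by rewrite -subSn.
set q := (n - m.+1)%N in nm.
(* Finiteness is read off the bound: n - m is positive, so an infinite potential at a chosen point
   would make the left side infinite. *)
have Vfin : V \is a fin_num.
  rewrite ge0_fin_numE// ltey; apply/eqP => Voo; move: le.
  rewrite Voo nm gt0_muley ?lte_fin ?ltr0n// addey ?addye//.
  by rewrite -ltNye (lt_le_trans _ S0).
have [z Pz hz] := greedy_step q (esym (fineK Vfin)).
exists (fun i => if i == m then z else x i); split.
  by move=> i; rewrite ltnS leq_eqVlt => /predU1P[->|im]; rewrite ?eqxx// ltn_eqF//; exact: xP.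
rewrite !big_ord_recr /= eqxx.
have -> : \sum_(j < m) \sum_(i < j) gker L (if i == m :> nat then z else x i)
    (if j == m :> nat then z else x j) = S.
  apply: eq_bigr => j _; apply: eq_bigr => i _.
  by rewrite !ltn_eqF// (ltn_trans (ltn_ord i)).
have -> : \sum_(i < m) gker L (if i == m :> nat then z else x i) z =
    \sum_(i < m) gker L (x i) z.
  by apply: eq_bigr => i _; rewrite ltn_eqF.
have -> : \sum_(i < m) U (if i == m :> nat then z else x i) = V.
  by apply: eq_bigr => i _; rewrite ltn_eqF.
have q0 : 0 <= (q%:R%:E : \bar R) by rewrite lee_fin.
rewrite ge0_muleDr//.
set h := \sum_(i < m) gker L (x i) z in hz *.
have -> : S + h + (q%:R%:E * V + q%:R%:E * U z) + ('C(q, 2)%:R * Er)%:E =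
  S + q%:R%:E * V + ('C(q, 2)%:R * Er)%:E + (h + q%:R%:E * U z).
  rewrite -!addeA; congr (_ + _); rewrite addeCA; congr (_ + _).
  by rewrite [RHS]addeCA; congr (_ + _); rewrite addeC.
apply: le_trans (leeD2l _ hz) _.
rewrite nm binS bin1 natrD mulrDl in le.
have Sfin : S \is a fin_num.
  rewrite ge0_fin_numE// ltey; apply/eqP => Soo; move: le.
  by rewrite Soo -(fineK Vfin) -EFinM addye// addye.
move: le; rewrite -(fineK Vfin) -natr1 EFinD.
rewrite -(fineK Sfin) -!EFinM -!EFinD !lee_fin => le; lra.
Qed.

End Greedy.

Lemma mul2_bin2 n : (2 * 'C(n, 2) = n * n.-1)%N.
Proof. by rewrite mul2n bin2 halfK oddM; case: n => //= n; rewrite andNb subn0. Qed.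

Section EnergyPoints.
Context {R : realType}.
Local Notation T := (R * R)%type.

Lemma vdm_pairs n (z : 'I_n -> R[i]) (x : nat -> T) :
  (forall i : 'I_n, z i = to_complex (x i)) ->
  vdm z = (\prod_(j < n) \prod_(i < j) dist (x i) (x j)) ^+ 2.
Proof.
move=> zx; rewrite /vdm prod_pairs; last by move=> i j; rewrite normcB.
congr (_ ^+ _); apply: eq_bigr => j _.
rewrite (big_ord_widen_cond n xpredT (fun i => dist (x i) (x j))) ?(ltnW (ltn_ord j))//.
by apply: eq_bigr => i _; rewrite !zx normcB.
Qed.

Lemma energy_points (K : set R[i]) (mu : probability T R) (l : R) :
  compact (K : set R[i]^o) -> mu (@to_complex R @^-1` K) = 1%E ->
  (l%:E < log_energy mu)%E -> forall n, exists z : 'I_n -> R[i],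
    (forall i, K (z i)) /\ expR (l * (n * n.-1)%:R) <= vdm z.
Proof.
move=> cK K1 lE n; have [B B0 KB] := compact_bound cK.
pose L := ln (2 * B + 1); have B1 : 1 <= 2 * B + 1 by rewrite lerDr mulr_ge0 ?ltW.
have L0 : 0 <= L by rewrite ln_ge0.
have KL z w : K z -> K w -> normc (z - w) <= expR L.
  move=> Kz Kw; rewrite lnK ?posrE ?(lt_le_trans ltr01)//.
  apply: le_trans (normc_tri _ _) _.
  by have := KB z Kz; have := KB w Kw; lra.
have mK := closed_plane_measurable (compact_copenC cK).
have EU := log_energy_potential L0 KL mK K1.
have [Er ErE] : exists Er : R, (\int[mu]_x potential mu L x)%E = Er%:E.
  have := lE; rewrite EU.
  have : (0 <= \int[mu]_x potential mu L x)%E.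
    by apply: integral_ge0 => x _; exact: potential_ge0.
  by case: (integral _ _ _) => [r _ _|//|//]; exists r.
rewrite EU ErE -EFinB lte_fin in lE.
(* Half of the slack: for n >= 2 the total loss n e is at most 2 C(n, 2) e, which is C(n, 2) times
   the slack, so the conclusion carries no error term. *)
pose e := (L - Er - l) / 2.
have e0 : 0 < e by rewrite divr_gt0// subr_gt0.
have [x [xK le_]] := greedy mK K1 ErE e0 (leqnn n).
rewrite subnn mul0e mul0r !adde0 in le_.
exists (fun i => to_complex (x i)); split=> [i|]; first exact: xK.
rewrite (vdm_pairs (x := x))//.
have [n1|n2] := leqP n 1.
  rewrite big1 ?expr1n.
    by move: n1; case: n {le_ xK} => [|[|]]//; rewrite ?muln0 ?mulr0 expR0.
  move=> j _; rewrite big1// => i _; have := leq_ltn_trans (leq0n i) (ltn_ord i).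
  by rewrite ltnNge -ltnS (leq_trans (ltn_ord j)).
have gf (j : 'I_n) (i : 'I_j) : gker L (x i) (x j) \is a fin_num.
  rewrite ge0_fin_numE ?gker_ge0// (le_lt_trans _ (ltry ('C(n, 2)%:R * Er + n%:R * e)))//.
  apply: le_trans le_.
  rewrite (bigD1 j)//= (bigD1 i)//= -addeA leeDl// adde_ge0// sume_ge0// => k _.
    exact: gker_ge0.
  by apply: sume_ge0 => m _; exact: gker_ge0.
have dg (j : 'I_n) (i : 'I_j) : 0 < dist (x i) (x j) /\
    L - fine (gker L (x i) (x j)) <= ln (dist (x i) (x j)).
  have := gf j i; have : (L%:E - lne (dist (x i) (x j))%:E <= gker L (x i) (x j))%E.
    by rewrite /gker le_max lexx orbT.
  have [d0|dn|d0] := ltgtP 0 (dist (x i) (x j)).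
  - rewrite lne_ln//; case: (gker _ _ _) => [r| |]// + _.
    by rewrite -EFinB lee_fin /= => ?; split => //; lra.
  - by have := dist_ge0 (x i) (x j); rewrite leNgt dn.
  - by rewrite -d0 le0_lneNy //= addey// leye_eq => /eqP ->.
have S2 : \sum_(j < n) \sum_(i < j) fine (gker L (x i) (x j)) <= 'C(n, 2)%:R * Er + n%:R * e.
  rewrite -lee_fin -sumEFin; apply: le_trans le_.
  rewrite lee_sum// => j _; rewrite -sumEFin lee_sum// => i _.
  by rewrite fineK.
have S3 : 'C(n, 2)%:R * L - \sum_(j < n) \sum_(i < j) fine (gker L (x i) (x j)) <=
   \sum_(j < n) \sum_(i < j) ln (dist (x i) (x j)).
  rewrite -count_pairs mulr_suml -sumrB ler_sum// => j _.
  rewrite mulr_suml -sumrB ler_sum// => i _.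
  by rewrite mul1r; case: (dg j i).
have -> : \prod_(j < n) \prod_(i < j) dist (x i) (x j) =
    expR (\sum_(j < n) \sum_(i < j) ln (dist (x i) (x j))).
  rewrite expR_sum; apply: eq_bigr => j _; rewrite expR_sum; apply: eq_bigr => i _.
  by rewrite lnK// posrE; case: (dg j i).
rewrite -expRM_natl ler_expR.
have -> : (n * n.-1)%:R = 2 * 'C(n, 2)%:R :> R.
  by rewrite -natrM mul2_bin2.
have nC : n%:R <= 2 * 'C(n, 2)%:R :> R.
  by rewrite -natrM ler_nat mul2_bin2 leq_pmulr// -ltnS prednK// ltnW.
have : n%:R * e <= 2 * 'C(n, 2)%:R * e by rewrite ler_wpM2r// ltW.
have -> : 2 * 'C(n, 2)%:R * e = 'C(n, 2)%:R * (L - Er - l).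
  by rewrite /e; field.
move: S2 S3; set S := \sum_(j < n) _; set S' := \sum_(j < n) _.
set c := 'C(n, 2)%:R; set ne := _ * e => *; lra.
Qed.

Lemma Cap_points (E : set R[i]) (l : R) : ((expR l)%:E < Cap E)%E ->
  exists K : set R[i], [/\ compact (K : set R[i]^o), K `<=` E &
   forall n, exists z : 'I_n -> R[i], (forall i, K (z i)) /\
     expR (l * (n * n.-1)%:R) <= vdm z].
Proof.
move=> /ereal_sup_gt[_ [K [cK KE] <-]] lK; exists K; split => //.
have {}lK : (l%:E < ereal_sup [set log_energy mu
    | mu in [set mu : probability T R | mu (@to_complex R @^-1` K) = 1%E]])%E.
  by move: lK; rewrite /compact_capacity; set s := ereal_sup _;
     case: s => [r| |]//=; rewrite ?lte_fin ?ltr_expR ?ltry// ltNge expR_ge0.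
by have [_ [mu mu1 <-] lmu] := ereal_sup_gt lK; exact: energy_points cK mu1 lmu.
Qed.

End EnergyPoints.

(** * Polar coordinates and means of log |v - u| over circles *)

Section UnitCircle.
Context {R : realType}.

Definition cis (t : R) : R[i] := (cos t +i* sin t)%C.

Lemma normc_cis t : normc (cis t) = 1.
Proof. by rewrite /cis /Normc.normc cos2Dsin2 sqrtr1. Qed.

Lemma cisD s t : cis (s + t) = cis s * cis t.
Proof. by rewrite /cis cosD sinD; simpc; congr (_ +i* _)%C; ring. Qed.

Lemma cis0 : cis 0 = 1. Proof. by rewrite /cis cos0 sin0. Qed.

Lemma cis_pi t : cis (t + pi) = - cis t.
Proof. by rewrite /cis cosDpi sinDpi; simpc. Qed.

Lemma cis_half t : cis (t / 2) ^+ 2 = cis t.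
Proof. by rewrite expr2 -cisD -splitr. Qed.

Lemma pdiff_cis t : pdiff cis t ('i%C * cis t).
Proof.
have dc := pdiff_real (is_derive_cos t); have ds := pdiff_real (is_derive_sin t).
have := diffatD dc (diffatZ 'i%C ds).
have -> : (- sin t)%:C%C + 'i%C * (cos t)%:C%C = 'i%C * cis t by rewrite /cis; simpc.
move/(diffat_near real_complex_inj); apply.
by exists 1 => // y _; rewrite /cis; simpc.
Qed.

Lemma pcont_cis t : pcont cis t.
Proof. exact: diffat_cont (pdiff_cis t). Qed.

Lemma cis_polar (z : R[i]) : exists t, z = (normc z)%:C%C * cis t.
Proof.
have [->|z0] := eqVneq z 0; first by exists 0; rewrite Normc.normc0 mul0r.
have n0 : 0 < normc z by rewrite normc_gt0.
have unit_circle (a b : R) : a ^+ 2 + b ^+ 2 = 1 -> exists t, (a +i* b)%C = cis t.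
  move=> ab; have a1 : -1 <= a <= 1.
    by rewrite -ler_norml -(@ler_pXn2r _ 2) ?nnegrE//= real_normK ?num_real// expr1n -ab lerDl sqr_ge0.
  have sb : sin (acos a) = `|b|.
    by rewrite sin_acos// -sqrtr_sqr -ab addrAC subrr add0r.
  have [b0|b0] := leP 0 b; first by exists (acos a); rewrite /cis sb acosK// ger0_norm.
  by exists (- acos a); rewrite /cis sinN cosN sb acosK// ltr0_norm// opprK.
have [|t tE] := unit_circle (Re z / normc z) (Im z / normc z).
  by rewrite !expr_div_n -mulrDl -normc_sqr divff// expf_neq0 ?gt_eqF.
exists t; rewrite -tE; case: z z0 n0 {tE} => x y _ n0; simpc.
by congr (_ +i* _)%C; rewrite mulrC divfK ?gt_eqF.
Qed.

Lemma pcont_normc (g : R -> R[i]) x : pcont g x -> {for x, continuous (fun t => normc (g t))}.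
Proof.
move=> cg; apply/cvgrPdist_lt => e e0; have [dl dl0 H] := cg e e0.
apply/nbhs_ballP; exists dl => // y yx; have {}yx : `|y - x| < dl by rewrite distrC.
have := H y; rewrite normc_real => /(_ yx).
by apply: le_lt_trans; rewrite distrC normc_rtri.
Qed.

End UnitCircle.

Section RealIntegral.
Context {R : realType}.
Local Notation mu := (@lebesgue_measure R).

Lemma primitive_integral (h P : R -> R) (a b : R) : a < b -> continuous h ->
  (forall x, a <= x <= b -> is_derive x (1 : R) P (h x)) ->
  (\int[mu]_(x in `[a, b]) (h x)%:E = (P b - P a)%:E)%E.
Proof.
move=> ab ch dP; rewrite EFinB; apply: continuous_FTC2 => //.
- exact: continuous_subspaceT.
- have cP x : a <= x <= b -> {for x, continuous P}.
    move=> /dP[dPx _]; apply: differentiable_continuous.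
    exact/derivable1_diffP.
  split.
  + by move=> x; rewrite in_itv /= => /andP[/ltW ? /ltW ?]; have [|//] := dP x; apply/andP.
  + by apply: cvg_at_right_filter; apply: cP; rewrite lexx ltW.
  + by apply: cvg_at_left_filter; apply: cP; rewrite lexx ltW.
- move=> x; rewrite in_itv /= => /andP[/ltW ? /ltW ?].
  by rewrite derive1E; have [|_ ->] := dP x; rewrite //; apply/andP.
Qed.

(** The doubling map of a circle of length b preserves means: here in terms of primitives, where the
    values at b/2 cancel. *)
Lemma half_integral (h g : R -> R) (b : R) : 0 < b -> continuous h -> continuous g ->
  (forall t, g t = h (t / 2) + h ((t + b) / 2)) ->
  (\int[mu]_(x in `[0%R, b]) (g x)%:E = 2%:E * \int[mu]_(x in `[0%R, b]) (h x)%:E)%E.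
Proof.
move=> b0 ch cg gE; have [P dP] := real_primitive (ltW b0) ch.
rewrite (primitive_integral b0 ch dP).
have dQ t : 0 <= t <= b ->
    is_derive t (1 : R) (fun t => 2 * (P (t / 2) + P ((t + b) / 2))) (g t).
  move=> tb; rewrite gE.
  have d1 : is_derive t (1 : R) (fun t : R => t / 2) (2^-1).
    by apply: is_derive_eq; rewrite /= ?scaler0 ?add0r ?addr0 /GRing.scale /= ?mulr1.
  have d2 : is_derive t (1 : R) (fun t : R => (t + b) / 2) (2^-1).
    by apply: is_derive_eq; rewrite /= ?scaler0 ?add0r ?addr0 /GRing.scale /= ?mulr1.
  have e1 : is_derive (t / 2) (1 : R) P (h (t / 2)) by apply: dP; lra.
  have e2 : is_derive ((t + b) / 2) (1 : R) P (h ((t + b) / 2)) by apply: dP; lra.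
  have f1 := @is_derive1_comp _ P (fun t => t / 2) t _ _ e1 d1.
  have f2 := @is_derive1_comp _ P (fun t => (t + b) / 2) t _ _ e2 d2.
  have := is_deriveZ 2 (is_deriveD f1 f2).
  move/is_derive_eq; apply.
  by rewrite /GRing.scale /=; field.
rewrite (primitive_integral b0 cg dQ) -EFinM; congr _%:E.
have -> : (0 + b) / 2 = b / 2 by rewrite add0r.
have -> : (b + b) / 2 = b by field.
by rewrite mul0r; ring.
Qed.

End RealIntegral.

Section CircleMean.
Context {R : realType}.
Local Notation mu := (@lebesgue_measure R).
Implicit Types u v : R[i].

Let h v u t : R := - ln (normc (v - u * cis t)).

Lemma circle_dist v u t : `|normc v - normc u| <= normc (v - u * cis t).
Proof.
apply: le_trans (normc_rtri _ _).
by rewrite Normc.normcM normc_cis mulr1.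
Qed.

Lemma circle_dist_gt0 v u t : normc v != normc u -> 0 < normc (v - u * cis t).
Proof.
by move=> vu; apply: lt_le_trans (circle_dist v u t); rewrite normr_gt0 subr_eq0.
Qed.

Lemma circle_log_continuous v u : normc v != normc u -> continuous (h v u).
Proof.
move=> vu t; rewrite /continuous_at /h; apply: cvgN.
apply: continuous_cvg; first exact: continuous_ln (circle_dist_gt0 t vu).
apply: pcont_normc; apply: contatB; first exact: contat_cst.
by apply: contatM; [exact: contat_cst|exact: pcont_cis].
Qed.

Let pi2_gt0 : 0 < 2 * pi :> R.
Proof. by rewrite mulr_gt0 ?pi_gt0. Qed.

Let J v u := fine (\int[mu]_(t in `[0%R, (2 * pi)%R]) (h v u t)%:E)%E.

Lemma circle_log_fin v u : normc v != normc u ->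
  (\int[mu]_(t in `[0%R, (2 * pi)%R]) (h v u t)%:E = (J v u)%:E)%E.
Proof.
move=> /circle_log_continuous ch; have [P dP] := real_primitive (ltW pi2_gt0) ch.
by rewrite /J (primitive_integral pi2_gt0 ch dP).
Qed.

(** v^2 - u^2 cis t factors as (v - u cis (t/2)) (v + u cis (t/2)), and the second factor is the
    first one at t/2 + pi. *)
Lemma circle_log_sqr v u : normc v != normc u -> J (v ^+ 2) (u ^+ 2) = 2 * J v u.
Proof.
move=> vu; have vu2 : normc (v ^+ 2) != normc (u ^+ 2).
  by rewrite !normcX eqrXn2 ?normc_ge0.
rewrite {1}/J (half_integral pi2_gt0 (circle_log_continuous vu)).
- by rewrite (circle_log_fin vu) -EFinM.
- exact: circle_log_continuous.
move=> t; rewrite /h -opprD -lnM ?posrE ?circle_dist_gt0// -Normc.normcM.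
have -> : (t + 2 * pi) / 2 = t / 2 + pi by field.
by rewrite cis_pi -(cis_half t); congr (- ln (normc _)); ring.
Qed.

Lemma circle_log_le v u : normc v != normc u ->
  J v u <= 2 * pi * - ln `|normc v - normc u|.
Proof.
move=> vu; rewrite -lee_fin -circle_log_fin//.
have -> : ((2 * pi * - ln `|normc v - normc u|)%:E =
    \int[mu]_(t in `[0%R, (2 * pi)%R]) (- ln `|normc v - normc u|)%:E)%E.
  rewrite integral_cst//= lebesgue_measure_itv/= lte_fin pi2_gt0 -EFinB subr0.
  by rewrite -EFinM mulrC.
have ch := circle_log_continuous vu.
apply: le_integral => //.
- apply: continuous_compact_integrable; first exact: segment_compact.
  exact: continuous_subspaceT.
- apply: continuous_compact_integrable; first exact: segment_compact.
  by apply: continuous_subspaceT => x; exact: cst_continuous.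
- move=> t _; rewrite lee_fin lerN2 ler_ln ?posrE ?circle_dist ?circle_dist_gt0//.
  by rewrite normr_gt0 subr_eq0.
Qed.

(* Doubling the circle m times turns the crude bound into an exact one. *)
Lemma circle_log_max v u : normc v != normc u ->
  J v u <= 2 * pi * - ln (Num.max (normc v) (normc u)).
Proof.
move=> vu; set a := Num.max _ _; pose q := Num.min (normc v) (normc u) / a.
have a0 : 0 < a.
  rewrite lt_neqAle le_max normc_ge0 andbT eq_sym; apply: contraNneq vu => a0.
  have [va ua] : normc v <= a /\ normc u <= a by rewrite /a !le_max !lexx orbT.
  by have := normc_ge0 v; have := normc_ge0 u; rewrite a0 in va ua; rewrite eq_le; lra.
have q0 : 0 <= q by rewrite divr_ge0 ?le_min ?normc_ge0// ltW.
have q1 : q < 1.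
  rewrite /q ltr_pdivrMr// mul1r /a; case: (ltgtP (normc v) (normc u)) => // E.
  by rewrite E eqxx in vu.
have iter m v' u' : normc v' != normc u' ->
    J (v' ^+ (2 ^ m)) (u' ^+ (2 ^ m)) = 2 ^+ m * J v' u'.
  elim: m v' u' => [|m IH] v' u' vu'; first by rewrite !expr1 mul1r.
  by rewrite expnSr !exprM circle_log_sqr ?IH ?exprSr ?mulrA ?[_ * 2]mulrC//
     !normcX eqrXn2 ?normc_ge0 ?expn_gt0.
(* After m doublings the crude bound involves a^(2^m) (1 - q^(2^m)), at least a^(2^m) (1 - q).
   Dividing by 2^m makes the contribution of 1 - q disappear. *)
have step m : 2 ^+ m * J v u <= 2 * pi * (- ln (a ^+ (2 ^ m) * (1 - q))).
  rewrite -iter//.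
  have M0 : (0 < 2 ^ m)%N by rewrite expn_gt0.
  apply: le_trans (circle_log_le _) _.
    by rewrite !normcX eqrXn2 ?normc_ge0.
  rewrite ler_pM2l// lerN2 ler_ln ?posrE; last 2 first.
  - by rewrite mulr_gt0 ?exprn_gt0// subr_gt0.
  - by rewrite normr_gt0 subr_eq0 !normcX eqrXn2 ?normc_ge0.
  have -> : `|normc (v ^+ (2 ^ m)) - normc (u ^+ (2 ^ m))| = a ^+ (2 ^ m) * (1 - q ^+ (2 ^ m)).
    rewrite !normcX mulrBr mulr1 -exprMn mulrCA divff ?gt_eqF// mulr1 /a.
    have [uv|uv] := leP (normc v) (normc u).
      by rewrite distrC ger0_norm// subr_ge0 lerXn2r// nnegrE normc_ge0.
    by rewrite ger0_norm// subr_ge0 lerXn2r ?nnegrE ?normc_ge0// ltW.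
  rewrite ler_pM2l ?exprn_gt0// lerB// -[leRHS]expr1 ler_wiXn2l// ltW//.
apply/ler_addgt0Pr => e e0.
pose c := 2 * pi * - ln (1 - q).
have [m cm] : exists m, c <= 2 ^+ m * e.
  exists (Num.truncn (c / e)); rewrite -ler_pdivrMr//.
  apply: le_trans (ltW (truncnS_gt _)) _.
  by rewrite -natrX ler_nat ltn_expl.
have m0 : 0 < 2 ^+ m :> R by rewrite exprn_gt0.
rewrite -(ler_pM2l m0); apply: le_trans (step m) _.
rewrite lnM ?posrE ?exprn_gt0 ?subr_gt0// lnXn// -[ln a *+ _]mulr_natl natrX.
have -> : 2 * pi * - (2 ^+ m * ln a + ln (1 - q)) = 2 ^+ m * (2 * pi * - ln a) + c.
  by rewrite /c; ring.
by rewrite [leRHS]mulrDr lerD2l.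
Qed.

End CircleMean.

Section CircleKernel.
Context {R : realType}.
Local Notation mu := (@lebesgue_measure R).
Implicit Types v : R[i].

Definition logker (L w : R) : \bar R := (maxe 0 (L%:E - lne w%:E))%E.

Lemma logkerE L w : 0 < w -> w <= expR L -> logker L w = (L - ln w)%:E.
Proof.
move=> w0 wL; rewrite /logker lne_ln// -EFinB; apply: max_r.
by rewrite lee_fin subr_ge0 -(expRK L) ler_ln ?posrE ?expR_gt0.
Qed.

Lemma logker0 L : logker L 0 = +oo%E.
Proof. by rewrite /logker le0_lneNy//= addey// max_r. Qed.

Lemma measurable_logker L (d : R) v :
  measurable_fun setT (fun t => logker L (normc (v - d%:C%C * cis t)%R)).
Proof.
apply: measurable_maxe => //; apply: emeasurable_funB => //.
apply: measurable_lne_comp; apply: continuous_measurable_fun => t.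
apply: pcont_normc; apply: contatB; first exact: contat_cst.
by apply: contatM; [exact: contat_cst|exact: pcont_cis].
Qed.

Lemma cvg_logker L (w : nat -> R) (l : R) : (forall m, 0 < w m <= expR L) ->
  0 <= l <= expR L -> w m @[m --> \oo] --> l ->
  (logker L (w m))%E @[m --> \oo] --> logker L l.
Proof.
move=> wL /andP[l0 lL] wl.
have E m : logker L (w m) = (L - ln (w m))%:E by case/andP: (wL m) => ? ?; exact: logkerE.
rewrite (_ : (fun m => logker L (w m)) = fun m => (L - ln (w m))%:E); last exact/funext.
move: l0; rewrite le_eqVlt => /predU1P[l0|l0].
  rewrite -l0 logker0 in wl *; apply/cvgeyPge => A.
  have /cvgrPdist_lt/(_ _ (expR_gt0 (L - A)))[N _ H] := wl.
  exists N => // m /H; rewrite sub0r normrN; have /andP[w0 _] := wL m.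
  rewrite (ger0_norm (ltW w0)) => /ltW wA; rewrite lee_fin.
  have : ln (w m) <= L - A by rewrite -[leRHS]expRK ler_ln ?posrE ?expR_gt0.
  by move=> ?; lra.
rewrite logkerE//; apply: cvg_EFin; first by apply: nearW => m.
apply: cvgB; first exact: cvg_cst.
by apply: continuous_cvg wl; exact: continuous_ln.
Qed.

Let pi2_gt0 : 0 < 2 * pi :> R.
Proof. by rewrite mulr_gt0 ?pi_gt0. Qed.

Lemma circle_kernel_regular L (d : R) v : 0 < d -> normc v != d ->
  normc v + d <= expR L ->
  (\int[mu]_(t in `[0%R, (2 * pi)%R]) logker L (normc (v - d%:C%C * cis t)%R)
   <= (2 * pi * (L - ln (Num.max (normc v) d)))%:E)%E.
Proof.
move=> d0 vd vL; have nd : normc (d%:C%C : R[i]) = d by rewrite normc_real gtr0_norm.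
have vd' : normc v != normc (d%:C%C : R[i]) by rewrite nd.
have dL t : normc (v - d%:C%C * cis t) <= expR L.
  apply: le_trans (normc_tri _ _) _.
  by rewrite Normc.normcM normc_cis mulr1 nd.
have -> : (\int[mu]_(t in `[0%R, (2 * pi)%R]) logker L (normc (v - d%:C%C * cis t)%R) =
   \int[mu]_(t in `[0%R, (2 * pi)%R]) (L - ln (normc (v - d%:C%C * cis t)))%:E)%E.
  by apply: eq_integral => t _; rewrite logkerE// circle_dist_gt0.
have ch := circle_log_continuous vd'.
have [P dP] := real_primitive (ltW pi2_gt0) ch.
have := circle_log_max vd'; rewrite (primitive_integral pi2_gt0 ch dP) /= nd => le.
have cLh : continuous (fun t => L - ln (normc (v - d%:C%C * cis t))).
  by move=> t; apply: cvgD (ch t); exact: cvg_cst.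
have dLP t : 0 <= t <= 2 * pi ->
    is_derive t (1 : R) (fun t => L * t + P t) (L - ln (normc (v - d%:C%C * cis t))).
  move=> tb; have dPt := dP t tb; apply: is_derive_eq.
  by rewrite /GRing.scale /= mulr1.
rewrite (primitive_integral pi2_gt0 cLh dLP) lee_fin.
have -> : L * (2 * pi) + P (2 * pi) - (L * 0 + P 0) = L * (2 * pi) + (P (2 * pi) - P 0).
  by ring.
apply: le_trans (lerD (lexx _) le) _.
by rewrite le_eqVlt; apply/orP; left; apply/eqP; ring.
Qed.

(** When [v] lies on the circle the kernel is unbounded. [v] is then approached along its radius by
    the points [V m], inside the circle, and Fatou's lemma preserves the upper bound. *)
Lemma circle_kernel L (d : R) v : 0 < d -> normc v + d <= expR L ->
  (\int[mu]_(t in `[0%R, (2 * pi)%R]) logker L (normc (v - d%:C%C * cis t)%R)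
   <= (2 * pi * (L - ln (Num.max (normc v) d)))%:E)%E.
Proof.
move=> d0 vL; have [vd|] := eqVneq (normc v) d; last by move=> vd; exact: circle_kernel_regular.
have nd : normc (d%:C%C : R[i]) = d by rewrite normc_real gtr0_norm.
pose s m : R := (m.+2%:R)^-1.
have s0 m : 0 < s m by rewrite invr_gt0.
have s1 m : s m < 1 by rewrite invf_lt1 ?ltr1n.
pose V m := (1 - s m)%:C%C * v.
have nV m : normc (V m) = (1 - s m) * d.
  by rewrite Normc.normcM normc_real vd ger0_norm// subr_ge0 ltW.
have nVd m : normc (V m) < d by rewrite nV gtr_pMl// ltrBlDr ltrDl.
have VL m t : normc (V m - d%:C%C * cis t) <= expR L.
  apply: le_trans (normc_tri _ _) (le_trans _ vL).
  by rewrite [normc (_ * cis t)]Normc.normcM normc_cis mulr1 nd lerD2r vd ltW.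
have vL' t : normc (v - d%:C%C * cis t) <= expR L.
  apply: le_trans (normc_tri _ _) (le_trans _ vL).
  by rewrite [normc (_ * cis t)]Normc.normcM normc_cis mulr1 nd.
have cV t : logker L (normc (V m - d%:C%C * cis t)%R) @[m --> \oo] -->
    logker L (normc (v - d%:C%C * cis t)%R).
  apply: cvg_logker => [m||].
  - by rewrite VL circle_dist_gt0// nd lt_eqF.
  - by rewrite vL' normc_ge0.
  apply/cvgrPdist_le => e e0.
  exists (Num.truncn (d / e)) => // m /= mN.
  apply: le_trans (normc_rtri _ _) _.
  have -> : v - d%:C%C * cis t - (V m - d%:C%C * cis t) = (s m)%:C%C * v.
    by rewrite /V rmorphB; ring.
  rewrite Normc.normcM normc_real gtr0_norm// vd /s mulrC ler_pdivrMr// mulrC -ler_pdivrMr//.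
  by apply: ltW (lt_le_trans (truncnS_gt _) _); rewrite ler_nat ltnW.
have -> : (\int[mu]_(t in `[0%R, (2 * pi)%R]) logker L (normc (v - d%:C%C * cis t)%R) =
  \int[mu]_(t in `[0%R, (2 * pi)%R]) limn_einf (fun m => logker L (normc (V m - d%:C%C * cis t)%R)))%E.
  apply: eq_integral => t _; by rewrite (cvg_limn_einf_sup (cV t)).1.
have mV m : measurable_fun `[0%R, (2 * pi)%R]
    (fun t => logker L (normc (V m - d%:C%C * cis t)%R)).
  by apply: measurable_funTS; exact: measurable_logker.
have V0 m t : `[0%R, (2 * pi)%R]%classic t ->
    (0 <= logker L (normc (V m - d%:C%C * cis t)%R))%E.
  by move=> _; rewrite /logker le_max lexx.
apply: le_trans (fatou mu (measurable_itv _) mV V0) _.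
rewrite vd maxxx; set c := (_%:E).
have le m : (\int[mu]_(t in `[0%R, (2 * pi)%R]) logker L (normc (V m - d%:C%C * cis t)%R) <= c)%E.
  apply: le_trans (circle_kernel_regular d0 _ _) _; first by rewrite lt_eqF.
    by rewrite (le_trans _ vL)// lerD2r vd ltW.
  by rewrite (max_r (ltW (nVd m))) lexx.
rewrite limn_einf_lim; apply: lime_le; first exact: is_cvg_einfs.
apply: nearW => m; apply: le_trans (le m).
by apply: ereal_inf_lbound; exists m => /=.
Qed.

End CircleKernel.

(** * From point configurations to measures: smearing over circles *)

Section Smear.
Context {R : realType}.
Local Notation T := (R * R)%type.
Local Open Scope ereal_scope.
Implicit Types c : R[i].

Definition circ c (d t : R) : T := (complex.Re c + d * cos t, complex.Im c + d * sin t)%R.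

Lemma circE c d t : to_complex (circ c d t) = (c + d%:C%C * cis t)%R.
Proof.
apply/eqP; rewrite eq_complex raddfD raddfD /=.
by rewrite !mul0r subr0 ?addr0 ?add0r !eqxx.
Qed.

Lemma measurable_circ c d : @measurable_fun _ _ (measurableTypeR R) T setT (circ c d).
Proof.
apply: measurable_fun_pair; apply: measurable_funD => //; apply: measurable_funM => //;
  apply: continuous_measurable_fun; [exact: continuous_cos|exact: continuous_sin].
Qed.

Definition mcirc c d : {mfun measurableTypeR R >-> T} :=
  @mfun_Sub _ _ (measurableTypeR R) T (circ c d) (mem_set (@measurable_circ c d)).

Lemma pi2_gt0 : (0 < 2 * pi :> R)%R.
Proof. by rewrite mulr_gt0 ?pi_gt0. Qed.

Let U := uniform_prob pi2_gt0.

Section Mixture.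
Variables (n : nat) (z : nat -> R[i]) (d : R).

Let invn_ge0 : (0 <= n.+1%:R^-1 :> R)%R.
Proof. by rewrite invr_ge0. Qed.

(** Atoms have energy -oo; replacing each by the uniform measure on a circle of radius d > 0 makes
    the energy finite. *)
Definition circles : set T -> \bar R :=
  mscale (NngNum invn_ge0) (msum (fun i => distribution U (mcirc (z i) d)) n.+1).

HB.instance Definition _ := Measure.on circles.

Lemma circles_setT : circles setT = 1.
Proof.
have E i : distribution U (mcirc (z i) d) setT = 1%:E by exact: probability_setT.
have -> : circles setT =
  (n.+1%:R^-1)%:E * \sum_(i < n.+1) distribution U (mcirc (z i) d) setT by [].
rewrite (eq_bigr (fun=> 1%:E)) => [|i _]; last exact: E.
by rewrite sumEFin sumr_const card_ord -EFinM mulVf.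
Qed.

HB.instance Definition _ := Measure_isProbability.Build _ _ _ circles circles_setT.

Definition cavg c (f : T -> \bar R) : \bar R :=
  ((2 * pi)^-1)%:E * \int[@lebesgue_measure R]_(t in `[0%R, (2 * pi)%R]) f (circ c d t).

Lemma integral_circles (f : T -> \bar R) : (forall x, 0 <= f x) -> measurable_fun setT f ->
  \int[circles]_x f x = (n.+1%:R^-1)%:E * \sum_(i < n.+1) cavg (z i) f.
Proof.
move=> f0 mf; rewrite ge0_integral_mscale//; congr (_ * _).
rewrite ge0_integral_measure_sum//; apply: eq_bigr => i _.
rewrite ge0_integral_pushforward//.
rewrite preimage_setT integral_uniform.
- by rewrite subr0.
- by apply: measurableT_comp => //; exact: measurable_circ.
- by move=> t; exact: f0.
Qed.

End Mixture.

Lemma logker_max (L w d : R) : (0 < d)%R -> (0 <= w)%R ->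
  (L - ln (Num.max w d))%:E <= logker L w.
Proof.
move=> d0; rewrite le_eqVlt => /predU1P[<-|w0]; first by rewrite logker0 leey.
rewrite /logker lne_ln// -EFinB le_max; apply/orP; right.
rewrite lee_fin lerB// ler_ln ?posrE//; last by rewrite lt_max w0.
by rewrite le_max lexx.
Qed.

Lemma cavg_logker (L d : R) c (x : T) : (0 < d)%R ->
  (normc (to_complex x - c) + d <= expR L)%R ->
  cavg d c (gker L x) <= (L - ln (Num.max (normc (to_complex x - c)) d))%:E.
Proof.
move=> d0 xL; have le := circle_kernel d0 xL; rewrite /cavg.
rewrite (eq_integral (fun t : measurableTypeR R => logker L (normc (to_complex x - c - d%:C%C * cis t)%R))).
  apply: (le_trans (lee_wpmul2l _ le)); first by rewrite lee_fin invr_ge0 ltW// pi2_gt0.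
  by rewrite -EFinM lee_fin mulrA mulVf ?mul1r// gt_eqF// pi2_gt0.
by move=> t _; rewrite /gker /logker /dist circE opprD addrA.
Qed.

Lemma le_cavg d c (f g : T -> \bar R) : measurable_fun setT f -> measurable_fun setT g ->
  (forall x, 0 <= f x) -> (forall t, f (circ c d t) <= g (circ c d t)) ->
  cavg d c f <= cavg d c g.
Proof.
move=> mf mg f0 fg; apply: lee_wpmul2l.
  by rewrite lee_fin invr_ge0 ltW// pi2_gt0.
apply: ge0_le_integral => //.
- apply: measurable_funTS; apply: measurableT_comp => //; exact: measurable_circ.
- apply: measurable_funTS; apply: measurableT_comp => //; exact: measurable_circ.
Qed.

Lemma cavg_cst d c (k : R) : cavg d c (fun=> k%:E) = k%:E.
Proof.
rewrite /cavg integral_cst//= lebesgue_measure_itv/= lte_fin pi2_gt0 -EFinB subr0.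
by rewrite -!EFinM; congr _%:E; rewrite mulrC mulfK// gt_eqF// pi2_gt0.
Qed.

Lemma cavg_sum d c n (f : 'I_n -> T -> \bar R) : (forall i x, 0 <= f i x) ->
  (forall i, measurable_fun setT (f i)) ->
  cavg d c (fun x => \sum_(i < n) f i x) = \sum_(i < n) cavg d c (f i).
Proof.
move=> f0 mf; rewrite /cavg ge0_integral_sum//; first last.
- by move=> i; apply: measurable_funTS; apply: measurableT_comp => //; exact: measurable_circ.
by rewrite ge0_sume_distrr// => i _; exact: integral_ge0.
Qed.

Lemma cavgZ d c (k : R) (f : T -> \bar R) : (0 <= k)%R -> (forall x, 0 <= f x) ->
  measurable_fun setT f -> cavg d c (fun x => k%:E * f x) = k%:E * cavg d c f.
Proof.
move=> k0 f0 mf; rewrite /cavg ge0_integralZl//; first by rewrite muleCA.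
apply: measurable_funTS; apply: measurableT_comp => //; exact: measurable_circ.
Qed.

Section Configuration.
Variables (n : nat) (z : nat -> R[i]) (d : R) (K : set R[i]).
Hypotheses (d0 : (0 < d)%R) (cK : compact (K : set R[i]^o))
  (zK : forall i t, (i < n.+1)%N -> K (z i + d%:C%C * cis t)%R)
  (z_inj : forall i j, (i < n.+1)%N -> (j < n.+1)%N -> i != j -> z i != z j).

Let a i j := if i == j then ln d else ln (normc (z i - z j)%R).

Let mP : measurable (@to_complex R @^-1` K).
Proof. exact: closed_plane_measurable (compact_copenC cK). Qed.

Lemma circles_support : circles n z d (@to_complex R @^-1` K) = 1.
Proof.
rewrite -[_ @^-1` K]setIT -integral_indic// integral_circles//; last first.
  by apply/measurable_EFinP; exact: measurable_indic.
rewrite (eq_bigr (fun=> 1%:E)) => [|i _].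
  by rewrite sumEFin sumr_const card_ord -EFinM mulVf.
rewrite -[RHS](cavg_cst d (z i)); congr (_ * _); apply: eq_integral => t _.
rewrite indicE mem_set//= circE; apply: zK; exact: ltn_ord.
Qed.

(** log |x - y| is subharmonic, so averaging over circles does not lower the energy of a pair: the
    mean is at least log |z_i - z_j| for two circles and log d for a circle with itself. The two
    variables are averaged in turn. *)
Lemma smear_energy :
  ((\sum_(i < n.+1) \sum_(j < n.+1) a i j) / n.+1%:R ^+ 2)%:E <= log_energy (circles n z d).
Proof.
have [B B0 KB] := compact_bound cK.
(* Centers lie within B + d of the origin, so a distance between two centers, plus d, is at most 2 B
   + 3 d; the summand 1 makes [L] nonnegative. *)
pose L := ln (2 * B + 4 * d + 1)%R.
have L1 : (1 <= 2 * B + 4 * d + 1)%R by rewrite lerDr addr_ge0 ?mulr_ge0 ?ltW.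
have L0 : (0 <= L)%R by rewrite ln_ge0.
have LE : expR L = (2 * B + 4 * d + 1)%R by rewrite lnK ?posrE ?(lt_le_trans ltr01).
have KL x y : K x -> K y -> (normc (x - y) <= expR L)%R.
  move=> /KB ? /KB ?; rewrite LE; apply: le_trans (normc_tri _ _) _.
  by move: d0 => ?; lra.
have zB i : (i < n.+1)%N -> (normc (z i) <= B + d)%R.
  move=> /(zK 0)/KB zb; have -> : z i = (z i + d%:C%C * cis 0 - d%:C%C * cis 0)%R by ring.
  apply: le_trans (normc_tri _ _) _; rewrite lerD// Normc.normcM normc_cis mulr1.
  by rewrite normc_real gtr0_norm.
have zL i x : (i < n.+1)%N -> K x -> (normc (x - z i) + d <= expR L)%R.
  move=> /zB ? /KB ?; rewrite LE; have := normc_tri x (z i).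
  by move: d0 => ? ?; lra.
rewrite (log_energy_potential L0 KL mP circles_support).
(* Bound for the mean over the j-th circle, at a point of the i-th one, in a form that can be
   averaged again; [circ (z j) 0 0] is the center as a pair of reals. *)
pose psi (i j : nat) (x : T) := if i == j then (L - ln d)%:E
  else gker L (circ (z j) 0 0) x.
pose N : R := n.+1%:R.
have N0 : (0 <= N^-1)%R by rewrite invr_ge0.
have psi0 (i j : 'I_n.+1) x : 0 <= psi i j x.
  rewrite /psi; case: ifP => _; last exact: gker_ge0.
  rewrite lee_fin subr_ge0 -[leRHS]expRK ler_ln ?posrE ?expR_gt0//.
  rewrite LE; move: d0 B0 => ? ?; lra.
have mpsi (i j : 'I_n.+1) : measurable_fun setT (psi i j).
  by rewrite /psi; case: (_ == _) => //; exact: measurable_gker2.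
have pot (i : 'I_n.+1) t : potential (circles n z d) L (circ (z i) d t) <=
    (N^-1)%:E * \sum_(j < n.+1) psi i j (circ (z i) d t).
  rewrite /potential integral_circles; last 2 first.
  - by move=> x; exact: gker_ge0.
  - exact: measurable_gker2.
  apply: lee_wpmul2l; first by rewrite lee_fin.
  apply: lee_sum => j _.
  have Kx : K (to_complex (circ (z i) d t)) by rewrite circE; apply: zK; exact: ltn_ord.
  apply: le_trans (cavg_logker d0 (zL j _ _ Kx)) _; first exact: ltn_ord.
  rewrite /psi; case: ifP => _.
    rewrite lee_fin lerB// ler_ln ?posrE ?lt_max ?d0 ?orbT//.
    by rewrite le_max lexx orbT.
  apply: le_trans (logker_max L d0 (normc_ge0 _)) _.
  by rewrite /gker /logker /dist !circE mul0r addr0 normcB.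
have mpot := measurable_potential (circles n z d) L.
have pot0 x : 0 <= potential (circles n z d) L x by exact: potential_ge0.
have main : \int[circles n z d]_x potential (circles n z d) L x <=
    ((L - (\sum_(i < n.+1) \sum_(j < n.+1) a i j) / n.+1%:R ^+ 2)%R)%:E.
  rewrite integral_circles//.
  have step (i : 'I_n.+1) : cavg d (z i) (potential (circles n z d) L) <=
      (N^-1 * \sum_(j < n.+1) (L - a i j))%:E.
    have ms : measurable_fun setT (fun x => \sum_(j < n.+1) psi i j x).
      by apply: emeasurable_sum.
    pose g x := (N^-1)%:E * \sum_(j < n.+1) psi i j x.
    have mg : measurable_fun setT g by exact: measurable_funeM.
    apply: (le_trans (@le_cavg d (z i) _ g mpot mg pot0 (pot i))); rewrite /g.
    rewrite cavgZ//; last by move=> x; exact: sume_ge0.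
    rewrite EFinM; apply: lee_wpmul2l; first by rewrite lee_fin.
    rewrite cavg_sum// -sumEFin; apply: lee_sum => j _.
    rewrite /psi /a; case: ifPn => [_|ij]; first by rewrite cavg_cst.
    have zij : z i != z j by apply: z_inj ij; exact: ltn_ord.
    have Kzj : (normc (z j - z i) + d <= expR L)%R.
      rewrite LE; have := normc_tri (z j) (z i).
      have := zB i (ltn_ord i); have := zB j (ltn_ord j); move: d0 => ?; lra.
    apply: le_trans (cavg_logker d0 _) _; rewrite circE mul0r addr0//.
    rewrite lee_fin lerB// ler_ln ?posrE.
    - by rewrite normcB le_max lexx.
    - by rewrite normc_gt0 subr_eq0.
    - by rewrite lt_max d0 orbT.
  apply: (@le_trans _ _ ((N^-1)%:E *
      \sum_(i < n.+1) (N^-1 * \sum_(j < n.+1) (L - a i j))%:E)).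
    by apply: lee_wpmul2l; rewrite ?lee_fin//; exact: lee_sum.
  rewrite sumEFin -EFinM lee_fin -mulr_sumr mulrA -invfM -expr2.
  under eq_bigr do rewrite sumrB sumr_const card_ord.
  rewrite sumrB sumr_const card_ord -mulrnA mulrBr [X in (_ - X <= _)%R]mulrC lerD2r.
  have -> : ((N ^+ 2)^-1 * (L *+ (n.+1 * n.+1)) = L)%R; last exact: lexx.
  by rewrite -(mulr_natl L) natrM -expr2 mulrA mulVf ?mul1r// expf_neq0// pnatr_eq0.
move: main; set S := (_ / _)%R; case: (integral _ _ _) => [r| |] //=.
- by rewrite -EFinB !lee_fin !lerBrDr addrC.
- by rewrite leey.
Qed.

Lemma smear_capacity :
  (expR ((\sum_(i < n.+1) \sum_(j < n.+1) a i j) / n.+1%:R ^+ 2))%:E <= compact_capacity K.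
Proof.
rewrite /compact_capacity -[X in X <= _]/(expeR (_%:E)) lee_expeR.
apply: le_trans smear_energy _; apply: ereal_sup_ubound; exists (circles n z d) => //.
exact: circles_support.
Qed.

End Configuration.

End Smear.

(** * Comparison of capacity with products of distances *)

Section CapacityPoints.
Context {R : realType}.
Implicit Types (E K : set R[i]) (l d : R).

Lemma vdm_neq n (z : 'I_n -> R[i]) : 0 < vdm z -> forall i j, i != j -> z i != z j.
Proof.
move=> z0 i j ij; apply: contraTneq z0 => zij.
by rewrite /vdm (bigD1 i)//= (bigD1 j) 1?eq_sym//= zij subrr Normc.normc0 !mul0r ltxx.
Qed.

Lemma Cap_mono E F : E `<=` F -> (Cap E <= Cap F)%E.
Proof.
move=> EF; apply: le_ereal_sup => _ [K [cK KE] <-]; exists K => //; split => //.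
exact: subset_trans EF.
Qed.

Lemma vdm_Cap n (z : 'I_n.+1 -> R[i]) d K E : 0 < d ->
  compact (K : set R[i]^o) -> K `<=` E ->
  (forall i t, K (z i + d%:C%C * cis t)) -> 0 < vdm z ->
  ((expR ((ln (vdm z) + n.+1%:R * ln d) / n.+1%:R ^+ 2))%:E <= Cap E)%E.
Proof.
move=> d0 cK KE zK z0; pose zz (i : nat) := z (inord i).
have zzK i t : (i < n.+1)%N -> K (zz i + d%:C%C * cis t) by move=> _; exact: zK.
have zz_inj i j : (i < n.+1)%N -> (j < n.+1)%N -> i != j -> zz i != zz j.
  move=> i_n j_n ij; apply: (vdm_neq z0); apply: contraNneq ij => /(congr1 val).
  by rewrite /= !inordK// => ->.
have := smear_capacity d0 cK zzK zz_inj.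
set S := \sum_(i < n.+1) _; have -> : S = ln (vdm z) + n.+1%:R * ln d.
  have -> : ln (vdm z) = \sum_(i < n.+1) \sum_(j < n.+1 | j != i) ln (normc (z i - z j)).
    have pos (i j : 'I_n.+1) : j != i -> 0 < normc (z i - z j).
      by move=> ij; rewrite normc_gt0 subr_eq0 (vdm_neq z0)// eq_sym.
    rewrite -[RHS]expRK expR_sum; congr ln; apply: eq_bigr => i _.
    rewrite expR_sum; apply: eq_bigr => j ij; rewrite lnK// posrE; exact: pos.
  have -> : n.+1%:R * ln d = \sum_(i < n.+1) ln d.
    by rewrite sumr_const card_ord mulr_natl.
  rewrite -big_split; apply: eq_bigr => i _ /=.
  rewrite (bigD1 i)//= eqxx addrC; congr (_ + _); apply: eq_bigr => j ji.
  by rewrite eq_sym ifN// /zz !inord_val.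
move/le_trans; apply; apply: ereal_sup_ubound; exists K => //; split => //.
Qed.

Lemma expR_lim l (x : \bar R) : (forall e, 0 < e -> ((expR (l - e))%:E <= x)%E) ->
  ((expR l)%:E <= x)%E.
Proof.
case: x => [x| |] H; last 2 first; first by rewrite leey.
  by have := H 1 ltr01; rewrite leeNy_eq.
have x0 : 0 < x by apply: lt_le_trans (expR_gt0 (l - 1)) _; rewrite -lee_fin H.
rewrite lee_fin -[leRHS]lnK ?posrE// ler_expR; apply/ler_addgt0Pr => e e0.
by have := H e e0; rewrite lee_fin -{1}(lnK x0) ler_expR lerBlDr.
Qed.

Definition has_points K l := forall n, exists z : 'I_n -> R[i],
  (forall i, K (z i)) /\ expR (l * (n * n.-1)%:R) <= vdm z.

Lemma Cap_has_points E l : ((expR l)%:E < Cap E)%E ->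
  exists K, [/\ compact (K : set R[i]^o), K `<=` E & has_points K l].
Proof. exact: Cap_points. Qed.

(** The self-energies and the missing diagonal change the exponent by n (l - log d) against n^2 l,
    so n is taken larger than |l - log d| / e. *)
Lemma points_Cap K0 K E l d : has_points K0 l -> 0 < d ->
  compact (K : set R[i]^o) -> K `<=` E ->
  (forall z t, K0 z -> K (z + d%:C%C * cis t)) -> ((expR l)%:E <= Cap E)%E.
Proof.
move=> pts d0 cK KE K0K; apply: expR_lim => e e0.
pose n := Num.truncn (`|l - ln d| / e); pose N : R := n.+1%:R.
have N0 : 0 < N by rewrite ltr0n.
have [z [zK0 zl]] := pts n.+1.
have z0 : 0 < vdm z := lt_le_trans (expR_gt0 _) zl.
apply: le_trans (vdm_Cap d0 cK KE _ z0); last by move=> i t; exact: K0K.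
rewrite lee_fin ler_expR ler_pdivlMr ?exprn_gt0//.
have : l * (N * (N - 1)) <= ln (vdm z).
  rewrite -[leLHS]expRK ler_ln ?posrE ?expR_gt0//; apply: le_trans zl.
  have -> : N - 1 = n%:R by rewrite /N -addn1 natrD addrK.
  by rewrite ler_expR natrM.
have : l - ln d <= N * e.
  rewrite -ler_pdivrMr// (le_trans _ (ltW (truncnS_gt _)))// ler_pM2r ?invr_gt0//.
  exact: ler_norm.
rewrite -(ler_pM2l N0) -/N => *.
have -> : (l - e) * N ^+ 2 = l * (N * (N - 1)) + N * (l - N * e) by ring.
lra.
Qed.

(** Capacities are compared through strict lower bounds exp l, which produce configurations; this
    form also covers an infinite capacity. *)
Lemma Cap_approx E (x : \bar R) : (0 <= x)%E ->
  (forall l, ((expR l)%:E < Cap E)%E -> ((expR l)%:E <= x)%E) -> (Cap E <= x)%E.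
Proof.
move=> x0 H; rewrite leNgt; apply/negP => xE.
have [r [r0 xr rE]] : exists r, [/\ 0 < r, (x < r%:E)%E & (r%:E < Cap E)%E].
  case: x {H} x0 xE => [y| |] x0 xE; last 2 first.
  - by move: xE; rewrite ltNge leey.
  - by move: x0; rewrite leeNy_eq.
  rewrite lee_fin in x0; move: xE; case: (Cap E) => [r| |]; last by [].
    by rewrite lte_fin => yr; exists ((y + r) / 2); rewrite !lte_fin; split; lra.
  by move=> _; exists (y + 1); rewrite ltry lte_fin; split => //; lra.
have := H (ln r); rewrite lnK// => /(_ rE).
by rewrite leNgt xr.
Qed.

(** Configurations of two points already bound the capacity, and finiteness is what this bound
    serves for. *)
Lemma Cap_le E B : 0 < B -> (forall z, E z -> normc z <= B) -> (Cap E <= (2 * B)%:E)%E.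
Proof.
move=> B0 EB; apply: Cap_approx => [|l lE]; first by rewrite lee_fin mulr_ge0 ?ltW.
have [K [cK KE pts]] := Cap_has_points lE; have [z [zK]] := pts 2%N.
rewrite /vdm; under eq_bigr do rewrite big_mkcond.
rewrite !big_ord_recl !big_ord0 /= !mul1r !mulr1 mulrC expRM_natl lee_fin => le.
have zB i j : normc (z i - z j) <= 2 * B.
  apply: le_trans (normc_tri _ _) _; have := EB _ (KE _ (zK i)).
  by have := EB _ (KE _ (zK j)); lra.
rewrite -ler_sqr ?nnegrE ?expR_ge0 ?mulr_ge0 ?(ltW B0)//.
by apply: (le_trans le); rewrite expr2 ler_pM ?normc_ge0.
Qed.

Lemma Cap_gt0 E K c d : 0 < d -> compact (K : set R[i]^o) -> K `<=` E ->
  (forall t, K (c + d%:C%C * cis t)) -> (d%:E <= Cap E)%E.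
Proof.
move=> d0 cK KE cKt.
pose zc : 'I_1 -> R[i] := fun=> c.
have vdm1 : vdm zc = 1.
  by rewrite /vdm big_ord1 big1// => j; rewrite (ord1 j).
have := @vdm_Cap 0 zc d K E d0 cK KE (fun _ t => cKt t).
by rewrite vdm1 ln1 add0r mul1r expr1n divr1 lnK//; apply.
Qed.

Lemma vdmZ n c (z : 'I_n -> R[i]) :
  vdm (fun i => c * z i) = normc c ^+ (n * n.-1) * vdm z.
Proof.
rewrite /vdm.
have -> : normc c ^+ (n * n.-1) = \prod_(i < n) \prod_(j < n | j != i) normc c.
  rewrite (eq_bigr (fun=> normc c ^+ n.-1)) => [|i _].
    by rewrite prodr_const card_ord -exprM mulnC.
  by rewrite prodr_const -[in RHS](card_ord n) -(cardC1 i).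
rewrite -big_split; apply: eq_bigr => i _; rewrite -big_split; apply: eq_bigr => j _.
by rewrite /= -mulrBr Normc.normcM.
Qed.

Lemma compact_in_disk K r : 0 < r -> compact (K : set R[i]^o) -> K `<=` disk r ->
  exists2 r', 0 <= r' < r & forall z, K z -> normc z <= r'.
Proof.
move=> r0 cK Kr; have [K0|[z0 Kz0]] : K = set0 \/ exists z, K z.
  by have [[z Kz]|nK] := pselect (exists z, K z); [right; exists z|left;
    apply/seteqP; split => // z Kz; case: nK; exists z].
  by exists 0; rewrite ?lexx ?r0//= => z; rewrite K0.
have [c Kc cmax] := compact_normc_max cK Kz0 (fun z _ => @ccont_id R z).
by exists (normc c) => //; rewrite normc_ge0; exact: Kr.
Qed.

(** A homothety multiplies every distance by s / r; compactness of [K] in the open disk leaves the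
    margin [d] for smearing. *)
Lemma points_disk r s l : 0 < r -> 0 < s -> ((expR l)%:E < Cap (disk r))%E ->
  ((expR (l + ln (s / r)))%:E <= Cap (disk s))%E.
Proof.
move=> r0 s0 lE; have [K [cK Kr pts]] := Cap_has_points lE.
have [r' /andP[r'0 r'r] Kr'] := compact_in_disk r0 cK Kr.
pose q := s / r; have q0 : 0 < q by rewrite divr_gt0.
have qr' : q * r' < s by rewrite /q mulrAC ltr_pdivrMr// ltr_pM2l.
pose d := (s - q * r') / 2; have d0 : 0 < d by rewrite divr_gt0// subr_gt0.
apply: (@points_Cap (fun w => exists2 z, K z & w = q%:C%C * z)
  [set w | normc w <= q * r' + d] _ _ d) => //.
- move=> n; have [z [zK le]] := pts n; exists (fun i => q%:C%C * z i); split.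
    by move=> i; exists (z i).
  rewrite vdmZ normc_real gtr0_norm// mulrDl expRD mulrC ler_pM ?expR_ge0//.
  by rewrite mulrC expRM_natl lnK.
- exact: compact_disk.
- by move=> w /= wle; rewrite /disk /=; apply: le_lt_trans wle _; rewrite /d; lra.
- move=> _ t [z Kz ->]; rewrite /=; apply: le_trans (le_normcD _ _) _.
  rewrite !Normc.normcM normc_cis !normc_real !gtr0_norm// mulr1 lerD2r ler_pM2l//.
  exact: Kr'.
Qed.

Lemma Cap_disk_fin (r : R) : 0 < r -> exists2 x : R, 0 < x & Cap (disk r) = x%:E.
Proof.
move=> r0.
have le : (Cap (disk r) <= (2 * r)%:E)%E by apply: Cap_le => // z; exact: ltW.
have ge : ((r / 2)%:E <= Cap (disk r))%E.
  apply: (@Cap_gt0 _ [set z | normc z <= r / 2] 0) => //.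
  - by rewrite divr_gt0.
  - exact: compact_disk.
  - by move=> z /= zr; apply: le_lt_trans zr _; lra.
  - by move=> t; rewrite /= add0r Normc.normcM normc_cis normc_real mulr1 gtr0_norm ?divr_gt0.
move: le ge; case: (Cap _) => [x| |]//; rewrite !lee_fin => _ x0.
by exists x => //; lra.
Qed.

Lemma Cap_disk_scale (r s x y : R) : 0 < r -> 0 < s -> 0 < x -> 0 < y ->
  Cap (disk r) = x%:E -> Cap (disk s) = y%:E -> x * (s / r) <= y.
Proof.
move=> r0 s0 x0 y0 xE yE; rewrite -lee_fin.
have sr0 : 0 < s / r by rewrite divr_gt0.
have -> : x * (s / r) = expR (ln x + ln (s / r)) by rewrite expRD !lnK.
apply: expR_lim => e e0.
have -> : ln x + ln (s / r) - e = ln x - e + ln (s / r) by ring.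
rewrite -yE; apply: points_disk => //.
by rewrite xE lte_fin -[ltRHS]lnK// ltr_expR ltrBlDr ltrDl.
Qed.

(** Homogeneity determines the capacity of disks up to the factor [k], which enters log psi as an
    additive constant. *)
Lemma Cap_disk : exists2 k : R, 0 < k & forall r : R, 0 < r -> Cap (disk r) = (r * k)%:E.
Proof.
have [k k0 kE] := Cap_disk_fin ltr01; exists k => // r r0.
have [x x0 xE] := Cap_disk_fin r0; rewrite xE; congr _%:E.
have := Cap_disk_scale r0 ltr01 x0 k0 xE kE; rewrite div1r ler_pdivrMr// => h1.
have := Cap_disk_scale ltr01 r0 k0 x0 kE xE; rewrite divr1 => h2.
by apply/eqP; rewrite eq_le [r * k]mulrC h1 h2.
Qed.

End CapacityPoints.

(** * Analytic content of the class *)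

Section ClassFacts.
Context {R : realType}.
Implicit Types (z w : R[i]).

Lemma derivable_cdiff (f : R[i]^o -> R[i]^o) (z : R[i]^o) :
  derivable f z 1 -> exists D : R[i], cdiff f z D.
Proof.
rewrite /derivable => /cvg_ex[l fl]; exists l.
apply: eps_diffat idfun_inj _ => e e0.
have e0' : 0 < (e%:C)%C :> R[i] by rewrite ltcR.
move: fl => /cvgrPdist_le/(_ _ e0').
rewrite near_withinE => /nbhs_normc[dl /= dl0 H]; exists dl => // h hd.
have [->|hn] := eqVneq h 0.
  by rewrite addr0 subrr mulr0 subr0 Normc.normc0 mulr0.
have := H h; rewrite subr0 => /(_ hd hn).
rewrite normc_normE lecR /GRing.scale /= mulr1 [h + z]addrC.
have -> : f (z + h) - f z - l * h = - ((l - h^-1 * (f (z + h) - f z)) * h).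
  by field.
by rewrite normcN Normc.normcM ler_pM2r// normc_gt0.
Qed.

(** |f| > 1 holds because the closed disk, a component of the complement of the image, misses the
    image. The boundary limit is then expressed by an upper bound. *)
Lemma class_S_facts (rho : R) (f : R[i]^o -> R[i]^o) : class_S rho f -> [/\
  forall z, 1 < normc z < rho -> exists D : R[i], cdiff f z D,
  forall z w, 1 < normc z < rho -> 1 < normc w < rho -> f z = f w -> z = w,
  forall z, 1 < normc z < rho -> 1 < normc (f z) &
  forall e : R, 0 < e -> exists2 dl : R, 0 < dl &
    forall z, 1 < normc z < 1 + dl -> normc (f z) < 1 + e].
Proof.
move=> [fd fi _ fb fl]; split => //.
- by move=> z zr; apply: derivable_cdiff; exact: fd.
- move=> z zr; rewrite ltNge; apply/negP => fz1.
  have : bounded_components_of_complement (f @` annulus rho) closed_unit_disk by rewrite fb.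
  move=> [_ [w _ E]]; have : closed_unit_disk (f z) by [].
  by rewrite E => /connected_component_sub; apply; exists z.
- move=> e /fl; rewrite near_withinE => /nbhs_ballP[dl /= dl0 H]; exists dl => //.
  move=> z /andP[z1 zd]; have := H (normc z) _ z1 z erefl.
  have bz : ball (1 : R) dl (normc z) by rewrite /ball /= ltr_distlC; apply/andP; split; lra.
  by move=> /(_ bz)/ltr_normlW; lra.
Qed.

End ClassFacts.

Section Balls.
Context {R : realType}.
Implicit Types (z w : R[i]).

Lemma compact_cball z0 (r : R) : compact ([set z | normc (z - z0) <= r] : set R[i]^o).
Proof.
apply: (@closed_bounded_compact _ _ (r + normc z0)).
  move=> z /= /negP; rewrite -ltNge => zr; exists (normc (z - z0) - r).
    by rewrite subr_gt0.
  move=> w wz; apply/negP; rewrite -ltNge.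
  by have := normc_dist w z z0; rewrite [normc (z - w)]normcB; lra.
by move=> z /= zr; have := normc_dist z0 z 0; rewrite !subr0; lra.
Qed.

Lemma copen_ball z0 (r : R) : copen [set z | normc (z - z0) < r].
Proof.
move=> z /= zr; exists (r - normc (z - z0)); first by rewrite subr_gt0.
by move=> w wz; have := normc_dist z w z0; move: zr wz; lra.
Qed.

Lemma compact_sphere z0 (r : R) : compact ([set z | normc (z - z0) = r] : set R[i]^o).
Proof.
apply: (subclosed_compact _ (@compact_cball z0 r)); last by move=> z /= ->.
rewrite -[X in closed X]setCK; apply: open_closedC; apply/copenP => z zr.
exists `|normc (z - z0) - r|; first by rewrite normr_gt0 subr_eq0; apply/eqP.
move=> w wz wr; move: wz; rewrite ltNge -wr.
have -> : normc (w - z) = normc (z - z0 - (w - z0)) by rewrite normcB; congr normc; ring.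
by rewrite normc_rtri.
Qed.

End Balls.

Section OpenMapping.
Context {R : realType}.
Variables (f : R[i] -> R[i]).
Implicit Types (z w : R[i]).

(** If [w] were missed, 1/(f - w) would be holomorphic on the ball. By the choice of [mu] its
    modulus is at most 2/mu on the sphere and more than 2/mu at the center, against the maximum
    principle. *)
Lemma injective_open z0 (r : R) : 0 < r ->
  (forall z, normc (z - z0) <= r -> exists D, cdiff f z D) ->
  (forall z, normc (z - z0) <= r -> f z = f z0 -> z = z0) ->
  exists2 mu : R, 0 < mu & forall w, normc (w - f z0) < mu ->
    exists2 z, normc (z - z0) < r & f z = w.
Proof.
move=> r0 df inj.
pose K := [set z | normc (z - z0) <= r]; pose U := [set z | normc (z - z0) < r].
pose S := [set z | normc (z - z0) = r].
have cK : compact (K : set R[i]^o) by exact: compact_cball.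
have cS : compact (S : set R[i]^o) by exact: compact_sphere.
have oU : copen U by exact: copen_ball.
have S0 : S (z0 + r%:C%C) by rewrite /S /= addrAC subrr add0r normc_real gtr0_norm.
have [c Sc cmin] := compact_normc_min (F := fun z => f z - f z0) cS S0 (fun z Sz =>
  contatB (let: ex_intro D dD := df z (eq_ind_r (fun x => x <= r) (lexx r) Sz) in diffat_cont dD)
    (contat_cst idfun _ _)).
pose mu := normc (f c - f z0).
have mu0 : 0 < mu.
  rewrite normc_gt0 subr_eq0; apply/eqP => /inj; rewrite -[normc _]/(normc _) Sc lexx.
  by move=> /(_ isT) cz; move: Sc r0; rewrite /S /= cz subrr Normc.normc0 => <-; rewrite ltxx.
exists (mu / 2); first by rewrite divr_gt0.
move=> w wf; apply: contrapT => nw.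
have fw z : K z -> f z - w != 0.
  move=> Kz; apply/negP => /eqP/subr0_eq fz; move: Kz; rewrite /K /= le_eqVlt => /predU1P[zr|zr].
    by have := cmin z zr; rewrite fz -/mu; lra.
  by apply: nw; exists z.
have m2 : 0 < mu / 2 by rewrite divr_gt0.
have fw0 z : K z -> 0 < normc (f z - w) by move=> /fw; rewrite normc_gt0.
have cF z : K z -> exists D, cdiff (fun z => (f z - w)^-1) z D.
  move=> Kz; have [D dD] := df z Kz.
  by eexists; apply: diffatV (diffatB dD (diffat_cst idfun w z)) (fw z Kz); exact: idfun_inj.
have KF : forall z, K z -> normc (f z - w)^-1 <= (mu / 2)^-1.
  apply: (max_principle cK oU).
  - by move=> z; exact: ltW.
  - by move=> z /cF[D]; exact: diffat_cont.
  - by move=> z Uz; apply: cF; exact: ltW.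
  - by rewrite invr_ge0 ltW.
  move=> z Kz nUz; rewrite Normc.normcV lef_pV2 ?posrE ?fw0//.
  have Sz : S z by apply/eqP; rewrite eq_le Kz leNgt; apply/negP.
  have := cmin z Sz; rewrite -/mu.
  by have := normc_dist w (f z) (f z0); lra.
have Kz0 : K z0 by rewrite /K /= subrr Normc.normc0 ltW.
have := KF _ Kz0; rewrite Normc.normcV lef_pV2 ?posrE ?fw0//.
by rewrite normcB leNgt wf.
Qed.

End OpenMapping.

(** * The filled images *)

Section Lipschitz.
Context {R : realType}.

Lemma cis_lipschitz (a b : R) : normc (cis a - cis b) <= `|a - b|.
Proof.
wlog ab : a b / b <= a => [H|].
  have [/H//|/ltW/H] := leP b a.
  by rewrite normcB distrC.
rewrite ger0_norm ?subr_ge0// -[leRHS]mul1r.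
apply: (pdiff_normc_le ab (fun x _ => pdiff_cis x)) => x _.
by rewrite Normc.normcM normc_i normc_cis mulr1.
Qed.

Lemma compact_increasing (K : set R[i]) (U : nat -> set R[i]) :
  compact (K : set R[i]^o) -> (forall n, copen (U n)) ->
  (forall m n, (m <= n)%N -> U m `<=` U n) ->
  (forall z, K z -> exists n, U n z) -> exists n, K `<=` U n.
Proof.
rewrite compact_cover => cK oU incr KU.
have [D _ KD] := cK nat setT U (fun n _ => (copenP (U n)).1 (oU n))
  (fun z Kz => let: ex_intro n Un := KU z Kz in ex_intro2 _ _ n I Un).
exists (\max_(i <- finmap.enum_fset D) i)%N => z /KD[i iD Uz].
apply: incr Uz; exact: (leq_bigmax_seq (F := id)).
Qed.

Lemma compact_margin (K V : set R[i]) : compact (K : set R[i]^o) -> copen V -> K `<=` V ->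
  exists2 d : R, 0 < d & forall z w, K z -> normc (w - z) <= d -> V w.
Proof.
move=> cK oV KV.
pose U n := [set z | exists2 r : R, n.+1%:R^-1 < r & forall w, normc (w - z) < r -> V w].
have [|||n Kn] := @compact_increasing K U cK.
- move=> n z []; rewrite /U /=; set q := n.+1%:R^-1 => r nr rV.
  exists ((r - q) / 2); first by rewrite divr_gt0// subr_gt0.
  move=> w wz; exists ((r + q) / 2); first by lra.
  by move=> x xw; apply: rV; have := normc_dist w x z; lra.
- move=> m n mn z [r nr rV]; exists r => //; apply: le_lt_trans nr.
  by rewrite lef_pV2 ?posrE ?ltr0n// ler_nat.
- move=> z /KV/oV[r r0 rV]; exists (Num.truncn r^-1); exists r => //.
  by rewrite invf_plt ?posrE// truncnS_gt.
exists n.+1%:R^-1; first by rewrite invr_gt0 ltr0n.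
by move=> z w /Kn[r nr rV] wz; apply: rV; exact: le_lt_trans nr.
Qed.

End Lipschitz.

Section Exterior.
Context {R : realType}.
Variables (rho : R) (f : R[i] -> R[i]).
Implicit Types (z w : R[i]).
Hypotheses (hd : forall z, 1 < normc z < rho -> exists D : R[i], cdiff f z D)
  (hinj : forall z w, 1 < normc z < rho -> 1 < normc w < rho -> f z = f w -> z = w)
  (h1 : forall z, 1 < normc z < rho -> 1 < normc (f z))
  (hlim : forall e : R, 0 < e -> exists2 dl : R, 0 < dl &
    forall z, 1 < normc z < 1 + dl -> normc (f z) < 1 + e).

(** For a value [w] missed on the annulus, the maximum principle for 1/(f - w) bounds |f - w| below
    by its boundary values: at least m - |w| outside, and about |w| - 1 near the unit circle, where
    |f| -> 1. *)
Lemma image_gap (s m : R) w : 1 < s < rho -> (forall z, normc z = s -> m <= normc (f z)) ->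
  1 < normc w < m -> (forall z, 1 < normc z < s -> f z != w) ->
  forall z, 1 < normc z < s -> Num.min (normc w - 1) (m - normc w) <= normc (f z - w).
Proof.
move=> /andP[s1 sr] fm /andP[w1 wm] nw z /andP[z1 zs].
set eta := Num.min _ _; have eta0 : 0 < eta by rewrite lt_min !subr_gt0 w1.
have [eta1 eta2] : eta <= normc w - 1 /\ eta <= m - normc w.
  by rewrite /eta !ge_min !lexx orbT.
apply/ler_addgt0Pr => e e0.
pose e' := Num.min e (eta / 2); have e'0 : 0 < e' by rewrite lt_min e0 divr_gt0.
have [e'1 e'2] : e' <= e /\ e' <= eta / 2 by rewrite /e' !ge_min !lexx orbT.
have [dl dl0 near1] := hlim e'0.
pose a := Num.min (1 + dl / 2) ((1 + normc z) / 2).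
have [a1 a2] : a <= 1 + dl / 2 /\ a <= (1 + normc z) / 2 by rewrite /a !ge_min !lexx orbT.
have a3 : 1 < a by rewrite lt_min; apply/andP; split; lra.
have fw x : a <= normc x <= s -> f x - w != 0.
  move=> /andP[ax xs]; rewrite subr_eq0; move: xs; rewrite le_eqVlt => /predU1P[xs|xs].
    by apply: contraTneq (fm x xs) => ->; rewrite -ltNge.
  by apply: nw; rewrite xs (lt_le_trans a3).
have fw0 x : a <= normc x <= s -> 0 < normc (f x - w) by move=> /fw; rewrite normc_gt0.
have df x : a <= normc x <= s -> exists D, cdiff (fun x => (f x - w)^-1) x D.
  move=> xas; have [|D dD] := hd (z := x); first by case/andP: xas => /(lt_le_trans a3) -> /le_lt_trans ->.
  by eexists; apply: diffatV (diffatB dD (diffat_cst idfun w x)) (fw x xas); exact: idfun_inj.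
have e3 : 0 < eta - e' by lra.
have KF : forall x, [set z | a <= normc z <= s] x -> normc ((f x - w)^-1) <= (eta - e')^-1.
  have sub : [set z : R[i] | a < normc z < s] `<=` [set z | a <= normc z <= s].
    by move=> x /= /andP[? ?]; rewrite !ltW.
  have MP := @max_principle R _ _ (fun x => (f x - w)^-1) (eta - e')^-1
    (@compact_annulus R a s) (@copen_annulus R a s) sub; apply: MP => //.
  - by move=> x /df[D]; exact: diffat_cont.
  - by move=> x /= /andP[? ?]; apply: df; rewrite !ltW.
  - by rewrite invr_ge0 ltW.
  - move=> x /= xas nx; rewrite Normc.normcV lef_pV2 ?posrE ?fw0//.
    have := normc_rtri (f x) w; rewrite ler_norml => /andP[f1 f2].
    case/andP: xas => ax; rewrite le_eqVlt => /predU1P[xs|xs].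
      by have := fm x xs; lra.
    have xa : normc x = a.
      by apply/eqP; rewrite eq_le ax andbT leNgt; apply/negP => ax'; apply: nx; rewrite ax'.
    have := near1 x; rewrite xa => /(_ _) fx.
    have : normc (f x) < 1 + e' by apply: fx; apply/andP; split; lra.
    by lra.
have zas : a <= normc z <= s by apply/andP; split; lra.
have := KF z zas; rewrite Normc.normcV lef_pV2 ?posrE ?fw0//; lra.
Qed.

(** By [image_gap] a missed value keeps the distance [eta] from the attained ones. A path in polar
    coordinates from an attained value to [w] is cut into N pieces shorter than [eta], and
    attainment propagates along it. *)
Lemma ring_image (s m : R) w : 1 < s < rho -> 1 < m ->
  (forall z, normc z = s -> m <= normc (f z)) ->
  1 < normc w < m -> exists2 z, 1 < normc z < s & f z = w.
Proof.
move=> sr m1 fm wm; case/andP: (sr) => s1 s2; case/andP: (wm) => w1 w2.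
have [dl dl0 near1] : exists2 dl : R, 0 < dl &
    forall z, 1 < normc z < 1 + dl -> normc (f z) < m.
  have [|dl dl0 H] := hlim (e := m - 1); first by rewrite subr_gt0.
  by exists dl => // z /H; rewrite addrC subrK.
pose x0 := 1 + Num.min dl (s - 1) / 2.
have [x1 x2] : Num.min dl (s - 1) <= dl /\ Num.min dl (s - 1) <= s - 1.
  by rewrite !ge_min !lexx orbT.
have x3 : 0 < Num.min dl (s - 1) by rewrite lt_min dl0 subr_gt0.
pose z0 : R[i] := x0%:C%C.
have nz0 : normc z0 = x0 by rewrite normc_real ger0_norm// /x0; lra.
have z0s : 1 < normc z0 < s by rewrite nz0 /x0; apply/andP; split; lra.
have w01 : 1 < normc (f z0) by apply: h1; case/andP: z0s => -> /lt_trans; apply.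
have w02 : normc (f z0) < m by apply: near1; rewrite nz0 /x0; apply/andP; split; lra.
have [t0 E0] := cis_polar (f z0); have [t1 E1] := cis_polar w.
set r0 := normc (f z0) in w01 w02 E0; set r1 := normc w in w1 w2 E1.
pose rad x := r0 + x * (r1 - r0); pose ang x := t0 + x * (t1 - t0).
pose gam x := (rad x)%:C%C * cis (ang x).
pose C := `|r1 - r0| + m * `|t1 - t0| + 1.
(* Uniform gap: the moduli along the path stay between those of its two ends. *)
pose eta := Num.min (Num.min r0 r1 - 1) (m - Num.max r0 r1).
have eta0 : 0 < eta by rewrite lt_min !subr_gt0 lt_min gt_max w01 w02 w1 w2.
have C0 : 0 < C by rewrite ltr_wpDl// addr_ge0// mulr_ge0// ltW// (lt_trans ltr01).
have rad01 x : 0 <= x <= 1 -> Num.min r0 r1 <= rad x <= Num.max r0 r1.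
  move=> /andP[x0' x1']; have h1' : rad x = (1 - x) * r0 + x * r1 by rewrite /rad; ring.
  rewrite h1'; have y0 : 0 <= 1 - x by rewrite subr_ge0.
  have E y : y = (1 - x) * y + x * y by ring.
  rewrite {1}[Num.min _ _]E [X in _ && (_ <= X)]E.
  by rewrite !lerD// ler_wpM2l// ?ge_min ?le_max ?lexx ?orbT.
have radp x : 0 <= x <= 1 -> 0 < rad x.
  move=> /rad01/andP[h _]; apply: lt_le_trans h.
  by rewrite lt_min !(lt_trans ltr01).
have ngam x : 0 <= x <= 1 -> normc (gam x) = rad x.
  by move=> /radp x01; rewrite Normc.normcM normc_cis mulr1 normc_real gtr0_norm.
have radm x : 0 <= x <= 1 -> rad x <= m.
  by move=> /rad01/andP[_ /le_trans]; apply; rewrite ge_max !ltW.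
have lip x y : 0 <= x <= 1 -> 0 <= y <= 1 -> normc (gam x - gam y) <= C * `|x - y|.
  move=> x01 y01.
  have -> : gam x - gam y = (rad x - rad y)%:C%C * cis (ang x) +
      (rad y)%:C%C * (cis (ang x) - cis (ang y)) by rewrite /gam rmorphB; ring.
  apply: le_trans (le_normcD _ _) _; rewrite !Normc.normcM normc_cis !normc_real mulr1.
  have -> : rad x - rad y = (x - y) * (r1 - r0) by rewrite /rad; ring.
  rewrite normrM (gtr0_norm (radp _ y01)).
  have cl := cis_lipschitz (ang x) (ang y).
  have E : `|ang x - ang y| = `|x - y| * `|t1 - t0|.
    by rewrite -normrM; congr (`|_|); rewrite /ang; ring.
  rewrite E in cl.
  have := ler_pM (ltW (radp _ y01)) (normc_ge0 _) (radm _ y01) cl.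
  move=> h; have -> : C * `|x - y| = `|x - y| * `|r1 - r0| + m * (`|x - y| * `|t1 - t0|) + `|x - y|.
    by rewrite /C; ring.
  by rewrite -addrA lerD2l (le_trans h)// lerDl.
pose N := (Num.truncn (C / eta)).+1; have N0 : 0 < N%:R :> R by rewrite ltr0n.
have CN : C / N%:R < eta by rewrite ltr_pdivrMr// mulrC -ltr_pdivrMr// truncnS_gt.
have kN k : (k <= N)%N -> 0 <= (k%:R / N%:R : R) <= 1.
  by move=> kn; rewrite divr_ge0 ?ler0n//= ler_pdivrMr// mul1r ler_nat.
have prop k : (k <= N)%N -> exists2 z, 1 < normc z < s & f z = gam (k%:R / N%:R).
  elim: k => [_|k IH kn].
    by exists z0 => //; rewrite mul0r /gam /rad /ang !mul0r !addr0.
  have [z zs fz] := IH (ltnW kn).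
  apply: contrapT => nw; set y := k.+1%:R / N%:R in nw.
  have y01 := kN _ kn; have x01 := kN _ (ltnW kn).
  have /andP[y1 y2] := rad01 _ y01.
  have [e1 e2] : eta <= Num.min r0 r1 - 1 /\ eta <= m - Num.max r0 r1.
    by rewrite /eta !ge_min !lexx orbT.
  have := @image_gap s m (gam y) sr fm _ _ z zs.
  rewrite fz ngam// => H.
  have {}H : Num.min (rad y - 1) (m - rad y) <= normc (gam (k%:R / N%:R) - gam y).
    apply: H; first by rewrite (lt_le_trans _ y1) ?(le_lt_trans y2) ?lt_min ?gt_max ?w01 ?w02 ?w1 ?w2.
    by move=> x xs; apply/eqP => fx; apply: nw; exists x.
  have := lip _ _ x01 y01.
  have -> : `|k%:R / N%:R - y| = N%:R^-1.
    rewrite /y -mulrBl -natr1 opprD addrA subrr add0r mulN1r normrN.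
    by rewrite ger0_norm// invr_ge0.
  have : eta <= Num.min (rad y - 1) (m - rad y).
    by rewrite le_min (le_trans e1 (lerB y1 (lexx 1))) (le_trans e2 (lerB (lexx m) y2)).
  by move=> + le2; rewrite leNgt (le_lt_trans H (le_lt_trans le2 CN)).
have [z zs fz] := prop N (leqnn N); exists z => //.
rewrite fz divff ?gt_eqF// /gam /rad /ang !mul1r.
by rewrite [r0 + _]addrC subrK [t0 + _]addrC subrK -E1.
Qed.

Definition Om (s : R) : set R[i] :=
  [set w | normc w <= 1 \/ exists2 z, 1 < normc z < s & f z = w].

(** For 1 < s < rho this is compact and lies in every larger [Om], which provides the room for
    smearing. *)
Definition Ks (s : R) : set R[i] :=
  [set w | Om s w \/ exists2 z, normc z = s & f z = w].

Lemma Om_mono (r s : R) : r <= s -> Om r `<=` Om s.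
Proof.
move=> rs w [w1|[z /andP[z1 zr] fz]]; [by left|right; exists z => //].
by rewrite z1 (lt_le_trans zr).
Qed.

Lemma Ks_Om (r s : R) : 1 < r -> r < s -> Ks r `<=` Om s.
Proof.
move=> r1 rs w [/(Om_mono (ltW rs))//|[z zr fz]]; right; exists z => //.
by rewrite zr r1.
Qed.

Lemma circle_min (s : R) : 1 < s < rho ->
  exists2 m : R, 1 < m & forall z, normc z = s -> m <= normc (f z).
Proof.
move=> sr; have [s1 s2] := andP sr.
have ns : normc (s%:C%C : R[i]) = s by rewrite normc_real gtr0_norm// (lt_trans ltr01).
have [|z|c cs cmin] := @compact_normc_min R _ f s%:C%C (@compact_annulus R s s).
- by rewrite /= ns lexx.
- rewrite /= -eq_le => /eqP zs; have [|D] := hd (z := z); first by rewrite -zs.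
  exact: diffat_cont.
have {}cs : normc c = s by apply/esym/eqP; rewrite eq_le.
exists (normc (f c)); first by apply: h1; rewrite cs.
by move=> z zs; apply: cmin; rewrite /= zs lexx.
Qed.

Lemma image_bounded (s : R) : 1 < s < rho ->
  exists2 B : R, 0 < B & forall z, 1 < normc z <= s -> normc (f z) <= B.
Proof.
move=> sr; have [s1 s2] := andP sr.
have ns : normc (s%:C%C : R[i]) = s by rewrite normc_real gtr0_norm// (lt_trans ltr01).
have [dl dl0 near1] := hlim ltr01; pose a := Num.min (1 + dl / 2) s.
have [a1 a2] : a <= 1 + dl / 2 /\ a <= s by rewrite /a !ge_min !lexx orbT.
have a3 : 1 < a by rewrite lt_min s1 andbT; lra.
have [|z|c cs cmax] := @compact_normc_max R _ f s%:C%C (@compact_annulus R a s).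
- by rewrite /= ns lexx a2.
- move=> /= /andP[az zs]; have [|D] := hd (z := z); last exact: diffat_cont.
  by rewrite (lt_le_trans a3 az) (le_lt_trans zs).
exists (Num.max 2 (normc (f c))); first by rewrite lt_max ltr0n.
move=> z /andP[z1 zs]; rewrite le_max; have [az|za] := leP a (normc z).
  by rewrite cmax ?orbT//= az.
have : normc (f z) < 1 + 1 by apply: near1; rewrite z1 /=; lra.
by move=> /ltW ->.
Qed.

(** The open mapping argument does not reach the unit circle; [ring_image] puts the whole disk of
    radius m > 1 inside [Om s]. *)
Lemma Om_open (s : R) : 1 < s < rho -> copen (Om s).
Proof.
move=> sr w; have [s1 s2] := andP sr; have [m m1 fm] := circle_min sr.
have inner x : normc x < m -> Om s x.
  move=> xm; have [x1|x1] := leP (normc x) 1; [by left|right].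
  by apply: (ring_image sr m1 fm); rewrite x1.
have [wm _|mw] := ltP (normc w) m.
  exists (m - normc w); first by rewrite subr_gt0.
  move=> x xw; apply: inner.
  by have := normc_rtri x w; rewrite ler_norml => /andP[_]; lra.
case=> [w1|[z /andP[z1 zs] fz]]; first by lra.
pose r := Num.min (normc z - 1) (s - normc z) / 2.
have [r1 r2] : 2 * r <= normc z - 1 /\ 2 * r <= s - normc z.
  by rewrite /r mulrC divfK// !ge_min !lexx orbT.
have r0 : 0 < r by rewrite divr_gt0// lt_min !subr_gt0 z1.
have nz x : normc (x - z) <= r -> 1 < normc x < s.
  move=> xz; have := normc_rtri x z; rewrite ler_norml => /andP[? ?].
  by apply/andP; split; lra.
have nzr x : normc (x - z) <= r -> 1 < normc x < rho.
  by move=> /nz/andP[-> /lt_trans]; apply.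
have zr : 1 < normc z < rho by rewrite z1 (lt_trans zs).
have [x /nzr/hd//|x /nzr xr fx|mu mu0 H] := @injective_open R f z r r0.
  exact: hinj fx.
exists mu => // x; rewrite -fz => /H[y yz fy]; right; exists y => //.
by apply: nz; exact: ltW.
Qed.

(** Around a point w outside, values near the unit circle stay away because |f| is close to 1 < |w|
    there, and on the remaining compact annulus |f - w| has a positive minimum. *)
Lemma Ks_compact (s : R) : 1 < s < rho -> compact (Ks s : set R[i]^o).
Proof.
move=> sr; have [s1 s2] := andP sr; have [B B0 fB] := image_bounded sr.
have ns : normc (s%:C%C : R[i]) = s by rewrite normc_real gtr0_norm// (lt_trans ltr01).
apply: (@closed_bounded_compact _ _ (Num.max 1 B)); last first.
  move=> w [[w1|[z /andP[z1 zs] <-]]|[z zs <-]]; rewrite le_max; first by rewrite w1.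
    by rewrite fB ?orbT// z1 ltW.
  by rewrite fB ?orbT// zs s1 lexx.
move=> w nw.
have w1 : 1 < normc w by rewrite ltNge; apply/negP => w1; apply: nw; left; left.
have fw z : 1 < normc z <= s -> f z - w != 0.
  move=> /andP[z1 zs]; rewrite subr_eq0; apply/eqP => fz; apply: nw.
  move: zs; rewrite le_eqVlt => /predU1P[zs|zs]; first by right; exists z.
  by left; right; exists z; rewrite ?z1.
have [|dl dl0 near1] := hlim (e := (normc w - 1) / 2); first by rewrite divr_gt0// subr_gt0.
pose a := Num.min (1 + dl / 2) s.
have [a1 a2] : a <= 1 + dl / 2 /\ a <= s by rewrite /a !ge_min !lexx orbT.
have a3 : 1 < a by rewrite lt_min s1 andbT; lra.
have [|z|c /andP[ca cs] cmin] :=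
  @compact_normc_min R _ (fun z => f z - w) s%:C%C (@compact_annulus R a s).
- by rewrite /= ns lexx a2.
- move=> /= /andP[az zs]; have [|D dD] := hd (z := z).
    by rewrite (lt_le_trans a3 az) (le_lt_trans zs).
  by apply: contatB; [exact: diffat_cont dD|exact: contat_cst].
have c0 : 0 < normc (f c - w) by rewrite normc_gt0 fw// (lt_le_trans a3 ca).
exists (Num.min (normc (f c - w)) ((normc w - 1) / 2)).
  by rewrite lt_min c0 divr_gt0// subr_gt0.
move=> x; rewrite lt_min => /andP[x1 x2].
have xw := normc_rtri x w; rewrite ler_norml in xw; case/andP: xw => x3 x4.
have far z : 1 < normc z <= s -> f z <> x.
  move=> /andP[z1 zs] fz; have [az|za] := leP a (normc z).
    by have := cmin z; rewrite /= az zs fz => /(_ isT); lra.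
  have := near1 z; rewrite z1 fz => /(_ _) H.
  have : normc x < 1 + (normc w - 1) / 2 by apply: H; lra.
  by lra.
case=> [[xle|[z /andP[z1 zs]]]|[z zs]]; first by lra.
- by apply: far; rewrite z1 ltW.
- by apply: far; rewrite zs s1 lexx.
Qed.

(** [Om s] is the increasing union of the open sets [Om (u n)], with u n -> s and every u n above
    max(1, r). *)
Lemma Om_exhaust (K : set R[i]) (r s : R) : compact (K : set R[i]^o) -> 1 < s < rho ->
  r < s -> K `<=` Om s -> exists s', [/\ 1 < s', r < s', s' < s & K `<=` Om s'].
Proof.
move=> cK /andP[s1 s2] rs Ks; pose t := Num.max 1 r.
have [t1 t2] : 1 <= t /\ r <= t by rewrite /t !le_max !lexx orbT.
have ts : t < s by rewrite gt_max s1.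
pose u n := s - (s - t) / n.+2%:R.
have n2 n : 0 < n.+2%:R :> R by rewrite ltr0n.
have us n : t < u n < s.
  rewrite /u ltrBlDr ltrDl divr_gt0 ?subr_gt0// andbT ltrBrDr -ltrBrDl.
  by rewrite ltr_pdivrMr// ltr_pMr ?subr_gt0// ltr1n.
have [|||n Kn] := @compact_increasing R K (fun n => Om (u n)) cK.
- move=> n; apply: Om_open; have /andP[? ?] := us n; apply/andP; split; lra.
- move=> m n mn; apply: Om_mono; rewrite /u lerB// ler_pM2l ?subr_gt0//.
  by rewrite lef_pV2 ?posrE// ler_nat !ltnS.
- move=> z /Ks[z1|[x /andP[x1 xs] fx]]; first by exists 0%N; left.
  exists (Num.truncn ((s - t) / (s - normc x))); right; exists x => //; rewrite x1 /=.
  have sx : 0 < s - normc x by rewrite subr_gt0.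
  rewrite /u ltrBrDr addrC -ltrBrDr ltr_pdivrMr// mulrC -ltr_pdivrMr//.
  by apply: lt_trans (truncnS_gt _) _; rewrite ltr_nat.
have /andP[? ?] := us n.
by exists (u n); split => //; lra.
Qed.

(* Polynomial products of distances to the remaining points are maximal on f(|z| = s). *)
Lemma Om_max (s M : R) (G : R[i] -> R[i]) : 1 < s < rho ->
  (forall w, exists D : R[i], cdiff G w D) -> 0 <= M ->
  (forall z, normc z = s -> normc (G (f z)) <= M) -> forall w, Om s w -> normc (G w) <= M.
Proof.
move=> sr dG M0 GM w Ow; have [s1 s2] := andP sr.
have sub : Om s `<=` Ks s by left.
apply: (@max_principle R _ _ G M (Ks_compact sr) (Om_open sr) sub) => //; last by left.
- by move=> z _; have [D] := dG z; exact: diffat_cont.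
- by move=> z [/[swap]//|[x xs <-] _]; exact: GM.
Qed.

Lemma Ks_margin (r s : R) : 1 < r -> r < s -> s < rho -> exists2 d : R, 0 < d &
  exists K, [/\ compact (K : set R[i]^o), K `<=` Om s &
    forall z t, Ks r z -> K (z + d%:C%C * cis t)].
Proof.
move=> r1 rs sr; pose s' := (r + s) / 2.
have rr : 1 < r < rho by apply/andP; split; lra.
have rs' : 1 < s' < rho by rewrite /s'; apply/andP; split; lra.
have [|d d0 H] := compact_margin (Ks_compact rr) (Om_open rs').
  by apply: Ks_Om => //; rewrite /s'; lra.
exists d => //; exists (Ks s'); split; first exact: Ks_compact.
  by apply: Ks_Om; rewrite /s'; lra.
move=> z t Kz; left; apply: H Kz _.
by rewrite addrAC subrr add0r Normc.normcM normc_cis mulr1 normc_real gtr0_norm.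
Qed.

End Exterior.

Section VdmCoordinates.
Context {R : realType}.

Definition upd n (y : 'I_n -> R[i]) k w : 'I_n -> R[i] := fun i => if i == k then w else y i.

Lemma vdm_split n (y : 'I_n -> R[i]) k :
  vdm y = (\prod_(i | i != k) \prod_(j | (j != i) && (j != k)) normc (y i - y j)) *
    normc (\prod_(j | j != k) (y k - y j)) ^+ 2.
Proof.
rewrite /vdm (bigD1 k)//= normc_prod expr2 mulrA mulrC; congr (_ * _).
rewrite -big_split; apply: eq_bigr => i ik /=.
by rewrite (bigD1 k) 1?eq_sym//= mulrC normcB.
Qed.

Lemma vdm_upd n (y : 'I_n -> R[i]) k w :
  vdm (upd y k w) = (\prod_(i | i != k) \prod_(j | (j != i) && (j != k)) normc (y i - y j)) *
    normc (\prod_(j | j != k) (w - y j)) ^+ 2.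
Proof.
rewrite (vdm_split _ k); congr (_ * normc _ ^+ 2).
  apply: eq_bigr => i ik; apply: eq_bigr => j /andP[_ jk].
  by rewrite /upd (negbTE ik) (negbTE jk).
by apply: eq_bigr => j jk; rewrite /upd eqxx (negbTE jk).
Qed.

Lemma cdiff_prod (I : Type) (r : seq I) (P : pred I) (F : I -> R[i] -> R[i]) z :
  (forall i, P i -> exists D, cdiff (F i) z D) ->
  exists D, cdiff (fun w => \prod_(i <- r | P i) F i w) z D.
Proof.
move=> dF; elim: r => [|i r [D IH]].
  exists 0; have := diffat_cst idfun (1 : R[i]) z.
  move/(diffat_near idfun_inj); apply.
  by exists 1 => // w _; rewrite big_nil.
have [Pi|nPi] := boolP (P i).
  have [D' dFi] := dF i Pi; exists (D' * \prod_(i <- r | P i) F i z + F i z * D).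
  move/(diffat_near idfun_inj): (diffatM dFi IH); apply.
  by exists 1 => // w _; rewrite big_cons Pi.
exists D; move/(diffat_near idfun_inj): IH; apply.
by exists 1 => // w _; rewrite big_cons (negbTE nPi).
Qed.

End VdmCoordinates.

(** * Logarithmic convexity of the capacity *)

Section Convexity.
Context {R : realType}.
Variables (rho : R) (f : R[i] -> R[i]).
Implicit Types (z w : R[i]).
Hypotheses (hd : forall z, 1 < normc z < rho -> exists D : R[i], cdiff f z D)
  (hinj : forall z w, 1 < normc z < rho -> 1 < normc w < rho -> f z = f w -> z = w)
  (h1 : forall z, 1 < normc z < rho -> 1 < normc (f z))
  (hlim : forall e : R, 0 < e -> exists2 dl : R, 0 < dl &
    forall z, 1 < normc z < 1 + dl -> normc (f z) < 1 + e).

Definition lcap (E : set R[i]) : R := ln (fine (Cap E)).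

Lemma CapE (E : set R[i]) (B : R) : 0 < B -> [set z | normc z <= 1] `<=` E ->
  (forall z, E z -> normc z <= B) -> Cap E = (expR (lcap E))%:E.
Proof.
move=> B0 DE EB.
have le := Cap_le B0 EB.
have ge : (1%:E <= Cap E)%E.
  apply: (@Cap_gt0 _ _ [set z | normc z <= 1] 0) => //; first exact: compact_disk.
  by move=> t; rewrite /= add0r Normc.normcM normc_cis mulr1 normc_real normr1.
rewrite /lcap; move: le ge; case: (Cap E) => [x| |]//=; rewrite !lee_fin => _ x1.
by rewrite lnK// posrE (lt_le_trans ltr01).
Qed.

Lemma CapOmE (s : R) : 1 < s < rho -> Cap (Om f s) = (expR (lcap (Om f s)))%:E.
Proof.
move=> sr; have [B B0 fB] := image_bounded hd hlim sr.
apply: (@CapE _ (Num.max 1 B)); first by rewrite lt_max ltr01.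
  by move=> z z1; left.
move=> w [w1|[z /andP[z1 zs] <-]]; rewrite le_max ?w1//.
by rewrite fB ?orbT// z1 ltW.
Qed.

(** As a function of one point, [vdm] is a constant times the squared modulus of a polynomial; by
    [Om_max] that point can be moved to the image of the circle without loss. The points are treated
    one after the other. *)
Lemma push_boundary n (z : 'I_n -> R[i]) (s : R) : 1 < s < rho -> (forall i, Om f s (z i)) ->
  exists zeta : 'I_n -> R[i], (forall i, normc (zeta i) = s) /\
    vdm z <= vdm (fun i => f (zeta i)).
Proof.
move=> sr zO; have [s1 s2] := andP sr.
have ns : normc (s%:C%C : R[i]) = s by rewrite normc_real gtr0_norm// (lt_trans ltr01).
pose ok (k : nat) (y : 'I_n -> R[i]) := forall i : 'I_n, if (i < k)%N then
  exists2 x, normc x = s & f x = y i else Om f s (y i).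
suff step k : (k <= n)%N -> exists y, ok k y /\ vdm z <= vdm y.
  have [y [oky zy]] := step n (leqnn n).
  have /choice[zeta H] : forall i, exists x, normc x = s /\ f x = y i.
    by move=> i; have := oky i; rewrite ltn_ord => -[x]; exists x.
  exists zeta; split=> [i|]; first exact: (H i).1.
  have -> : (fun i => f (zeta i)) = y by apply/funext => i; exact: (H i).2.
  exact: zy.
elim: k => [_|k IH kn]; first by exists z; split => // i.
have [y [oky zy]] := IH (ltnW kn); pose k' := Ordinal kn.
pose G w := \prod_(j | j != k') (w - y j).
have dG w : exists D, cdiff G w D.
  apply: cdiff_prod => j _; exists (1 - 0).
  exact: diffatB (cdiff_id w) (diffat_cst idfun (y j) w).
have [|x|c /andP[c1 c2] cmax] :=
  @compact_normc_max R _ (fun x => G (f x)) s%:C%C (@compact_annulus R s s).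
- by rewrite /= ns lexx.
- rewrite /= -eq_le => /eqP xs; have [|D dD] := hd (z := x); first by rewrite -xs.
  have [D' dD'] := dG (f x).
  exact: contat_comp (diffat_cont dD') (diffat_cont dD).
have cs : normc c = s by apply/eqP; rewrite eq_le c1 c2.
exists (upd y k' (f c)); split=> [i|].
  rewrite /upd; have [->|ik] := eqVneq i k'; first by rewrite /= ltnS leqnn; exists c.
  have -> : (i < k.+1)%N = (i < k)%N by rewrite ltnS leq_eqVlt -[_ == k]/(i == k') (negbTE ik).
  exact: oky.
have Ok : Om f s (y k') by have := oky k'; rewrite ltnn.
apply: le_trans zy _; rewrite (vdm_split y k') vdm_upd.
apply: ler_wpM2l; first by do 2!apply: prodr_ge0 => ? _; exact: normc_ge0.
rewrite lerXn2r ?nnegrE ?normc_ge0//.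
apply: (Om_max hd hinj h1 hlim sr dG) Ok; first exact: normc_ge0.
by move=> x xs; apply: cmax; rewrite /= xs lexx.
Qed.

(** Boundary points f(zeta_i) are moved together to f(w zeta_i / c): the product of all differences
    is one holomorphic function of w, to which the three circles theorem applies. On the outer two
    circles [vdm] is bounded by capacity, with an error linear in n. *)
Lemma lcap_convex (a x b : R) : 0 < a -> a <= x <= b -> a < b -> expR b < rho ->
  (b - a) * lcap (Om f (expR x)) <=
  (b - x) * lcap (Om f (expR a)) + (x - a) * lcap (Om f (expR b)).
Proof.
move=> a0 /andP[ax xb] ab br.
have rng t : 0 < t -> t <= b -> 1 < expR t < rho.
  by move=> t0 tb; rewrite expR_gt1 t0 (le_lt_trans _ br)// ler_expR.
have ba0 : 0 < b - a by rewrite subr_gt0.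
rewrite -ler_pdivlMl//; apply/ler_addgt0Pr => e e0; rewrite -lerBlDr.
set l := _ - e; set T := _^-1 * _.
have x0 : 0 < x by lra.
have xr := rng x x0 xb.
have : ((expR l)%:E < Cap (Om f (expR x)))%E.
  by rewrite CapOmE// lte_fin ltr_expR /l gtrBl.
move=> /Cap_has_points[K [cK KO pts]].
(* The condition c > exp(x - a) makes a' = a - (x - y) positive, so that the inner circle stays in
   the domain of [f]. *)
have [|c [c1 ac cx Kc]] := Om_exhaust hd hinj h1 hlim cK xr (r := expR (x - a)) _ KO.
  by rewrite ltr_expR gtrBl.
pose y := ln c; have cE : c = expR y by rewrite lnK// posrE (lt_trans ltr01).
have y0 : 0 < y by rewrite ln_gt0.
have yx : y < x by rewrite -ltr_expR -cE.
have yxa : x - a < y by rewrite -ltr_expR -cE.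
(* The points lie on |z| = exp y with y < x. Shifting a and b by the same amount keeps the
   interpolation weights and leaves room for smearing inside [Om] at exp a and exp b. *)
pose d := x - y; pose a' := a - d; pose b' := b - d.
have a'0 : 0 < a' by rewrite /a' /d; lra.
have cr : 1 < c < rho by rewrite c1 (lt_trans cx)//; case/andP: xr.
have [||| da da0 [Ka [cKa KaO KaM]]] := Ks_margin hd hinj h1 hlim (r := expR a') (s := expR a).
- by rewrite expR_gt1.
- by rewrite ltr_expR /a' /d; lra.
- by have /andP[] := rng a a0 (ltW ab).
have b0 : 0 < b by lra.
have [||| db db0 [Kb [cKb KbO KbM]]] := Ks_margin hd hinj h1 hlim (r := expR b') (s := expR b).
- by rewrite expR_gt1 /b' /d; lra.
- by rewrite ltr_expR /b' /d; lra.
- by have /andP[] := rng b b0 (lexx b).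
have bound n (t t' dt : R) Kt (q : 'I_n.+1 -> R[i]) : 0 < t -> t <= b -> 0 < dt ->
    compact (Kt : set R[i]^o) -> Kt `<=` Om f (expR t) ->
    (forall z s, Ks f (expR t') z -> Kt (z + dt%:C%C * cis s)) ->
    (forall i, normc (q i) = expR t') ->
    vdm (fun i => f (q i)) <= expR (n.+1%:R ^+ 2 * lcap (Om f (expR t)) - n.+1%:R * ln dt).
  move=> t0 tb dt0 cKt KtO KtM qt; set v := vdm _.
  have [v0|v0] := leP v 0; first by rewrite (le_trans v0)// expR_ge0.
  have := vdm_Cap dt0 cKt KtO _ v0; rewrite CapOmE ?rng// lee_fin ler_expR => H.
  have {}H := H (fun i s => KtM _ s (or_intror (ex_intro2 _ _ (q i) (qt i) erefl))).
  rewrite -[leLHS]lnK// ler_expR.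
  rewrite ler_pdivrMr ?exprn_gt0 ?ltr0n// -/v in H; move: H.
  set N := n.+1%:R ^+ 2; set M := n.+1%:R * ln dt; lra.
pose Ca := lcap (Om f (expR a)); pose Cb := lcap (Om f (expR b)).
pose D := (b - a)^-1 * ((b - x) * ln da + (x - a) * ln db).
(* The three-circles inequality for n + 1 points, divided by n + 1; its right side does not depend
   on n, which forces l <= T. *)
have key n : n.+1%:R * (l - T) <= l - D.
  have [z [zK zl]] := pts n.+1.
  have [zeta [zc zv]] := push_boundary cr (fun i => Kc _ (zK i)).
  pose u i := zeta i / c%:C%C.
  have c0 : 0 < c by rewrite (lt_trans ltr01).
  have nc : normc (c%:C%C : R[i]) = c by rewrite normc_real gtr0_norm.
  have cn0 : c%:C%C != 0 :> R[i] by rewrite -normc_gt0 nc.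
  have nu i : normc (u i) = 1 by rewrite normcf_div zc nc divff// gt_eqF.
  pose F w := \prod_i \prod_(j | j != i) (f (w * u i) - f (w * u j)).
  have FE w : normc (F w) = vdm (fun i => f (w * u i)).
    by rewrite normc_prod; apply: eq_bigr => i _; rewrite normc_prod.
  have dF w : expR a' <= normc w <= expR b' -> exists D, cdiff F w D.
    move=> /andP[w1 w2]; apply: cdiff_prod => i _; apply: cdiff_prod => j _.
    have df k : exists D, cdiff (fun w => f (w * u k)) w D.
      have [|E dE] := hd (z := w * u k).
        rewrite Normc.normcM nu mulr1 (lt_le_trans _ w1) ?expR_gt1//.
        by rewrite (le_lt_trans w2)// (le_lt_trans _ br)// ler_expR /b' /d; lra.
      have dwu := diffatM (cdiff_id w) (diffat_cst idfun (u k) w).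
      eexists; exact: (@diffat_chain _ _ idfun f (fun w => w * u k) w _ _ dE dwu).
    by have [D1 d1] := df i; have [D2 d2] := df j; exists (D1 - D2); exact: diffatB.
  have := @three_circles R F a' b' _ _ _ dF _ _ c%:C%C y.
  move=> /(_ (n.+1%:R ^+ 2 * Ca - n.+1%:R * ln da) (n.+1%:R ^+ 2 * Cb - n.+1%:R * ln db)).
  have -> : a' < b' by rewrite /a' /b'; lra.
  move=> /(_ isT) H.
  have {}H : normc (F c%:C%C) <= expR (((b' - y) * (n.+1%:R ^+ 2 * Ca - n.+1%:R * ln da) +
      (y - a') * (n.+1%:R ^+ 2 * Cb - n.+1%:R * ln db)) / (b' - a')).
    apply: H; last by rewrite /a' /b' /d; apply/andP; split; lra.
    - move=> w wa; rewrite FE; apply: (bound n a a' da Ka) => //; first exact: ltW.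
      by move=> i; rewrite Normc.normcM nu mulr1.
    - move=> w wb; rewrite FE; apply: (bound n b b' db Kb) => //.
      by move=> i; rewrite Normc.normcM nu mulr1.
    - by rewrite nc.
  have := le_trans zl (le_trans zv _).
  have -> : vdm (fun i => f (zeta i)) = normc (F c%:C%C).
    by rewrite FE; apply: eq_bigr => i _; apply: eq_bigr => j _; rewrite /u ![c%:C%C * _]mulrC !divfK.
  move=> /(_ _ H); rewrite ler_expR.
  have -> : (n.+1 * n.+1.-1)%:R = n.+1%:R * (n.+1%:R - 1) :> R.
    by rewrite natrM -{4}addn1 natrD addrK.
  have -> : b' - y = b - x by rewrite /b' /d; ring.
  have -> : y - a' = x - a by rewrite /a' /d; ring.
  have -> : b' - a' = b - a by rewrite /a' /b'; ring.
  have N0 : 0 < n.+1%:R :> R by rewrite ltr0n.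
  have -> : ((b - x) * (n.+1%:R ^+ 2 * Ca - n.+1%:R * ln da) +
      (x - a) * (n.+1%:R ^+ 2 * Cb - n.+1%:R * ln db)) / (b - a) =
      n.+1%:R * (n.+1%:R * T - D).
    by rewrite /T /D -/Ca -/Cb; ring.
  have -> : l * (n.+1%:R * (n.+1%:R - 1)) = n.+1%:R * (n.+1%:R * l - l) by ring.
  rewrite ler_pM2l//; move: (n.+1%:R) => N; lra.
rewrite leNgt; apply/negP => Tl.
have lT0 : 0 < l - T by rewrite subr_gt0.
have := key (Num.truncn ((l - D) / (l - T))).
by rewrite -ler_pdivlMr// leNgt truncnS_gt.
Qed.

End Convexity.

(** * Derivative and inverse of an injective holomorphic function *)

Section InverseFunction.
Context {R : realType}.
Implicit Types (z w a : R[i]).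

Lemma cder_zero_const F z0 (r : R) : (forall z, normc (z - z0) < r -> cdiff F z 0) ->
  forall z, normc (z - z0) < r -> F z = F z0.
Proof.
move=> dF z zr; apply/eqP; rewrite -subr_eq0 -normc_eq0 eq_le normc_ge0 andbT.
pose g (t : R) := F (z0 + t%:C%C * (z - z0)).
have dg t : 0 <= t <= 1 -> pdiff g t 0.
  move=> /andP[t0 t1].
  have dt := diffatD (diffat_cst (real_complex R) z0 t)
    (diffatM (diffat_emb (real_complex R) t) (diffat_cst (real_complex R) (z - z0) t)).
  have dFt : cdiff F (z0 + t%:C%C * (z - z0)) 0.
    apply: dF; rewrite addrAC subrr add0r Normc.normcM normc_real ger0_norm//.
    by apply: le_lt_trans zr; rewrite -[leRHS]mul1r ler_wpM2r// normc_ge0.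
  have := @diffat_chain _ _ (real_complex R) F _ t _ _ dFt dt.
  by rewrite mul0r.
have g1 : g 1 = F z by rewrite /g mul1r addrC subrK.
have g0 : g 0 = F z0 by rewrite /g mul0r addr0.
have := @pdiff_normc_le _ g (fun=> 0) 0 1 0 ler01 dg.
by rewrite g1 g0 mul0r; apply => x _; rewrite Normc.normc0.
Qed.

Definition dquot (F : R[i] -> R[i]) a z :=
  if z == a then cder F a else (F z - F a) / (z - a).

Lemma dquotE F a z : z != a -> dquot F a z = (F z - F a) / (z - a).
Proof. by move=> /negbTE za; rewrite /dquot za. Qed.

Lemma dquot_mul F a z : dquot F a z * (z - a) = F z - F a.
Proof.
have [->|za] := eqVneq z a; first by rewrite !subrr mulr0.
by rewrite dquotE// divfK// subr_eq0.
Qed.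

Lemma holo_dquot V F a : copen V -> holo V F -> V a -> holo V (dquot F a).
Proof.
move=> oV hF Va.
have dG z : V z -> z != a -> exists D, cdiff (dquot F a) z D.
  move=> Vz za; have [D dD] := hF z Vz; have za0 : z - a != 0 by rewrite subr_eq0.
  have dq := diffatM (diffatB dD (diffat_cst idfun (F a) z))
    (diffatV idfun_inj (diffatB (cdiff_id z) (diffat_cst idfun a z)) za0).
  eexists; apply: (diffat_near idfun_inj dq).
  exists (normc (z - a)); first by rewrite normc_gt0 subr_eq0.
  by move=> w wz; rewrite dquotE//; apply: contraTneq wz => ->; rewrite normcB ltxx.
apply: (removable (q := a)) => // z Vz; have [->|za] := eqVneq z a; last first.
  by have [D] := dG z Vz za; exact: diffat_cont.
have [phi [cphi phi0 fE]] := cderP (hF a Va).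
move=> eps /cphi[dl dl0 H]; exists dl => // w wa.
have [->|wa'] := eqVneq w a.
  by rewrite subrr Normc.normc0; move: (H 0); rewrite subrr Normc.normc0 subrr Normc.normc0; apply.
have := H (w - a); rewrite subr0 => /(_ wa).
rewrite {2}/dquot eqxx -phi0 dquotE//.
have -> : (F w - F a) / (w - a) = phi (w - a).
  have wE : a + (w - a) = w by ring.
  by rewrite -{1}wE fE [F a + _]addrC addrK mulfK// subr_eq0.
by [].
Qed.

Variables (U : set R[i]) (f : R[i] -> R[i]).
Hypotheses (oU : copen U) (df : holo U f)
  (inj : forall z w, U z -> U w -> f z = f w -> z = w).

(* If f'(z0) = 0, then (f z - f a) / (z - a) has no zero in a disk about z0, so that by the
   minimum principle its value at z0 cannot tend to f'(z0) = 0 when a tends to z0. *)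
Lemma injective_cder_neq0 z0 : U z0 -> cder f z0 != 0.
Proof.
move=> Uz0; apply/eqP => f0.
have [r0 r00 rU] := oU Uz0; pose r := r0 / 2; have r_gt0 : 0 < r by rewrite divr_gt0.
have rr : r < r0 by rewrite /r; lra.
pose K := [set z | normc (z - z0) <= r]; pose V := [set z | normc (z - z0) < r].
have KU z : K z -> U z by move=> zr; apply: rU; exact: le_lt_trans rr.
have VK : V `<=` K by move=> z; exact: ltW.
have cK : compact (K : set R[i]^o) by exact: compact_cball.
have oV : copen V by exact: copen_ball.
pose S := [set z | normc (z - z0) = r].
have cS : compact (S : set R[i]^o) by exact: compact_sphere.
have SK : S `<=` K by move=> z zr; rewrite /K /= zr.
have Sr : S (z0 + r%:C%C) by rewrite /S /= addrAC subrr add0r normc_real gtr0_norm.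
have cf z : U z -> ccont f z by exact: holo_cont df.
have [|c Sc cmin] := @compact_normc_min R S (fun z => f z - f z0) _ cS Sr.
  by move=> z /SK/KU/cf cz; apply: contatB cz (contat_cst _ _ _).
pose m := normc (f c - f z0).
have m0 : 0 < m.
  rewrite normc_gt0 subr_eq0; apply/eqP => /(inj (KU _ (SK _ Sc)) Uz0) cz.
  by move: Sc r_gt0; rewrite /S /= cz subrr Normc.normc0 => <-; rewrite ltxx.
(* The minimum principle below yields |G z0| >= m / (4 r), and [e] is half of that. *)
pose e := m / (4 * r) / 2.
have e0 : 0 < e by rewrite !divr_gt0// mulr_gt0.
have dz0 : cdiff f z0 0 by rewrite -f0; apply: cderP; exact: df.
have [d1 d10 H1] := diffat_eps dz0 e0.
have [d2 d20 H2] := cf z0 Uz0 _ (divr_gt0 m0 (ltr0n _ 2)).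
pose d := Num.min (Num.min d1 d2) r.
have d0 : 0 < d by rewrite !lt_min d10 d20.
have [dd1 [dd2 dr]] : d <= d1 /\ d <= d2 /\ d <= r.
  by rewrite /d !ge_min !lexx !orbT.
(* If f' vanished near z0, f would be constant there. The quotient [G] centered at [a] takes the
   value f'(a) at [a], so it has no zero. *)
have [a ad fa0] : exists2 a, normc (a - z0) < d & cder f a != 0.
  apply: contrapT => na.
  have zero z : normc (z - z0) < d -> cdiff f z 0.
    move=> zd; have -> : 0 = cder f z.
      by apply/esym/eqP; apply: contrapT => /negP fz; apply: na; exists z.
    by apply: cderP; apply: df; apply: KU; rewrite /K /=; lra.
  have n2 : normc ((d / 2)%:C%C : R[i]) = d / 2 by rewrite normc_real gtr0_norm ?divr_gt0.
  have := cder_zero_const zero (z := z0 + (d / 2)%:C%C).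
  rewrite addrAC subrr add0r n2 => /(_ _) E.
  have /inj H : f (z0 + (d / 2)%:C%C) = f z0 by apply: E; lra.
  have Uz : U (z0 + (d / 2)%:C%C).
    by apply: KU; rewrite /K /= addrAC subrr add0r n2; lra.
  have := H Uz Uz0 => /(congr1 (fun z => normc (z - z0))).
  by rewrite addrAC subrr add0r n2 Normc.normc0; lra.
have az0 : a != z0 by apply: contraNneq fa0 => ->; rewrite f0.
have Va : V a by rewrite /V /=; lra.
have Ua : U a by apply/KU/VK.
pose G := dquot f a.
have Gz z : z != a -> G z = (f z - f a) / (z - a) by exact: dquotE.
have G0 z : U z -> G z != 0.
  move=> Uz; have [->|za] := eqVneq z a; first by rewrite /G /dquot eqxx.
  rewrite Gz// mulf_neq0// ?invr_eq0 subr_eq0//; apply: contraNneq za => fza.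
  by apply/eqP; exact: inj fza.
have hG : holo U G by exact: holo_dquot.
have cG z : U z -> ccont G z by exact: holo_cont.
have MP : forall z, K z -> normc (G z)^-1 <= 4 * r / m.
  apply: (@max_principle R _ _ (fun z => (G z)^-1) _ cK oV VK).
  - by move=> z /KU Uz; apply: contatV (cG z Uz) (G0 z Uz).
  - move=> z /VK/KU Uz; have [D dD] := hG z Uz.
    by eexists; exact: diffatV idfun_inj dD (G0 z Uz).
  - by rewrite divr_ge0 ?mulr_ge0 ?ltW.
  move=> z Kz nVz; have zr : normc (z - z0) = r by apply/eqP; rewrite eq_le Kz leNgt; apply/negP.
  have za : z != a by apply: contra_not_neq nVz => ->.
  rewrite Normc.normcV Gz// normcf_div invf_div.
  have f1 := cmin z zr; rewrite -/m in f1.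
  have f2 : normc (f a - f z0) < m / 2 by apply: H2; lra.
  have f3 := normc_dist (f a) (f z) (f z0).
  have f4 := normc_dist z0 z a; rewrite zr [normc (z0 - a)]normcB in f4.
  have f5 : m / 2 <= normc (f z - f a) by lra.
  rewrite ler_pdivrMr; last by apply: lt_le_trans f5; rewrite divr_gt0.
  rewrite mulrAC ler_pdivlMr//.
  have := ler_wpM2l (ltW r_gt0) f5; nra.
have Kz0 : K z0 by rewrite /K /= subrr Normc.normc0 ltW.
have zz : z0 != a by rewrite eq_sym.
have := MP z0 Kz0; rewrite Normc.normcV Gz// normcf_div invf_div.
have zaE : z0 + (a - z0) = a by ring.
have := H1 (a - z0); rewrite zaE mul0r subr0 => /(_ _) H.
have {}H : normc (f a - f z0) <= e * normc (a - z0) by apply: H; lra.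
have f0' : 0 < normc (f z0 - f a).
  by rewrite normc_gt0 subr_eq0; apply: contraNneq zz => fza; apply/eqP; exact: inj fza.
rewrite ler_pdivrMr// mulrAC ler_pdivlMr// [normc (z0 - a)]normcB [normc (f z0 - _)]normcB.
have na : 0 < normc (a - z0) by rewrite normc_gt0 subr_eq0.
have : 4 * r * normc (f a - f z0) <= 4 * r * (e * normc (a - z0)).
  by rewrite ler_wpM2l// mulr_ge0// ltW.
have -> : 4 * r * (e * normc (a - z0)) = normc (a - z0) * m / 2.
  by rewrite /e; field; rewrite gt_eqF.
by have := mulr_gt0 na m0; lra.
Qed.

(** [injective_open] gives the continuity of [k]; its slope is then the inverse of the slope of [f],
    which is nonzero at the limit. *)
Lemma inverse_cdiff (k : R[i] -> R[i]) z0 : (forall z, U z -> k (f z) = z) -> U z0 ->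
  exists2 D, D != 0 & cdiff k (f z0) D.
Proof.
move=> kf Uz0; have D0 := injective_cder_neq0 Uz0.
have [phi [cphi phi0 fE]] := cderP (df Uz0).
set D := cder f z0 in D0 phi0; exists D^-1; first by rewrite invr_eq0.
have [r0 r00 rU] := oU Uz0.
have phiD0 : phi 0 != 0 by rewrite phi0.
have cV := contatV cphi phiD0.
have [d2 d20 H2] := contat_neq0 cphi phiD0.
apply: eps_diffat idfun_inj _ => e e0; have [d1 d10 H1] := cV e e0.
pose r := Num.min (Num.min d1 d2) r0 / 2.
have r_gt0 : 0 < r by rewrite divr_gt0// !lt_min d10 d20.
have [rd1 [rd2 rr0]] : r < d1 /\ r < d2 /\ r < r0.
  have : Num.min (Num.min d1 d2) r0 <= d1 /\ Num.min (Num.min d1 d2) r0 <= d2 /\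
    Num.min (Num.min d1 d2) r0 <= r0 by rewrite !ge_min !lexx !orbT.
  by move: r_gt0; rewrite /r; lra.
have [||mu mu0 H] := @injective_open R f z0 r r_gt0.
- by move=> z zr; apply: df; apply: rU; exact: le_lt_trans rr0.
- by move=> z zr; apply: inj => //; apply: rU; exact: le_lt_trans rr0.
exists mu => // h hmu; have [|z zr fz] := H (f z0 + h).
  by rewrite addrAC subrr add0r.
have Uz : U z by apply: rU; exact: lt_trans rr0.
rewrite -fz !kf//; have hE : h = phi (z - z0) * (z - z0).
  have := fE (z - z0); rewrite [z0 + _]addrC subrK fz => /(congr1 (fun x => x - f z0)).
  by rewrite [LHS]addrAC subrr add0r [RHS]addrAC subrr add0r.
have pz0 : phi (z - z0) != 0.
  rewrite -normc_gt0; apply: le_lt_trans (H2 _ _); first by rewrite divr_ge0 ?normc_ge0.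
  by rewrite subr0; apply: lt_trans rd2.
have -> : z - z0 - D^-1 * h = ((phi (z - z0))^-1 - D^-1) * h.
  by rewrite mulrBl; congr (_ - _); rewrite hE mulKf.
rewrite Normc.normcM ler_wpM2r ?normc_ge0// -phi0 ltW//.
by apply: H1; rewrite subr0; apply: lt_trans rd1.
Qed.

End InverseFunction.

(** * Logarithmic derivatives on circles *)

Section ComplexExponential.
Context {R : realType}.
Implicit Types (z w : R[i]).

Definition cexp z : R[i] := (expR (Re z))%:C%C * cis (Im z).

Lemma cexpD z w : cexp (z + w) = cexp z * cexp w.
Proof. by rewrite /cexp !raddfD /= expRD cisD rmorphM; ring. Qed.

Lemma normc_cexp z : normc (cexp z) = expR (Re z).
Proof. by rewrite Normc.normcM normc_cis mulr1 normc_real gtr0_norm ?expR_gt0. Qed.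

Lemma cexp_neq0 z : cexp z != 0.
Proof. by rewrite -normc_gt0 normc_cexp expR_gt0. Qed.

Lemma cexp_polar w : w != 0 -> exists t : R, w = cexp (ln (normc w) +i* t)%C.
Proof.
rewrite -normc_gt0 => w0; have [t wE] := cis_polar w.
by exists t; rewrite /cexp /= lnK.
Qed.

Lemma cis_period (t : R) : cis (t + 2 * pi) = cis t.
Proof.
have -> : t + 2 * pi = t + pi + pi by ring.
by rewrite !cis_pi opprK.
Qed.

Lemma cdiff_cexp z : cdiff cexp z (cexp z).
Proof.
have dE := pdiff_real (is_derive_expR (0 : R)); have dC := pdiff_cis (0 : R).
apply: eps_diffat idfun_inj _ => e e0.
(* The relative remainder is at most 6 e' |h|: e' |h| from each of [A] and [B], and 4 e' |h| from
   the product of the two increments. *)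
pose e' := Num.min 1 (e / (6 * expR (Re z))).
have ez := expR_gt0 (Re z).
have e'0 : 0 < e' by rewrite lt_min ltr01 divr_gt0// mulr_gt0.
have [e'1 e'2] : e' <= 1 /\ e' <= e / (6 * expR (Re z)) by rewrite /e' !ge_min !lexx orbT.
have [d1 d10 H1] := diffat_eps dE e'0; have [d2 d20 H2] := diffat_eps dC e'0.
exists (Num.min (Num.min d1 d2) e'); first by rewrite lt_min e'0 andbT lt_min d10.
move=> h; rewrite lt_min => /andP[]; rewrite lt_min => /andP[h1 h2] h3.
have hx := normc_Re h; have hy := normc_Im h.
case: h h1 h2 h3 hx hy => x y h1 h2 h3 hx hy; rewrite /= in hx hy.
have := H1 x; rewrite normc_real => /(_ (le_lt_trans hx h1)).
rewrite !add0r expR0 rmorph1 mul1r => E1.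
have := H2 y; rewrite normc_real => /(_ (le_lt_trans hy h2)).
rewrite !add0r cis0 mulr1 => E2.
have -> : cexp (z + (x +i* y)%C) - cexp z - cexp z * (x +i* y)%C =
  cexp z * (((expR x)%:C%C - 1 - x%:C%C) + (cis y - 1 - 'i%C * y%:C%C)
    + ((expR x)%:C%C - 1) * (cis y - 1)).
  have -> : (x +i* y)%C = x%:C%C + 'i%C * y%:C%C by simpc.
  rewrite cexpD; have -> : cexp (x%:C%C + 'i%C * y%:C%C) = (expR x)%:C%C * cis y.
    by rewrite /cexp; simpc.
  by ring.
rewrite Normc.normcM normc_cexp.
set N := normc (x +i* y)%C in h1 h2 h3 hx hy *.
have N0 : 0 <= N := normc_ge0 _.
set A := _ - 1 - _ in E1 *; set B := _ - 1 - _ in E2 *.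
have F1 : normc ((expR x)%:C%C - 1) <= 2 * N.
  have -> : (expR x)%:C%C - 1 = A + x%:C%C by rewrite /A; ring.
  apply: le_trans (le_normcD _ _) _; rewrite normc_real.
  have := ler_pM (ltW e'0) (normr_ge0 x) e'1 hx; lra.
have F2 : normc (cis y - 1) <= 2 * e'.
  have -> : cis y - 1 = B + 'i%C * y%:C%C by rewrite /B; ring.
  apply: le_trans (le_normcD _ _) _; rewrite Normc.normcM normc_i mul1r normc_real.
  have := ler_pM (ltW e'0) (normr_ge0 y) e'1 hy; lra.
have F3 : normc (((expR x)%:C%C - 1) * (cis y - 1)) <= 4 * (e' * N).
  rewrite Normc.normcM; apply: le_trans (ler_pM (normc_ge0 _) (normc_ge0 _) F1 F2) _.
  by rewrite le_eqVlt; apply/orP; left; apply/eqP; ring.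
have G1 := ler_wpM2l (ltW e'0) hx; have G2 := ler_wpM2l (ltW e'0) hy.
have := le_normcD (A + B) (((expR x)%:C%C - 1) * (cis y - 1)); have := le_normcD A B.
set S := normc (A + B + _) => h4 h5.
have S6 : S <= 6 * (e' * N) by lra.
apply: le_trans (ler_wpM2l (ltW ez) S6) _.
have -> : expR (Re z) * (6 * (e' * N)) = e' * (6 * expR (Re z)) * N by ring.
by rewrite ler_wpM2r// -ler_pdivlMr// mulr_gt0.
Qed.

Definition ray (s : R) : R -> R[i] := fun t => cexp (s +i* t)%C.

Lemma normc_ray s t : normc (ray s t) = expR s.
Proof. exact: normc_cexp. Qed.

Lemma ray_period s : ray s (2 * pi) = ray s 0.
Proof. by rewrite /ray /cexp /= -[2 * pi]add0r cis_period. Qed.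

Lemma pdiff_ray s t : pdiff (ray s) t ('i%C * ray s t).
Proof.
rewrite mulrC; exact: diffat_chain (cdiff_cexp _) (pdiff_vline s t).
Qed.

Lemma pdiff_ray_radial s t : pdiff (fun s => ray s t) s (ray s t).
Proof.
rewrite -[X in pdiff _ _ X]mulr1; exact: diffat_chain (cdiff_cexp _) (pdiff_hline t s).
Qed.

Definition circint (Z : R[i] -> R[i]) (s : R) : R[i] := cint (fun t => Z (ray s t)) 0 (2 * pi).

Lemma circint_cont Z s t : (forall w, normc w = expR s -> ccont Z w) ->
  pcont (fun t => Z (ray s t)) t.
Proof.
move=> cZ; apply: contat_comp; first exact: cZ (normc_ray s t).
exact: diffat_cont (pdiff_ray s t).
Qed.

Let pi2_ge0 : 0 <= 2 * pi :> R. Proof. exact: ltW (pi2_gt0). Qed.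

(** Cauchy's theorem for Z composed with exp on a rectangle of height 2 pi, whose horizontal sides
    cancel by periodicity. *)
Lemma circint_const Z (s1 s2 : R) : s1 <= s2 ->
  (forall w, expR s1 <= normc w <= expR s2 -> exists D, cdiff Z w D) ->
  circint Z s1 = circint Z s2.
Proof.
move=> s12 dZ.
have := @goursat R (fun z => Z (cexp z)) s1 s2 0 (2 * pi) s12 pi2_ge0 _.
rewrite /oint -/(circint Z s1) -/(circint Z s2).
have -> : (fun x => Z (cexp (x +i* (2 * pi))%C)) = (fun x => Z (cexp (x +i* 0)%C)).
  by apply/funext => x; rewrite -!/(ray _ _) ray_period.
rewrite subrr add0r => H; apply/esym/eqP; rewrite -subr_eq0.
have /eqP : 'i%C * (circint Z s2 - circint Z s1) = 0.
  apply: H => z /andP[/andP[z1 z2] _].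
  have [|D dD] := dZ (cexp z); first by rewrite normc_cexp !ler_expR z1.
  by eexists; exact: diffat_chain dD (cdiff_cexp z).
have /negbTE i0 : 'i%C != 0 :> R[i] by rewrite -normc_gt0 normc_i.
by rewrite mulf_eq0 i0.
Qed.

Lemma circint_ext Y Z s : (forall w, normc w = expR s -> Y w = Z w) ->
  circint Y s = circint Z s.
Proof. by move=> YZ; apply: cint_ext => t _; apply: YZ; exact: normc_ray. Qed.

Lemma circintD Y Z s : (forall w, normc w = expR s -> ccont Y w) ->
  (forall w, normc w = expR s -> ccont Z w) ->
  circint (fun w => Y w + Z w) s = circint Y s + circint Z s.
Proof. by move=> cY cZ; apply: cintD => // t _; exact: circint_cont. Qed.

Lemma circint_cst c s : circint (fun=> c) s = c * (2 * pi)%:C%C.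
Proof. by rewrite /circint cint_cst// subr0. Qed.

(** The derivative of log G with respect to log w: its real part is the radial growth rate of log
    |G|, and also the angular speed of arg G along the circle. *)
Definition lder (G : R[i] -> R[i]) w := w * cder G w / G w.

Lemma lderM G H w : (exists D, cdiff G w D) -> (exists D, cdiff H w D) ->
  G w != 0 -> H w != 0 -> lder (fun w => G w * H w) w = lder G w + lder H w.
Proof.
move=> /cderP dG /cderP dH G0 H0; rewrite /lder (cder_eq (diffatM dG dH)).
by field; rewrite G0 H0.
Qed.

Lemma holo_lder U G : copen U -> holo U G -> (forall w, U w -> G w != 0) -> holo U (lder G).
Proof.
move=> oU hG G0 w Uw; have [D dD] := holo_cder oU hG Uw; have [D' dD'] := hG w Uw.
eexists; apply: diffatM (diffatM (cdiff_id w) dD) (diffatV idfun_inj dD' (G0 w Uw)).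
Qed.

(* With P = kappa on the circle, P'/(1 - P) is the sum of the exact terms P^j P', up to a
   geometrically small remainder. *)
Lemma circint_geometric U kappa (s th : R) : copen U -> holo U kappa -> 0 <= th < 1 ->
  (forall w, normc w = expR s -> U w /\ normc (kappa w) <= th) ->
  circint (lder (fun w => 1 - kappa w)) s = 0.
Proof.
move=> oU hk th01 kU; have /andP[th0 th1] := th01.
have dk w : U w -> cdiff kappa w (cder kappa w) by move=> /hk/cderP.
pose P t := kappa (ray s t).
pose dP t := cder kappa (ray s t) * ('i%C * ray s t).
have rU t : U (ray s t) by have [] := kU _ (normc_ray s t).
have Pth t : normc (P t) <= th by have [] := kU _ (normc_ray s t).
have PP t : pdiff P t (dP t) by exact: diffat_chain (dk _ (rU t)) (pdiff_ray s t).
have P1 t : 1 - P t != 0.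
  rewrite subr_eq0; apply/eqP => E; have := Pth t; rewrite -E.
  by rewrite Normc.normc1 leNgt th1.
have P1n t : 1 - th <= normc (1 - P t).
  have := normc_rtri 1 (P t); rewrite Normc.normc1 => /(le_trans (ler_norm _)).
  by have := Pth t; lra.
have cdP t : pcont dP t.
  apply: contatM; last by apply: contatM; [exact: contat_cst|exact: diffat_cont (pdiff_ray s t)].
  apply: contat_comp; last exact: diffat_cont (pdiff_ray s t).
  exact: holo_cont (holo_cder oU hk) (rU t).
have [C C0 dPC] : exists2 C : R, 0 < C & forall t, normc (dP t) <= C.
  have ccd w : [set w | expR s <= normc w <= expR s] w -> ccont (cder kappa) w.
    rewrite /= -eq_le => /eqP/esym/kU[Uw _]; exact: holo_cont (holo_cder oU hk) Uw.
  have [|c _ cmax] := @compact_normc_max R _ (cder kappa) (ray s 0)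
    (@compact_annulus R (expR s) (expR s)) _ ccd; first by rewrite /= normc_ray lexx.
  exists (normc (cder kappa c) * expR s + 1).
    by rewrite ltr_wpDl// mulr_ge0 ?normc_ge0// expR_ge0.
  move=> t; have -> : normc (dP t) = normc (cder kappa (ray s t)) * expR s.
    by rewrite /dP Normc.normcM [normc ('i%C * _)]Normc.normcM normc_i mul1r normc_ray.
  rewrite ler_wpDr// ler_wpM2r ?expR_ge0//.
  by apply: cmax; rewrite /= normc_ray lexx.
have cP t : pcont P t by exact: diffat_cont (PP t).
pose h t := (1 - P t)^-1.
have ch t : pcont h t.
  exact: contatV (contatB (contat_cst (real_complex R) 1 t) (cP t)) (P1 t).
have -> : circint (lder (fun w => 1 - kappa w)) s = 'i%C * cint (fun t => dP t * h t) 0 (2 * pi).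
  rewrite -cintZ//; last by move=> t _; exact: contatM.
  apply: cint_ext => t _; rewrite /lder (cder_eq (diffatB (diffat_cst idfun 1 _) (dk _ (rU t)))).
  rewrite /dP /h -/(P t).
  have i2 : 'i%C * 'i%C = -1 :> R[i] by rewrite -expr2 sqr_i.
  have -> : 'i%C * (cder kappa (ray s t) * ('i%C * ray s t) * (1 - P t)^-1) =
    ('i%C * 'i%C) * (cder kappa (ray s t) * ray s t * (1 - P t)^-1) by ring.
  by rewrite i2; field; exact: P1.
suff -> : cint (fun t => dP t * h t) 0 (2 * pi) = 0 by rewrite mulr0.
apply/eqP; rewrite -normc_eq0 eq_le normc_ge0 andbT.
apply/ler_addgt0Pr => e e0; rewrite add0r.
pose M := C / (1 - th) * (2 * pi).
have M0 : 0 < M by rewrite mulr_gt0// ?pi2_gt0// divr_gt0// subr_gt0.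
have [n nM] := geometric_small th01 (divr_gt0 e0 M0).
pose H (t : R) := \sum_(j < n) P t ^+ j.+1 / j.+1%:R.
have dH t : pdiff H t (dP t * \sum_(j < n) P t ^+ j).
  rewrite /H; elim: (n) => [|m IH].
    rewrite big_ord0 mulr0; move/(diffat_near (@real_complex_inj R)): (diffat_cst (real_complex R) 0 t).
    by apply; exists 1 => // y _; rewrite big_ord0.
  rewrite big_ord_recr /= mulrDr.
  have dX := diffatM (diffat_chain (cdiffX m.+1 (cdiff_id (P t))) (PP t))
    (diffat_cst (real_complex R) m.+1%:R^-1 t).
  have := diffatD IH dX.
  have -> : m.+1%:R * P t ^+ m.+1.-1 * 1 * dP t * m.+1%:R^-1 + P t ^+ m.+1 * 0 = dP t * P t ^+ m.
    have q0 : m.+1%:R != 0 :> R[i] by rewrite pnatr_eq0.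
    by rewrite mulr0 addr0 mulr1 /=; move: q0; move: (m.+1%:R) => q q0; field.
  move/(diffat_near (@real_complex_inj R)); apply.
  by exists 1 => // y _; rewrite big_ord_recr.
have E t : dP t * h t = dP t * (\sum_(j < n) P t ^+ j) + P t ^+ n * (dP t * h t).
  have geo : \sum_(j < n) P t ^+ j = (1 - P t ^+ n) * h t.
    apply: (mulIf (P1 t)); rewrite -mulrA mulVf// mulr1.
    elim: (n) => [|m IH]; first by rewrite big_ord0 mul0r expr0 subrr.
    by rewrite big_ord_recr /= mulrDl IH exprSr; ring.
  by rewrite geo; ring.
rewrite (@cint_ext _ _ (fun t => dP t * (\sum_(j < n) P t ^+ j) + P t ^+ n * (dP t * h t))) => [|t _]; last exact: E.
have cS t : pcont (fun t => dP t * (\sum_(j < n) P t ^+ j)) t.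
  apply: contatM => //; elim: (n) => [|m IH].
    move/contat_near: (contat_cst (real_complex R) 0 t); apply.
    by exists 1 => // y _; rewrite big_ord0.
  move/contat_near: (contatD IH (contatX m (cP t))); apply.
  by exists 1 => // y _; rewrite big_ord_recr.
have cR t : pcont (fun t => P t ^+ n * (dP t * h t)) t.
  by apply: contatM; [exact: contatX|exact: contatM].
rewrite cintD//.
have -> : cint (fun t => dP t * (\sum_(j < n) P t ^+ j)) 0 (2 * pi) = 0.
  rewrite (@cint_FTC _ H)//.
  by rewrite /H /P ray_period subrr.
rewrite add0r; apply: le_trans (cint_normc_le (M := e / (2 * pi)) pi2_ge0 _ _) _ => //.
  move=> t _; rewrite Normc.normcM [normc (dP t * _)]Normc.normcM Normc.normcV normcX.
  have t1 : 0 < 1 - th by rewrite subr_gt0.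
  have : normc (dP t) * (normc (1 - P t))^-1 <= C / (1 - th).
    apply: ler_pM; rewrite ?normc_ge0 ?invr_ge0 ?normc_ge0//.
    by rewrite lef_pV2 ?posrE// (lt_le_trans t1).
  have : normc (P t) ^+ n <= th ^+ n by rewrite lerXn2r ?nnegrE ?normc_ge0.
  move=> u1 u2; apply: le_trans (ler_pM _ _ u1 u2) _.
  - by rewrite exprn_ge0// normc_ge0.
  - by rewrite mulr_ge0 ?normc_ge0// invr_ge0 normc_ge0.
  apply: le_trans (ler_wpM2r _ (ltW nM)) _; first by apply: divr_ge0; exact: ltW.
  have : C / (1 - th) != 0 by rewrite gt_eqF// divr_gt0.
  have : 2 * pi != 0 :> R by rewrite gt_eqF// pi2_gt0.
  rewrite /M; move: (C / (1 - th)) (2 * pi) => Q p p0 Q0.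
  by have -> : e / (Q * p) * Q = e / p by field; rewrite p0.
by rewrite subr0 divfK// gt_eqF// pi2_gt0.
Qed.

End ComplexExponential.

Section Degree.
Context {R : realType}.
Implicit Types (z w : R[i]) (U : set R[i]) (G : R[i] -> R[i]).

Lemma lder_cont U G w : copen U -> holo U G -> U w -> G w != 0 -> ccont (lder G) w.
Proof.
move=> oU hG Uw G0; apply: contatM; last first.
  by apply: contatV G0; exact: holo_cont hG Uw.
by apply: contatM; [exact: ccont_id|exact: holo_cont (holo_cder oU hG) Uw].
Qed.

Lemma lder_germ U G H w : copen U -> U w -> (exists D, cdiff G w D) ->
  (forall x, U x -> G x = H x) -> lder G w = lder H w.
Proof.
move=> oU Uw /cderP dG GH; rewrite /lder (GH w Uw); congr (_ * _ / _).
apply/esym/cder_eq; apply: (diffat_near idfun_inj dG).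
by have [r r0 rU] := oU w Uw; exists r => // x /rU/GH.
Qed.

Lemma lderZ c G w : c != 0 -> (exists D, cdiff G w D) -> lder (fun w => c * G w) w = lder G w.
Proof.
move=> c0 /cderP dG; rewrite /lder (cder_eq (diffatZ c dG)).
have [->|G0] := eqVneq (G w) 0; first by rewrite mulr0 invr0 !mulr0.
by field; rewrite c0 G0.
Qed.

(** Rouche's argument when c dominates: G - c is -c times 1 - G / c, which has no flux by
    [circint_geometric]. *)
Lemma circint_inner U G c (s th : R) : copen U -> holo U G -> 0 <= th < 1 -> c != 0 ->
  (forall w, normc w = expR s -> U w /\ normc (G w) <= th * normc c) ->
  circint (lder (fun w => G w - c)) s = 0.
Proof.
move=> oU hG th01 c0 GU; pose ka w := c^-1 * G w.
have hka : holo U ka by move=> w /hG[D dD]; eexists; exact: diffatZ dD.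
have n0 : 0 < normc c by rewrite normc_gt0.
rewrite -(@circint_geometric R U ka s th oU hka th01) => [|w /GU[Uw Gw]]; last first.
  split => //; rewrite Normc.normcM Normc.normcV mulrC ler_pdivrMr//.
apply: circint_ext => w /GU[Uw _].
have [D dD] := hka w Uw; have Nc0 : - c != 0 by rewrite oppr_eq0.
rewrite -[RHS](lderZ Nc0); last by eexists; exact: diffatB (diffat_cst idfun 1 w) dD.
congr (lder _ w); apply/funext => x; rewrite /ka mulrBr mulr1 mulrA mulNr divff// mulN1r opprK.
by rewrite addrC.
Qed.

(** Rouche's argument when G dominates: G - c is G times 1 - c / G, and logarithmic derivatives
    add. *)
Lemma circint_outer U G c (s th : R) : copen U -> holo U G -> 0 <= th < 1 ->
  (forall w, U w -> G w != 0) ->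
  (forall w, normc w = expR s -> U w /\ normc c <= th * normc (G w)) ->
  circint (lder (fun w => G w - c)) s = circint (lder G) s.
Proof.
move=> oU hG th01 G0 GU; pose ka w := c * (G w)^-1; have /andP[th0 th1] := th01.
have hka : holo U ka.
  by move=> w Uw; have [D dD] := hG w Uw; eexists; exact: diffatZ (diffatV idfun_inj dD (G0 w Uw)).
have kth w : normc w = expR s -> normc (ka w) <= th.
  move=> /GU[Uw cw]; rewrite Normc.normcM Normc.normcV ler_pdivrMr// normc_gt0.
  exact: G0.
have h1 : holo U (fun w => 1 - ka w).
  by move=> w /hka[D dD]; eexists; exact: diffatB (diffat_cst idfun 1 w) dD.
have n1 w : normc w = expR s -> 1 - ka w != 0.
  move=> /kth kw; rewrite subr_eq0; apply/eqP => E; move: kw.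
  by rewrite -E Normc.normc1 leNgt th1.
have E0 := @circint_geometric R U ka s th oU hka th01 (fun w ws => conj (GU w ws).1 (kth w ws)).
rewrite -[RHS]addr0 -E0 -circintD; last 2 first.
- by move=> w ws; have [Uw _] := GU w ws; exact: lder_cont oU hG Uw (G0 w Uw).
- by move=> w ws; have [Uw _] := GU w ws; exact: lder_cont oU h1 Uw (n1 w ws).
apply: circint_ext => w ws; have [Uw _] := GU w ws.
rewrite -lderM; [|exact: hG|exact: h1|exact: G0|exact: n1].
apply: (lder_germ oU Uw).
  by have [D dD] := hG w Uw; eexists; exact: diffatB dD (diffat_cst idfun c w).
by move=> x Ux; rewrite /ka mulrBr mulr1 mulrCA divff ?mulr1// G0.
Qed.

Variables (rho : R) (f : R[i] -> R[i]).
Hypotheses (hd : forall z, 1 < normc z < rho -> exists D : R[i], cdiff f z D)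
  (hinj : forall z w, 1 < normc z < rho -> 1 < normc w < rho -> f z = f w -> z = w)
  (h1 : forall z, 1 < normc z < rho -> 1 < normc (f z))
  (hlim : forall e : R, 0 < e -> exists2 dl : R, 0 < dl &
    forall z, 1 < normc z < 1 + dl -> normc (f z) < 1 + e).

Let U := [set w : R[i] | 1 < normc w < rho].
Let oU : copen U. Proof. exact: copen_annulus. Qed.
Let hf : holo U f. Proof. exact: hd. Qed.

Lemma exterior_neq0 w : U w -> f w != 0.
Proof. by move=> /h1 fw; rewrite -normc_gt0 (lt_trans ltr01). Qed.

(* For a fixed point a, the flux of (f - f a) / (w - a) is the same on circles on both sides
   of a, where the fluxes of f - f a and of w - a are computed by geometric series. *)
Lemma degree (s : R) : 0 < s -> expR s < rho -> circint (lder f) s = (2 * pi)%:C%C.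
Proof.
move=> s0 sr; have es1 : 1 < expR s by rewrite expR_gt1.
have [|mu mu1 fmu] := circle_min hd h1 (s := expR s); first by rewrite es1.
have [|dl dl0 near1] := hlim (e := mu - 1); first by rewrite subr_gt0.
(* [a] is taken so near the unit circle that |f a| is below the minimum of |f| on the outer
   circle. *)
pose x := Num.min (1 + dl / 2) ((1 + expR s) / 2).
have [x1 x2] : x <= 1 + dl / 2 /\ x <= (1 + expR s) / 2 by rewrite /x !ge_min !lexx orbT.
have x3 : 1 < x by rewrite lt_min; apply/andP; split; lra.
pose a : R[i] := x%:C%C.
have na : normc a = x by rewrite normc_real gtr0_norm// (lt_trans ltr01).
have Ua : U a by rewrite /U /= na x3 /=; lra.
have fa1 : 1 < normc (f a) by exact: h1.
have fa2 : normc (f a) < mu by have := near1 a; rewrite na => /(_ _) H; rewrite -[mu](subrK 1) addrC H//; apply/andP; split; lra.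
have [|dl2 dl20 near2] := hlim (e := (normc (f a) - 1) / 2); first by rewrite divr_gt0// subr_gt0.
(* On the inner circle |f| is at most the midpoint of 1 and |f a|, hence below |f a|. *)
pose y := Num.min (1 + dl2 / 2) ((1 + x) / 2).
have [y1 y2] : y <= 1 + dl2 / 2 /\ y <= (1 + x) / 2 by rewrite /y !ge_min !lexx orbT.
have y3 : 1 < y by rewrite lt_min; apply/andP; split; lra.
have x0 : 0 < x by rewrite (lt_trans ltr01).
have y0 : 0 < y by rewrite (lt_trans ltr01).
have fa0 : 0 < normc (f a) by rewrite (lt_trans ltr01).
have mu0 : 0 < mu by rewrite (lt_trans ltr01).
have ratio (u v : R) : 0 < u -> u < v -> 0 <= u / v < 1.
  by move=> u0 uv; rewrite ltr_pdivrMr ?mul1r ?uv ?andbT ?(lt_trans u0)// divr_ge0// ltW// (lt_trans u0).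
have th1 : 0 <= (1 + normc (f a)) / 2 / normc (f a) < 1 by apply: ratio; lra.
have th2 : 0 <= y / x < 1 by apply: ratio; lra.
have th3 := ratio _ _ fa0 fa2.
have th4 : 0 <= x / expR s < 1 by apply: ratio; lra.
have xs : expR s != x by rewrite gt_eqF//; lra.
have yx : y != x by rewrite lt_eqF//; lra.
have fa_neq := lt0r_neq0 fa0; have x_neq := lt0r_neq0 x0; have mu_neq := lt0r_neq0 mu0.
have es_neq := lt0r_neq0 (expR_gt0 s).
have neary w : normc w = y -> normc (f w) <= (1 + normc (f a)) / 2.
  by move=> wy; have := near2 w; rewrite wy => /(_ _) H; have := H _; lra.
have outer w : normc w = expR s -> normc (f a) <= normc (f a) / mu * normc (f w).
  by move=> ws; rewrite mulrAC ler_pdivlMr// ler_pM2l// fmu.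
pose t := ln y; have ty : expR t = y by rewrite lnK// posrE (lt_trans ltr01).
have ts : t <= s by rewrite -ler_expR ty; lra.
have Us w : normc w = expR s -> U w by rewrite /U /= => ->; rewrite es1.
have Ut w : normc w = expR t -> U w by rewrite /U /= => ->; rewrite ty y3 /=; lra.
pose Q := dquot f a.
have hQ : holo U Q by exact: holo_dquot.
have Q0 w : U w -> Q w != 0.
  move=> Uw; have [->|wa] := eqVneq w a.
    rewrite /Q /dquot eqxx; exact: injective_cder_neq0 oU hf hinj _ Ua.
  rewrite /Q dquotE// mulf_neq0// ?invr_eq0 subr_eq0//; apply: contraNneq wa => fwa.
  by apply/eqP; exact: hinj fwa.
have did w : exists D, cdiff (fun w => w - a) w D.
  by eexists; exact: diffatB (cdiff_id w) (diffat_cst idfun a w).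
have split w : U w -> w != a ->
    lder (fun w => f w - f a) w = lder Q w + lder (fun w => w - a) w.
  move=> Uw wa; rewrite -lderM; [|exact: hQ|exact: did|exact: Q0|by rewrite subr_eq0].
  by congr (lder _ w); apply/funext => v; rewrite dquot_mul.
have splitint r : (forall w, normc w = expR r -> U w /\ w != a) ->
    circint (lder (fun w => f w - f a)) r = circint (lder Q) r + circint (lder (fun w => w - a)) r.
  move=> rU; rewrite -circintD.
  - by apply: circint_ext => w /rU[Uw wa]; exact: split.
  - by move=> w /rU[Uw _]; exact: lder_cont oU hQ Uw (Q0 w Uw).
  - move=> w /rU[Uw wa]; apply: (@lder_cont U _ w oU _ Uw); last by rewrite subr_eq0.
    by move=> v _; exact: did.
have Qc : circint (lder Q) t = circint (lder Q) s.
  apply: circint_const ts _ => w /andP[w1 w2]; apply: (holo_lder oU hQ Q0).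
  by rewrite /U /= (lt_le_trans _ w1) ?(le_lt_trans w2)// ty.
have neq r : expR r != x -> forall w, normc w = expR r -> w != a.
  by move=> rx w wr; apply: contraNneq rx => wa; rewrite -wr wa na.
pose V := [set w : R[i] | 0 < normc w < rho].
have oV : copen V by exact: copen_annulus.
have hV : holo V (fun w => w) by move=> w _; exists 1; exact: cdiff_id.
have V0 w : V w -> w != 0 by rewrite /V /= -normc_gt0 => /andP[].
have UV w : U w -> V w by rewrite /U /V /= => /andP[w1 ->]; rewrite (lt_trans ltr01).
have f0 : f a != 0 by exact: exterior_neq0.
have a0 : a != 0 by rewrite -normc_gt0 na.
have I1 : circint (lder (fun w => f w - f a)) t = 0.
  apply: (@circint_inner U f (f a) t _ oU hf th1 f0) => w wt; split; first exact: Ut.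
  by rewrite (divfK fa_neq); apply: neary; rewrite wt.
have I2 : circint (lder (fun w => w - a)) t = 0.
  apply: (@circint_inner V (fun w => w) a t _ oV hV th2 a0) => w wt; split.
    by apply: UV; exact: Ut.
  by rewrite na (divfK x_neq) wt ty.
have O1 : circint (lder (fun w => f w - f a)) s = circint (lder f) s.
  apply: (@circint_outer U f (f a) s _ oU hf th3 exterior_neq0) => w ws; split.
    exact: Us.
  exact: outer.
have O2 : circint (lder (fun w => w - a)) s = (2 * pi)%:C%C.
  rewrite (@circint_outer V (fun w => w) a s _ oV hV th4 V0).
    rewrite (@circint_ext _ _ (fun=> 1)) => [|w ws]; first by rewrite circint_cst mul1r.
    rewrite /lder (cder_eq (cdiff_id w)) mulr1 divff; [by []|apply: V0; apply: UV; exact: Us].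
  move=> w ws; split; first by apply: UV; exact: Us.
  by rewrite na ws (divfK es_neq).
have St := splitint t; have Ss := splitint s.
rewrite O1 O2 -Qc in Ss; rewrite I1 I2 addr0 in St.
have Hs w : normc w = expR s -> U w /\ w != a by move=> ws; split; [exact: Us|exact: neq xs w ws].
have Ht w : normc w = expR t -> U w /\ w != a.
  by move=> wt; split; [exact: Ut|apply: neq wt; rewrite ty].
by rewrite (Ss Hs) -(St Ht) add0r.
Qed.

End Degree.

Section CauchyEstimates.
Context {R : realType}.
Implicit Types (z w : R[i]).

(** D is the value at z0 of the difference quotient, which is at most 2 M / (r / 3) on the boundary
    of a square of half-side r / 3; [center_bound] doubles this. *)
Lemma cauchy_estimate F z0 (r M : R) D : 0 < r ->
  (forall z, normc (z - z0) < r -> exists D, cdiff F z D) ->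
  (forall z, normc (z - z0) < r -> normc (F z) <= M) ->
  cdiff F z0 D -> normc D <= 12 * M / r.
Proof.
move=> r0 dF FM dz0; pose V := [set z | normc (z - z0) < r].
have Vz0 : V z0 by rewrite /V /= subrr Normc.normc0.
have hG := @holo_dquot R V F z0 (@copen_ball R z0 r) dF Vz0.
pose l := r / 3; have l0 : 0 < l by rewrite divr_gt0.
have inV w : inrect (Re z0 - l) (Re z0 + l) (Im z0 - l) (Im z0 + l) w -> V w.
  by move=> /square_in_ball wl; apply: le_lt_trans wl _; rewrite /l; lra.
have -> : D = dquot F z0 z0 by rewrite /dquot eqxx (cder_eq dz0).
have -> : 12 * M / r = 2 * (2 * M / l) by rewrite /l; field; rewrite gt_eqF.
apply: (center_bound l0) => [w /inV/hG//|w /andP[win wside]].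
have wl : l <= normc (w - z0).
  have h1 := normc_Re (w - z0); have h2 := normc_Im (w - z0).
  rewrite !raddfB /= in h1 h2.
  case/or4P: wside => /eqP E; rewrite E in h1 h2.
  - apply: le_trans h1; rewrite -normrN; apply: le_trans (ler_norm _); lra.
  - apply: le_trans h1; apply: le_trans (ler_norm _); lra.
  - apply: le_trans h2; rewrite -normrN; apply: le_trans (ler_norm _); lra.
  - apply: le_trans h2; apply: le_trans (ler_norm _); lra.
have wz0 : w != z0 by apply: contraTneq wl => ->; rewrite subrr Normc.normc0 -ltNge.
rewrite dquotE// normcf_div.
have w0 : 0 < normc (w - z0) by exact: lt_le_trans wl.
apply: ler_pM; rewrite ?normc_ge0 ?invr_ge0 ?normc_ge0//.
  apply: le_trans (normc_tri _ _) _.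
  by have := FM w (inV w win); have := FM z0 Vz0; lra.
by rewrite lef_pV2 ?posrE.
Qed.

(* Borel-Caratheodory: apply the Cauchy estimate to exp(- i H / M), which is bounded by e. *)
Lemma cauchy_estimate_Im H z0 (r M : R) D : 0 < r -> 0 < M ->
  (forall z, normc (z - z0) < r -> exists D, cdiff H z D) ->
  (forall z, normc (z - z0) < r -> `|Im (H z)| <= M) ->
  cdiff H z0 D -> normc D <= 12 * expR 2 * M / r.
Proof.
move=> r0 M0 dH HM dz0; pose c : R[i] := (0 +i* (- M^-1))%C.
have nc : normc c = M^-1.
  have -> : c = 'i%C * (- M^-1)%:C%C by rewrite /c; simpc.
  by rewrite Normc.normcM normc_i mul1r normc_real normrN gtr0_norm ?invr_gt0.
have Rec w : Re (c * w) = Im w / M by case: w => x y; rewrite /c; simpc; rewrite /= mulrC.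
pose F z := cexp (c * H z).
have nF z : normc (z - z0) < r -> expR (-1) <= normc (F z) <= expR 1.
  move=> /HM; rewrite ler_norml => /andP[h1 h2].
  by rewrite normc_cexp Rec !ler_expR ler_pdivlMr// ler_pdivrMr// mulN1r mul1r h1.
have dF z E : cdiff H z E -> cdiff F z (F z * (c * E)).
  by move=> dE; exact: diffat_chain (cdiff_cexp _) (diffatZ c dE).
have z0r : normc (z0 - z0) < r by rewrite subrr Normc.normc0.
have := @cauchy_estimate F z0 r (expR 1) _ r0 _ _ (dF z0 D dz0).
have E1 : forall z, normc (z - z0) < r -> exists D, cdiff F z D.
  by move=> z /dH[E dE]; eexists; exact: dF dE.
have E2 z : normc (z - z0) < r -> normc (F z) <= expR 1 by move=> /nF/andP[].
move=> /(_ E1 E2); rewrite Normc.normcM [normc (c * D)]Normc.normcM nc.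
have /andP[Fz _] := nF z0 z0r.
have : expR (-1) * (M^-1 * normc D) <= normc (F z0) * (M^-1 * normc D).
  by rewrite ler_wpM2r// mulr_ge0 ?normc_ge0// invr_ge0 ltW.
move=> /le_trans/[apply]; rewrite expRN mulrC ler_pdivrMr ?expR_gt0//.
rewrite mulrC ler_pdivrMr//.
have -> : 12 * expR 1 / r * expR 1 * M = 12 * (expR 1 * expR 1) * M / r by ring.
by rewrite -expRD.
Qed.

End CauchyEstimates.

(** * Uniform estimates near the unit circle *)

Section Radial.
Context {R : realType}.
Implicit Types (z w : R[i]).
Variables (rho : R) (f : R[i] -> R[i]).
Hypotheses (hd : forall z, 1 < normc z < rho -> exists D : R[i], cdiff f z D)
  (h1 : forall z, 1 < normc z < rho -> 1 < normc (f z))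
  (hlim : forall e : R, 0 < e -> exists2 dl : R, 0 < dl &
    forall z, 1 < normc z < 1 + dl -> normc (f z) < 1 + e).

Let U := [set w : R[i] | 1 < normc w < rho].
Let oU : copen U. Proof. exact: copen_annulus. Qed.
Let hf : holo U f. Proof. exact: hd. Qed.
Let f0 w : U w -> f w != 0. Proof. exact: exterior_neq0. Qed.
Let Z := lder f.

Lemma ray_in (s t : R) : 0 < s -> expR s < rho -> U (ray s t).
Proof. by move=> s0 sr; rewrite /U /= normc_ray expR_gt1 s0. Qed.

Lemma pdiff_f_ray (s t : R) : U (ray s t) ->
  pdiff (fun t => f (ray s t)) t ('i%C * Z (ray s t) * f (ray s t)).
Proof.
move=> Us; have := diffat_chain (cderP (hf Us)) (pdiff_ray s t).
congr (pdiff _ _ _); rewrite /Z /lder; field; exact: f0.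
Qed.

Lemma pdiff_f_radial (s t : R) : U (ray s t) ->
  pdiff (fun s => f (ray s t)) s (Z (ray s t) * f (ray s t)).
Proof.
move=> Us; have := @diffat_chain _ _ (real_complex R) f (fun s => ray s t) s _ _
  (cderP (hf Us)) (pdiff_ray_radial s t).
congr (pdiff _ _ _); rewrite /Z /lder; field; exact: f0.
Qed.

Lemma ray_rot (s t eta : R) : ray s (t + eta) = ray s t * cis eta.
Proof. by rewrite /ray /cexp /= cisD mulrA. Qed.

(** Stands in for reflection across the unit circle. The quotient f(w cis eta) / f(w) has limiting
    modulus at most 1 there and at most exp(C1 |eta|) on |w| = exp b; [log_linear_bound]
    interpolates, and the factor s appears. *)
Lemma angular_lipschitz (b : R) : 0 < b -> expR b < rho -> exists2 C : R, 0 < C &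
  forall s t eta, 0 < s <= b ->
    normc (f (ray s (t + eta))) <= expR (s * C * `|eta|) * normc (f (ray s t)).
Proof.
move=> b0 br; have cdf w : [set w | expR b <= normc w <= expR b] w -> ccont (cder f) w.
  rewrite /= -eq_le => /eqP/esym wb; apply: (holo_cont (holo_cder oU hf)).
  by rewrite /U /= wb expR_gt1 b0.
have [|c _ cmax] := @compact_normc_max R _ (cder f) (ray b 0)
    (@compact_annulus R (expR b) (expR b)) _ cdf; first by rewrite /= normc_ray lexx.
pose C1 := normc (cder f c) * expR b + 1.
have C10 : 0 < C1 by rewrite ltr_wpDl// mulr_ge0 ?normc_ge0 ?expR_ge0.
exists (C1 / b) => [|s t eta /andP[s0 sb]]; first by rewrite divr_gt0.
have rU x : U (ray b x) by exact: ray_in.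
have fr x : pdiff (fun t => f (ray b t)) x (cder f (ray b x) * ('i%C * ray b x)).
  exact: diffat_chain (cderP (hf (rU x))) (pdiff_ray b x).
have fb x : normc (cder f (ray b x) * ('i%C * ray b x)) <= C1.
  rewrite Normc.normcM [normc ('i%C * _)]Normc.normcM normc_i mul1r normc_ray.
  by rewrite ler_wpDr// ler_wpM2r ?expR_ge0//; apply: cmax; rewrite /= normc_ray lexx.
have lip x y : normc (f (ray b x) - f (ray b y)) <= C1 * `|x - y|.
  wlog xy : x y / y <= x => [H|].
    have [/H//|/ltW/H] := leP y x; by rewrite normcB distrC.
  rewrite ger0_norm ?subr_ge0//.
  exact: (pdiff_normc_le xy (fun x _ => fr x) (fun x _ => fb x)).
pose S w := f (w * cis eta) / f w.
have nrot w : normc (w * cis eta) = normc w by rewrite Normc.normcM normc_cis mulr1.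
have Urot w : U w -> U (w * cis eta) by rewrite /U /= nrot.
have := @log_linear_bound R S b (C1 * `|eta|) rho b0 br _ _ _ (ray s t) s (normc_ray s t) _.
rewrite /S normcf_div -ray_rot.
have f0' : 0 < normc (f (ray s t)).
  by rewrite normc_gt0; apply/f0/ray_in => //; apply: le_lt_trans br; rewrite ler_expR.
rewrite ler_pdivrMr//.
have -> : s * (C1 / b) * `|eta| = s * (C1 * `|eta|) / b by ring.
apply.
- move=> w Uw; have [D dD] := hf (Urot w Uw); have [D' dD'] := hf Uw.
  have dr := diffatM (cdiff_id w) (diffat_cst idfun (cis eta) w).
  have dc := @diffat_chain _ _ idfun f (fun w => w * cis eta) w _ _ dD dr.
  by eexists; exact: diffatM dc (diffatV idfun_inj dD' (f0 Uw)).
- move=> e e0; have [dl dl0 H] := hlim e0.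
  exists (Num.min dl (rho - 1)).
    by rewrite lt_min dl0 subr_gt0 (lt_trans _ br)// expR_gt1.
  move=> w /andP[w1 w2].
  have [m1 m2] : Num.min dl (rho - 1) <= dl /\ Num.min dl (rho - 1) <= rho - 1.
    by rewrite !ge_min !lexx orbT.
  have Uw : U w by rewrite /U /= w1 /=; lra.
  have fw1 : 1 < normc (f w) := h1 Uw.
  rewrite normcf_div ler_pdivrMr ?(lt_trans ltr01)//.
  have : normc (f (w * cis eta)) < 1 + e by apply: H; rewrite nrot w1 /=; lra.
  have : 1 + e <= expR e := expR_ge1Dx e.
  have : expR e <= expR e * normc (f w) by rewrite ler_peMr ?expR_ge0// ltW.
  lra.
- move=> w wb; have [|x wE] := @cexp_polar R w; first by rewrite -normc_gt0 wb expR_gt0.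
  rewrite wb expRK in wE; have -> : w = ray b x by [].
  rewrite -ray_rot normcf_div.
  have f1 : 1 < normc (f (ray b x)) by exact: (h1 (rU x)).
  rewrite ler_pdivrMr ?(lt_trans ltr01)//.
  have l := lip (x + eta) x; rewrite [x + eta]addrC addrK in l.
  have := normc_tri (f (ray b (eta + x)) - f (ray b x)) (- f (ray b x)).
  rewrite opprK subrK normcN [eta + x]addrC => l2; rewrite [x + eta]addrC in l2 *.
  have u0 : 0 <= C1 * `|eta| by rewrite mulr_ge0// ltW.
  have : 1 + C1 * `|eta| <= expR (C1 * `|eta|) := expR_ge1Dx _.
  move=> /(ler_wpM2r (normc_ge0 (f (ray b x)))); rewrite mulrDl mul1r.
  have : C1 * `|eta| <= C1 * `|eta| * normc (f (ray b x)) by rewrite ler_peMr// ltW.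
  lra.
- by rewrite s0.
Qed.

(** - Im Z is the derivative in eta, at 0, of log |f(ray s (t + eta))|; the bound for both signs of
    eta gives the absolute value. *)
Lemma Im_lder_le (b C s t : R) : 0 < b -> expR b < rho -> 0 <= C ->
  (forall s t eta, 0 < s <= b ->
    normc (f (ray s (t + eta))) <= expR (s * C * `|eta|) * normc (f (ray s t))) ->
  0 < s <= b -> `|Im (Z (ray s t))| <= s * C.
Proof.
move=> b0 br C0 H /andP[s0 sb]; set c := s * C.
have c0 : 0 <= c by rewrite mulr_ge0// ltW.
have Us : U (ray s t) by apply: ray_in => //; apply: le_lt_trans br; rewrite ler_expR.
pose P x := f (ray s x) / f (ray s t).
have dP : pdiff P t ('i%C * Z (ray s t)).
  have := diffatM (pdiff_f_ray Us) (diffat_cst (real_complex R) (f (ray s t))^-1 t).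
  by congr (pdiff _ _ _); rewrite mulr0 addr0 mulfK// f0.
have Pt : P t = 1 by rewrite /P divff// f0.
have PH eta : normc (P (t + eta)) <= expR (c * `|eta|).
  rewrite /P normcf_div ler_pdivrMr ?normc_gt0 ?f0//.
  by have := H s t eta; rewrite s0 sb; apply.
have dE := pdiff_real (is_derive_expR (0 : R)).
apply/ler_addgt0Pr => e e0.
pose e1 := e / 2 / (c + 1); have e10 : 0 < e1 by rewrite !divr_gt0// ltr_wpDl.
have e20 : 0 < e / 2 by rewrite divr_gt0.
have [d1 d10 H1] := diffat_eps dP e20.
have [d2 d20 H2] := diffat_eps dE e10.
pose eta := Num.min d1 (d2 / (c + 1)) / 2.
have eta0 : 0 < eta by rewrite divr_gt0// lt_min d10 divr_gt0// ltr_wpDl.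
have [n1 n2] : eta < d1 /\ eta < d2 / (c + 1).
  have : Num.min d1 (d2 / (c + 1)) <= d1 /\ Num.min d1 (d2 / (c + 1)) <= d2 / (c + 1).
    by rewrite !ge_min !lexx orbT.
  by move: eta0; rewrite /eta; lra.
have expb : expR (c * eta) <= 1 + c * eta + e / 2 * eta.
  have cd : c * eta < d2.
    by move: n2; rewrite ltr_pdivlMr ?ltr_wpDl// mulrDr mulr1 [eta * c]mulrC; lra.
  have ce0 : 0 <= c * eta := mulr_ge0 c0 (ltW eta0).
  have := H2 (c * eta); rewrite normc_real (ger0_norm ce0) => /(_ cd).
  rewrite add0r expR0 rmorph1 mul1r.
  have -> : (expR (c * eta))%:C%C - 1 - (c * eta)%:C%C = (expR (c * eta) - 1 - c * eta)%:C%C.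
    by rewrite !rmorphB rmorph1.
  rewrite normc_real => /(le_trans (ler_norm _)).
  have : e1 * (c * eta) <= e / 2 * eta.
    rewrite /e1 mulrA ler_wpM2r ?(ltW eta0)// mulrAC ler_pdivrMr ?ltr_wpDl//.
    by rewrite ler_pM2l//; lra.
  lra.
have side (x : R) : `|x| = eta -> - Im (Z (ray s t)) * x <= c * eta + e * eta.
  move=> xe; have := H1 x; rewrite normc_real xe => /(_ n1).
  rewrite Pt => h; have := PH x; rewrite xe => hP.
  have := le_trans (normc_Re _) h; rewrite ler_norml => /andP[hr _].
  have hRe := le_trans (ler_norm _) (le_trans (normc_Re _) hP).
  move: hr; rewrite !raddfB /=.
  have -> : Re ('i%C * Z (ray s t) * x%:C%C) = - Im (Z (ray s t)) * x.
    by case: (Z _) => p q; simpc.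
  lra.
have ee : c + e = (c * eta + e * eta) / eta by rewrite -mulrDl mulfK// gt_eqF.
rewrite ee ler_pdivlMr//.
have [i0|i0] := leP 0 (Im (Z (ray s t))).
  rewrite ger0_norm//; have := side (- eta); rewrite normrN gtr0_norm// mulrNN.
  exact.
by rewrite ltr0_norm//; apply: side; rewrite gtr0_norm.
Qed.

(** In the logarithmic coordinate, the disk of radius s / 2 around s + i t stays at height O(s)
    above the boundary. Since Im Z = O(s) there, the Borel-Caratheodory estimate at that scale
    bounds the derivative independently of s. *)
Lemma lder_estimates : 1 < rho -> exists b C : R, [/\ 0 < b, expR b < rho, 0 < C,
  forall s t, 0 < s <= b -> `|Im (Z (ray s t))| <= C * s &
  forall s t D, 0 < s <= b -> cdiff Z (ray s t) D -> normc (D * ray s t) <= C].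
Proof.
move=> rho1; pose b := ln rho / 3; have b0 : 0 < b by rewrite divr_gt0// ln_gt0.
have r0 : 0 < rho by rewrite (lt_trans ltr01).
have b2r : expR (2 * b) < rho by rewrite -[ltRHS]lnK// ltr_expR /b; have := ln_gt0 rho1; lra.
have b20 : 0 < 2 * b by rewrite mulr_gt0.
have [C C0 CH] := angular_lipschitz b20 b2r.
have ImZ s t : 0 < s <= 2 * b -> `|Im (Z (ray s t))| <= s * C.
  exact: Im_lder_le b20 b2r (ltW C0) CH.
exists b, (48 * expR 2 * C); split => //.
- by apply: lt_trans b2r; rewrite ltr_expR; lra.
- by rewrite !mulr_gt0// expR_gt0.
- move=> s t /andP[s0 sb]; apply: le_trans (ImZ s t _) _; first by apply/andP; split; lra.
  rewrite mulrC ler_wpM2r ?(ltW s0)// -[leLHS]mul1r ler_wpM2r ?(ltW C0)//.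
  by have := expR_ge1Dx (2 : R); lra.
move=> s t D /andP[s0 sb] dD.
have dH : cdiff (fun z => Z (cexp z)) (s +i* t)%C (D * ray s t).
  exact: (@diffat_chain _ _ idfun Z cexp _ _ _ dD (cdiff_cexp _)).
have hZ : holo U Z by exact: holo_lder oU hf f0.
have near_ray z : normc (z - (s +i* t)%C) < s / 2 -> 0 < Re z <= 2 * b /\ Re z <= 2 * s.
  move=> zr; have := le_lt_trans (normc_Re _) zr; rewrite raddfB /= ltr_norml => /andP[? ?].
  by split; last lra; apply/andP; split; lra.
have zE z : cexp z = ray (Re z) (Im z) by case: z.
have := @cauchy_estimate_Im R (fun z => Z (cexp z)) (s +i* t)%C (s / 2) (2 * s * C) _ _ _ _ _ dH.
have -> : 12 * expR 2 * (2 * s * C) / (s / 2) = 48 * expR 2 * C by field; rewrite gt_eqF.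
apply.
- by rewrite divr_gt0.
- by rewrite !mulr_gt0.
- move=> z /near_ray[/andP[z1 z2] _]; 
  have Uz : U (cexp z).
    by rewrite zE; apply: ray_in => //; apply: le_lt_trans b2r; rewrite ler_expR.
  have [E dE] := hZ _ Uz; by eexists; exact: (@diffat_chain _ _ idfun Z cexp z _ _ dE (cdiff_cexp z)).
- move=> z /near_ray[zb zs]; rewrite zE; apply: le_trans (ImZ _ _ zb) _.
  by rewrite ler_wpM2r// ltW.
Qed.

End Radial.

Section CircleAverages.
Context {R : realType}.
Implicit Types (z w : R[i]) (Y : R[i] -> R[i]).

Let pi2_ge0 : 0 <= 2 * pi :> R. Proof. exact: ltW (pi2_gt0). Qed.

Lemma ray_per (s t : R) : ray s (t + 2 * pi) = ray s t.
Proof. by rewrite /ray /cexp /= cis_period. Qed.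

Lemma pdiff_shift (P : R -> R[i]) (a t : R) d : pdiff P (a + t) d -> pdiff (fun t => P (a + t)) t d.
Proof. by move=> [phi [c p0 E]]; exists phi; split => // h; rewrite addrA E. Qed.

Lemma circint_shift Y (s a : R) : (forall w, normc w = expR s -> ccont Y w) ->
  cint (fun t => Y (ray s (a + t))) 0 (2 * pi) = circint Y s.
Proof.
move=> cY; pose g t := Y (ray s t); have cg t : pcont g t by exact: circint_cont.
pose l := Num.min a 0; pose u := Num.max a 0.
have [la l0] : l <= a /\ l <= 0 by rewrite /l !ge_min !lexx orbT.
have [ua u0] : a <= u /\ 0 <= u by rewrite /u !le_max !lexx orbT.
have pi0 := pi2_ge0; set p := 2 * pi in pi0 *.
have lu : l <= u + p by lra.
have [P dP] := cprimitive lu (fun x _ => cg x).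
rewrite (@cint_FTC _ (fun t => P (a + t))) => [||t /andP[t0 t1]]; last 2 first.
- exact: pi0.
- by apply: pdiff_shift; apply: dP; apply/andP; split; lra.
have -> : circint Y s = P p - P 0.
  by rewrite /circint -/p; apply: cint_FTC => // t /andP[t0 t1]; apply: dP; apply/andP; split; lra.
(* Periodicity makes the derivative of [D] vanish, and D a = D 0 is the claim. *)
pose D x := P (x + p) - P x.
have dD x : l <= x <= u -> pdiff D x 0.
  move=> /andP[x0 x1]; rewrite -[X in pdiff _ _ X](subrr (g x)); apply: diffatB.
    have := @pdiff_shift P p x (g x); rewrite /D.
    have -> : (fun t => P (p + t)) = (fun t => P (t + p)) by apply/funext => t; rewrite addrC.
    apply; rewrite addrC -[g x]/(Y (ray s x)) -ray_per; apply: dP.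
    by apply/andP; split; lra.
  by apply: dP; apply/andP; split; lra.
have Dc : D a = D 0.
  have Deq x y : l <= x -> x <= y -> y <= u -> D y = D x.
    move=> lx xy yu; apply/eqP; rewrite -subr_eq0 -normc_eq0 eq_le normc_ge0 andbT.
    have := @pdiff_normc_le _ D (fun=> 0) x y 0 xy; rewrite mul0r; apply.
      by move=> v /andP[v1 v2]; apply: dD; apply/andP; split; lra.
    by move=> v _; rewrite Normc.normc0.
  by have [a0|a0] := leP 0 a; [apply: Deq|apply/esym/Deq => //; exact: ltW].
by move: Dc; rewrite /D add0r addr0.
Qed.

Lemma cint_sum n (g : 'I_n -> R -> R[i]) (a b : R) : a <= b ->
  (forall i x, pcont (g i) x) ->
  cint (fun x => \sum_(i < n) g i x) a b = \sum_(i < n) cint (g i) a b /\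
  forall x, pcont (fun x => \sum_(i < n) g i x) x.
Proof.
move=> ab; elim: n g => [|n IH] g cg.
  rewrite big_ord0; split => [|x].
    rewrite (@cint_ext _ _ (fun=> 0)) => [|x _]; last by rewrite big_ord0.
    by rewrite cint_cst// mul0r.
  apply: contat_near (contat_cst (real_complex R) 0 x) _.
  by exists 1 => // y _; rewrite big_ord0.
have [I1 I2] := IH (fun i => g (widen_ord (leqnSn n) i)) (fun i => cg _).
have E x : \sum_(i < n.+1) g i x =
    (\sum_(i < n) g (widen_ord (leqnSn n) i) x) + g ord_max x by rewrite big_ord_recr.
split => [|x].
  rewrite (@cint_ext _ _ (fun x => (\sum_(i < n) g (widen_ord (leqnSn n) i) x) + g ord_max x));
    last by move=> x _; exact: E.
  by rewrite cintD// I1 big_ord_recr.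
apply: contat_near (contatD (I2 x) (cg ord_max x)) _.
by exists 1 => // y _; rewrite E.
Qed.

(** Averaged over the angle [a], all summands have the same mean, that of Y on the circle; some
    angle does at least as well. *)
Lemma exists_rotation n (th : 'I_n.+1 -> R) Y (s v : R) :
  (forall w, normc w = expR s -> ccont Y w) -> 2 * pi * v < Re (circint Y s) ->
  exists a, n.+1%:R * v < \sum_(i < n.+1) Re (Y (ray s (th i + a))).
Proof.
move=> cY vY; apply: contrapT => na.
pose g i t := Y (ray s (th i + t)).
have cg i x : pcont (g i) x.
  rewrite /g => e e0; have [d d0 H] := circint_cont (th i + x) cY e0.
  exists d => // y yx; apply: H; have -> : th i + y - (th i + x) = y - x by ring.
  exact: yx.
have [I1 I2] := cint_sum (a := 0) (b := 2 * pi) pi2_ge0 cg.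
have := @cint_Re_le R (fun x => \sum_(i < n.+1) g i x) 0 (2 * pi) (n.+1%:R * v) pi2_ge0 (fun x _ => I2 x).
have Re_sum (F : 'I_n.+1 -> R[i]) : Re (\sum_i F i) = \sum_i Re (F i) by rewrite raddf_sum.
rewrite I1 (eq_bigr (fun=> circint Y s)) => [|i _]; last exact: circint_shift.
rewrite sumr_const card_ord raddfMn /= => H.
have {}H : Re (circint Y s) *+ n.+1 <= n.+1%:R * v * (2 * pi - 0).
  by apply: H => x _; rewrite Re_sum leNgt; apply/negP => xv; apply: na; exists x.
move: H; rewrite -[Re _ *+ _]mulr_natl subr0 -mulrA ler_pM2l ?ltr0n// leNgt.
by rewrite mulrC vY.
Qed.

End CircleAverages.

(** * Radial growth and the defect *)

Section RadialGrowth.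
Context {R : realType}.
Implicit Types (z w : R[i]).
Variables (rho : R) (f : R[i] -> R[i]).
Hypotheses (hd : forall z, 1 < normc z < rho -> exists D : R[i], cdiff f z D)
  (h1 : forall z, 1 < normc z < rho -> 1 < normc (f z))
  (hlim : forall e : R, 0 < e -> exists2 dl : R, 0 < dl &
    forall z, 1 < normc z < 1 + dl -> normc (f z) < 1 + e).

Let U := [set w : R[i] | 1 < normc w < rho].
Let oU : copen U. Proof. exact: copen_annulus. Qed.
Let hf : holo U f. Proof. exact: hd. Qed.
Let f0 w : U w -> f w != 0. Proof. exact: exterior_neq0. Qed.
Let Z := lder f.
Let hZ : holo U Z. Proof. exact: holo_lder oU hf f0. Qed.

Variables (b C : R).
Hypotheses (b0 : 0 < b) (br : expR b < rho) (C0 : 0 < C)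
  (ImZ : forall s t, 0 < s <= b -> `|Im (Z (ray s t))| <= C * s)
  (dZC : forall s t D, 0 < s <= b -> cdiff Z (ray s t) D -> normc (D * ray s t) <= C).

Let inU s t : 0 < s <= b -> U (ray s t).
Proof. by move=> /andP[s0 sb]; apply: ray_in => //; apply: le_lt_trans br; rewrite ler_expR. Qed.

Lemma lder_radial s s' t : 0 < s -> s <= s' -> s' <= b ->
  normc (Z (ray s' t) - Z (ray s t)) <= C * (s' - s).
Proof.
move=> s0 ss sb; have rng x : s <= x <= s' -> 0 < x <= b.
  by move=> /andP[? ?]; apply/andP; split; lra.
have dz x : s <= x <= s' -> cdiff Z (ray x t) (cder Z (ray x t)).
  by move=> /rng/inU Ux; apply: cderP; exact: hZ.
apply: (pdiff_normc_le ss (P := fun s => Z (ray s t)) (g := fun x => cder Z (ray x t) * ray x t)).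
  move=> x xs; exact: (@diffat_chain _ _ (real_complex R) Z (fun s => ray s t) x _ _ (dz x xs)
    (pdiff_ray_radial x t)).
by move=> x xs; exact: dZC (rng x xs) (dz x xs).
Qed.

Lemma lder_angular s t t' : 0 < s <= b -> normc (Z (ray s t) - Z (ray s t')) <= C * `|t - t'|.
Proof.
move=> sb; wlog tt : t t' / t' <= t => [H|].
  by have [/H//|/ltW/H] := leP t' t; rewrite normcB distrC.
rewrite ger0_norm ?subr_ge0//.
have dz x : cdiff Z (ray s x) (cder Z (ray s x)) by apply: cderP; apply: hZ; exact: inU.
apply: (pdiff_normc_le tt (P := fun t => Z (ray s t)) (g := fun x => cder Z (ray s x) * ('i%C * ray s x))).
  by move=> x _; exact: diffat_chain (dz x) (pdiff_ray s x).
move=> x _; rewrite mulrCA Normc.normcM normc_i mul1r; exact: dZC sb (dz x).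
Qed.

Lemma pdiff_conj (g : R -> R[i]) x d : pdiff g x d -> pdiff (fun x => conjc (g x)) x (conjc d).
Proof.
move=> [phi [cphi phi0 gE]]; exists (fun h => conjc (phi h)); split.
- move=> e /cphi[dl dl0 H]; exists dl => // y /H.
  by rewrite -[X in X < _ -> _]normc_conj rmorphB.
- by rewrite phi0.
- by move=> h; rewrite gE rmorphD rmorphM /= oppr0.
Qed.

(** The squared modulus of f exp(-q x) along the ray has derivative 2 (Re Z - q) times itself, which
    is nonpositive. *)
Lemma radial_decreasing s1 s t (q : R) : 0 < s1 -> s1 <= s -> s <= b ->
  (forall x, s1 <= x <= s -> Re (Z (ray x t)) <= q) ->
  normc (f (ray s t)) <= expR (q * (s - s1)) * normc (f (ray s1 t)).
Proof.
move=> s10 ss sb Zq.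
have rng x : s1 <= x <= s -> 0 < x <= b by move=> /andP[? ?]; apply/andP; split; lra.
pose E x := cexp ((- q)%:C%C * (x +i* 0)%C).
have dE x : pdiff E x (E x * (- q)%:C%C).
  have := @diffat_chain _ _ (real_complex R) cexp (fun x => (- q)%:C%C * (x +i* 0)%C) x _ _
    (cdiff_cexp _) (diffatZ (- q)%:C%C (pdiff_hline 0 x)).
  by rewrite mulr1.
pose g x := f (ray x t) * E x.
have dg x : s1 <= x <= s -> pdiff g x ((Z (ray x t) - q%:C%C) * g x).
  move=> xs; have Ux := inU t (rng x xs).
  have := diffatM (pdiff_f_radial hd h1 Ux) (dE x).
  congr (pdiff _ _ _); rewrite /g -/Z rmorphN; ring.
have dN x : s1 <= x <= s -> pdiff (fun x => g x * conjc (g x)) x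
    ((Z (ray x t) - q%:C%C) * g x * conjc (g x) + g x * conjc ((Z (ray x t) - q%:C%C) * g x)).
  by move=> xs; exact: diffatM (dg x xs) (pdiff_conj (dg x xs)).
have ng x : normc (g x) = normc (f (ray x t)) * expR (- q * x).
  by rewrite Normc.normcM normc_cexp; congr (_ * expR _); simpc.
have sqr (v : R[i]) : Re (v * conjc v) = normc v ^+ 2.
  by rewrite normc_sqr; case: v => x y; simpc; rewrite /= !expr2; ring.
have := @pdiff_Re_le R _ _ s1 s 0 ss dN; rewrite mul0r raddfB /= !sqr => H.
have {}H : normc (g s) ^+ 2 - normc (g s1) ^+ 2 <= 0.
  apply: H => x xs; have Zx := Zq x xs; rewrite raddfD /= -mulrA.
  have -> : Re ((Z (ray x t) - q%:C%C) * (g x * conjc (g x))) = (Re (Z (ray x t)) - q) * normc (g x) ^+ 2.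
    by rewrite normc_sqr; case: (Z _) (g x) => a c [u v]; simpc; rewrite /= !expr2; ring.
  have -> : Re (g x * conjc ((Z (ray x t) - q%:C%C) * g x)) = (Re (Z (ray x t)) - q) * normc (g x) ^+ 2.
    by rewrite normc_sqr; case: (Z _) (g x) => a c [u v]; simpc; rewrite /= !expr2; ring.
  have : (Re (Z (ray x t)) - q) * normc (g x) ^+ 2 <= 0.
    by rewrite mulr_le0_ge0 ?sqr_ge0// subr_le0.
  lra.
move: H; rewrite subr_le0 ler_pXn2r ?nnegrE ?normc_ge0// !ng => H.
have -> : expR (q * (s - s1)) * normc (f (ray s1 t)) =
    expR (q * s) * (normc (f (ray s1 t)) * expR (- q * s1)).
  by rewrite [RHS]mulrCA -expRD mulrC; congr (_ * expR _); ring.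
apply: le_trans (ler_wpM2l (expR_ge0 (q * s)) H).
rewrite mulrCA -expRD; have -> : q * s + - q * s = 0 by ring.
by rewrite expR0 mulr1.
Qed.

(** log |f| starts from limit 0 at the unit circle and grows at rate Re Z, which on the whole ray up
    to s0 is at most Re Z(ray s0 t) + C s0 by the Lipschitz bound. The starting radius [x] is sent
    to the circle. *)
Lemma growth s s0 t : 0 < s -> s <= s0 -> s0 <= b ->
  normc (f (ray s t)) <= expR (s * (Re (Z (ray s0 t)) + C * s0)).
Proof.
move=> s_0 ss sb; set q := Re _ + _.
have s00 : 0 < s0 by exact: lt_le_trans ss.
have Zq x : 0 < x -> x <= s -> Re (Z (ray x t)) <= q.
  move=> x0 xs; have := lder_radial t x0 (le_trans xs ss) sb.
  move/(le_trans (normc_Re _)); rewrite raddfB /= ler_norml => /andP[h _].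
  have : 0 <= C * x by rewrite mulr_ge0// ltW.
  rewrite /q; move: h; lra.
have fs0 : 0 < normc (f (ray s t)).
  by rewrite normc_gt0 f0//; apply: inU; rewrite s_0 (le_trans ss).
rewrite -[leLHS]lnK// ler_expR; apply/ler_addgt0Pr => e e0.
have e20 : 0 < e / 2 by rewrite divr_gt0.
have [dl dl0 H] := hlim e20.
pose x := Num.min (Num.min s (ln (1 + dl / 2))) (e / 2 / (`|q| + 1)).
have q10 : 0 < `|q| + 1 by rewrite ltr_wpDl.
have x0 : 0 < x by rewrite !lt_min s_0 ln_gt0 ?divr_gt0// ltrDl divr_gt0.
have [x1 [x2 x3]] : x <= s /\ x <= ln (1 + dl / 2) /\ x <= e / 2 / (`|q| + 1).
  by rewrite /x !ge_min !lexx !orbT.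
have rr := @radial_decreasing x s t q x0 x1 (le_trans ss sb) (fun y yx =>
  Zq y (lt_le_trans x0 (andP yx).1) (andP yx).2).
rewrite -ler_expR lnK//; apply: le_trans rr _.
have fx : normc (f (ray x t)) <= expR (e / 2).
  apply: le_trans (ltW (H _ _)) (expR_ge1Dx _).
  rewrite normc_ray expR_gt1 x0 /=; apply: (@le_lt_trans _ _ (1 + dl / 2)); last by lra.
  by rewrite -[leRHS]lnK ?ler_expR// posrE; lra.
apply: le_trans (ler_wpM2l (expR_ge0 _) fx) _; rewrite -expRD ler_expR.
have : - q * x <= e / 2.
  rewrite ler_pdivlMr// in x3; apply: le_trans x3.
  rewrite [leRHS]mulrC ler_wpM2r ?(ltW x0)//.
  by have := ler_norm (- q); rewrite normrN; lra.
lra.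
Qed.

Lemma Re_lder_gt0 s t : 0 < s <= b -> 0 < Re (Z (ray s t)) + C * s.
Proof.
move=> /andP[s0 sb]; have := growth t s0 (lexx s) sb.
have : 1 < normc (f (ray s t)) by apply: h1; apply: inU; rewrite s0.
move=> /lt_le_trans/[apply]; rewrite expR_gt1.
by rewrite pmulr_rgt0.
Qed.

(* Independent of s, by Cauchy's theorem; as s -> 0, Z becomes real on the circle, so that this
   is a squared L^2 norm. *)
Definition defect s := circint (fun w => (Z w - 1) ^+ 2) s.

Lemma Zsqr_cont s w : 0 < s <= b -> normc w = expR s -> ccont (fun w => (Z w - 1) ^+ 2) w.
Proof.
move=> /andP[s0 sb] ws; apply: contatX; apply: contatB; last exact: contat_cst.
apply: (holo_cont hZ); rewrite /U /= ws expR_gt1 s0 /=.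
by apply: le_lt_trans br; rewrite ler_expR.
Qed.

Lemma defect_const s s' : 0 < s -> s <= s' -> s' <= b -> defect s = defect s'.
Proof.
move=> s0 ss sb; apply: circint_const => // w /andP[w1 w2].
have Uw : U w.
  rewrite /U /= (lt_le_trans _ w1) ?expR_gt1//=.
  by apply: le_lt_trans w2 (le_lt_trans _ br); rewrite ler_expR.
have [D dD] := hZ Uw; eexists.
exact: cdiffX 2 (diffatB dD (diffat_cst idfun 1 w)).
Qed.

Let Re_sqr (v : R[i]) : Re ((v - 1) ^+ 2) = normc (v - 1) ^+ 2 - 2 * Im v ^+ 2.
Proof. by rewrite normc_sqr; case: v => x y; rewrite !expr2; simpc; rewrite /=; ring. Qed.

(** Re (Z - 1)^2 is |Z - 1|^2 - 2 (Im Z)^2, and Im Z is at most C s: an arc where |Z - 1| is large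
    cannot be compensated elsewhere. *)
Lemma defect_ge s (l ep : R) : 0 < s <= b -> 0 <= l <= 2 * pi ->
  (exists t0, forall t, 0 <= t <= l -> ep <= normc (Z (ray s (t0 + t)) - 1) ^+ 2) ->
  l * ep - 2 * (2 * pi) * (C * s) ^+ 2 <= Re (defect s).
Proof.
move=> sb /andP[l0 lp] [t0 tl].
have cY w : normc w = expR s -> ccont (fun w => (Z w - 1) ^+ 2) w by exact: Zsqr_cont.
rewrite /defect -(@circint_shift _ _ s t0 cY).
have cg x : pcont (fun t => (Z (ray s (t0 + t)) - 1) ^+ 2) x.
  move=> e e0; have [d d0 H] := circint_cont (t0 + x) cY e0.
  exists d => // y yx; apply: H; have -> : t0 + y - (t0 + x) = y - x by ring.
  exact: yx.
have cgN x : pcont (fun t => - (Z (ray s (t0 + t)) - 1) ^+ 2) x by exact: contatN.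
have Im2 t : Im (Z (ray s t)) ^+ 2 <= (C * s) ^+ 2.
  rewrite -real_normK ?num_real// lerXn2r ?nnegrE ?ImZ//.
  by rewrite mulr_ge0 ?(ltW C0)//; case/andP: sb => /ltW.
have cs0 : 0 <= (C * s) ^+ 2 by exact: sqr_ge0.
rewrite (@cint_split R _ 0 l (2 * pi)); last 2 first.
- by rewrite l0.
- by move=> x _; exact: cg.
have neg a c : a <= c -> cint (fun t => - (Z (ray s (t0 + t)) - 1) ^+ 2) a c =
    - cint (fun t => (Z (ray s (t0 + t)) - 1) ^+ 2) a c.
  move=> ac; have := @cintZ R (-1) (fun t => (Z (ray s (t0 + t)) - 1) ^+ 2) a c ac (fun x _ => cg x).
  by rewrite mulN1r => <-; apply: cint_ext => x _; rewrite mulN1r.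
have B1 := @cint_Re_le R _ 0 l (2 * (C * s) ^+ 2 - ep) l0 (fun x _ => cgN x).
have B2 := @cint_Re_le R _ l (2 * pi) (2 * (C * s) ^+ 2) lp (fun x _ => cgN x).
rewrite neg// raddfN /= subr0 in B1; rewrite neg// raddfN /= in B2.
have {}B1 := B1 _; have {}B2 := B2 _.
have {}B1 : - Re (cint (fun t => (Z (ray s (t0 + t)) - 1) ^+ 2) 0 l) <= (2 * (C * s) ^+ 2 - ep) * l.
  apply: B1 => x xl; rewrite raddfN /= Re_sqr.
  have := tl x xl; have := Im2 (t0 + x); lra.
have {}B2 : - Re (cint (fun t => (Z (ray s (t0 + t)) - 1) ^+ 2) l (2 * pi)) <= 2 * (C * s) ^+ 2 * (2 * pi - l).
  apply: B2 => x xl; rewrite raddfN /= Re_sqr.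
  have := Im2 (t0 + x); have := sqr_ge0 (normc (Z (ray s (t0 + x)) - 1)); lra.
rewrite raddfD /=.
move: B1 B2; set I1 := Re _; set I2 := Re _; set q := (C * s) ^+ 2.
lra.
Qed.

(** [defect_ge] with an empty arc bounds the defect below by a multiple of -s^2; as the defect does
    not depend on s, s is sent to 0. *)
Lemma defect_ge0 s : 0 < s <= b -> 0 <= Re (defect s).
Proof.
move=> /andP[s0 sb]; apply/ler_addgt0Pr => e e0.
pose M := 2 * (2 * pi) * C ^+ 2 * b.
have M0 : 0 < M by rewrite !mulr_gt0 ?pi_gt0 ?exprn_gt0.
pose x := Num.min s (e / M).
have [x1 x2] : x <= s /\ x <= e / M by rewrite /x !ge_min !lexx orbT.
have x0 : 0 < x by rewrite lt_min s0 divr_gt0.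
rewrite -(defect_const x0 x1 sb).
have xb : 0 < x <= b by rewrite x0 (le_trans x1).
have := @defect_ge x 0 0 xb; rewrite lexx (ltW (pi2_gt0)) mul0r sub0r => /(_ isT) H.
have {}H : - (2 * (2 * pi) * (C * x) ^+ 2) <= Re (defect x).
  by apply: H; exists 0 => t _; exact: sqr_ge0.
have : 2 * (2 * pi) * (C * x) ^+ 2 <= e.
  have -> : 2 * (2 * pi) * (C * x) ^+ 2 = 2 * (2 * pi) * C ^+ 2 * x * x by ring.
  apply: (@le_trans _ _ (M * x)).
    rewrite /M; apply: (ler_wpM2r (ltW x0)); apply: ler_wpM2l; last by case/andP: xb.
    apply: mulr_ge0; last exact: sqr_ge0.
    by apply: mulr_ge0; [exact: ler0n|exact: ltW (pi2_gt0)].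
  by rewrite mulrC -ler_pdivlMr.
lra.
Qed.

(* As s -> 0, Z is nearly real on the circle, so that a vanishing defect forces Z -> 1. *)
Lemma defect_eq0 : Re (defect b) <= 0 -> forall e : R, 0 < e ->
  exists2 d : R, 0 < d <= b & forall s t, 0 < s <= d -> normc (Z (ray s t) - 1) < e.
Proof.
(* On an arc of this length Z varies by at most e / 2, so one point with |Z - 1| >= e spoils the
   whole arc. *)
move=> d0 e e0; pose l := Num.min (e / (2 * C)) pi.
have l0 : 0 < l by rewrite lt_min pi_gt0 divr_gt0// mulr_gt0.
have [l1 l2] : l <= e / (2 * C) /\ l <= pi by rewrite /l !ge_min !lexx orbT.
pose A := l * (e / 2) ^+ 2; have A0 : 0 < A by rewrite mulr_gt0// exprn_gt0// divr_gt0.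
pose M := 2 * (2 * pi) * C ^+ 2 * b.
have M0 : 0 < M by rewrite !mulr_gt0 ?pi_gt0 ?exprn_gt0.
exists (Num.min b (A / M / 2)).
  by rewrite lt_min b0 ge_min lexx !divr_gt0.
move=> s t /andP[s0]; rewrite le_min => /andP[sb sA].
have sbb : 0 < s <= b by rewrite s0.
rewrite ltNge; apply/negP => Ze.
have lp : 0 <= l <= 2 * pi by apply/andP; split; [exact: ltW|have := pi_gt0 R; lra].
have := @defect_ge s l ((e / 2) ^+ 2) sbb lp; rewrite (defect_const s0 sb (lexx b)) => H.
have {}H : l * (e / 2) ^+ 2 - 2 * (2 * pi) * (C * s) ^+ 2 <= Re (defect b).
  apply: H; exists t => x /andP[x0 xl].
  have e2 : 0 <= e / 2 by rewrite divr_ge0// ltW.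
  rewrite lerXn2r ?nnegrE ?normc_ge0//.
  have := lder_angular (t + x) t sbb; rewrite [t + x]addrC addrK ger0_norm// => Lx.
  have Cx : C * x <= e / 2.
    have : x <= e / (2 * C) by exact: le_trans l1.
    by rewrite invfM mulrA ler_pdivlMr// mulrC.
  have := normc_dist (Z (ray s (x + t))) (Z (ray s t)) 1.
  rewrite [normc (Z (ray s t) - Z _)]normcB; lra.
have : 2 * (2 * pi) * (C * s) ^+ 2 <= A / 2.
  have -> : 2 * (2 * pi) * (C * s) ^+ 2 = 2 * (2 * pi) * C ^+ 2 * s * s by ring.
  apply: (@le_trans _ _ (M * s)).
    rewrite /M; apply: (ler_wpM2r (ltW s0)); apply: (ler_wpM2l _ sb).
    apply: mulr_ge0; last exact: sqr_ge0.
    by apply: mulr_ge0; [exact: ler0n|exact: ltW (pi2_gt0)].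
  have M2 : 0 < M * 2 by apply: mulr_gt0 M0 _.
  move: sA; rewrite -mulrA -invfM (ler_pdivlMr _ _ M2).
  by rewrite [s * _]mulrC mulrAC => sA; rewrite ler_pdivlMr.
move: H; rewrite -/A; lra.
Qed.

End RadialGrowth.

(** * Configurations on the unit circle and their radial displacement *)

Section DiskConfigurations.
Context {R : realType}.

(** [push_boundary] for the identity map moves a configuration of the disk to |w| = s with s > 1.
    Scaling back to the unit circle costs s^(n(n - 1)), covered by the slack l' - l. *)
Lemma disk_config l n : l < lcap [set z : R[i] | normc z <= 1] ->
  exists th : 'I_n -> R, expR (l * (n * n.-1)%:R) <= vdm (fun i => cis (th i)).
Proof.
set D := [set z | _]; move=> lD; pose l' := (l + lcap D) / 2.
have [ll' l'D] : l < l' /\ l' < lcap D by rewrite /l'; split; lra.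
have CD : Cap D = (expR (lcap D))%:E by apply: (@CapE R D 1).
have : ((expR l')%:E < Cap D)%E by rewrite CD lte_fin ltr_expR.
move=> /Cap_has_points[K [cK KD pts]]; have [z [zK zl]] := pts n.
pose s := expR (l' - l); have s1 : 1 < s by rewrite expR_gt1 subr_gt0.
have hd (w : R[i]) : 1 < normc w < s + 1 -> exists E, cdiff (fun w => w) w E.
  by move=> _; exists 1; exact: cdiff_id.
have hlim (e : R) : 0 < e -> exists2 dl : R, 0 < dl &
    forall w : R[i], 1 < normc w < 1 + dl -> normc w < 1 + e.
  by move=> e0; exists e => // w /andP[].
have h1 (w : R[i]) : 1 < normc w < s + 1 -> 1 < normc w by case/andP.
have hinj (w v : R[i]) : 1 < normc w < s + 1 -> 1 < normc v < s + 1 -> w = v -> w = v by [].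
have ss : 1 < s < s + 1 by apply/andP; split; [exact: s1|rewrite ltrDl ltr01].
have [zeta [zs zv]] := push_boundary hd hinj h1 hlim ss (fun i => or_introl (KD _ (zK i))).
have /choice[th thE] : forall i, exists t, zeta i = s%:C%C * cis t.
  by move=> i; have [t E] := cis_polar (zeta i); exists t; rewrite {1}E zs.
exists th; have zE : zeta = (fun i => s%:C%C * cis (th i)) by apply/funext => i; exact: thE.
have s0 : 0 < s := expR_gt0 _.
have := le_trans zl zv; rewrite zE vdmZ normc_real (gtr0_norm s0) /s -expRM_natl.
rewrite -ler_pdivrMl ?expR_gt0// -expRN -expRD.
have -> : - ((n * n.-1)%:R * (l' - l)) + l' * (n * n.-1)%:R = l * (n * n.-1)%:R by ring.
by [].
Qed.

(** The difference of the squares is (exp x - exp y)^2. The bound is symmetric in the two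
    displacements, so each x_i enters the product over pairs with the weight n - 1. *)
Lemma ray_dist (x y a b : R) :
  expR ((x + y) / 2) * normc (cis a - cis b) <= normc (ray x a - ray y b).
Proof.
rewrite -(@ler_pXn2r _ 2) ?nnegrE ?mulr_ge0 ?normc_ge0 ?expR_ge0//.
rewrite exprMn !normc_sqr.
have -> : expR ((x + y) / 2) ^+ 2 = expR x * expR y.
  by rewrite -expRM_natl -expRD; congr expR; field.
rewrite /ray /cexp /cis !raddfB /= !mul0r !subr0 !addr0.
have ca := cos2Dsin2 a; have cb := cos2Dsin2 b.
move: (expR x) (expR y) (cos a) (sin a) (cos b) (sin b) ca cb => X Y p q u v ca cb.
have -> : X * p + (- (Y * u) - - 0) = X * p - Y * u by ring.
rewrite -subr_ge0.
have -> : (X * p - Y * u) ^+ 2 + (X * q - Y * v) ^+ 2 - X * Y * ((p - u) ^+ 2 + (q - v) ^+ 2) =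
  X ^+ 2 * (p ^+ 2 + q ^+ 2) + Y ^+ 2 * (u ^+ 2 + v ^+ 2) -
  X * Y * ((p ^+ 2 + q ^+ 2) + (u ^+ 2 + v ^+ 2)) by ring.
rewrite ca cb !mulr1; have -> : X ^+ 2 + Y ^+ 2 - X * Y * (1 + 1) = (X - Y) ^+ 2 by ring.
exact: sqr_ge0.
Qed.

Lemma vdm_ray n (x th : 'I_n -> R) :
  expR (n.-1%:R * \sum_i x i) * vdm (fun i => cis (th i)) <= vdm (fun i => ray (x i) (th i)).
Proof.
have -> : expR (n.-1%:R * \sum_i x i) = \prod_i \prod_(j | j != i) expR ((x i + x j) / 2).
  under [RHS]eq_bigr do rewrite -expR_sum.
  rewrite -expR_sum; congr expR.
  have E1 : \sum_i \sum_(j < n | j != i) x i = n.-1%:R * \sum_i x i.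
    rewrite mulr_sumr; apply: eq_bigr => i _.
    by rewrite sumr_const -[in RHS](card_ord n) -(cardC1 i) mulr_natl.
  have E2 : \sum_i \sum_(j < n | j != i) x j = n.-1%:R * \sum_i x i.
    rewrite -E1 (exchange_big_dep xpredT)//=; apply: eq_bigr => i _.
    by apply: eq_bigl => j; rewrite eq_sym.
  apply/esym; rewrite (eq_bigr (fun i => \sum_(j < n | j != i) x i / 2 + \sum_(j < n | j != i) x j / 2)).
    have half (g : 'I_n -> 'I_n -> R) : \sum_i \sum_(j < n | j != i) g i j / 2 =
        (\sum_i \sum_(j < n | j != i) g i j) / 2.
      by rewrite mulr_suml; apply: eq_bigr => i _; rewrite mulr_suml.
    by rewrite big_split /= (half (fun i _ => x i)) (half (fun _ j => x j)) E1 E2 -splitr.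
  by move=> i _; rewrite -big_split; apply: eq_bigr => j _; rewrite /= -mulrDl.
rewrite /vdm -big_split /=; apply: ler_prod => i _; rewrite -big_split /= prodr_ge0 /=.
  by apply: ler_prod => j _; rewrite mulr_ge0 ?expR_ge0 ?normc_ge0 ?ray_dist.
by move=> j _; rewrite mulr_ge0 ?expR_ge0 ?normc_ge0.
Qed.

Lemma vdm_rot n (th : 'I_n -> R) (a : R) :
  vdm (fun i => cis (th i + a)) = vdm (fun i => cis (th i)).
Proof.
have -> : (fun i => cis (th i + a)) = (fun i => cis a * cis (th i)).
  by apply/funext => i; rewrite addrC cisD.
by rewrite vdmZ normc_cis expr1n mul1r.
Qed.

(** A holomorphic function that is arbitrarily small on circles near the unit circle vanishes: let A
    tend to -oo in the three circles theorem. *)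
Lemma three_circles_zero F (b x t : R) : 0 < x -> x < b ->
  (forall z, 1 < normc z <= expR b -> exists D, cdiff F z D) ->
  (forall A : R, exists a, [/\ 0 < a, a < x & forall z, normc z = expR a -> normc (F z) <= expR A]) ->
  F (ray x t) = 0.
Proof.
move=> x0 xb dF Fsmall.
have cF z : [set z | expR b <= normc z <= expR b] z -> ccont F z.
  rewrite /= => /andP[z1 z2]; have [|D] := dF z; last exact: diffat_cont.
  by rewrite z2 (lt_le_trans _ z1)// expR_gt1 (lt_trans x0).
have [|c _ cmax] := @compact_normc_max R _ F (ray b 0) (@compact_annulus R (expR b) (expR b)) _ cF.
  by rewrite /= normc_ray lexx.
pose B := ln (normc (F c) + 1).
have B0 : 0 <= B by rewrite ln_ge0// lerDr normc_ge0.
have FB z : normc z = expR b -> normc (F z) <= expR B.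
  move=> zb; have := cmax z; rewrite /= zb lexx => /(_ isT).
  by rewrite lnK ?posrE ?ltr_wpDl ?normc_ge0//; lra.
apply/eqP; rewrite -normc_eq0; apply/eqP/le_anti; rewrite normc_ge0 andbT.
rewrite leNgt; apply/negP => F0.
have b0 : 0 < b by lra.
have bx : 0 < b - x by rewrite subr_gt0.
pose u := ln (normc (F (ray x t))).
(* So low that, for every inner radius a < x, the three-circles bound for the logarithm [u] becomes
   u <= u - 1. *)
pose A := Num.min 0 ((u - B - 1) * b / (b - x)).
have [A1 A2] : A <= 0 /\ A <= (u - B - 1) * b / (b - x) by rewrite /A !ge_min !lexx orbT.
have [a [a0 ax FA]] := Fsmall A.
have ba : 0 < b - a by lra.
have := @three_circles R F a b A B _ _ FA FB (ray x t) x (normc_ray x t) _.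
move=> H; have {}H : normc (F (ray x t)) <= expR (((b - x) * A + (x - a) * B) / (b - a)).
  apply: H; [lra| |by apply/andP; split; lra].
  move=> z /andP[z1 z2]; apply: dF; rewrite z2 andbT.
  by apply: lt_le_trans z1; rewrite expR_gt1.
move: H; rewrite -(lnK F0) ler_expR -/u ler_pdivlMr// => H.
have H1 : (x - a) * B <= (b - a) * B by rewrite ler_wpM2r//; lra.
have H2 : (b - x) * A <= (b - a) * (u - B - 1).
  rewrite ler_pdivlMr// in A2; apply: (@le_trans _ _ ((b - a) / b * (A * (b - x)))).
    have : (b - a) / b <= 1 by rewrite ler_pdivrMr// mul1r; lra.
    have : A * (b - x) <= 0 by rewrite mulr_le0_ge0// ltW.
    rewrite [(b - x) * A]mulrC; move: (A * (b - x)) ((b - a) / b) => p q p0 q1.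
    have : 0 <= (1 - q) * - p by rewrite mulr_ge0 ?oppr_ge0 ?subr_ge0.
    lra.
  have -> : (b - a) * (u - B - 1) = (b - a) / b * ((u - B - 1) * b) by field; rewrite gt_eqF.
  by rewrite ler_wpM2l// divr_ge0 ?ltW.
have : (b - a) * 1 <= 0 by lra.
by rewrite mulr1 leNgt ba.
Qed.

End DiskConfigurations.

Section Inverse.
Context {R : realType}.
Variables (rho : R) (f : R[i] -> R[i]).
Implicit Types (z w : R[i]).
Hypotheses (rho1 : 1 < rho) (hd : forall z, 1 < normc z < rho -> exists D : R[i], cdiff f z D)
  (hinj : forall z w, 1 < normc z < rho -> 1 < normc w < rho -> f z = f w -> z = w)
  (h1 : forall z, 1 < normc z < rho -> 1 < normc (f z))
  (hlim : forall e : R, 0 < e -> exists2 dl : R, 0 < dl &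
    forall z, 1 < normc z < 1 + dl -> normc (f z) < 1 + e).

(** A point w lies in [Om f (expR tau)] when |k w| < exp tau, so upper bounds for |k| show that the
    set is large. [k] satisfies the same conditions as [f], hence all the estimates above. *)
Lemma inverse_exterior : exists (m : R) (k : R[i] -> R[i]), [/\ 1 < m,
  forall w, 1 < normc w < m -> exists D : R[i], cdiff k w D,
  forall w v, 1 < normc w < m -> 1 < normc v < m -> k w = k v -> w = v,
  forall w, 1 < normc w < m -> 1 < normc (k w) < rho /\ f (k w) = w &
  forall e : R, 0 < e -> exists2 dl : R, 0 < dl &
    forall w, 1 < normc w < 1 + dl -> normc (k w) < 1 + e].
Proof.
have r1 := rho1; pose s := (1 + rho) / 2; have sr : 1 < s < rho by rewrite /s; apply/andP; split; lra.
have [m m1 fm] := circle_min hd h1 sr; have /andP[s1 s2] := sr.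
pose k w := xget 0 [set z | 1 < normc z < rho /\ f z = w].
have kf z : 1 < normc z < rho -> k (f z) = z.
  move=> zr; rewrite /k; case: xgetP => [v _ [vr fv]|/(_ z)]; first exact: hinj fv.
  by case; split.
have ring := ring_image hd h1 hlim.
have img w : 1 < normc w < m -> exists2 z, 1 < normc z < rho & f z = w.
  move=> wm; have [z /andP[z1 zs] fz] := ring s m w sr m1 fm wm; exists z => //.
  by rewrite z1 (lt_trans zs).
exists m, k; split => //.
- move=> w /img[z zr <-].
  have [D _ dD] := @inverse_cdiff R [set z | 1 < normc z < rho] f (@copen_annulus R 1 rho)
    hd hinj k z kf zr.
  by exists D.
- by move=> w v /img[z zr <-] /img[y yr <-]; rewrite !kf// => ->.
- by move=> w /img[z zr <-]; rewrite kf.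
move=> e e0; pose e' := Num.min e ((rho - 1) / 2).
have [e1 e2] : e' <= e /\ e' <= (rho - 1) / 2 by rewrite /e' !ge_min !lexx orbT.
have e'0 : 0 < e' by rewrite lt_min e0; lra.
have er : 1 < 1 + e' < rho by apply/andP; split; lra.
have [m' m'1 fm'] := circle_min hd h1 er.
exists (m' - 1); first by rewrite subr_gt0.
move=> w; rewrite addrC subrK => wm'.
have [z /andP[z1 zs] <-] := ring (1 + e') m' w er m'1 fm' wm'.
rewrite kf; first by lra.
by rewrite z1 /=; lra.
Qed.

End Inverse.

(** * Growth of the capacity *)

Section Slope.
Context {R : realType}.
Implicit Types (z w : R[i]).
Variables (rho m : R) (f k : R[i] -> R[i]).
Hypotheses (hd : forall z, 1 < normc z < m -> exists D : R[i], cdiff k z D)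
  (hinj : forall z w, 1 < normc z < m -> 1 < normc w < m -> k z = k w -> z = w)
  (h1 : forall z, 1 < normc z < m -> 1 < normc (k z))
  (hlim : forall e : R, 0 < e -> exists2 dl : R, 0 < dl &
    forall z, 1 < normc z < 1 + dl -> normc (k z) < 1 + e)
  (fk : forall w, 1 < normc w < m -> f (k w) = w).

Let U := [set w : R[i] | 1 < normc w < m].
Let oU : copen U. Proof. exact: copen_annulus. Qed.
Let hk : holo U k. Proof. exact: hd. Qed.
Let k0 w : U w -> k w != 0. Proof. exact: exterior_neq0. Qed.
Let Z := lder k.
Let hZ : holo U Z. Proof. exact: holo_lder oU hk k0. Qed.

Variables (b C : R).
Hypotheses (b0 : 0 < b) (br : expR b < m) (C0 : 0 < C)
  (ImZ : forall s t, 0 < s <= b -> `|Im (Z (ray s t))| <= C * s)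
  (dZC : forall s t D, 0 < s <= b -> cdiff Z (ray s t) D -> normc (D * ray s t) <= C).

Let inU s t : 0 < s <= b -> U (ray s t).
Proof. by move=> /andP[s0 sb]; apply: ray_in => //; apply: le_lt_trans br; rewrite ler_expR. Qed.

(* With q = Re Z + kap, the real part is at most 2 - q + lam (q - 1)^2, which is at most 1/q
   as long as lam q <= 1; kap absorbs the variation of Z between the circles. *)
Definition profile (kap lam : R) w : R[i] :=
  (2 - kap)%:C%C - Z w + lam%:C%C * (Z w - 1 + kap%:C%C) ^+ 2.

Lemma Zcont s w : 0 < s <= b -> normc w = expR s -> ccont Z w.
Proof.
move=> /andP[s0 sb] ws; apply: (holo_cont hZ); rewrite /U /= ws expR_gt1 s0 /=.
by apply: le_lt_trans br; rewrite ler_expR.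
Qed.

Lemma profile_cont kap lam s w : 0 < s <= b -> normc w = expR s -> ccont (profile kap lam) w.
Proof.
move=> sb ws; have cZ := Zcont sb ws.
apply: contatD; first by apply: contatB cZ; exact: contat_cst.
apply: contatM; first exact: contat_cst.
apply: contatX; apply: contatD; last exact: contat_cst.
by apply: contatB cZ _; exact: contat_cst.
Qed.

(** The minorant is quadratic in Z because these means are known: [degree] gives that of Z, and
    [defect] that of (Z - 1)^2. *)
Lemma circint_profile kap lam s : 0 < s <= b ->
  Re (circint (profile kap lam) s) =
  2 * pi * (1 - kap + lam * kap ^+ 2) + lam * Re (defect k s).
Proof.
move=> sb; have /andP[s0 sb'] := sb.
have cZ w : normc w = expR s -> ccont Z w by exact: Zcont sb.
have c2 w : normc w = expR s -> ccont (fun w => (Z w - 1) ^+ 2) w.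
  by move=> ws; apply: contatX; apply: contatB (cZ w ws) _; exact: contat_cst.
pose a : R := 2 - kap - 2 * lam * kap + lam * kap ^+ 2.
pose c : R := 2 * lam * kap - 1.
have cc w : normc w = expR s -> ccont (fun w => c%:C%C * Z w) w.
  by move=> ws; apply: contatM (cZ w ws); exact: contat_cst.
have cl w : normc w = expR s -> ccont (fun w => lam%:C%C * (Z w - 1) ^+ 2) w.
  by move=> ws; apply: contatM (c2 w ws); exact: contat_cst.
have -> : circint (profile kap lam) s =
    a%:C%C * (2 * pi)%:C%C + c%:C%C * (2 * pi)%:C%C + lam%:C%C * defect k s.
  have deg := @degree R m k hd hinj h1 hlim s s0.
  rewrite -[X in X + _ + _](circint_cst _ s).
  have -> : c%:C%C * (2 * pi)%:C%C = circint (fun w => c%:C%C * Z w) s.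
    rewrite -deg ?(le_lt_trans _ br) ?ler_expR//.
    by apply/esym; apply: cintZ; [exact: ltW (pi2_gt0)|move=> t _; exact: circint_cont].
  have -> : lam%:C%C * defect k s = circint (fun w => lam%:C%C * (Z w - 1) ^+ 2) s.
    by apply/esym; apply: cintZ; [exact: ltW (pi2_gt0)|move=> t _; exact: circint_cont c2].
  rewrite -circintD; [|by move=> w _; exact: contat_cst|exact: cc].
  rewrite -circintD; [|by move=> w ws; apply: contatD (cc w ws); exact: contat_cst|exact: cl].
  apply: circint_ext => w _; rewrite /profile /a /c.
  rewrite !rmorphD !rmorphN !rmorphM /= !rmorphD /=; ring.
have ReD (u v : R[i]) : Re (u + v) = Re u + Re v by case: u; case: v.
have Rer (x y : R) : Re (x%:C%C * y%:C%C) = x * y by simpc.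
have Rel (x : R) v : Re (x%:C%C * v) = x * Re v by case: v => p q; simpc.
by rewrite !ReD !Rer Rel /a /c; ring.
Qed.

(** A configuration of the unit circle, rotated by [a], is moved out to radii exp(tau / q). There
    [growth] keeps |k| below exp tau, strictly because del > 0, so the points lie in
    [Om f (expR tau)]. [vdm_ray] and the minorant of 1/q, averaged over rotations, give the gain tau
    v. *)
Lemma slope_points (s0 del tau lam v M l : R) : 0 < s0 -> s0 <= b -> 0 < del ->
  0 < tau -> tau <= s0 * del -> 0 <= lam -> lam * M <= 1 ->
  (forall t, Re (Z (ray s0 t)) + (C * s0 + del) <= M) ->
  2 * pi * v < 2 * pi * (1 - (C * s0 + del)) + lam * Re (defect k s0) ->
  l < lcap [set z : R[i] | normc z <= 1] ->
  has_points (Om f (expR tau)) (l + tau * v).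
Proof.
move=> s00 s0b del0 tau0 taus lam0 lamM qM vI lD [|n].
  exists (fun=> 0); split => [[]//|].
  by rewrite mul0n mulr0 expR0 /vdm big_ord0.
have s0r : 0 < s0 <= b by rewrite s00.
set kap := C * s0 + del in qM vI *.
have pi0 := pi2_gt0 (R := R).
have vI' : 2 * pi * v < Re (circint (profile kap lam) s0).
  rewrite circint_profile//; apply: lt_le_trans vI _.
  have : 0 <= 2 * pi * (lam * kap ^+ 2).
    by apply: mulr_ge0; [exact: ltW|apply: mulr_ge0 lam0 _; exact: sqr_ge0].
  by rewrite -subr_ge0 => h; rewrite -subr_ge0; apply: le_trans h _; rewrite le_eqVlt;
     apply/orP; left; apply/eqP; ring.
have [th thl] := @disk_config R l n.+1 lD.
have [a av] := exists_rotation th (fun w ws => profile_cont kap lam s0r ws) vI'.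
pose q t := Re (Z (ray s0 t)) + kap.
have qdel t : del < q t.
  by have := Re_lder_gt0 hd h1 hlim br C0 dZC t s0r; rewrite -/Z /q /kap; lra.
have q0 t : 0 < q t by exact: lt_trans (qdel t).
(* It stays below s0, where the bounds on Z hold, because tau <= s0 del and del < q. *)
pose sg t := tau / q t.
have sg0 t : 0 < sg t by rewrite divr_gt0.
have sgs t : sg t <= s0.
  rewrite ler_pdivrMr//; apply: le_trans taus _.
  by rewrite ler_pM2l// ltW.
have sgp t : tau * Re (profile kap lam (ray s0 t)) <= sg t.
  rewrite /sg ler_pM2l//.
  have P1 : Re (profile kap lam (ray s0 t)) <= 2 - q t + lam * (q t - 1) ^+ 2.
    rewrite /profile /q; case: (Z _) => x y.
    have -> : Re ((2 - kap)%:C%C - (x +i* y)%C + lam%:C%C * ((x +i* y)%C - 1 + kap%:C%C) ^+ 2) =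
        2 - (x + kap) + lam * ((x + kap - 1) ^+ 2 - y ^+ 2).
      by rewrite !expr2; simpc; rewrite /=; ring.
    have : 0 <= lam * y ^+ 2 by rewrite mulr_ge0 ?sqr_ge0.
    rewrite /= mulrBr; lra.
  apply: le_trans P1 _.
  have qm : lam * q t <= 1 by apply: le_trans lamM; rewrite ler_wpM2l// qM.
  rewrite -[leRHS]mul1r ler_pdivlMr//.
  have : 0 <= (1 - lam * q t) * (q t - 1) ^+ 2 by rewrite mulr_ge0 ?sqr_ge0// subr_ge0.
  have -> : (1 - lam * q t) * (q t - 1) ^+ 2 =
    1 - (2 - q t + lam * (q t - 1) ^+ 2) * q t by ring.
  by rewrite subr_ge0.
pose th' i := th i + a; pose x i := sg (th' i).
exists (fun i => ray (x i) (th' i)); split=> [i|].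
  have xb : 0 < x i <= b by rewrite sg0 (le_trans (sgs _)).
  have Ux := inU (th' i) xb.
  right; exists (k (ray (x i) (th' i))); last exact: fk.
  rewrite h1//=; apply: le_lt_trans (growth hd h1 hlim br C0 dZC (th' i) (sg0 _) (sgs _) s0b) _.
  rewrite ltr_expR -/Z; have -> : tau = x i * q (th' i) by rewrite /x /sg divfK// gt_eqF.
  by rewrite ltr_pM2l ?sg0// /q /kap; lra.
apply: le_trans (vdm_ray x th').
rewrite vdm_rot; apply: le_trans (ler_wpM2l (expR_ge0 _) thl).
rewrite -expRD ler_expR mulrDl addrC lerD2r natrM /= mulrA [X in _ <= X]mulrC.
apply: ler_wpM2r => //.
have -> : tau * v * n.+1%:R = tau * (n.+1%:R * v) by ring.
apply: le_trans (ler_wpM2l (ltW tau0) (ltW av)) _.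
by rewrite mulr_sumr; apply: ler_sum => i _; exact: sgp.
Qed.

Lemma lder_bounded : exists2 B : R, 0 < B &
  forall s t, 0 < s <= b -> normc (Z (ray s t)) <= B.
Proof.
have cZ w : [set w | expR b <= normc w <= expR b] w -> ccont Z w.
  rewrite /= -eq_le => /eqP/esym wb; apply: Zcont wb; by rewrite b0 lexx.
have [|c _ cmax] := @compact_normc_max R _ Z (ray b 0) (@compact_annulus R (expR b) (expR b)) _ cZ.
  by rewrite /= normc_ray lexx.
have Cb : 0 < C * b by rewrite mulr_gt0.
exists (normc (Z c) + C * b) => [|s t /andP[s0 sb]]; first by have := normc_ge0 (Z c); lra.
have h := lder_radial hd h1 br dZC t s0 sb (lexx b).
have h2 : normc (Z (ray b t)) <= normc (Z c) by apply: cmax; rewrite /= normc_ray lexx.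
have := normc_tri (Z (ray b t)) (Z (ray b t) - Z (ray s t)).
rewrite opprB addrC subrK => h3.
have : C * (b - s) <= C * b by rewrite ler_pM2l//; lra.
rewrite -/Z in h; lra.
Qed.

(* When the defect vanishes, Z = w k'/k is identically 1 near the unit circle. *)
Lemma defect_rotation : Re (defect k b) <= 0 ->
  exists2 c : R[i], normc c = 1 & forall s t, 0 < s < b -> k (ray s t) = c * ray s t.
Proof.
move=> d0; have small := defect_eq0 hd h1 b0 br C0 ImZ dZC d0.
have Z1 x t : 0 < x < b -> Z (ray x t) = 1.
  move=> /andP[x0 xb]; apply/eqP; rewrite -subr_eq0; apply/eqP.
  apply: (@three_circles_zero R (fun w => Z w - 1) b x t x0 xb) => [z /andP[z1 z2]|A].
    have [|D dD] := hZ (z := z); first by rewrite /U /= z1 (le_lt_trans z2).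
    by eexists; exact: diffatB dD (diffat_cst idfun 1 z).
  have [d /andP[dp db] H] := small (expR A) (expR_gt0 A).
  exists (Num.min d (x / 2)).
  have [d1 d2] : Num.min d (x / 2) <= d /\ Num.min d (x / 2) <= x / 2.
    by rewrite !ge_min !lexx orbT.
  have dp' : 0 < Num.min d (x / 2) by rewrite lt_min dp divr_gt0.
  split => //; first lra.
  move=> z za; have [|u zE] := @cexp_polar R z; first by rewrite -normc_gt0 za expR_gt0.
  rewrite za expRK in zE; rewrite zE -/(ray _ u); apply: ltW; apply: H.
  by rewrite dp'.
pose g w := k w / w.
have dgr s t : 0 < s < b -> pdiff (fun s => g (ray s t)) s 0.
  move=> sb; have /andP[s0 s1] := sb; have sb' : 0 < s <= b by rewrite s0 ltW.
  have r0 := cexp_neq0 (s +i* t)%C; rewrite -/(ray s t) in r0.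
  have := diffatM (pdiff_f_radial hd h1 (inU t sb'))
    (diffatV (@real_complex_inj R) (pdiff_ray_radial s t) r0).
  rewrite -/Z Z1//; congr (pdiff _ _ _); rewrite /g; field; exact: r0.
have dga s t : 0 < s < b -> pdiff (fun t => g (ray s t)) t 0.
  move=> sb; have /andP[s0 s1] := sb; have sb' : 0 < s <= b by rewrite s0 ltW.
  have r0 := cexp_neq0 (s +i* t)%C; rewrite -/(ray s t) in r0.
  have := diffatM (pdiff_f_ray hd h1 (inU t sb'))
    (diffatV (@real_complex_inj R) (pdiff_ray s t) r0).
  rewrite -/Z Z1//; congr (pdiff _ _ _); rewrite /g; field; exact: r0.
have const (P : R -> R[i]) (x y : R) : x <= y -> (forall v, x <= v <= y -> pdiff P v 0) -> P y = P x.
  move=> xy dP; apply/eqP; rewrite -subr_eq0 -normc_eq0 eq_le normc_ge0 andbT.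
  have := @pdiff_normc_le _ P (fun=> 0) x y 0 xy dP; rewrite mul0r; apply => v _.
  by rewrite Normc.normc0.
have b2 : 0 < b / 2 < b by move: b0 => ?; apply/andP; split; lra.
pose c := g (ray (b / 2) 0).
have gc s t : 0 < s < b -> g (ray s t) = c.
  move=> /andP[s0 sb].
  have -> : g (ray s t) = g (ray (b / 2) t).
    have [h|h] := leP s (b / 2).
      apply/esym; apply: (const (fun s => g (ray s t))) h _ => v /andP[v1 v2].
      by apply: dgr; apply/andP; split; lra.
    apply: (const (fun s => g (ray s t))) (ltW h) _ => v /andP[v1 v2].
    by apply: dgr; apply/andP; split; lra.
  have [h|h] := leP 0 t.
    by apply: (const (fun t => g (ray (b / 2) t))) h _ => v _; exact: dga.
  by apply/esym; apply: (const (fun t => g (ray (b / 2) t))) (ltW h) _ => v _; exact: dga.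
have kc s t : 0 < s < b -> k (ray s t) = c * ray s t.
  by move=> sb; rewrite -(gc s t sb) /g divfK// cexp_neq0.
exists c => //.
have nc s : 0 < s < b -> normc (k (ray s 0)) = normc c * expR s.
  by move=> sb; rewrite kc// Normc.normcM normc_ray.
apply/eqP; rewrite eq_le; apply/andP; split; apply/ler_addgt0Pr => e e0.
  have [dl dl0 H] := hlim e0.
  pose s := Num.min (b / 2) (ln (1 + dl / 2)).
  have [s1 s2] : s <= b / 2 /\ s <= ln (1 + dl / 2) by rewrite /s !ge_min !lexx orbT.
  have s0 : 0 < s by rewrite lt_min divr_gt0//= ln_gt0// ltrDl divr_gt0.
  have es : expR s < 1 + dl.
    apply: (@le_lt_trans _ _ (1 + dl / 2)); last by lra.
    by rewrite -[leRHS]lnK ?ler_expR// posrE; lra.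
  have sb : 0 < s < b by apply/andP; split; lra.
  have := H (ray s 0); rewrite normc_ray expR_gt1 s0 es nc// => /(_ isT) kl.
  have : normc c <= normc c * expR s by rewrite ler_peMr ?normc_ge0// -expR0 ler_expR ltW.
  lra.
pose s := Num.min (b / 2) (ln (1 + e)).
have [s1 s2] : s <= b / 2 /\ s <= ln (1 + e) by rewrite /s !ge_min !lexx orbT.
have s0 : 0 < s by rewrite lt_min divr_gt0//= ln_gt0// ltrDl.
have sb : 0 < s < b by apply/andP; split; lra.
have : 1 < normc (k (ray s 0)).
  by apply: h1; apply: inU; rewrite s0; lra.
rewrite nc//.
have : expR s <= 1 + e by rewrite -[leRHS]lnK ?ler_expR// posrE; lra.
move=> h3 h4.
have nc0 : 0 < normc c.
  rewrite lt_neqAle normc_ge0 andbT eq_sym; apply: contraTneq h4 => ->.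
  by rewrite mul0r ltNge ler01.
have [c1|c1] := leP 1 (normc c); first by lra.
have : normc c * expR s <= normc c * (1 + e) by rewrite ler_pM2l.
have : normc c * e <= e by rewrite ler_piMl ?ltW.
lra.
Qed.

End Slope.

(** L h enters the convexity inequality with the nonnegative weight b - x, so an upper estimate of L
    near 0 passes to the limit h -> 0. *)
Lemma convex_endpoint (R : realType) (L : R -> R) (x b : R) : 0 < x <= b ->
  (forall h, 0 < h < x -> (b - h) * L x <= (b - x) * L h + (x - h) * L b) ->
  (forall e, 0 < e -> exists2 d, 0 < d & forall h, 0 < h < d -> h < b -> L h <= L 0 + e) ->
  b * L x <= (b - x) * L 0 + x * L b.
Proof.
move=> /andP[x0 xb] cv lim; apply/ler_addgt0Pr => e e0; have b0 := lt_le_trans x0 xb.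
move: (L x) (L b) cv => u v cv.
pose c := b + `|u| + `|v| + 1.
have [nx nb] : 0 <= `|u| /\ 0 <= `|v| by [].
have c0 : 0 < c by rewrite /c; lra.
have [d d0 Ld] := lim _ (divr_gt0 e0 (mulr_gt0 (ltr0Sn R 1) c0)).
pose h := Num.min (Num.min (d / 2) (x / 2)) (e / (2 * c)).
have [[hd1 hx] he] : (h <= d / 2 /\ h <= x / 2) /\ h <= e / (2 * c).
  by rewrite /h !ge_min !lexx !orbT.
have h0 : 0 < h by rewrite !lt_min !divr_gt0// mulr_gt0.
have hh : 0 < h < d by rewrite h0 /=; lra.
have hxx : 0 < h < x by rewrite h0 /=; lra.
have hb : h < b by lra.
have {Ld} Lh := Ld h hh hb; have {}cv := cv h hxx.
set q := e / (2 * c) in Lh he.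
have qe : q * c = e / 2 by rewrite /q; field; rewrite gt_eqF.
have q0 : 0 < q by rewrite divr_gt0// mulr_gt0.
have H1 : (b - x) * L h <= (b - x) * (L 0 + q) by apply: ler_wpM2l => //; lra.
have H2 : x * q >= 0 by rewrite mulr_ge0 ?ltW.
have H3 : h * (u - v) <= q * (`|u| + `|v|).
  apply: (@le_trans _ _ (h * (`|u| + `|v|))); last exact: (ler_wpM2r (addr_ge0 nx nb) he).
  apply: (ler_wpM2l (ltW h0)); apply: lerD; first exact: ler_norm.
  by rewrite -normrN; exact: ler_norm.
have H4 : q * c = q * b + q * (`|u| + `|v|) + q by rewrite /c; ring.
rewrite -subr_ge0.
have -> : (b - x) * L 0 + x * v + e - b * u =
  (((b - x) * L h + (x - h) * v) - (b - h) * u) +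
  ((b - x) * (L 0 + q) - (b - x) * L h) +
  (q * (`|u| + `|v|) - h * (u - v)) + x * q + q + (e - q * c).
  by rewrite H4; ring.
apply: addr_ge0; last by rewrite subr_ge0 qe; lra.
apply: addr_ge0; last exact: ltW.
apply: addr_ge0 H2; apply: addr_ge0; last by rewrite subr_ge0.
by apply: addr_ge0; rewrite subr_ge0.
Qed.

(** * Slope at the unit circle and global growth *)

Section Growth.
Context {R : realType}.
Implicit Types (z w : R[i]).
Variables (rho : R) (f : R[i] -> R[i]).
Hypotheses (rho1 : 1 < rho)
  (hd : forall z, 1 < normc z < rho -> exists D : R[i], cdiff f z D)
  (hinj : forall z w, 1 < normc z < rho -> 1 < normc w < rho -> f z = f w -> z = w)
  (h1 : forall z, 1 < normc z < rho -> 1 < normc (f z))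
  (hlim : forall e : R, 0 < e -> exists2 dl : R, 0 < dl &
    forall z, 1 < normc z < 1 + dl -> normc (f z) < 1 + e).

Lemma ray_polar z : 1 < normc z -> exists t, z = ray (ln (normc z)) t.
Proof.
move=> z1; have [|t zE] := @cexp_polar R z; first by rewrite -normc_gt0 (lt_trans ltr01).
by exists t.
Qed.

(** Close to the unit circle f w falls in the ring where k is multiplication by c, so c f w - w
    vanishes there; [three_circles_zero] extends this to the annulus. *)
Lemma local_rotation (m b : R) (k : R[i] -> R[i]) (c : R[i]) : 0 < b -> expR b < m ->
  (forall w, 1 < normc w < m -> 1 < normc (k w) < rho /\ f (k w) = w) ->
  normc c = 1 -> (forall s t, 0 < s < b -> k (ray s t) = c * ray s t) ->
  forall z, 1 < normc z < rho -> f z = c^-1 * z.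
Proof.
move=> b0 bm kf c1 kc z zr; have [z1 z2] := andP zr.
have z0 : 0 < normc z by apply: lt_trans z1.
have c0 : c != 0 by rewrite -normc_gt0 c1.
have x0 : 0 < ln (normc z) by rewrite ln_gt0.
have xr : ln (normc z) < ln rho by rewrite ltr_ln// posrE (lt_trans ltr01).
suff cf : c * f z - z = 0 by rewrite -[X in _ * X](subr0_eq cf) mulKf.
have [t zE] := ray_polar z1.
pose x := ln (normc z); pose b' := (x + ln rho) / 2.
have [b1 b2] : x < b' /\ b' < ln rho by rewrite /b' /x; split; lra.
rewrite zE; apply: (@three_circles_zero R (fun w => c * f w - w) b' x t) => //.
  move=> w /andP[w1 w2]; have [|D dD] := hd (z := w).
    rewrite w1 (le_lt_trans w2)//; rewrite -[ltRHS]lnK ?ltr_expR// posrE.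
    exact: lt_trans rho1.
  by eexists; exact: diffatB (diffatM (diffat_cst idfun c w) dD) (cdiff_id w).
move=> A; have [|dl dl0 fl] := hlim (e := expR b - 1); first by rewrite subr_gt0 expR_gt1.
pose a := Num.min (x / 2) (ln (1 + dl / 2)).
have [a1 a2] : a <= x / 2 /\ a <= ln (1 + dl / 2) by rewrite /a !ge_min !lexx orbT.
have a0 : 0 < a by rewrite lt_min divr_gt0//= ln_gt0// ltrDl divr_gt0.
exists a; split => //; first by rewrite /x in a1 *; lra.
move=> w wa; have w1 : 1 < normc w by rewrite wa expR_gt1.
have wdl : normc w < 1 + dl.
  apply: (@le_lt_trans _ _ (1 + dl / 2)); last by lra.
  by rewrite wa -[leRHS]lnK ?ler_expR// posrE; lra.
have wr : 1 < normc w < rho.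
  rewrite w1 /= wa; apply: (@lt_trans _ _ (normc z)) => //.
  by rewrite -[ltRHS]lnK// ltr_expR; rewrite /x in a1 *; lra.
have fw1 := h1 wr; have fwb : normc (f w) < expR b.
  by have := fl w; rewrite w1 wdl => /(_ isT); lra.
have [u fwE] := ray_polar fw1.
have fwm : 1 < normc (f w) < m by rewrite fw1 (lt_trans fwb).
have [kr kE] := kf _ fwm.
have kw : k (f w) = w by apply: hinj.
have : k (f w) = c * f w.
  rewrite {1 2}fwE kc// ln_gt0//= -ltr_expR lnK// posrE; exact: lt_trans fw1.
by rewrite kw => <-; rewrite subrr Normc.normc0 expR_ge0.
Qed.

Let D : set R[i] := [set z | normc z <= 1].

(** The gain [g] is the mean defect times lam = 1/M, a coefficient for which the [profile] stays
    below 1/q because M bounds q. The two radii t < t' leave room for smearing. *)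
Lemma capacity_slope : exists g : R, [/\ 0 <= g,
  g <= 0 -> exists2 c : R[i], normc c = 1 & forall z, 1 < normc z < rho -> f z = c * z &
  forall e, 0 < e -> exists2 t0, 0 < t0 & forall t t', 0 < t -> t <= t0 -> t < t' ->
    expR t' < rho -> lcap D + t * (1 + g - e) <= lcap (Om f (expR t'))].
Proof.
have [m [k [m1 kd kinj kf klim]]] := inverse_exterior rho1 hd hinj h1 hlim.
have k1 w : 1 < normc w < m -> 1 < normc (k w) by case/kf => /andP[].
have fk w : 1 < normc w < m -> f (k w) = w by case/kf.
have [b [C [b0 br C0 ImZ dZC]]] := lder_estimates kd k1 klim m1.
have [B B0 ZB] := lder_bounded kd k1 b0 br C0 dZC.
have Cb0 : 0 < C * b := mulr_gt0 C0 b0.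
pose M := B + C * b + 1; have M0 : 0 < M by rewrite /M; lra.
have bb : 0 < b <= b by rewrite b0 lexx.
pose d := Re (defect k b); have d0 : 0 <= d := defect_ge0 kd k1 b0 br C0 ImZ bb.
have pi0 := pi2_gt0 (R := R).
have lam0 : 0 < M^-1 by rewrite invr_gt0.
exists (M^-1 * d / (2 * pi)); split.
- by apply: divr_ge0; [apply: mulr_ge0 => //; exact: ltW|exact: ltW].
- rewrite ler_pdivrMr// mul0r pmulr_rle0// => dle.
  have [c c1 kc] := defect_rotation kd k1 klim b0 br C0 ImZ dZC dle.
  exists c^-1; first by have := Normc.normcM c^-1 c; rewrite mulVf ?Normc.normc1 ?c1 ?mulr1// -normc_gt0 c1.
  exact: local_rotation b0 br kf c1 kc.
(* With these choices kap = C s0 + del is at most e / 2, within the loss e allowed in the slope; del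
   <= 1 matches the summand 1 in [M]. *)
move=> e e0; pose s0 := Num.min b (e / (4 * C)); pose del := Num.min 1 (e / 4).
have [s1 s2] : s0 <= b /\ s0 <= e / (4 * C) by rewrite /s0 !ge_min !lexx orbT.
have [l1 l2] : del <= 1 /\ del <= e / 4 by rewrite /del !ge_min !lexx orbT.
have s00 : 0 < s0 by rewrite lt_min b0 /= divr_gt0// mulr_gt0.
have del0 : 0 < del by rewrite lt_min ltr01 divr_gt0.
have Cs : C * s0 <= e / 4.
  have -> : e / 4 = C * (e / (4 * C)) by field; rewrite gt_eqF.
  by rewrite ler_pM2l.
have Csb : C * s0 <= C * b by rewrite ler_pM2l.
exists (s0 * del); first exact: mulr_gt0.
move=> t t' t0 tl tt' t'r.
set v := _ - e.
have pts l : l < lcap D -> has_points (Om f (expR t)) (l + t * v).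
  apply: (slope_points kd kinj k1 klim fk br C0 dZC (M := M) s00 s1 del0 t0 tl (ltW lam0)).
  - by rewrite mulVf// gt_eqF.
  - move=> u; have h : normc (lder k (ray s0 u)) <= B by apply: ZB; rewrite s00.
    have := le_trans (ler_norm _) (normc_Re (lder k (ray s0 u))); rewrite /M; lra.
  - have -> : defect k s0 = defect k b by exact: (defect_const kd k1 br).
    have -> : 2 * pi * v = 2 * pi * (1 - e) + M^-1 * d.
      by rewrite /v; move: pi0; generalize (@pi R) => p p0; field; apply/andP; split; lra.
    rewrite ltrD2r ltr_pM2l//; lra.
have [|||dd dd0 [K [cK KO KK]]] := @Ks_margin R rho f hd hinj h1 hlim (expR t) (expR t') => //.
- by rewrite expR_gt1.
- by rewrite ltr_expR.
have t'0 : 0 < t' by exact: lt_trans tt'.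
apply/ler_addgt0Pr => x x0.
have lx : lcap D - x < lcap D by rewrite ltrBlDr ltrDl.
have := points_Cap (pts _ lx) dd0 cK KO (fun z u Oz => KK z u (or_introl Oz)).
rewrite (CapOmE hd hlim) ?expR_gt1 ?t'0// lee_fin ler_expR.
by rewrite -lerBlDr addrAC.
Qed.

Lemma Om_ring (s : R) : filled_image f s = Om f s.
Proof.
apply/seteqP; split=> w [].
- by move=> [z zr fz]; right; exists z.
- by move=> w1; left.
- by move=> w1; right.
- by move=> [z zr fz]; left; exists z.
Qed.

Lemma Om_expR0 : Om f (expR 0) = D.
Proof.
rewrite expR0; apply/seteqP; split=> w; last by left.
by case=> // -[z /andP[z1 /(lt_trans z1)]]; rewrite ltxx.
Qed.

Let L t := lcap (Om f (expR t)).

Lemma Cap_Om_exp t : 0 <= t -> expR t < rho -> Cap (Om f (expR t)) = (expR (L t))%:E.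
Proof.
rewrite le_eqVlt => /predU1P[<- _|t0 tr]; last by apply: (CapOmE hd hlim); rewrite expR_gt1 t0.
by rewrite /L Om_expR0; apply: (CapE (B := 1)).
Qed.

Lemma lcap_continuous0 e : 0 < e -> exists2 d, 0 < d &
  forall t, 0 < t < d -> expR t < rho -> L t <= L 0 + e.
Proof.
move=> e0; have [k k0 kE] := @Cap_disk R.
have kL : k <= expR (L 0).
  have : (Cap (disk 1) <= Cap (Om f (expR 0)))%E.
    by apply: Cap_mono => z; rewrite Om_expR0; exact: ltW.
  by rewrite kE// Cap_Om_exp ?expR0// lee_fin mul1r.
have [|dl dl0 fl] := hlim (e := expR e - 1); first by rewrite subr_gt0 expR_gt1.
exists (ln (1 + dl)); first by rewrite ln_gt0// ltrDl.
move=> t /andP[t0 td] tr.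
have td' : expR t <= 1 + dl by rewrite -[leRHS]lnK ?ler_expR ?ltW// posrE; lra.
have : (Cap (Om f (expR t)) <= Cap (disk (expR e)))%E.
  apply: Cap_mono => w [w1|[z /andP[z1 z2] <-]]; rewrite /disk /=.
    by apply: le_lt_trans w1 _; rewrite expR_gt1.
  by have := fl z; rewrite z1 (lt_le_trans z2 td') => /(_ isT); lra.
rewrite kE ?expR_gt0// (Cap_Om_exp (ltW t0) tr) lee_fin => h.
rewrite -ler_expR expRD mulrC; apply: le_trans h _.
by rewrite ler_pM2l ?expR_gt0.
Qed.

Lemma lcap_convex0 a x b : 0 <= a -> a <= x <= b -> a < b -> expR b < rho ->
  (b - a) * L x <= (b - x) * L a + (x - a) * L b.
Proof.
rewrite le_eqVlt => /predU1P[<-|a0]; last exact: lcap_convex.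
move=> /andP[]; rewrite le_eqVlt => /predU1P[<- _ _ _|x0 xb b0 br].
  by rewrite subrr mul0r addr0.
have xb' : 0 < x <= b by rewrite x0.
rewrite !subr0; apply: (convex_endpoint xb') => [h /andP[h0 hx]|e e0].
  apply: (lcap_convex hd hinj h1 hlim) => //; last exact: lt_le_trans xb.
  by rewrite xb ltW.
have [d d0 Ld] := lcap_continuous0 e0; exists d => // h /andP[h0 hxd] hb.
by apply: Ld; [rewrite h0|apply: lt_trans br; rewrite ltr_expR].
Qed.

(** Convexity on [0, y] and the slope at 0 give L y >= L 0 + y (1 + g); convexity at x between 0 and
    y turns this into growth from x to y. *)
Lemma capacity_growth : exists g : R, [/\ 0 <= g,
  g <= 0 -> exists2 c : R[i], normc c = 1 & forall z, 1 < normc z < rho -> f z = c * z &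
  forall x y, 0 <= x <= y -> expR y < rho -> L x - x + (y - x) * g <= L y - y].
Proof.
have [g [g0 gR slope]] := capacity_slope; exists g; split => // x y /andP[x0 xy] yr.
have [y0|y0] := eqVneq y 0.
  rewrite y0 in xy *; have -> : x = 0 by apply/eqP; rewrite eq_le x0 xy.
  by rewrite subrr mul0r addr0.
have {}y0 : 0 < y by rewrite lt_neqAle eq_sym y0 (le_trans x0).
have H : L 0 + y * (1 + g) <= L y.
  apply/ler_addgt0Pr => e e0.
  pose N := `|L y - L 0 + y| + 1; pose q := e / N.
  have N0 : 0 < N by rewrite ltr_wpDl.
  have q0 : 0 < q by rewrite divr_gt0.
  have [t0 t00 st] := slope q q0.
  (* [capacity_slope] compares t with a strictly larger t'. The ratio 1 + q makes the total loss q
     (L y - L 0 + y), at most e by the choice of q. *)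
  pose t' := Num.min t0 y; pose t := t' / (1 + q).
  have [t1 t2] : t' <= t0 /\ t' <= y by rewrite /t' !ge_min !lexx orbT.
  have t'0 : 0 < t' by rewrite lt_min t00.
  have q1 : 0 < 1 + q by rewrite addr_gt0.
  have tE : t * (1 + q) = t' by rewrite /t divfK// gt_eqF.
  have tp : 0 < t by rewrite divr_gt0.
  have tq : 0 < t * q by rewrite mulr_gt0.
  have tt : t < t' by rewrite -tE mulrDr mulr1; lra.
  have t'r : expR t' < rho by apply: le_lt_trans yr; rewrite ler_expR.
  have := st t t' tp (le_trans (ltW tt) t1) tt t'r; rewrite -Om_expR0 -!/(L _) => s1.
  have t'y : 0 <= t' <= y by rewrite ltW.
  have := lcap_convex0 (lexx 0) t'y y0 yr; rewrite !subr0 => cv.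
  have s2 : y * (L 0 + t * (1 + g - q)) <= y * L t' by rewrite ler_pM2l.
  have s3 : t * (y * (1 + g - q)) <= t * ((1 + q) * (L y - L 0)).
    rewrite -subr_ge0; rewrite -subr_ge0 in cv; rewrite -subr_ge0 in s2.
    have := addr_ge0 cv s2; rewrite -tE; move: (L y) (L 0) (L _) => u v w; congr (0 <= _); ring.
  rewrite ler_pM2l// in s3.
  have s4 : q * (L y - L 0 + y) <= q * N.
    by rewrite ler_pM2l// (le_trans (ler_norm _))// lerDl.
  have qN : q * N = e by rewrite divfK// gt_eqF.
  rewrite -subr_ge0; rewrite -subr_ge0 in s3; rewrite -subr_ge0 in s4.
  have := addr_ge0 s3 s4; rewrite qN; move: (L y) (L 0) => u v; congr (0 <= _); ring.
have xy' : 0 <= x <= y by rewrite x0.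
have := lcap_convex0 (lexx 0) xy' y0 yr; rewrite !subr0 => cv.
rewrite -(ler_pM2l y0).
have : (y - x) * (L 0 + y * (1 + g)) <= (y - x) * L y by apply: ler_wpM2l => //; rewrite subr_ge0.
move=> h; rewrite -subr_ge0 in h; rewrite -subr_ge0 in cv.
rewrite -subr_ge0; have := addr_ge0 cv h.
by move: (L x) (L y) (L 0) => u v w; congr (0 <= _); ring.
Qed.

Lemma lcap_conv (p x y : R) : 0 <= p <= 1 -> 0 <= x -> 0 <= y -> expR x < rho -> expR y < rho ->
  L (p * x + (1 - p) * y) <= p * L x + (1 - p) * L y.
Proof.
wlog xy : p x y / x < y => [W|/andP[p0 p1] x0 y0 _ yr].
  move=> /andP[p0 p1] x0 y0 xr yr; have [xy|yx|->] := ltgtP x y.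
  - by apply: W => //; rewrite p0.
  - have := W (1 - p) y x yx; rewrite subKr [X in L X]addrC [X in _ -> _ <= X]addrC.
    by apply => //; apply/andP; split; lra.
  - by rewrite -!mulrDl addrC subrK !mul1r.
have d0 : 0 < y - x by rewrite subr_gt0.
have h1' : 0 <= (1 - p) * (y - x) by rewrite mulr_ge0 ?subr_ge0// ltW.
have h2' : 0 <= p * (y - x) by rewrite mulr_ge0// ltW.
have xzy : x <= p * x + (1 - p) * y <= y.
  by apply/andP; split; rewrite -subr_ge0; [apply: le_trans h1' _|apply: le_trans h2' _];
     rewrite le_eqVlt; apply/orP; left; apply/eqP; ring.
rewrite -(ler_pM2l d0); apply: le_trans (lcap_convex0 x0 xzy xy yr) _.
by rewrite le_eqVlt; apply/orP; left; apply/eqP; move: (L x) (L y) => u v; ring.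
Qed.

End Growth.

Theorem theorem1p2 (R : realType) (rho : R) (f : R[i]^o -> R[i]^o)
    (hrho : 1 < rho) (hf : class_S rho f) :
  [/\ (forall r : R, 1 <= r < rho -> (0 < psi_Cap f r < +oo)%E),
      convex_function (E := R^o) [set t : R | 0 <= t < ln rho]
        (fun t => ln (fine (psi_Cap f (expR t)))),
      (~ rotation_on (annulus rho) f ->
       forall r s : R, 1 <= r -> r < s -> s < rho ->
         (psi_Cap f r < psi_Cap f s)%E) &
      (forall r : R, 1 <= r < rho ->
        (Cap (filled_image f r)
         <= r%:E * (Cap (filled_image f rho) / rho%:E))%E)].
Proof.
have [hd hinj h1 hlim] := class_S_facts hf.
have [k k0 kE] := @Cap_disk R.
have [g [g0 gR G]] := capacity_growth hrho hd hinj h1 hlim.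
pose L t := lcap (Om f (expR t)).
have rho0 : 0 < rho by exact: lt_trans hrho.
have lnr t : t < ln rho -> expR t < rho by move=> tr; rewrite -[ltRHS]lnK// ltr_expR.
have CE t : 0 <= t -> expR t < rho -> Cap (filled_image f (expR t)) = (expR (L t))%:E.
  by move=> t0 tr; rewrite Om_ring; exact: (Cap_Om_exp hd hlim).
have psiE t : 0 <= t -> expR t < rho ->
    psi_Cap f (expR t) = (expR (L t - t - ln k))%:E.
  move=> t0 tr; rewrite /psi_Cap CE// kE ?expR_gt0// inver gt_eqF ?mulr_gt0 ?expR_gt0//.
  by rewrite -EFinM !expRB lnK// invfM mulrA.
have expln r : 1 <= r < rho -> [/\ 0 <= ln r, expR (ln r) = r & expR (ln r) < rho].
  by move=> /andP[r1 rr]; rewrite lnK ?posrE ?(lt_le_trans ltr01)//; split => //; exact: ln_ge0.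
split.
- move=> r /expln[r0 rE rr]; rewrite -rE psiE//.
  by rewrite lte_fin expR_gt0 ltry.
- move=> t x y; rewrite !inE /= => /andP[x0 xr] /andP[y0 yr].
  have [xr' yr'] := (lnr _ xr, lnr _ yr).
  have p01 : 0 <= t%:num <= (1 : R) by rewrite ge0 le1.
  set p := t%:num in p01; have /andP[p0 p1] := p01.
  change (ln (fine (psi_Cap f (expR (p * x + (1 - p) * y)))) <=
    p * ln (fine (psi_Cap f (expR x))) + (1 - p) * ln (fine (psi_Cap f (expR y)))).
  have z0 : 0 <= p * x + (1 - p) * y by rewrite addr_ge0 ?mulr_ge0// subr_ge0.
  have zr : expR (p * x + (1 - p) * y) < rho.
    apply: lnr; have [xy|yx] := leP x y.
      have : p * x <= p * y by rewrite ler_wpM2l.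
      lra.
    have : (1 - p) * y <= (1 - p) * x by rewrite ler_wpM2l ?subr_ge0// ltW.
    lra.
  rewrite !psiE//= !expRK.
  have := lcap_conv hrho hd hinj h1 hlim p01 x0 y0 xr' yr'; rewrite -!/(L _).
  by move: (L x) (L y) (L _) (ln k) => u v w l; lra.
- move=> nrot r s r1 rs sr.
  (* Strictness comes from the gain in slope: g <= 0 would make [f] a rotation. *)
  have gp : 0 < g.
    rewrite ltNge; apply/negP => /gR[c c1 fc]; apply: nrot; exists c => //.
  have [|l0 lE lr] := expln r; first by rewrite r1 (lt_trans rs).
  have [|m0 mE mr] := expln s; first by rewrite sr (le_trans r1)// ltW.
  rewrite -lE -mE !psiE// lte_fin ltr_expR.
  have lm : ln r < ln s by rewrite ltr_ln// posrE; lra.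
  have := G (ln r) (ln s); rewrite l0 ltW// => /(_ isT mr); rewrite -!/(L _).
  have : 0 < (ln s - ln r) * g by rewrite mulr_gt0// subr_gt0.
  by move: (L (ln r)) (L (ln s)) => u v; lra.
- move=> r rr; have [l0 lE lr] := expln r rr; have /andP[r1 r2] := rr.
  have r0 : 0 < r by exact: lt_le_trans r1.
  (* The growth estimate holds below rho only, and the capacity at rho may be infinite: monotonicity
     of [Cap] carries the bound from s < rho. *)
  have H s : r <= s -> s < rho -> ((expR (L (ln r)) * (s / r))%:E <= Cap (filled_image f rho))%E.
    move=> rs sr; have [|m0 mE mr] := expln s; first by rewrite sr (le_trans r1).
    have s0 : 0 < s by exact: lt_le_trans rs.
    apply: (@le_trans _ _ (Cap (filled_image f s))); last first.
      by rewrite !Om_ring; apply: Cap_mono; apply: Om_mono; exact: ltW.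
    have -> : s / r = expR (ln s - ln r) by rewrite expRB mE lE.
    rewrite -{2}mE CE// lee_fin -expRD ler_expR.
    have lm : ln r <= ln s by rewrite ler_ln.
    have := G (ln r) (ln s); rewrite l0 lm => /(_ isT mr); rewrite -!/(L _).
    have : 0 <= (ln s - ln r) * g by rewrite mulr_ge0// subr_ge0.
    by move: (L (ln r)) (L (ln s)) => u v; lra.
  have -> : Cap (filled_image f r) = (expR (L (ln r)))%:E by rewrite -{1}lE CE.
  have := H; case: (Cap (filled_image f rho)) => [x| |] {}H.
  + rewrite inver gt_eqF// -!EFinM lee_fin.
    suff : expR (L (ln r)) * rho <= x * r.
      by rewrite mulrA ler_pdivlMr// [r * x]mulrC.
    apply/ler_addgt0Pr => e e0.
    pose E := expR (L (ln r)); have E0 : 0 < E := expR_gt0 _.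
    (* Letting s approach rho costs at most E (rho - s) <= e. *)
    pose s := Num.max r (rho - e / E).
    have sr : s < rho by rewrite gt_max r2 /= ltrBlDr ltrDl divr_gt0.
    have [rs es] : r <= s /\ rho - e / E <= s by rewrite /s !le_max !lexx orbT.
    have := H s rs sr; rewrite lee_fin mulrA ler_pdivrMr// -/E.
    have : E * (rho - e / E) <= E * s by rewrite ler_pM2l.
    rewrite mulrBr mulrCA divff ?gt_eqF// mulr1; lra.
  + rewrite inver gt_eqF// gt0_mulye ?lte_fin ?invr_gt0//.
    by rewrite gt0_muley ?lte_fin// leey.
  + by have := H r (lexx r) r2; rewrite leNgt ltNyr.
Qed.
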